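(* Let $\theta\in(0,1)$, let $u_0\in L^1(0,\infty)$ satisfy $\sup_{0<x<1}x^\theta|u_0(x)|+\sup_{x>1}|u_0(x)|<\infty$, and let $(u,p_c)$ be the solution pair with $u(0)=u_0$ described in the context. Then $p_c\in C([0,\infty))$ is bounded on $[0,\infty)$ and $$\lim_{t\to\infty}p_c(t)=p_c(0)\exp(-\mathcal M_\infty),$$ $$\mathcal M_\infty=C_*\int_0^\infty n_0(x)(1+n_0(x))x^4dx-\int_0^\infty n_0(x)(1+n_0(x))u_0(x)x^4dx,$$ where $C_*=\dfrac{\int_0^\infty n_0(1+n_0)u_0(x)x^6dx}{\int_0^\infty n_0(1+n_0)x^6dx}$.
   Context: For $x,y>0$, $x\ne y$, let $$M(x,y)=\Big(\frac1{\sinh|x^2-y^2|}-\frac1{\sinh(x^2+y^2)}\Big)\frac{y^3\sinh x^2}{x^3\sinh y^2},\qquad \mathcal L(g)(x)=\int_0^\infty(g(y)-g(x))M(x,y)\,dy .$$ $n_0$ is the equilibrium $n_0(p)=(e^{\beta_0|p|^2}-1)^{-1}$ ($\beta_0>0$ fixed) in the variable $x=\sqrt{\beta_0}|p|/\sqrt2$, so that $n_0(x)(1+n_0(x))=\frac1{4\sinh^2(x^2)}$. The pair $(u,p_c)$ is the one constructed in the paper's existence theorem, as follows. First, $f=f(\tau,x)$ is the solution of $\partial_\tau f=\mathcal L(f)$ (a.e. $\tau>0,x>0$) with $f(0)=u_0$, $f\in C([0,\infty);L^1(0,\infty))\cap L^\infty_{loc}((0,\infty);L^\infty(0,\infty))$,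 $\partial_\tau f,\mathcal L(f)\in L^\infty_{loc}((0,\infty)\times(0,\infty))\cap L^1((0,T)\times(0,\infty))$ for all $T>0$; $f$ is the mild solution $f(\tau)=S(\tau)u_0+\int_0^\tau S(\tau-\sigma)(\mathcal L-L)(f(\sigma))d\sigma$, where $L(g)(x)=\int_0^\infty(g(y)-g(x))\big(\frac1{|x^2-y^2|}-\frac1{x^2+y^2}\big)\frac yxdy$ and $S(\tau)g(x)=\int_0^\infty\Lambda(\frac \tau y,\frac xy)g(y)\frac{dy}y$, $\Lambda$ being the fundamental solution of $\partial_\tau h=L(h)$ (initial datum the Dirac mass at $x=1$). Next, with $q_c(0)>0$ given, $$\mathcal M(\tau)=\int_0^\tau\int_0^\infty\mathcal L(f(\sigma))(x)n_0(x)(1+n_0(x))x^4dx\,d\sigma,\qquad q_c(\tau)=q_c(0)e^{-\mathcal M(\tau)} .$$ Finally, for $t>0$, $\tau=\tau(t)$ is the unique number with $t=\int_0^\tau\frac{d\sigma}{q_c(\sigma)}$ (and $\tau(0)=0$), and $u(t,x)=f(\tau(t),x)$, $p_c(t)=q_c(\tau(t))$. *)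

(* Defs.v *)
From HB Require Import structures.
From mathcomp Require Import all_boot all_order all_algebra.
From mathcomp Require Import all_classical all_reals all_analysis.
Import Order.TTheory GRing.Theory Num.Theory.
Import numFieldNormedType.Exports.

Set Implicit Arguments.
Unset Strict Implicit.
Unset Printing Implicit Defensive.

Local Open Scope classical_set_scope.
Local Open Scope ring_scope.

Section Defs.
Variable R : realType.
Implicit Types (x y t tau sigma : R) (g phi : R -> R) (h : R -> R -> R).

Local Notation mu := (@lebesgue_measure R).
Local Notation mu2 := (mu \x mu)%E.
Local Notation Rpos := (`]0, +oo[%classic : set R).
(* Functions h(tau, x) on (0, oo) x (0, oo) are curried, time first. *)
Local Notation Qpos := (Rpos `*` Rpos : set (R * R)).

Definition sinh x : R := (expR x - expR (- x)) / 2.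

(* The value on the diagonal x = y is irrelevant. *)
Definition kerM x y : R :=
  ((sinh `|x ^+ 2 - y ^+ 2|)^-1 - (sinh (x ^+ 2 + y ^+ 2))^-1) *
  ((y ^+ 3 * sinh (x ^+ 2)) / (x ^+ 3 * sinh (y ^+ 2))).

Definition kerL x y : R :=
  ((`|x ^+ 2 - y ^+ 2|)^-1 - (x ^+ 2 + y ^+ 2)^-1) * (y / x).

Definition jump_op (K : R -> R -> R) g x : R :=
  \int[mu]_(y in Rpos) ((g y - g x) * K x y).

(* Rintegral is total, so absolute convergence has to be required apart. *)
Definition jump_op_defined (K : R -> R -> R) g x : Prop :=
  mu.-integrable Rpos (fun y => ((g y - g x) * K x y)%:E).

(* Formal adjoint of jump_op K for the Lebesgue measure on (0, oo). *)
Definition jump_op_adj (K : R -> R -> R) phi x : R :=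
  \int[mu]_(y in Rpos) (phi y * K y x - phi x * K x y).

Definition calL g x : R := jump_op kerM g x.
Definition opL g x : R := jump_op kerL g x.

(* C_c^oo((0, oo)) *)
Definition test_function phi : Prop :=
  (forall n x, derivable (derive1n n phi) x 1) /\
  exists a b : R, [/\ 0 < a, a < b &
    forall x, ~ (a <= x <= b) -> phi x = 0].

(* h in C(I; L^1(0, oo)) *)
Definition L1_continuous (I : set R) h : Prop :=
  (forall t, I t -> mu.-integrable Rpos (fun x => (h t x)%:E)) /\
  (forall t, I t ->
     (\int[mu]_(x in Rpos) `|h s x - h t x|) @[s --> within I (nbhs t)] --> 0).

(* h in L^oo_loc((0, oo); L^oo(0, oo)) *)
Definition Linfty_loc_time h : Prop :=
  forall a b : R, 0 < a -> a < b -> exists C : R,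
    {ae mu2, forall z : R * R, a <= z.1 <= b -> 0 < z.2 -> `|h z.1 z.2| <= C}.

(* h in L^oo_loc((0, oo) x (0, oo)) *)
Definition Linfty_loc h : Prop :=
  measurable_fun Qpos (fun z : R * R => h z.1 z.2) /\
  forall a b c d : R, 0 < a -> a < b -> 0 < c -> c < d -> exists C : R,
    {ae mu2, forall z : R * R,
       a <= z.1 <= b -> c <= z.2 <= d -> `|h z.1 z.2| <= C}.

(* h in L^1((0, T) x (0, oo)) for all T > 0 *)
Definition L1_time_loc h : Prop :=
  forall T : R, 0 < T ->
    mu2.-integrable (`]0, T[%classic `*` Rpos) (fun z : R * R => (h z.1 z.2)%:E).

(* k is the weak (distributional) derivative of h with respect to time on
   (0, oo) x (0, oo); by density it is enough to test in the time variable for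
   almost every x. A pointwise a.e. derivative would not see a part of h that
   is singular in time. *)
Definition weak_dtime h (k : R -> R -> R) : Prop :=
  forall eta : R -> R, test_function eta ->
  {ae mu, forall x, 0 < x ->
    [/\ mu.-integrable Rpos (fun s => (derive1 eta s * h s x)%:E),
        mu.-integrable Rpos (fun s => (eta s * k s x)%:E) &
        \int[mu]_(s in Rpos) (derive1 eta s * h s x) =
        - \int[mu]_(s in Rpos) (eta s * k s x)]}.

(* Lam is the fundamental solution of d_tau h = opL h: the equation holds in
   the sense of distributions on (0, oo) x (0, oo), and Lam(tau) converges to
   the Dirac mass at 1 in the weak sense of measures as tau -> 0+. The
   singular integral opL Lam is tested through the adjoint kernel. *)
Definition fundamental_solution (Lam : R -> R -> R) : Prop :=
  [/\ measurable_fun Qpos (fun z : R * R => Lam z.1 z.2),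
      L1_continuous Rpos Lam,
      (forall eta phi : R -> R, test_function eta -> test_function phi ->
        \int[mu]_(s in Rpos)
          (derive1 eta s * \int[mu]_(x in Rpos) (Lam s x * phi x)) =
        - \int[mu]_(s in Rpos)
          (eta s * \int[mu]_(x in Rpos) (Lam s x * jump_op_adj kerL phi x))) &
      forall phi : R -> R, {within Rpos, continuous phi} ->
        (exists C : R, forall x, 0 < x -> `|phi x| <= C) ->
        (\int[mu]_(x in Rpos) (Lam s x * phi x)) @[s --> 0^'+] --> phi 1].

Definition semigroup_integrand (Lam : R -> R -> R) tau g x y : R :=
  Lam (tau / y) (x / y) * g y / y.

Definition semigroup (Lam : R -> R -> R) tau g x : R :=
  \int[mu]_(y in Rpos) semigroup_integrand Lam tau g x y.

Definition semigroup_defined (Lam : R -> R -> R) tau g x : Prop :=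
  mu.-integrable Rpos (fun y => (semigroup_integrand Lam tau g x y)%:E).

Definition perturbation g x : R := calL g x - opL g x.

(* f(tau) = S(tau) u0 + int_0^tau S(tau - sigma) ((calL - opL) f(sigma)) dsigma
   as an identity in L^1(0, oo) for every tau > 0, with all the integrals that
   occur in it absolutely convergent. *)
Definition mild_solution (Lam : R -> R -> R) (u0 : R -> R) (f : R -> R -> R) :=
  {ae mu2, forall z : R * R, 0 < z.1 -> 0 < z.2 ->
     jump_op_defined kerL (f z.1) z.2} /\
  forall tau, 0 < tau -> {ae mu, forall x, 0 < x ->
    [/\ semigroup_defined Lam tau u0 x,
        {ae mu, forall sigma, 0 < sigma < tau ->
           semigroup_defined Lam (tau - sigma) (perturbation (f sigma)) x},
        mu.-integrable `]0, tau[%classic (fun sigma =>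
          (semigroup Lam (tau - sigma) (perturbation (f sigma)) x)%:E) &
        f tau x = semigroup Lam tau u0 x +
          \int[mu]_(sigma in `]0, tau[%classic)
            semigroup Lam (tau - sigma) (perturbation (f sigma)) x]}.

(* d_tau f = calL f a.e. with f(0) = u0, in the regularity class of the
   existence theorem. *)
Definition strong_solution (u0 : R -> R) (f : R -> R -> R) : Prop :=
  [/\ measurable_fun Qpos (fun z : R * R => f z.1 z.2),
      L1_continuous `[0, +oo[%classic f,
      Linfty_loc_time f,
      {ae mu, forall x, 0 < x -> f 0 x = u0 x} &
      {ae mu2, forall z : R * R, 0 < z.1 -> 0 < z.2 ->
         jump_op_defined kerM (f z.1) z.2} /\
      Linfty_loc (fun tau x => calL (f tau) x) /\
      L1_time_loc (fun tau x => calL (f tau) x) /\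
      exists dtf : R -> R -> R,
        [/\ weak_dtime f dtf, Linfty_loc dtf, L1_time_loc dtf &
            {ae mu2, forall z : R * R, 0 < z.1 -> 0 < z.2 ->
               dtf z.1 z.2 = calL (f z.1) z.2}]].

(* Equilibrium as a function of r = |p|. *)
Definition equilibrium (beta0 r : R) : R := (expR (beta0 * r ^+ 2) - 1)^-1.

(* The equilibrium in the variable x = sqrt beta0 * |p| / sqrt 2. *)
Definition n0 (beta0 : R) x : R :=
  equilibrium beta0 (Num.sqrt 2 * x / Num.sqrt beta0).

Definition weight (beta0 : R) x : R := n0 beta0 x * (1 + n0 beta0 x).

Definition calM (beta0 : R) (f : R -> R -> R) tau : R :=
  \int[mu]_(sigma in `]0, tau[%classic)
    \int[mu]_(x in Rpos) (calL (f sigma) x * weight beta0 x * x ^+ 4).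

Definition q_c (beta0 qc0 : R) (f : R -> R -> R) tau : R :=
  qc0 * expR (- calM beta0 f tau).

Definition time_change (qc : R -> R) (T : R -> R) : Prop :=
  T 0 = 0 /\
  forall t, 0 < t ->
    [set s : R | 0 <= s /\ t = \int[mu]_(sigma in `]0, s[%classic) (qc sigma)^-1]
    = [set T t].

Definition solution_pair (beta0 : R) (u0 : R -> R)
    (u : R -> R -> R) (pc : R -> R) : Prop :=
  exists (Lam f : R -> R -> R) (qc0 : R) (T : R -> R),
    [/\ fundamental_solution Lam,
        strong_solution u0 f /\ mild_solution Lam u0 f,
        0 < qc0,
        time_change (q_c beta0 qc0 f) T &
        forall t, 0 <= t ->
          (forall x, 0 < x -> u t x = f (T t) x) /\
          pc t = q_c beta0 qc0 f (T t)].

Definition C_star (beta0 : R) (u0 : R -> R) : R :=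
  (\int[mu]_(x in Rpos) (weight beta0 x * u0 x * x ^+ 6)) /
  (\int[mu]_(x in Rpos) (weight beta0 x * x ^+ 6)).

Definition M_infty (beta0 : R) (u0 : R -> R) : R :=
  C_star beta0 u0 * \int[mu]_(x in Rpos) (weight beta0 x * x ^+ 4) -
  \int[mu]_(x in Rpos) (weight beta0 x * u0 x * x ^+ 4).

End Defs.

(* Main.v *)
(* The weight w = n_0 (1 + n_0) x^6 makes w(x) M(x, y) symmetric. Hence the
   integral of f w is conserved, and that of J(f) w decreases for convex J at the
   rate of a Dirichlet form. Convex J vanishing on an interval bound f uniformly;
   J = (f - C)^2, with C = C_star and a Poincare inequality on compact boxes,
   drives f to its w-mean C. So M(tau), which is the integral of
   (f(tau) - u_0) n_0 (1 + n_0) x^4, converges; q_c then stays between positive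
   constants, and the change of time is bi-Lipschitz.

   The symmetrization has to be justified for the singular kernel. The difference
   kD of the kernels of calL and L has a bounded action, and L is homogeneous.
   Therefore mollification by dilations almost commutes with L: the error tends to
   zero in L^1(W dx), W = x^2 / (1 + x^4). With Kato's inequality this bounds
   Lam(s / y, x / y) / y in L^1(W dx), which gives a weak equation for the mild
   solution; comparing it with the strong one identifies calL f, for almost every
   time, with the limit of truncated operators applied to mollified f. *)
Require Import Defs.
From HB Require Import structures.
From mathcomp Require Import all_boot all_order all_algebra.
From mathcomp Require Import all_classical all_reals all_analysis.
From mathcomp Require Import measurable_realfun.
From mathcomp Require Import ring lra.
Import Order.TTheory GRing.Theory Num.Theory.
Import numFieldNormedType.Exports.
Local Open Scope classical_set_scope.
Local Open Scope ring_scope.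
Set Implicit Arguments.
Unset Strict Implicit.
Unset Printing Implicit Defensive.

(** The obstacle is the lack of regularity of f in x. At almost every point [calL f] is an
    absolutely convergent integral, but nothing bounds the double integral of (f(y) - f(x)) w(x)
    M(x, y), so its variables cannot be exchanged. The mild formula supplies the missing
    information, yet its kernel is known only through a distributional equation and a weak initial
    condition; even a uniform L1 bound for small times has to be extracted, by the uniform
    boundedness principle. That bound is not uniform in the source point y, whereas the perturbation
    term lies only in L1(W dx). Kato's inequality repairs this, because the crude bound multiplies
    the commutator error alone and disappears in the limit. The same error dictates the scales:
    truncation at relative distance d and mollification at scale e cost d / e^2 near the diagonal
    and e log(1 / d) away from it. The same double limit at almost every fixed time yields one
    energy inequality for all bounded continuous monotone j, with the dissipation restricted to a
    box where the symmetric kernel is bounded below. *)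

Local Notation measfun f := (measurable_fun setT f).
Local Notation measfun2 R F := (measurable_fun setT (fun z : R * R => F z.1 z.2)).

(** * Measurability and integration of real functions *)

Section MeasurableClosure.
Context d (T : measurableType d) (R : realType).
Implicit Types (f g : T -> R) (b c : T -> bool).

Lemma mfun_cst (r : R) : measfun (fun _ : T => r).
Proof. exact: measurable_cst. Qed.

Lemma mfunD f g : measfun f -> measfun g ->
  measfun (fun x => f x + g x).
Proof. exact: measurable_funD. Qed.

Lemma mfunB f g : measfun f -> measfun g ->
  measfun (fun x => f x - g x).
Proof. exact: measurable_funB. Qed.

Lemma mfunN f : measfun f -> measfun (fun x => - f x).
Proof. exact: measurable_funN. Qed.

Lemma mfunM f g : measfun f -> measfun g ->
  measfun (fun x => f x * g x).
Proof. exact: measurable_funM. Qed.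

Lemma mfunX f n : measfun f -> measfun (fun x => f x ^+ n).
Proof. exact: measurable_funX. Qed.

Lemma mfun_norm f : measfun f -> measfun (fun x => `|f x|).
Proof. by move=> mf; apply: measurableT_comp => //. Qed.

Lemma mfun_exp f : measfun f -> measfun (fun x => expR (f x)).
Proof. by move=> mf; apply: measurableT_comp => //. Qed.

Lemma mfun_max f g : measfun f -> measfun g ->
  measfun (fun x => Num.max (f x) (g x)).
Proof. exact: measurable_maxr. Qed.

Lemma mfun_min f g : measfun f -> measfun g ->
  measfun (fun x => Num.min (f x) (g x)).
Proof. exact: measurable_minr. Qed.

Lemma mfun_lt f g : measfun f -> measfun g ->
  measfun (fun x => f x < g x).
Proof. exact: measurable_fun_ltr. Qed.

Lemma mfun_le f g : measfun f -> measfun g ->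
  measfun (fun x => f x <= g x).
Proof. exact: measurable_fun_ler. Qed.

Lemma mfun_and b c : measfun b -> measfun c ->
  measfun (fun x => b x && c x).
Proof. exact: measurable_and. Qed.

Lemma mfun_or b c : measfun b -> measfun c ->
  measfun (fun x => b x || c x).
Proof. exact: measurable_or. Qed.

Lemma mfun_ite b f g : measfun b -> measfun f ->
  measfun g -> measfun (fun x => if b x then f x else g x).
Proof. exact: measurable_fun_ifT. Qed.

Lemma invr_measurable : measfun (@GRing.inv R).
Proof.
have -> : [set: R] = [set x | x != 0] `|` [set 0].
  by apply/esym/seteqP; split=> // x _; have [->|?] := eqVneq x 0; [right|left].
apply/measurable_funU => //.
  have -> : [set x : R | x != 0] = ~` [set 0].
    by apply/seteqP; split=> x /= /eqP.
  exact: measurableC.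
split; last exact: measurable_fun_set1.
have o : open [set x : R | x != 0] by exact: open_neq.
apply: open_continuous_measurable_fun => // x; rewrite inE/= => x0.
exact: inv_continuous.
Qed.

Lemma mfunV f : measfun f -> measfun (fun x => (f x)^-1).
Proof. by move=> mf; apply: measurableT_comp => //; exact: invr_measurable. Qed.

End MeasurableClosure.

Lemma mfun_pair d1 d2 d3 (T1 : measurableType d1) (T2 : measurableType d2)
    (T3 : measurableType d3) (f : T1 -> T2) (g : T1 -> T3) :
  measfun f -> measfun g ->
  measfun (fun x => (f x, g x)).
Proof. exact: measurable_fun_pair. Qed.

Lemma mfun_comp d1 d2 d3 (T1 : measurableType d1) (T2 : measurableType d2)
    (T3 : measurableType d3) (f : T2 -> T3) (g : T1 -> T2) :
  measfun f -> measfun g ->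
  measfun (fun x => f (g x)).
Proof. by move=> mf mg; apply: measurableT_comp. Qed.

Lemma mfun_fst d1 d2 d3 (T1 : measurableType d1) (T2 : measurableType d2)
    (T3 : measurableType d3) (f : T1 -> T2 * T3) :
  measfun f -> measfun (fun x => (f x).1).
Proof. by move=> mf; apply: measurableT_comp => //; exact: measurable_fst. Qed.

Lemma mfun_snd d1 d2 d3 (T1 : measurableType d1) (T2 : measurableType d2)
    (T3 : measurableType d3) (f : T1 -> T2 * T3) :
  measfun f -> measfun (fun x => (f x).2).
Proof. by move=> mf; apply: measurableT_comp => //; exact: measurable_snd. Qed.

Lemma mfun_curry d1 d2 d3 d (T1 : measurableType d1) (T2 : measurableType d2)
    (T3 : measurableType d3) (T : measurableType d) (F : T1 -> T2 -> T3)
    (f : T -> T1) (g : T -> T2) :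
  measfun (fun z : T1 * T2 => F z.1 z.2) ->
  measfun f -> measfun g ->
  measfun (fun x => F (f x) (g x)).
Proof.
move=> mF mf mg.
exact: (@mfun_comp _ _ _ _ _ _ (fun z : T1 * T2 => F z.1 z.2)
  (fun x => (f x, g x)) mF (mfun_pair mf mg)).
Qed.

Ltac mfun1 := first [ assumption | lazymatch goal with
  | |- measurable_fun _ (fun _ => ?c) => exact: mfun_cst
  | |- measurable_fun _ (fun x => x) => exact: measurable_id
  | |- measurable_fun _ (fun x => if _ then _ else _) => apply: mfun_ite
  | |- measurable_fun _ (fun x => _ && _) => apply: mfun_and
  | |- measurable_fun _ (fun x => _ || _) => apply: mfun_or
  | |- measurable_fun _ (fun x => (_ < _)%R) => apply: mfun_lt
  | |- measurable_fun _ (fun x => (_ <= _)%R) => apply: mfun_le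
  | |- measurable_fun _ (fun x => _ + _) => apply: mfunD
  | |- measurable_fun _ (fun x => - _) => apply: mfunN
  | |- measurable_fun _ (fun x => _ * _) => apply: mfunM
  | |- measurable_fun _ (fun x => _ ^-1) => apply: mfunV
  | |- measurable_fun _ (fun x => _ ^+ _) => apply: mfunX
  | |- measurable_fun _ (fun x => `|_|) => apply: mfun_norm
  | |- measurable_fun _ (fun x => expR _) => apply: mfun_exp
  | |- measurable_fun _ (fun x => Num.max _ _) => apply: mfun_max
  | |- measurable_fun _ (fun x => Num.min _ _) => apply: mfun_min
  | |- measurable_fun _ (fun x => fst _) => first [exact: measurable_fst | apply: mfun_fst]
  | |- measurable_fun _ (fun x => snd _) => first [exact: measurable_snd | apply: mfun_snd]
  | |- measurable_fun _ (fun x => (_, _)) => apply: mfun_pair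
  (* a unification may have eta-reduced the body *)
  | |- measurable_fun _ (Order.lt _) => apply: mfun_lt
  | |- measurable_fun _ (Order.le _) => apply: mfun_le
  | |- measurable_fun _ (+%R _) => apply: mfunD
  | |- measurable_fun _ ( *%R _) => apply: mfunM
  | |- measurable_fun _ (@GRing.inv _) => exact: invr_measurable
  | |- measurable_fun _ fst => exact: measurable_fst
  | |- measurable_fun _ snd => exact: measurable_snd
  end ].
Ltac mfun := repeat mfun1.

Section L1.
Context d (T : measurableType d) (R : realType) (m : {measure set T -> \bar R}).
Implicit Types (f g : T -> R).

(** Integration is always over the whole space. Functions on a half line or an interval enter
    extended by zero, so that later statements carry no domain conditions. *)
Definition L1 f : Prop := m.-integrable setT (EFin \o f).

Lemma L1_meas f : L1 f -> measfun f.
Proof. by move=> /measurable_int /measurable_EFinP. Qed.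

Lemma L1_norm f : L1 f -> L1 (fun x => `|f x|).
Proof. by move=> /integrable_norm. Qed.

Lemma L1D f g : L1 f -> L1 g -> L1 (fun x => f x + g x).
Proof.
by move=> fi gi; apply: (eq_integrable _ _ _ _ (integrableD _ fi gi)).
Qed.

Lemma L1N f : L1 f -> L1 (fun x => - f x).
Proof. by move=> fi; apply: (eq_integrable _ _ _ _ (integrableN fi)). Qed.

Lemma L1B f g : L1 f -> L1 g -> L1 (fun x => f x - g x).
Proof. by move=> fi gi; apply: L1D => //; exact: L1N. Qed.

Lemma L1Z r f : L1 f -> L1 (fun x => r * f x).
Proof. by move=> fi; apply: (eq_integrable _ _ _ _ (integrableZl _ r fi)). Qed.

Lemma L1_0 : L1 (fun _ => 0).
Proof. exact: integrable0. Qed.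

Lemma L1_le f g : measfun f -> (forall x, `|f x| <= g x) -> L1 g -> L1 f.
Proof.
move=> mf fg gi; apply: (le_integrable _ _ _ gi) => //.
  exact/measurable_EFinP.
by move=> x _ /=; rewrite lee_fin (le_trans (fg x))// ler_norm.
Qed.

Lemma L1_ext f g : L1 g -> (forall x, f x = g x) -> L1 f.
Proof. by move=> gi fg; have -> : f = g by apply/funext. Qed.

Lemma L1M (C : R) (h f : T -> R) : measfun h -> (forall x, `|h x| <= C) -> L1 f ->
  L1 (fun x => h x * f x).
Proof.
move=> mh hC fi; apply: (@L1_le _ (fun x => C * `|f x|)).
- by have := L1_meas fi => ?; mfun.
- by move=> x; rewrite normrM ler_wpM2r.
- exact/L1Z/L1_norm.
Qed.

Lemma L1_ae f g : measfun f -> {ae m, forall x, f x = g x} -> L1 g -> L1 f.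
Proof.
move=> mf fg gi; move/integrableP : (gi) => [mg ig]; apply/integrableP; split.
  exact/measurable_EFinP.
rewrite (@ae_eq_integral _ _ _ _ _ (fun x => `|(EFin \o g) x|%E))//.
- by apply/measurable_EFinP; mfun.
- by apply: measurableT_comp.
- by apply: filterS fg => x /= -> _.
Qed.

Lemma L1_le_ae f g : measfun f -> {ae m, forall x, `|f x| <= g x} -> L1 g -> L1 f.
Proof.
move=> mf fg gi; have mg := L1_meas gi.
apply: (@L1_ae _ (fun x => if `|f x| <= g x then f x else 0)) => //.
  by apply: filterS fg => x /= ->.
apply: (@L1_le _ (fun x => `|g x|)); [by mfun| |exact: L1_norm].
by move=> x; case: ifPn => [/le_trans|_]; [apply; rewrite ler_norm|rewrite normr0].
Qed.

Lemma intRD f g : L1 f -> L1 g ->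
  \int[m]_x (f x + g x) = \int[m]_x f x + \int[m]_x g x.
Proof. exact: RintegralD. Qed.

Lemma intRB f g : L1 f -> L1 g ->
  \int[m]_x (f x - g x) = \int[m]_x f x - \int[m]_x g x.
Proof. exact: RintegralB. Qed.

Lemma intRZ r f : L1 f -> \int[m]_x (r * f x) = r * \int[m]_x f x.
Proof. exact: RintegralZl. Qed.

Lemma intRN f : L1 f -> \int[m]_x (- f x) = - \int[m]_x f x.
Proof.
move=> fi; rewrite -mulN1r -intRZ//.
by congr fine; apply: eq_integral => x _; rewrite mulN1r.
Qed.

Lemma intR_ext f g : (forall x, f x = g x) -> \int[m]_x f x = \int[m]_x g x.
Proof. by move=> fg; congr fine; apply: eq_integral => x _; rewrite fg. Qed.

Lemma intR_le f g : L1 f -> L1 g -> (forall x, f x <= g x) ->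
  \int[m]_x f x <= \int[m]_x g x.
Proof. by move=> fi gi fg; apply: le_Rintegral. Qed.

Lemma intR_ge0 f : (forall x, 0 <= f x) -> 0 <= \int[m]_x f x.
Proof. by move=> f0; apply: Rintegral_ge0. Qed.

Lemma intR_norm f : L1 f -> `|\int[m]_x f x| <= \int[m]_x `|f x|.
Proof. exact: le_normr_Rintegral. Qed.

Lemma intR_ae f g : measfun f -> measfun g ->
  {ae m, forall x, f x = g x} -> \int[m]_x f x = \int[m]_x g x.
Proof.
move=> mf mg fg; congr fine; apply: ae_eq_integral => //; try exact/measurable_EFinP.
by apply: filterS fg => x /= ->.
Qed.

Lemma intR_le_ae f g : L1 f -> L1 g -> {ae m, forall x, f x <= g x} ->
  \int[m]_x f x <= \int[m]_x g x.
Proof.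
move=> fi gi fg; have mf := L1_meas fi; have mg := L1_meas gi.
rewrite (@intR_ae _ (fun x => Num.min (f x) (g x))); [|by []|by mfun|].
  apply: intR_le => // [|x]; last by rewrite ge_min lexx orbT.
  apply: (@L1_le _ (fun x => `|f x| + `|g x|)); [by mfun| |].
    move=> x; case: (leP (f x) (g x)) => _; first by rewrite lerDl.
    by rewrite lerDr.
  by apply: L1D; exact: L1_norm.
by apply: filterS fg => x /= /min_idPl ->.
Qed.

Lemma intR0 : \int[m]_x (0 : R) = 0.
Proof. by rewrite /Rintegral integral0. Qed.

Lemma intR_eq0 f : (forall x, f x = 0) -> \int[m]_x f x = 0.
Proof. by move=> f0; rewrite (@intR_ext f (fun=> 0)) ?intR0. Qed.

Lemma L1_EFin f : L1 f -> (\int[m]_x f x)%:E = (\int[m]_x (f x)%:E)%E.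
Proof. by move=> fi; rewrite /Rintegral fineK//; apply: integrable_fin_num. Qed.

(** The bound is put on the extended integral, so that it contains integrability. A bound on the
    real integral would say nothing for a non-integrable function, whose integral has the default
    value 0. *)
Definition NB f c : Prop :=
  measfun f /\ (\int[m]_x `|(f x)%:E| <= c%:E)%E.

Lemma NB_L1 f c : NB f c -> L1 f.
Proof.
move=> [mf fc]; apply/integrableP; split; first exact/measurable_EFinP.
by apply: le_lt_trans fc _; rewrite ltry.
Qed.

Lemma NBP f c : NB f c <-> L1 f /\ \int[m]_x `|f x| <= c.
Proof.
split=> [fc|[fi fc]].
  have fi := NB_L1 fc; split=> //; case: fc => _ fc.
  by rewrite -lee_fin L1_EFin//; exact: L1_norm.
split; first exact: L1_meas.
rewrite -lee_fin L1_EFin in fc; last exact: L1_norm.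
exact: fc.
Qed.

Lemma NB_le f c g c' : measfun f -> (forall x, `|f x| <= `|g x|) -> NB g c ->
  c <= c' -> NB f c'.
Proof.
move=> mf fg /NBP[gi gc] cc'.
have fi : L1 f by apply: L1_le mf fg (L1_norm gi).
apply/NBP; split=> //; apply: le_trans cc'; apply: le_trans gc.
by apply: intR_le => //; exact: L1_norm.
Qed.

Lemma NBD f g c c' : NB f c -> NB g c' -> NB (fun x => f x + g x) (c + c').
Proof.
move=> /NBP[fi fc] /NBP[gi gc]; apply/NBP; split; first exact: L1D.
apply: le_trans (lerD fc gc); rewrite -intRD; [|exact: L1_norm..].
apply: intR_le; [exact/L1_norm/L1D|by apply: L1D; exact: L1_norm|].
by move=> x; exact: ler_normD.
Qed.

Lemma NBZ r f c : NB f c -> NB (fun x => r * f x) (`|r| * c).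
Proof.
move=> /NBP[fi fc]; apply/NBP; split; first exact: L1Z.
rewrite (intR_ext (g := fun x => `|r| * `|f x|)); last by move=> x; rewrite normrM.
by rewrite intRZ; [exact: ler_wpM2l|exact: L1_norm].
Qed.

Lemma L1_NB f : L1 f -> NB f (\int[m]_x `|f x|).
Proof. by move=> fi; apply/NBP. Qed.

Lemma NB_abs f c : NB f c -> `|\int[m]_x f x| <= c.
Proof. by move=> /NBP[fi fc]; exact: le_trans (intR_norm fi) fc. Qed.

Lemma dct (f_ : nat -> T -> R) f g :
  (forall n, measfun (f_ n)) -> measfun f ->
  {ae m, forall x, f_ n x @[n --> \oo] --> f x} ->
  L1 g -> (forall n, {ae m, forall x, `|f_ n x| <= g x}) ->
  \int[m]_x f_ n x @[n --> \oo] --> \int[m]_x f x.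
Proof.
move=> mf_ mf ff gi fg.
have fi n : L1 (f_ n) by apply: L1_le_ae (fg n) gi.
have : ((\int[m]_x (f_ n x)%:E)%E @[n --> \oo] --> (\int[m]_x (f x)%:E)%E).
  have [|||||_ _] := @dominated_convergence _ _ _ m setT measurableT
    (fun n => EFin \o f_ n) (EFin \o f) (EFin \o g) => //.
  - by move=> n; exact/measurable_EFinP.
  - exact/measurable_EFinP.
  - by apply: filterS ff => x /= fx _; apply: cvg_EFin => //; exact: nearW.
  - have := ae_foralln fg.
    by apply: filterS => x /= fx n _; rewrite lee_fin.
have L1f : L1 f.
  have fg' := ae_foralln fg.
  apply: (L1_le_ae mf _ gi).
  apply: filterS2 ff fg' => x fx fgx.
  have : `|f_ n x| @[n --> \oo] --> `|f x| by apply: cvg_norm.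
  move=> /cvg_lim <- //; apply: limr_le; last by near=> n; exact: fgx.
  by apply: is_cvg_norm; apply/cvg_ex; exists (f x).
rewrite -(L1_EFin L1f).
move=> /fine_cvgP[_]; exact.
Unshelve. all: by end_near. Qed.

End L1.
Arguments L1 {d T R} m f.
Arguments NB {d T R} m f c.

Section FubiniReal.
Context d1 d2 (T1 : measurableType d1) (T2 : measurableType d2) (R : realType).
Context (m1 : {sigma_finite_measure set T1 -> \bar R}).
Context (m2 : {sigma_finite_measure set T2 -> \bar R}).
Implicit Types (F : T1 * T2 -> R).

Lemma mfun_section1 F x : measfun F -> measfun (fun y => F (x, y)).
Proof. by move=> mF; apply: measurableT_comp => //; exact: pair1_measurable. Qed.

Lemma mfun_section2 F y : measfun F -> measfun (fun x => F (x, y)).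
Proof. by move=> mF; apply: measurableT_comp => //; exact: pair2_measurable. Qed.

(** No integrability is assumed: the integrals of the positive and negative parts are measurable in
    the parameter and so is [fine], which covers the points where the integral takes its default
    value. *)
Lemma mfun_intR1 F : measfun F ->
  measfun (fun x => \int[m2]_y F (x, y)).
Proof.
move=> mF; apply: (@measurableT_comp _ _ _ _ _ _ (@fine R)); first exact: fine_measurable.
have -> : (fun x => \int[m2]_y (F (x, y))%:E)%E =
  (fun x => \int[m2]_y ((EFin \o F)^\+%E (x, y)) - \int[m2]_y ((EFin \o F)^\-%E (x, y)))%E.
  apply/funext => x; rewrite integralE; congr (_ - _)%E;
    by apply: eq_integral => y _; rewrite ?funeposE ?funenegE.
have mF' : measfun (EFin \o F) by exact/measurable_EFinP.
apply: emeasurable_funB.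
- apply: (@measurable_fun_fubini_tonelli_F _ _ _ _ _ m2 (EFin \o F)^\+%E) => //.
  exact: measurable_funepos.
- apply: (@measurable_fun_fubini_tonelli_F _ _ _ _ _ m2 (EFin \o F)^\-%E) => //.
  exact: measurable_funeneg.
Qed.

Lemma L1_prod_of2 F c : measfun F ->
  {ae m2, forall y, NB m1 (fun x => F (x, y)) (c y)} -> L1 m2 c ->
  L1 (m1 \x m2)%E F /\ \int[(m1 \x m2)%E]_z `|F z| <= \int[m2]_y c y.
Proof.
move=> mF Fc ci.
have mF' : measfun (EFin \o F) by exact/measurable_EFinP.
have mN : measfun (fun z => (`|F z|)%:E) by apply/measurable_EFinP; mfun.
have le : (\int[m2]_y \int[m1]_x `|(EFin \o F) (x, y)| <= (\int[m2]_y c y)%:E)%E.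
  rewrite L1_EFin//.
  have mc : measfun (EFin \o c) by apply/measurable_EFinP; exact: (L1_meas ci).
  apply: (@le_trans _ _ (\int[m2]_y `|(c y)%:E|)%E).
    apply: ae_ge0_le_integral => //=.
    - by move=> y _; exact: integral_ge0.
    - exact: (@measurable_fun_fubini_tonelli_G _ _ _ _ _ m1 (fun z => (`|F z|)%:E)).
    - by apply/measurable_EFinP; have ? := L1_meas ci; mfun.
    - apply: filterS Fc => y [_ h] _; apply: le_trans h _.
      by rewrite lee_fin ler_norm.
  rewrite le_eqVlt; apply/orP; left; apply/eqP; apply: ae_eq_integral => //.
    by apply/measurable_EFinP; have ? := L1_meas ci; mfun.
  apply: filterS Fc => y [_ h] _; rewrite [LHS]abse_EFin ger0_norm// -lee_fin.
  by apply: le_trans h; exact: integral_ge0.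
have FI : L1 (m1 \x m2)%E F.
  by apply/(integrable21ltyP _ _ mF'); apply: le_lt_trans le _; rewrite ltry.
split=> //.
rewrite -lee_fin L1_EFin; last exact: L1_norm.
by rewrite (@fubini_tonelli2 _ _ _ _ _ m1 m2 (fun z => (`|F z|)%:E)).
Qed.

Lemma L1_prod_of1 F c : measfun F ->
  {ae m1, forall x, NB m2 (fun y => F (x, y)) (c x)} -> L1 m1 c ->
  L1 (m1 \x m2)%E F /\ \int[(m1 \x m2)%E]_z `|F z| <= \int[m1]_x c x.
Proof.
move=> mF Fc ci.
have mF' : measfun (EFin \o F) by exact/measurable_EFinP.
have mN : measfun (fun z => (`|F z|)%:E) by apply/measurable_EFinP; mfun.
have le : (\int[m1]_x \int[m2]_y `|(EFin \o F) (x, y)| <= (\int[m1]_x c x)%:E)%E.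
  rewrite L1_EFin//.
  have mc : measfun (EFin \o c) by apply/measurable_EFinP; exact: (L1_meas ci).
  apply: (@le_trans _ _ (\int[m1]_x `|(c x)%:E|)%E).
    apply: ae_ge0_le_integral => //=.
    - by move=> y _; exact: integral_ge0.
    - exact: (@measurable_fun_fubini_tonelli_F _ _ _ _ _ m2 (fun z => (`|F z|)%:E)).
    - by apply/measurable_EFinP; have ? := L1_meas ci; mfun.
    - apply: filterS Fc => y [_ h] _; apply: le_trans h _.
      by rewrite lee_fin ler_norm.
  rewrite le_eqVlt; apply/orP; left; apply/eqP; apply: ae_eq_integral => //.
    by apply/measurable_EFinP; have ? := L1_meas ci; mfun.
  apply: filterS Fc => y [_ h] _; rewrite [LHS]abse_EFin ger0_norm// -lee_fin.
  by apply: le_trans h; exact: integral_ge0.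
have FI : L1 (m1 \x m2)%E F.
  by apply/(integrable12ltyP _ _ mF'); apply: le_lt_trans le _; rewrite ltry.
split=> //.
rewrite -lee_fin L1_EFin; last exact: L1_norm.
by rewrite (@fubini_tonelli1 _ _ _ _ _ m1 m2 (fun z => (`|F z|)%:E)).
Qed.

Section fub.
Variable F : T1 * T2 -> R.
Hypothesis FI : L1 (m1 \x m2)%E F.

Lemma fub_ae1 : {ae m1, forall x, L1 m2 (fun y => F (x, y))}.
Proof. exact: (@ae_integrable1 _ _ _ _ _ m1 m2 (EFin \o F) FI). Qed.

Lemma fub_ae2 : {ae m2, forall y, L1 m1 (fun x => F (x, y))}.
Proof. exact: (@ae_integrable2 _ _ _ _ _ m1 m2 (EFin \o F) FI). Qed.

Lemma fub_L11 : L1 m1 (fun x => \int[m2]_y F (x, y)).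
Proof.
have h := @integrable_fubini_F _ _ _ _ _ m1 m2 (EFin \o F) FI.
have mF := L1_meas FI.
move/integrableP : (h) => [mh ih].
apply/integrableP; split; first exact/measurable_EFinP/mfun_intR1.
rewrite (@ae_eq_integral _ _ _ _ _ (fun x => `|fubini_F m2 (EFin \o F) x|)%E)//.
- by apply: measurableT_comp => //; exact/measurable_EFinP/mfun_intR1.
- exact: measurableT_comp.
- by apply: filterS fub_ae1 => x Fx _; rewrite /fubini_F /fubini_G -?(L1_EFin Fx).
Qed.

Lemma fub_eq1 : \int[m1]_x \int[m2]_y F (x, y) = \int[(m1 \x m2)%E]_z F z.
Proof.
apply: EFin_inj; rewrite !L1_EFin//; last exact: fub_L11.
rewrite -(@integral12_prod_meas1 _ _ _ _ _ m1 m2 (EFin \o F) FI).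
have h := @integrable_fubini_F _ _ _ _ _ m1 m2 (EFin \o F) FI.
apply: ae_eq_integral => //.
- by apply/measurable_EFinP/mfun_intR1; exact: L1_meas FI.
- exact: measurable_int h.
- by apply: filterS fub_ae1 => x Fx _; rewrite /fubini_F /fubini_G -?(L1_EFin Fx).
Qed.
End fub.
End FubiniReal.

Section FubiniReal2.
Context d1 d2 (T1 : measurableType d1) (T2 : measurableType d2) (R : realType).
Context (m1 : {sigma_finite_measure set T1 -> \bar R}).
Context (m2 : {sigma_finite_measure set T2 -> \bar R}).
Implicit Types (F : T1 * T2 -> R).

Lemma mfun_intR2 F : measfun F ->
  measfun (fun y => \int[m1]_x F (x, y)).
Proof.
move=> mF; apply: (@mfun_intR1 _ _ _ _ _ m1 (fun z => F (z.2, z.1))).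
by apply: mfun_comp => //; mfun.
Qed.

Variable F : T1 * T2 -> R.
Hypothesis FI : L1 (m1 \x m2)%E F.

Lemma L1_prod_swap : L1 (m2 \x m1)%E (fun z => F (z.2, z.1)).
Proof.
have mF := L1_meas FI.
have mF' : measfun (EFin \o F) by exact/measurable_EFinP.
have mF2 : measfun (EFin \o (fun z : T2 * T1 => F (z.2, z.1))).
  by apply/measurable_EFinP; apply: mfun_comp => //; mfun.
apply/(integrable12ltyP _ _ mF2).
by move/(integrable21ltyP _ _ mF') : FI.
Qed.

Lemma fub_L12 : L1 m2 (fun y => \int[m1]_x F (x, y)).
Proof. exact: (fub_L11 L1_prod_swap). Qed.

Lemma fub_eq2 : \int[m2]_y \int[m1]_x F (x, y) = \int[(m1 \x m2)%E]_z F z.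
Proof.
apply: EFin_inj; rewrite !L1_EFin//; last exact: fub_L12.
rewrite -(@integral21_prod_meas1 _ _ _ _ _ m1 m2 (EFin \o F) FI).
apply: ae_eq_integral => //.
- by apply/measurable_EFinP/mfun_intR2; exact: L1_meas FI.
- exact: (@measurable_fubini_G _ _ _ _ _ m1 m2 (EFin \o F) FI).
- by apply: filterS (fub_ae2 FI) => x Fx _; rewrite /fubini_F /fubini_G -?(L1_EFin Fx).
Qed.

Lemma fub_swap :
  \int[m1]_x \int[m2]_y F (x, y) = \int[m2]_y \int[m1]_x F (x, y).
Proof. by rewrite fub_eq1// fub_eq2. Qed.
End FubiniReal2.

Section Fatou.
Context d (T : measurableType d) (R : realType) (m : {measure set T -> \bar R}).

Lemma fatouR (h_ : nat -> T -> R) (h : T -> R) (c_ : nat -> R) c :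
  (forall n, NB m (h_ n) (c_ n)) -> measfun h ->
  {ae m, forall x, h_ n x @[n --> \oo] --> h x} -> c_ n @[n --> \oo] --> c -> NB m h c.
Proof.
move=> hc mh hh cc; split => //.
have mh_ n := (hc n).1.
have H := @fatou _ _ _ m setT measurableT (fun n x => (`|h_ n x|)%:E)
  (fun n => proj2 (measurable_EFinP _ _) (mfun_norm (mh_ n))) _.
have {}H := H (fun n x _ => normr_ge0 (h_ n x)).
have -> : (\int[m]_x `|(h x)%:E| = \int[m]_x limn_einf (fun n => (`|h_ n x|)%:E))%E.
  apply: ae_eq_integral => //.
  - by apply/measurable_EFinP; mfun.
  - have mn n : measfun (fun x => (`|h_ n x|)%:E).
      by apply/measurable_EFinP; mfun.
    apply: (@emeasurable_fun_cvg _ _ _ setT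
      (fun n x => einfs (fun k => (`|h_ k x|)%:E) n)) => [n|x _].
      exact: (@measurable_fun_einfs _ _ _ _ (fun n x => (`|h_ n x|)%:E)).
    rewrite limn_einf_lim; exact: is_cvg_einfs.
  - apply: filterS hh => x hx _.
    have : ((`|h_ n x|)%:E @[n --> \oo] --> (`|h x|)%:E)%E.
      by apply: cvg_EFin; [exact: nearW|apply: cvg_norm].
    move=> hx'; rewrite is_cvg_limn_einfE; last by apply/cvg_ex; eexists; exact: hx'.
    by rewrite (cvg_lim _ hx').
apply: le_trans H _.
have cc' : ((c_ n)%:E @[n --> \oo] --> c%:E)%E.
  by apply: cvg_EFin => //; exact: nearW.
rewrite -(cvg_lim _ cc')// -is_cvg_limn_einfE; last by apply/cvg_ex; eexists; exact: cc'.
rewrite !limn_einf_lim; apply: lee_lim; [exact: is_cvg_einfs..|].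
apply: nearW => n; apply: le_ereal_inf_tmp => _ [k /= nk <-].
apply: le_trans (hc k).2; apply: ereal_inf_lbound.
by exists k.
Qed.
End Fatou.

Section Lebesgue.
Variable R : realType.
Notation mu := (@lebesgue_measure R).
Implicit Types (f g : R -> R) (x y a b c l : R).

Lemma intR_Rpos f :
  \int[mu]_(x in `]0, +oo[%classic) f x = \int[mu]_x (if 0 < x then f x else 0).
Proof.
rewrite Rintegral_mkcond; apply: intR_ext => x.
by rewrite patchE mem_setE in_itv/= andbT.
Qed.

Lemma intR_itv a b f :
  \int[mu]_(x in `]a, b[%classic) f x = \int[mu]_x (if a < x < b then f x else 0).
Proof.
rewrite Rintegral_mkcond; apply: intR_ext => x.
by rewrite patchE mem_setE in_itv.
Qed.

Lemma L1_Rpos f :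
  mu.-integrable `]0, +oo[%classic (fun x => (f x)%:E) <->
  L1 mu (fun x => if 0 < x then f x else 0).
Proof.
have h : (fun x => (f x)%:E) \_ `]0, +oo[%classic =
         EFin \o (fun x => if 0 < x then f x else 0).
  apply/funext => x; rewrite patchE mem_setE in_itv/= andbT.
  by case: ifP.
by rewrite /L1 -h; exact: integrable_mkcond.
Qed.

Lemma L1_itv a b f :
  mu.-integrable `]a, b[%classic (fun x => (f x)%:E) <->
  L1 mu (fun x => if a < x < b then f x else 0).
Proof.
have h : (fun x => (f x)%:E) \_ `]a, b[%classic =
         EFin \o (fun x => if a < x < b then f x else 0).
  apply/funext => x; rewrite patchE mem_setE in_itv/=.
  by case: ifP.
by rewrite /L1 -h; exact: integrable_mkcond.
Qed.

Lemma NB_itv c a b : a <= b ->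
  NB mu (fun x => if a < x < b then c else 0) (`|c| * (b - a)).
Proof.
move=> ab; split; first by mfun.
rewrite (_ : (fun x => _) = (fun x => (`|c|)%:E) \_ `]a, b[%classic); last first.
  apply/funext => x; rewrite patchE mem_setE in_itv/=.
  by case: ifP => //; rewrite normr0.
rewrite -integral_mkcond integral_cst//.
have h := lebesgue_measure_itv (`]a, b[ : interval R); rewrite /= lte_fin in h.
rewrite [X in (_ * X)%E]h.
case: ltP => [_|ba]; first by rewrite -EFinB -EFinM.
by rewrite mule0 lee_fin mulr_ge0// subr_ge0.
Qed.

Lemma L1_itv_bd f c a b : measfun f -> (forall x, a < x < b -> `|f x| <= c) ->
  L1 mu (fun x => if a < x < b then f x else 0).
Proof.
move=> mf fc; have [ab|/ltW ba] := leP a b; last first.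
  apply: L1_ext (L1_0 mu) _ => x; case: ifP => // /andP[ax xb].
  by have := lt_trans ax xb; rewrite ltNge ba.
apply: (@L1_le _ _ _ mu _ (fun x : R => if a < x < b then c else 0)).
- by mfun.
- by move=> x; case: ifP => [/fc//|_]; rewrite normr0.
- exact: NB_L1 (NB_itv c ab).
Qed.

(* The image of Lebesgue measure and its multiple agree on half-open intervals. *)
Lemma ge0_int_affine l a (f : R -> \bar R) : 0 < l -> measfun f ->
  (forall x, 0 <= f x)%E ->
  (\int[mu]_x f (l * x + a)%R = (l^-1)%:E * \int[mu]_x f x)%E.
Proof.
move=> l0 mf f0.
pose phi x : measurableTypeR R := l * x + a.
have mphi : measfun phi by rewrite /phi; mfun.
pose k : {nonneg R} := NngNum (ltW l0).
pose m0 := measure_function_pushforward__canonical__measure_function_Measure mu mphi.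
pose m' := mscale k m0.
have mE : forall A, measurable A -> mu A = m' A.
  apply: lebesgue_measure_unique => X [[u v] _ <-] /=.
  pose J : set R := `](u - a) / l, (v - a) / l]%classic.
  have hP : phi @^-1` `]u, v]%classic = J.
    apply/seteqP; split => x; rewrite /J /= /phi !in_itv/=.
      by rewrite ltr_pdivrMr// ler_pdivlMr// ltrBlDr lerBrDr (mulrC x).
    by rewrite ltr_pdivrMr// ler_pdivlMr// ltrBlDr lerBrDr (mulrC x).
  have mE : m' `]u, v]%classic = (l%:E * mu J)%E.
    by rewrite -hP.
  have h1 := lebesgue_measure_itv (`]u, v] : interval R).
  have h2 := lebesgue_measure_itv (`](u - a) / l, (v - a) / l] : interval R).
  rewrite [LHS]h1 [RHS]mE h2 /= !lte_fin ltr_pM2r ?invr_gt0// ltrD2r.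
  case: ifP => _; last by rewrite mule0.
  rewrite -!EFinB -EFinM -mulrBl; congr EFin.
  by rewrite mulrC -mulrA mulVf ?gt_eqF// mulr1; ring.
have e : (\int[mu]_x f x = l%:E * \int[mu]_x f (phi x))%E.
  rewrite (@eq_measure_integral _ _ _ setT m' mu)//; last by move=> A mA _; exact: mE.
  rewrite ge0_integral_mscale//=.
  by rewrite ge0_integral_pushforward.
rewrite e muleA -EFinM mulVf ?gt_eqF// mul1e//.
Qed.

Lemma L1_affine l a f : 0 < l -> L1 mu f -> L1 mu (fun x => f (l * x + a)).
Proof.
move=> l0 /integrableP[mf ifoo]; apply/integrableP; split.
  by apply: measurableT_comp mf _; mfun.
rewrite (@ge0_int_affine l a (fun x => `|(f x)%:E|)%E)//.
  by rewrite lte_mul_pinfty// lee_fin invr_ge0 ltW.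
exact: measurableT_comp.
Qed.

Lemma intR_affine l a f : 0 < l -> measfun f ->
  \int[mu]_x f (l * x + a) = l^-1 * \int[mu]_x f x.
Proof.
move=> l0 mf.
have mf' : measfun (EFin \o f) by exact/measurable_EFinP.
rewrite /Rintegral integralE [X in _ = _ * fine X]integralE.
have e1 : (\int[mu]_x (fun x => (f (l * x + a))%:E)^\+ x = (l^-1)%:E * \int[mu]_x (EFin \o f)^\+ x)%E.
  rewrite -(@ge0_int_affine l a)//; last exact: measurable_funepos.
  by apply: eq_integral => x _; rewrite !funeposE.
have e2 : (\int[mu]_x (fun x => (f (l * x + a))%:E)^\- x = (l^-1)%:E * \int[mu]_x (EFin \o f)^\- x)%E.
  rewrite -(@ge0_int_affine l a)//; last exact: measurable_funeneg.
  by apply: eq_integral => x _; rewrite !funenegE.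
rewrite e1 e2; set A := integral _ _ _; set B := integral _ _ _.
have A0 : (0 <= A)%E by exact: integral_ge0.
have B0 : (0 <= B)%E by exact: integral_ge0.
have li : 0 < l^-1 by rewrite invr_gt0.
(* Integrability is not assumed: as soon as one part is infinite, [fine] sends both sides to 0. *)
case: A A0 => [A| |] // A0; case: B B0 => [B| |] // B0 /=.
- by rewrite mulrBr.
- by rewrite gt0_muley ?lte_fin//= mulr0.
- by rewrite gt0_muley ?lte_fin//= mulr0.
- by rewrite gt0_muley ?lte_fin//= mulr0.
Qed.

Lemma intR_dil l f : 0 < l -> measfun f ->
  \int[mu]_x f (l * x) = l^-1 * \int[mu]_x f x.
Proof.
move=> l0 mf; rewrite -(@intR_affine l 0)//.
by apply: intR_ext => x; rewrite addr0.
Qed.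

Lemma L1_dil l f : 0 < l -> L1 mu f -> L1 mu (fun x => f (l * x)).
Proof.
move=> l0 fi; apply: L1_ext (L1_affine 0 l0 fi) _ => x.
by rewrite addr0.
Qed.

Lemma intR_shift a f : measfun f -> \int[mu]_x f (x + a) = \int[mu]_x f x.
Proof.
move=> mf; rewrite -[RHS]mul1r -invr1 -(@intR_affine 1 a)//.
by apply: intR_ext => x; rewrite mul1r.
Qed.

Lemma L1_shift a f : L1 mu f -> L1 mu (fun x => f (x + a)).
Proof.
move=> fi; apply: L1_ext (L1_affine a ltr01 fi) _ => x.
by rewrite mul1r.
Qed.

Lemma NB_dil l f c : 0 < l -> NB mu f c -> NB mu (fun x => f (l * x)) (l^-1 * c).
Proof.
move=> l0 /NBP[fi fc]; apply/NBP; split; first exact: L1_dil.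
rewrite (@intR_dil l (fun x => `|f x|))//; last by have := L1_meas fi => ?; mfun.
by rewrite ler_wpM2l// invr_ge0 ltW.
Qed.

End Lebesgue.

(** * The kernels, and the weight that controls them *)

Section Hyperbolic.
Variable R : realType.
Implicit Types (x y a b s t u : R).

Definition cosh u : R := (expR u + expR (- u)) / 2.

Lemma ndecr_of_is_derive (f df : R -> R) : (forall x, is_derive x 1 f (df x)) ->
  (forall x, 0 <= x -> 0 <= df x) -> forall x y, 0 <= x -> x <= y -> f x <= f y.
Proof.
move=> fd df0 x y x0 xy; rewrite -subr_ge0.
have [|c] := @MVT_segment R f df x y xy (fun z _ => fd z).
  apply: continuous_subspaceT => z.
  by apply: differentiable_continuous; apply/derivable1_diffP; case: (fd z).
rewrite in_itv/= => /andP[xc _] ->.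
by rewrite mulr_ge0 ?subr_ge0// df0// (le_trans x0).
Qed.

Lemma is_derive_sinh u : is_derive u 1 (@sinh R) (cosh u).
Proof.
have -> : @sinh R = (fun u => (expR u - expR (- u)) / 2) by [].
apply: is_derive_eq; rewrite /cosh.
by rewrite /GRing.scale/=; ring.
Qed.

Lemma is_derive_cosh u : is_derive u 1 cosh (sinh u).
Proof.
rewrite /cosh; apply: is_derive_eq.
by rewrite /GRing.scale/= /sinh; ring.
Qed.

(** Hyperbolic functions are rational in [expR u]; in this form the addition formulas below are
    identities for [field]. *)
Lemma sinhE u : sinh u = (expR u ^+ 2 - 1) / (2 * expR u).
Proof.
rewrite /sinh expRN; have e0 := expR_gt0 u.
by field; rewrite gt_eqF.
Qed.

Lemma coshE u : cosh u = (expR u ^+ 2 + 1) / (2 * expR u).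
Proof.
rewrite /cosh expRN; have e0 := expR_gt0 u.
by field; rewrite gt_eqF.
Qed.

Lemma sinh0 : sinh (0 : R) = 0.
Proof. by rewrite /sinh oppr0 subrr mul0r. Qed.

Lemma cosh_ge1 u : 1 <= cosh u.
Proof.
rewrite coshE; have e0 := expR_gt0 u.
rewrite ler_pdivlMr ?mulr_gt0// mul1r -subr_ge0.
by have := sqr_ge0 (expR u - 1); rewrite sqrrB1; lra.
Qed.

Lemma sinh_mono a b : a <= b -> sinh a <= sinh b.
Proof.
move=> ab; rewrite /sinh ler_pM2r ?invr_gt0//; apply: lerB; by rewrite ler_expR// lerN2.
Qed.

Lemma sinh_ge u : 0 <= u -> u <= sinh u.
Proof.
move=> u0; rewrite -subr_ge0.
have := @ndecr_of_is_derive (fun u => sinh u - u) (fun u => cosh u - 1) _ _ 0 u (lexx _) u0.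
rewrite sinh0 subr0; apply.
- by move=> x; have := is_derive_sinh x => ?; apply: is_deriveB.
- by move=> x _; rewrite subr_ge0 cosh_ge1.
Qed.

Lemma sinh_gt0 u : 0 < u -> 0 < sinh u.
Proof. by move=> u0; apply: (lt_le_trans u0); exact/sinh_ge/ltW. Qed.

Lemma sinh_ge0 u : 0 <= u -> 0 <= sinh u.
Proof. by move=> u0; apply: (le_trans u0); exact/sinh_ge. Qed.

Lemma cosh_mono a b : 0 <= a -> a <= b -> cosh a <= cosh b.
Proof.
move=> a0 ab; apply: (@ndecr_of_is_derive cosh (@sinh R) is_derive_cosh _ _ _ a0 ab) => x; exact: sinh_ge0.
Qed.

Lemma sinh_le_cosh u : 0 <= u -> sinh u <= u * cosh u.
Proof.
move=> u0; rewrite -subr_ge0.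
have := @ndecr_of_is_derive (fun u => u * cosh u - sinh u) (fun u => u * sinh u) _ _ 0 u (lexx _) u0.
rewrite sinh0 mul0r subr0; apply.
- move=> x; have ? := is_derive_sinh x; have ? := is_derive_cosh x.
  by apply: is_derive_eq; rewrite /GRing.scale/=; ring.
- by move=> x x0; rewrite mulr_ge0// sinh_ge0.
Qed.

Lemma cosh_le_sinh u : 0 <= u -> u * cosh u <= (1 + u) * sinh u.
Proof.
move=> u0; have h : u * expR (- u) <= u by rewrite ler_piMr// -expR0 ler_expR; lra.
have h2 := sinh_ge u0.
have e : cosh u = sinh u + expR (- u) by rewrite /cosh /sinh; field.
by rewrite e; lra.
Qed.

(** Convexity of sinh on the half line, with sinh 0 = 0. *)
Lemma sinh_scale_le (l s : R) : 0 <= l <= 1 -> 0 <= s -> sinh (l * s) <= l * sinh s.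
Proof.
move=> /andP[l0 l1] s0; rewrite -subr_ge0.
have := @ndecr_of_is_derive (fun u => l * sinh u - sinh (l * u))
  (fun u => l * cosh u - l * cosh (l * u)) _ _ 0 s (lexx _) s0.
rewrite mulr0 sinh0 mulr0 subr0; apply.
- move=> x; have ? := is_derive_sinh x.
  have d1 : is_derive x 1 (fun u => l * u) l.
    by apply: is_derive_eq; rewrite /GRing.scale/=; ring.
  have d2 : is_derive x 1 (@sinh R \o (fun u => l * u)) (l * cosh (l * x)).
    have := @is_derive1_comp _ (@sinh R) (fun u => l * u) x (cosh (l * x)) l (is_derive_sinh _) d1.
    by rewrite mulrC.
  have d3 : is_derive x 1 (fun u => sinh (l * u)) (l * cosh (l * x)) by exact: d2.
  by apply: is_derive_eq; rewrite /GRing.scale/=; ring.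
- move=> x x0; rewrite -mulrBr mulr_ge0// subr_ge0 cosh_mono//; first by rewrite mulr_ge0.
  by rewrite ler_piMl.
Qed.

(** What remains of coth once its pole is removed (the Langevin function). The difference of the two
    kernels is a combination of such terms. *)
Definition langevin u : R := cosh u / sinh u - u^-1.

Lemma langevin_bound u : 0 < u -> 0 <= langevin u <= 1.
Proof.
move=> u0; have s0 := sinh_gt0 u0; rewrite /langevin.
have -> : cosh u / sinh u - u^-1 = (u * cosh u - sinh u) / (u * sinh u).
  by field; rewrite !gt_eqF.
have us : 0 < u * sinh u by rewrite mulr_gt0.
apply/andP; split; first by rewrite divr_ge0 ?(ltW us)// subr_ge0 sinh_le_cosh// ltW.
rewrite ler_pdivrMr//.
by have := cosh_le_sinh (ltW u0); lra.
Qed.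

(** With a = x^2 and b = y^2 this writes [kerM], up to the factor (y / x)^3, as a sum of values of
    coth. Replacing each coth u by 1 / u gives [kerL] exactly. *)
Lemma sinhD_coth a b : 0 < b -> b < a ->
  ((sinh (a - b))^-1 - (sinh (a + b))^-1) * (sinh a / sinh b) =
  cosh (a - b) / sinh (a - b) + cosh (a + b) / sinh (a + b).
Proof.
move=> b0 ba; have a0 := lt_trans b0 ba.
have e2 u : 0 < u -> expR u ^+ 2 - 1 != 0.
  by move=> u0; rewrite gt_eqF// subr_gt0 exprn_egt1// expR_gt1.
have p0 : expR a != 0 by rewrite gt_eqF ?expR_gt0.
have q0 : expR b != 0 by rewrite gt_eqF ?expR_gt0.
have q1 := e2 _ b0.
have /e2 : 0 < a + b by rewrite addr_gt0.
have /e2 : 0 < a - b by rewrite subr_gt0.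
rewrite expRB => h1; rewrite expRD => h2.
have h3 : expR a ^+ 2 - expR b ^+ 2 != 0.
  apply: contra h1; rewrite subr_eq0 => /eqP E.
  by rewrite exprMn exprVn E mulfV ?expf_neq0// subrr.
rewrite !sinhE ?coshE expRB expRD; field.
by rewrite !mulN1r ?q1 p0 q0 ?h3 ?h2 ?q1.
Qed.

Lemma sinhD_coth2 a b : 0 < a -> a < b ->
  ((sinh (b - a))^-1 - (sinh (a + b))^-1) * (sinh a / sinh b) =
  cosh (b - a) / sinh (b - a) + cosh (a + b) / sinh (a + b) - 2 * (cosh b / sinh b).
Proof.
move=> a0 ab; have b0 := lt_trans a0 ab.
have e2 u : 0 < u -> expR u ^+ 2 - 1 != 0.
  by move=> u0; rewrite gt_eqF// subr_gt0 exprn_egt1// expR_gt1.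
have p0 : expR a != 0 by rewrite gt_eqF ?expR_gt0.
have q0 : expR b != 0 by rewrite gt_eqF ?expR_gt0.
have q1 := e2 _ b0.
have /e2 : 0 < a + b by rewrite addr_gt0.
have /e2 : 0 < b - a by rewrite subr_gt0.
rewrite expRB => h1; rewrite expRD => h2.
have h3 : expR b ^+ 2 - expR a ^+ 2 != 0.
  apply: contra h1; rewrite subr_eq0 => /eqP E.
  by rewrite exprMn exprVn E mulfV ?expf_neq0// subrr.
rewrite !sinhE ?coshE expRB expRD; field.
by rewrite !mulN1r ?q1 p0 q0 ?h3 ?h2 ?q1.
Qed.

(** A product without cancellation; the sum of coth terms does not display the decay when b is much
    larger than a. *)
Lemma sinhD_mul a b : 0 < a -> a < b ->
  ((sinh (b - a))^-1 - (sinh (a + b))^-1) =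
  2 * cosh b * sinh a / (sinh (b - a) * sinh (a + b)).
Proof.
move=> a0 ab; have b0 := lt_trans a0 ab.
have e2 u : 0 < u -> expR u ^+ 2 - 1 != 0.
  by move=> u0; rewrite gt_eqF// subr_gt0 exprn_egt1// expR_gt1.
have p0 : expR a != 0 by rewrite gt_eqF ?expR_gt0.
have q0 : expR b != 0 by rewrite gt_eqF ?expR_gt0.
have /e2 : 0 < a + b by rewrite addr_gt0.
have /e2 : 0 < b - a by rewrite subr_gt0.
rewrite expRB => h1; rewrite expRD => h2.
have h3 : expR b ^+ 2 - expR a ^+ 2 != 0.
  apply: contra h1; rewrite subr_eq0 => /eqP E.
  by rewrite exprMn exprVn E mulfV ?expf_neq0// subrr.
rewrite !sinhE ?coshE expRB expRD; field.
by rewrite !mulN1r p0 q0 ?h3 ?h2.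
Qed.

End Hyperbolic.

Lemma NB_ae d (T : measurableType d) (R : realType) (m : {measure set T -> \bar R})
    (f g : T -> R) c : measfun f -> {ae m, forall x, f x = g x} ->
  NB m g c -> NB m f c.
Proof.
move=> mf fg /NBP[gi gc]; have mg := L1_meas gi.
apply/NBP; split; first exact: L1_ae fg gi.
apply: le_trans gc; rewrite le_eqVlt; apply/orP; left; apply/eqP.
by apply: intR_ae; [mfun|mfun|apply: filterS fg => x ->].
Qed.

Lemma NB_0 d (T : measurableType d) (R : realType) (m : {measure set T -> \bar R})
    (c : R) : 0 <= c -> NB m (fun _ => 0) c.
Proof.
move=> c0; apply/NBP; split; first exact: L1_0.
by rewrite intR_eq0// => x; rewrite normr0.
Qed.

Section FTCbounds.
Variable R : realType.
Notation mu := (@lebesgue_measure R).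
Implicit Types (f F : R -> R) (a b c x y l : R).

Lemma NB_ftc f F a b : a < b -> measfun f ->
  (forall x, a <= x <= b -> 0 <= f x) ->
  (forall x, a <= x <= b -> {for x, continuous f}) ->
  (forall x, a <= x <= b -> is_derive x 1 F (f x)) ->
  NB mu (fun x => if a < x < b then f x else 0) (F b - F a).
Proof.
move=> ab mf f0 cf dF.
have cF x : a <= x <= b -> {for x, continuous F}.
  move=> xab; apply: differentiable_continuous; apply/derivable1_diffP.
  by case: (dF x xab).
have w (g : R -> R) : (forall x, a <= x <= b -> {for x, continuous g}) ->
   {within `[a, b], continuous g}.
  move=> cg; apply: continuous_in_subspaceT => x; rewrite inE/= in_itv/=.
  exact: cg.
split; first by mfun.
have -> : (fun x => `|(if a < x < b then f x else 0)%:E|)%E = (EFin \o f) \_ `]a, b[%classic.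
  apply/funext => x; rewrite patchE mem_setE in_itv/=; case: ifP => [/andP[ax xb]|_].
    by rewrite /= ger0_norm// f0// !ltW.
  by rewrite /= normr0.
rewrite -integral_mkcond.
apply: (@le_trans _ _ (\int[mu]_(x in `[a, b]) (f x)%:E)%E).
  apply: ge0_subset_integral => //.
  - by apply/measurable_EFinP; exact: measurable_funTS.
  - by move=> x; rewrite /= !in_itv/= => /andP[ax xb]; rewrite !ltW.
rewrite (@continuous_FTC2 _ f F a b ab (w _ cf))//.
  split.
  - by move=> x; rewrite in_itv/= => /andP[ax xb]; have [] := dF x; rewrite ?ltW.
  - have := cF a; rewrite lexx ltW// => /(_ isT) h.
    exact: cvg_at_right_filter.
  - have := cF b; rewrite lexx ltW// => /(_ isT) h.
    exact: cvg_at_left_filter.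
move=> x; rewrite in_itv/= => /andP[ax xb].
by rewrite derive1E; apply: derive_val; apply: dF; rewrite !ltW.
Qed.

Lemma NB_inv_sqr a : 0 < a -> NB mu (fun y => if a < y then (y ^+ 2)^-1 else 0) a^-1.
Proof.
move=> a0; split; first by mfun.
have -> : (fun y => `|(if a < y then (y ^+ 2)^-1 else 0)%:E|)%E =
          (fun y => ((y ^+ 2)^-1)%:E) \_ `]a, +oo[%classic.
  apply/funext => x; rewrite patchE mem_setE in_itv/= andbT; case: ifP => [ax|_].
    by rewrite ger0_norm// invr_ge0 sqr_ge0.
  by rewrite normr0.
rewrite -integral_mkcond.
have mf : measfun (fun y : R => ((y ^+ 2)^-1)%:E).
  by apply/measurable_EFinP; mfun.
apply: (@le_trans _ _ (\int[mu]_(y in `[a, +oo[) ((y ^+ 2)^-1)%:E)%E).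
  apply: ge0_subset_integral => //.
  - exact: measurable_funTS.
  - by move=> x _; rewrite lee_fin invr_ge0 sqr_ge0.
  - by move=> x; rewrite /= !in_itv/= !andbT => /ltW.
have pos x : a <= x -> x != 0 by move=> ax; rewrite gt_eqF// (lt_le_trans a0).
have cV x : a <= x -> {for x, continuous (fun y : R => - y^-1)}.
  by move=> /pos x0; apply: cvgN; exact: inv_continuous.
rewrite (@ge0_continuous_FTC2y _ (fun y => (y ^+ 2)^-1) (fun y => - y^-1) a 0).
- by rewrite sub0e -EFinN opprK.
- by move=> x _; rewrite invr_ge0 sqr_ge0.
- apply: continuous_in_subspaceT => x; rewrite inE/= in_itv/= andbT => /pos x0.
  apply: (@continuous_comp _ _ _ (fun y : R => y ^+ 2) (@GRing.inv R)).
    exact: exprn_continuous.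
  by apply: inv_continuous; rewrite expf_neq0.
- rewrite -oppr0; apply: cvgN.
  apply/cvgrPdist_lt => e e0; near=> x.
  have x0 : 0 < x by near: x; exact: nbhs_pinfty_gt.
  rewrite sub0r normrN ger0_norm ?invr_ge0 ?ltW//.
  rewrite -[ltRHS]invrK ltf_pV2 ?posrE ?invr_gt0//.
  by near: x; apply: nbhs_pinfty_gt; exact: num_real.
- by move=> x ax; apply: derivableN; apply: derivableV => //; exact/pos/ltW.
- by apply: cvg_at_right_filter; apply: cV.
- move=> x; rewrite in_itv/= andbT => /ltW/pos x0.
  rewrite derive1E deriveN; last by apply: derivableV.
  rewrite deriveV// derive_id /GRing.scale/= mulr1 opprK.
  by [].
Unshelve. all: by end_near. Qed.

Lemma NB_inv_left d : 0 < d -> d < 1 ->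
  NB mu (fun t => if 0 < t < 1 - d then (1 - t)^-1 else 0) (- ln d).
Proof.
move=> d0 d1.
have -> : - ln d = - ln (1 - (1 - d)) - - ln (1 - 0) by rewrite subr0 ln1 oppr0 subr0; congr (- ln _); lra.
have pos t : 0 <= t <= 1 - d -> 0 < 1 - t by move=> /andP[_ h]; lra.
apply: (@NB_ftc (fun t => (1 - t)^-1) (fun t => - ln (1 - t))); [lra|by mfun|..].
- by move=> t /pos h; rewrite invr_ge0 ltW.
- move=> t /pos h; apply: (@continuous_comp _ _ _ (fun t : R => 1 - t) (@GRing.inv R)).
    by apply: cvgB; [exact: cvg_cst|exact: cvg_id].
  by apply: inv_continuous; rewrite gt_eqF.
- move=> t /pos h.
  have d2 : is_derive t 1 (fun t : R => 1 - t) (- 1).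
    by apply: is_derive_eq; rewrite /GRing.scale/=; ring.
  have d3 : is_derive t 1 (@ln R \o (fun t => 1 - t)) ((1 - t)^-1 * - 1).
    exact: (@is_derive1_comp _ (@ln R) (fun u => 1 - u) t ((1 - t)^-1) (- 1) (is_derive1_ln h) d2).
  have d4 : is_derive t 1 (fun t => ln (1 - t)) ((1 - t)^-1 * - 1) by exact: d3.
  by apply: is_derive_eq; rewrite /GRing.scale/=; ring.
Qed.

Lemma NB_inv_right d : 0 < d -> d < 1 ->
  NB mu (fun t => if 1 + d < t < 2 then (t - 1)^-1 else 0) (- ln d).
Proof.
move=> d0 d1.
have -> : - ln d = ln (2 - 1) - ln (1 + d - 1).
  have -> : 2 - 1 = 1 :> R by lra.
  by rewrite ln1 sub0r; congr (- ln _); lra.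
have pos t : 1 + d <= t <= 2 -> 0 < t - 1 by move=> /andP[h _]; lra.
apply: (@NB_ftc (fun t => (t - 1)^-1) (fun t => ln (t - 1))); [lra|by mfun|..].
- by move=> t /pos h; rewrite invr_ge0 ltW.
- move=> t /pos h; apply: (@continuous_comp _ _ _ (fun t : R => t - 1) (@GRing.inv R)).
    by apply: cvgB; [exact: cvg_id|exact: cvg_cst].
  by apply: inv_continuous; rewrite gt_eqF.
- move=> t /pos h.
  have d2 : is_derive t 1 (fun t : R => t - 1) 1.
    by apply: is_derive_eq; rewrite /GRing.scale/=; ring.
  have d3 : is_derive t 1 (@ln R \o (fun t => t - 1)) ((t - 1)^-1 * 1).
    exact: (@is_derive1_comp _ (@ln R) (fun u => u - 1) t ((t - 1)^-1) 1 (is_derive1_ln h) d2).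
  by rewrite mulr1 in d3.
Qed.

(* An integrable majorant of 2 y^2 / (1 + y^4). *)
Definition hb y : R := if 0 < y < 1 then 2 else if 1 <= y then 2 * (y ^+ 2)^-1 else 0.

Lemma mfun_hb : measfun hb.
Proof. by rewrite /hb; mfun. Qed.

Lemma NB_hb : NB mu hb 4.
Proof.
have h : NB mu (fun y => (if 0 < y < 1 then 2 else 0) + 2 * (if 1 < y then (y ^+ 2)^-1 else 0)) 4.
  have -> : 4 = `|2| * (1 - 0) + `|2| * 1^-1 :> R by rewrite ger0_norm// subr0 invr1; lra.
  apply: NBD; first by apply: NB_itv.
  by apply: NBZ; apply: NB_inv_sqr.
have ae : {ae mu, forall y, hb y = (if 0 < y < 1 then 2 else 0) + 2 * (if 1 < y then (y ^+ 2)^-1 else 0)}.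
  exists [set 1]; split => //; first exact: lebesgue_measure_set1.
  move=> y /= h0; apply/eqP/negPn/negP => y1; apply: h0; rewrite /hb.
  have [yl|yl|yE] := ltgtP (y : R) 1; last by rewrite yE eqxx in y1.
    by rewrite andbT mulr0 addr0.
  by rewrite andbF add0r.
by apply: (NB_ae _ ae h); exact: mfun_hb.
Qed.

Definition etaW x : R := (1 + x ^+ 4)^-1.
Definition W x : R := if 0 < x then x ^+ 2 * etaW x else 0.

Lemma etaW_den x : 0 < 1 + x ^+ 4.
Proof. by have := @exprn_even_ge0 _ 4 x isT; lra. Qed.

Lemma etaW_gt0 x : 0 < etaW x.
Proof. by rewrite invr_gt0 etaW_den. Qed.

Lemma mfun_etaW : measfun etaW.
Proof. by rewrite /etaW; mfun. Qed.

Lemma mfun_W : measfun W.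
Proof. by have := mfun_etaW; rewrite /W => ?; mfun. Qed.

Lemma W_ge0 x : 0 <= W x.
Proof. by rewrite /W; case: ifP => // _; rewrite mulr_ge0 ?sqr_ge0// ltW// etaW_gt0. Qed.

Lemma etaW_le1 x : etaW x <= 1.
Proof. by rewrite /etaW invf_le1 ?etaW_den// lerDl exprn_even_ge0. Qed.

Lemma mul_etaW_le1 x : 0 <= x ->
  [/\ x * etaW x <= 1, x ^+ 2 * etaW x <= 1 & x ^+ 3 * etaW x <= 1].
Proof.
move=> x0; have e0 := etaW_den x; rewrite /etaW; rewrite !ler_pdivrMr// !mul1r.
have h2 := sqr_ge0 x; have h : 0 <= (x ^+ 2 - 1) ^+ 2 by exact: sqr_ge0.
have h' : 0 <= (x - 1) ^+ 2 by exact: sqr_ge0.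
have h3 : 0 <= x * (x - 1) ^+ 2 by rewrite mulr_ge0.
have h4 : 0 <= x ^+ 2 * (x - 1) ^+ 2 by rewrite mulr_ge0.
have h5 : 0 <= x ^+ 3 by rewrite exprn_ge0.
split; nra.
Qed.

Lemma W_le1 x : W x <= 1.
Proof. by rewrite /W; case: ifP => // /ltW x0; have [] := mul_etaW_le1 x0. Qed.

Lemma W_le x : 0 <= x -> W x <= x.
Proof.
move=> x0; rewrite /W; case: ifP => // _.
rewrite expr2 -mulrA ler_piMr//; by have [] := mul_etaW_le1 x0.
Qed.

Lemma hb_ge0 x : 0 <= hb x.
Proof.
rewrite /hb; case: ifP => // _; case: ifP => // _.
by rewrite mulr_ge0// invr_ge0 sqr_ge0.
Qed.

Lemma W_le_hb x : 2 * W x <= hb x.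
Proof.
rewrite /W /hb; have [x0|x0] := ltP 0 x; last first.
  by rewrite mulr0 /=; case: ifP => // x1; rewrite mulr_ge0// invr_ge0 sqr_ge0.
have [x1|x1] /= := ltP x 1.
  by have [_ h _] := mul_etaW_le1 (ltW x0); lra.
rewrite ler_pM2l// /etaW ler_pdivrMr ?etaW_den// mulrC ler_pdivlMr ?exprn_gt0//.
by rewrite -exprD; lra.
Qed.

Lemma NB_W : NB mu W 2.
Proof.
have h := NBZ 2^-1 NB_hb.
apply: (NB_le _ _ h); [exact: mfun_W| |by rewrite ger0_norm//; lra].
move=> x; rewrite ger0_norm ?W_ge0// ger0_norm; last by rewrite mulr_ge0// hb_ge0.
by have := W_le_hb x; lra.
Qed.

(** [kerL] reduced to a single fraction on each side of the diagonal, with value 0 on the diagonal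
    and outside the quadrant. *)
Definition kL x y : R :=
  if 0 < y < x then 2 * y ^+ 3 / (x * (x ^+ 4 - y ^+ 4))
  else if 0 < x < y then 2 * x * y / (y ^+ 4 - x ^+ 4) else 0.

Lemma pow4_lt x y : 0 <= x -> x < y -> 0 < y ^+ 4 - x ^+ 4.
Proof. by move=> x0 xy; rewrite subr_gt0 ltrXn2r. Qed.

Lemma kL_ge0 x y : 0 <= kL x y.
Proof.
rewrite /kL; case: ifP => [/andP[y0 yx]|_].
  have x0 := lt_trans y0 yx; have h := pow4_lt (ltW y0) yx.
  by rewrite divr_ge0// mulr_ge0// ?exprn_ge0// ltW.
case: ifP => // /andP[x0 xy]; have h := pow4_lt (ltW x0) xy.
by rewrite divr_ge0// ?mulr_ge0// ltW// (lt_trans x0).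
Qed.

Lemma kL_eq0 x y : ~~ ((0 < x) && (0 < y)) -> kL x y = 0.
Proof.
rewrite negb_and -!leNgt /kL => /orP[h|h].
  case: ifP => [/andP[y0 yx]|_]; first by have := lt_le_trans (lt_trans y0 yx) h; rewrite ltxx.
  by case: ifP => // /andP[x0 _]; have := lt_le_trans x0 h; rewrite ltxx.
case: ifP => [/andP[y0 yx]|_]; first by have := lt_le_trans y0 h; rewrite ltxx.
by case: ifP => // /andP[x0 xy]; have := lt_le_trans (lt_trans x0 xy) h; rewrite ltxx.
Qed.

Lemma kL_lt x y : 0 < y -> y < x -> kL x y = 2 * y ^+ 3 / (x * (x ^+ 4 - y ^+ 4)).
Proof. by move=> y0 yx; rewrite /kL y0 yx. Qed.

Lemma kL_gt x y : 0 < x -> x < y -> kL x y = 2 * x * y / (y ^+ 4 - x ^+ 4).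
Proof. by move=> x0 xy; rewrite /kL x0 xy (lt_gtF xy) andbF. Qed.

Lemma kL_diag x : kL x x = 0.
Proof. by rewrite /kL ltxx !andbF. Qed.

Lemma kL_sym x y : x ^+ 2 * kL x y = y ^+ 2 * kL y x.
Proof.
have [/andP[x0 y0]|h] := boolP ((0 < x) && (0 < y)); last first.
  by rewrite !kL_eq0 ?mulr0// andbC.
wlog xy : x y x0 y0 / x < y => [hw|].
  have [xy|yx|->//] := ltgtP x y; first exact: hw.
  by rewrite (hw y x).
rewrite kL_gt// kL_lt//; have h := pow4_lt (ltW x0) xy.
by field; rewrite !gt_eqF.
Qed.

Lemma kL_scale l x y : 0 < l -> kL (l * x) (l * y) = l ^- 2 * kL x y.
Proof.
move=> l0; rewrite /kL !ltr_pM2l// !pmulr_rgt0//.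
case: ifP => [/andP[y0 yx]|_].
  have x0 := lt_trans y0 yx; have h := pow4_lt (ltW y0) yx.
  by field; rewrite !gt_eqF// !exprMn -mulrBr mulr_gt0// exprn_gt0.
case: ifP => [/andP[x0 xy]|_]; last by rewrite mulr0.
have h := pow4_lt (ltW x0) xy.
by field; rewrite !gt_eqF// !exprMn -mulrBr mulr_gt0// exprn_gt0.
Qed.

Lemma kerLE x y : 0 < x -> 0 < y -> x != y -> kerL x y = kL x y.
Proof.
move=> x0 y0; rewrite /kerL neq_lt => /orP[xy|yx].
  rewrite kL_gt//; have h := pow4_lt (ltW x0) xy.
  have h2 : x ^+ 2 < y ^+ 2 by rewrite ltrXn2r// ltW.
  rewrite ler0_norm ?subr_le0 ?ltW// opprB.
  have h3 : 0 < x ^+ 2 + y ^+ 2 by rewrite addr_gt0// exprn_gt0.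
  have h4 : 0 < y ^+ 2 - x ^+ 2 by rewrite subr_gt0.
  by field; rewrite !gt_eqF.
rewrite kL_lt//; have h := pow4_lt (ltW y0) yx.
have h2 : y ^+ 2 < x ^+ 2 by rewrite ltrXn2r// ltW.
rewrite ger0_norm ?subr_ge0 ?ltW//.
have h3 : 0 < x ^+ 2 + y ^+ 2 by rewrite addr_gt0// exprn_gt0.
have h4 : 0 < x ^+ 2 - y ^+ 2 by rewrite subr_gt0.
by field; rewrite !gt_eqF.
Qed.

Lemma mfun_kL : measfun2 R kL.
Proof. by rewrite /kL; mfun. Qed.

(** The factor x^4 - y^4 is the denominator of [kL]; this dictates the exponent 4 in [etaW]. *)
Lemma etaW_sub x y : etaW y - etaW x = (x ^+ 4 - y ^+ 4) * (etaW x * etaW y).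
Proof.
by rewrite /etaW; have h1 := etaW_den x; have h2 := etaW_den y; field; rewrite !gt_eqF.
Qed.

(* etaW y - etaW x vanishes where the kernel is singular: this is what makes
   W = x^2 etaW a weight with L^* W <= 6 W. *)
Lemma kL_eta_bound x y : 0 < x ->
  `|etaW y - etaW x| * kL x y <= etaW x * ((if 0 < y < x then 2 / x else 0) + hb y).
Proof.
move=> x0; have ex := etaW_gt0 x; have ey := etaW_gt0 y; have hb0 := hb_ge0 y.
have [y0|y0] := ltP 0 y; last first.
  rewrite kL_eq0 ?mulr0; last by rewrite negb_and -!leNgt y0 orbT.
  by rewrite /= add0r mulr_ge0// ltW.
rewrite etaW_sub normrM [`|etaW x * _|]ger0_norm; last by rewrite mulr_ge0 ?ltW.
rewrite -!mulrA mulrCA.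
rewrite ler_pM2l//; have [_ e2 e3] := mul_etaW_le1 (ltW y0).
have W2 := W_le_hb y; rewrite /W y0 in W2.
have [xy|yx|->] := ltgtP x y; last by rewrite kL_diag !mulr0 add0r.
  rewrite add0r kL_gt//; have h := pow4_lt (ltW x0) xy.
  rewrite ltr0_norm; last by rewrite -oppr_gt0 opprB.
  have -> : - (x ^+ 4 - y ^+ 4) * (etaW y * (2 * x * y / (y ^+ 4 - x ^+ 4))) =
     2 * (x * y * etaW y) by field; rewrite gt_eqF.
  apply: le_trans W2; rewrite ler_pM2l// ler_pM2r// expr2 ler_pM2r// ltW//.
rewrite kL_lt//; have h := pow4_lt (ltW y0) yx.
rewrite gtr0_norm//.
have -> : (x ^+ 4 - y ^+ 4) * (etaW y * (2 * y ^+ 3 / (x * (x ^+ 4 - y ^+ 4)))) =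
     (y ^+ 3 * etaW y) * (2 / x) by field; rewrite !gt_eqF.
apply: (@le_trans _ _ (2 / x)); last by rewrite lerDl.
by rewrite ler_piMl// divr_ge0// ltW.
Qed.

Lemma NB_kL_eta x : 0 < x -> NB mu (fun y => (etaW y - etaW x) * kL x y) (6 * etaW x).
Proof.
move=> x0; have ex := etaW_gt0 x.
have h1 : NB mu (fun y => (if 0 < y < x then 2 / x else 0) + hb y) 6.
  (* The box of height 2 / x over (0, x) has mass 2, and [hb] has mass at most 4. *)
  have -> : 6 = `|2 / x| * (x - 0) + 4 :> R.
    rewrite ger0_norm ?divr_ge0 ?ltW// subr0 divfK ?gt_eqF//; lra.
  by apply: NBD NB_hb; apply: NB_itv; exact: ltW.
have h2 := NBZ (etaW x) h1.
apply: NB_le h2 _.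
- have me := mfun_etaW; have mk := mfun_section1 x mfun_kL; mfun.
- move=> y; rewrite normrM (ger0_norm (kL_ge0 _ _)).
  by apply: le_trans (kL_eta_bound y x0) _; rewrite ler_norm.
- by rewrite gtr0_norm// mulrC.
Qed.

End FTCbounds.

Section Kernels.
Variable R : realType.
Notation mu := (@lebesgue_measure R).
Implicit Types (f F : R -> R) (a b c d x y l : R).

(** The distance is measured relatively, so that the truncation is invariant under dilations and the
    truncated kernel keeps the homogeneity and the symmetry of [kL]. *)
Definition far d x y : bool := (y <= (1 - d) * x) || (x <= (1 - d) * y).

Lemma farC d x y : far d x y = far d y x.
Proof. by rewrite /far orbC. Qed.

Lemma far_scale d l x y : 0 < l -> far d (l * x) (l * y) = far d x y.
Proof. by move=> l0; rewrite /far !(mulrCA _ l) !ler_pM2l. Qed.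

Definition kLd d x y : R := if far d x y then kL x y else 0.

Lemma mfun_far d : measfun2 R (far d).
Proof. by rewrite /far; mfun. Qed.

Lemma mfun_kLd d : measfun2 R (kLd d).
Proof. by have h1 := mfun_far d; have h2 := @mfun_kL R; rewrite /kLd; mfun. Qed.

Lemma kLd_ge0 d x y : 0 <= kLd d x y.
Proof. by rewrite /kLd; case: ifP => // _; exact: kL_ge0. Qed.

Lemma kLd_le d x y : kLd d x y <= kL x y.
Proof. by rewrite /kLd; case: ifP => // _; exact: kL_ge0. Qed.

Lemma kLd_sym d x y : x ^+ 2 * kLd d x y = y ^+ 2 * kLd d y x.
Proof. by rewrite /kLd farC; case: ifP => _; rewrite ?mulr0// kL_sym. Qed.

Lemma kLd_scale d l x y : 0 < l -> kLd d (l * x) (l * y) = l ^- 2 * kLd d x y.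
Proof. by move=> l0; rewrite /kLd far_scale// kL_scale//; case: ifP; rewrite ?mulr0. Qed.

Lemma kLd_eq0 d x y : ~~ ((0 < x) && (0 < y)) -> kLd d x y = 0.
Proof. by move=> h; rewrite /kLd kL_eq0//; case: ifP. Qed.

(* x^2 kL is homogeneous of degree 0, so it is bounded for x = 1 first. *)
Lemma kLd_bound1 d t : 0 < d -> d < 1 ->
  kLd d 1 t <= 2 * (if 0 < t < 1 - d / 2 then (1 - t)^-1 else 0) +
               2 * (if 1 + d / 2 < t < 2 then (t - 1)^-1 else 0) +
               4 * (if 1 < t then (t ^+ 2)^-1 else 0).
Proof.
move=> d0 d1.
set u := if 0 < t < _ then _ else _; set v := if 1 + _ < t < 2 then _ else _.
set w := if 1 < t then _ else _.
have u0 : 0 <= u by rewrite /u; case: ifP => // /andP[_ h]; rewrite invr_ge0; lra.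
have v0 : 0 <= v by rewrite /v; case: ifP => // /andP[h _]; rewrite invr_ge0; lra.
have w0 : 0 <= w by rewrite /w; case: ifP => // h; rewrite invr_ge0 sqr_ge0.
rewrite /kLd; case: ifP => [fr|_]; last by lra.
have [t0|t0] := ltP 0 t; last by rewrite kL_eq0 ?ltr01//= -?leNgt//; lra.
have [t1|t1|->] := ltgtP t 1; last by rewrite kL_diag; lra.
  have td : t <= 1 - d.
    by case/orP: fr => h; [lra|nra].
  suff : kL 1 t <= 2 * u by lra.
  have -> : u = (1 - t)^-1 by rewrite /u t0/= ifT//; lra.
  rewrite kL_lt// expr1n mul1r ler_pdivrMr; last by rewrite subr_gt0 exprn_ilt1// ltW.
  rewrite -mulrA ler_pM2l// mulrC ler_pdivlMr ?subr_gt0//.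
  have t2 : 0 < t ^+ 2 by rewrite exprn_gt0.
  have t3 : 0 < t ^+ 3 by rewrite exprn_gt0.
  have e : 1 - t ^+ 4 = (1 - t) * (1 + t + t ^+ 2 + t ^+ 3) by ring.
  by rewrite e mulrC ler_pM2l ?subr_gt0//; lra.
have e : t ^+ 4 - 1 = (t - 1) * (1 + t + t ^+ 2 + t ^+ 3) by ring.
have t2 : 0 < t ^+ 2 by rewrite exprn_gt0.
have t3 : 0 < t ^+ 3 by rewrite exprn_gt0.
have td : 1 + d / 2 < t.
  by case/orP: fr => h; [lra|nra].
have wE : w = (t ^+ 2)^-1 by rewrite /w t1.
have k1 : kL 1 t = 2 * t / ((t - 1) * (1 + t + t ^+ 2 + t ^+ 3)).
  by rewrite kL_gt// expr1n mulr1 e.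
have [t2'|t2'] := ltP t 2.
  suff : kL 1 t <= 2 * v by lra.
  have -> : v = (t - 1)^-1 by rewrite /v td/= t2'.
  rewrite k1 -mulrA ler_pM2l// ler_pdivrMr ?mulr_gt0//; [|lra..].
  by rewrite mulrA mulVf ?mul1r; [lra|rewrite gt_eqF//; lra].
suff : kL 1 t <= 4 * w by lra.
rewrite wE k1 ler_pdivrMr ?mulr_gt0//; [|lra..].
rewrite mulrAC ler_pdivlMr//.
have a1 : 2 * t ^+ 3 <= t ^+ 4 by rewrite [leRHS]exprS ler_pM2r.
have a2 : 2 * t ^+ 2 <= t ^+ 3 by rewrite [leRHS]exprS ler_pM2r.
have a3 : 2 * t <= t ^+ 2 by rewrite [leRHS]expr2 ler_pM2r.
have -> : 2 * t * t ^+ 2 = 2 * t ^+ 3 by ring.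
by rewrite -e; lra.
Qed.

Lemma NB_kLd1 d : 0 < d -> d < 1 -> NB mu (kLd d 1) (4 * - ln (d / 2) + 4).
Proof.
move=> d0 d1.
have h : NB mu (fun t => 2 * (if 0 < t < 1 - d / 2 then (1 - t)^-1 else 0) +
               2 * (if 1 + d / 2 < t < 2 then (t - 1)^-1 else 0) +
               4 * (if 1 < t then (t ^+ 2)^-1 else 0)) (4 * - ln (d / 2) + 4).
  have -> : 4 * - ln (d / 2) + 4 =
    `|2| * - ln (d / 2) + `|2| * - ln (d / 2) + `|4| * 1^-1.
    by rewrite !ger0_norm// invr1; lra.
  apply: NBD; [apply: NBD|]; apply: NBZ.
  - by apply: NB_inv_left; lra.
  - by apply: NB_inv_right; lra.
  - exact: NB_inv_sqr.
apply: NB_le h _ => //.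
  exact: (@mfun_section1 _ _ _ _ _ (fun z : R * R => kLd d z.1 z.2) 1 (mfun_kLd d)).
move=> t; rewrite ger0_norm ?kLd_ge0//; apply: le_trans (kLd_bound1 t d0 d1) _.
exact: ler_norm.
Qed.

Lemma kLd_homog d x y : 0 < x -> kLd d x y = x ^- 2 * kLd d 1 (x^-1 * y).
Proof.
move=> x0; rewrite -kLd_scale// mulr1 mulrA mulfV ?gt_eqF//.
by rewrite mul1r.
Qed.

Lemma NB_kLd d x : 0 < d -> d < 1 -> 0 < x ->
  NB mu (kLd d x) (x^-1 * (4 * - ln (d / 2) + 4)).
Proof.
move=> d0 d1 x0.
have h := NBZ (x ^- 2) (NB_dil (l := x^-1) _ (NB_kLd1 d0 d1)).
rewrite invr_gt0 in h; have {}h := h x0.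
apply: NB_le h _.
- exact: (mfun_section1 x (mfun_kLd d)).
- by move=> y; rewrite kLd_homog.
- rewrite invrK ger0_norm ?invr_ge0 ?sqr_ge0// mulrA.
  by rewrite expr2 invfM -(mulrA x^-1) mulVf ?mulr1 ?gt_eqF.
Qed.

Lemma NB_W_kLd d x : 0 < d -> d < 1 -> 0 < x ->
  NB mu (fun y => (W x) * kLd d x y) (4 * - ln (d / 2) + 4).
Proof.
move=> d0 d1 x0; have h := NBZ (W x) (NB_kLd d0 d1 x0).
apply: NB_le h _ => //.
  by have := mfun_section1 x (mfun_kLd d) => /= ?; mfun.
rewrite ger0_norm ?W_ge0// mulrA ler_piMl//.
  have := (NBP _ _ _ ).1 (NB_kLd1 d0 d1).
  by move=> [_]; apply: le_trans; apply: intR_ge0.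
by rewrite ler_pdivrMr// mul1r W_le// ltW.
Qed.

(** By the symmetry of x^2 kLd, passing from the kernel to its transpose costs only an increment of
    [etaW]. That term adds 6 whatever d is. *)
Lemma NB_W_kLd_adj d x : 0 < d -> d < 1 -> 0 < x ->
  NB mu (fun y => W y * kLd d y x) (4 * - ln (d / 2) + 10).
Proof.
move=> d0 d1 x0.
have e y : W y * kLd d y x = W x * kLd d x y + x ^+ 2 * ((etaW y - etaW x) * kLd d x y).
  have [y0|y0] := ltP 0 y; last first.
    by rewrite !kLd_eq0 ?mulr0 ?addr0// negb_and -!leNgt y0 ?orbT.
  rewrite /W y0 x0 mulrAC -kLd_sym.
  by ring.
have h2 := NBZ (x ^+ 2) (NB_kL_eta x0).
have h : NB mu (fun y => x ^+ 2 * ((etaW y - etaW x) * kLd d x y)) 6.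
  apply: NB_le h2 _.
  - by have := mfun_section1 x (mfun_kLd d) => /= ?; have := @mfun_etaW R => ?; mfun.
  - move=> y; rewrite !normrM ler_wpM2l// ler_wpM2l// !ger0_norm ?kLd_ge0 ?kL_ge0//.
    exact: kLd_le.
  - rewrite ger0_norm ?sqr_ge0//; have [_ h _] := mul_etaW_le1 (ltW x0); lra.
have h3 := NBD (NB_W_kLd d0 d1 x0) h.
apply: NB_le h3 _.
- by have := mfun_section2 x (mfun_kLd d) => /= ?; have := @mfun_W R => ?; mfun.
- by move=> y; rewrite e.
- lra.
Qed.

(** Symmetry extracts the common factor x^2 kL, and leaves the increment of q(y) / y^2. A Lipschitz
    bound for the latter compensates the pole on the diagonal, hence the adjoint converges on test
    functions although each of its two terms diverges. *)
Lemma kL_near_bound (q : R -> R) ell x y : 0 < x -> 0 < y ->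
  0 <= ell -> `|q y / y ^+ 2 - q x / x ^+ 2| <= ell * `|y - x| ->
  `|q y * kL y x - q x * kL x y| <= ell * x.
Proof.
move=> x0 y0 ell0 h.
have x2 : 0 < x ^+ 2 by rewrite exprn_gt0.
have y2 : 0 < y ^+ 2 by rewrite exprn_gt0.
have e : q y * kL y x - q x * kL x y = (q y / y ^+ 2 - q x / x ^+ 2) * (x ^+ 2 * kL x y).
  rewrite mulrBl [in X in _ = X - _]kL_sym; congr (_ - _); field; rewrite gt_eqF//.
have [xy|xy] := eqVneq x y; first by rewrite xy subrr normr0 mulr_ge0// ltW.
rewrite e normrM [X in _ * X]ger0_norm ?mulr_ge0 ?sqr_ge0 ?kL_ge0//.
apply: (@le_trans _ _ (ell * `|y - x| * (x ^+ 2 * kL x y))).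
  by rewrite ler_wpM2r// mulr_ge0 ?sqr_ge0 ?kL_ge0.
rewrite -mulrA ler_wpM2l//.
have xy0 : 0 < (x + y) * (x ^+ 2 + y ^+ 2) by rewrite mulr_gt0// addr_gt0.
have x3 : 0 < x ^+ 3 by rewrite exprn_gt0.
have y3 : 0 < y ^+ 3 by rewrite exprn_gt0.
have ex : (x + y) * (x ^+ 2 + y ^+ 2) = x ^+ 3 + x * y ^+ 2 + y * x ^+ 2 + y ^+ 3 by ring.
have h1 : 0 < x * y ^+ 2 by rewrite mulr_gt0.
have h2 : 0 < y * x ^+ 2 by rewrite mulr_gt0.
have [yx|xy'|xy'] := ltgtP y x; last by rewrite xy' eqxx in xy.
  rewrite [`|_|]ler0_norm; last by rewrite subr_le0 ltW.
  rewrite kL_lt//.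
  have -> : - (y - x) * (x ^+ 2 * (2 * y ^+ 3 / (x * (x ^+ 4 - y ^+ 4)))) =
            x * (2 * y ^+ 3 / ((x + y) * (x ^+ 2 + y ^+ 2))).
    have p := pow4_lt (ltW y0) yx.
    by field; do ?(apply/andP; split); rewrite gt_eqF//; lra.
  apply: ler_piMr; first exact: ltW.
  rewrite ler_pdivrMr// mul1r ex.
  have : y ^+ 3 <= x ^+ 3 by rewrite lerXn2r ?nnegrE ?ltW.
  by lra.
rewrite [`|_|]ger0_norm; last by rewrite subr_ge0 ltW.
rewrite kL_gt//.
have -> : (y - x) * (x ^+ 2 * (2 * x * y / (y ^+ 4 - x ^+ 4))) =
          x * (2 * (y * x ^+ 2) / ((x + y) * (x ^+ 2 + y ^+ 2))).
  have p := pow4_lt (ltW x0) xy'.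
  by field; do ?(apply/andP; split); rewrite gt_eqF//; lra.
apply: ler_piMr; first exact: ltW.
rewrite ler_pdivrMr// mul1r ex.
have : y * x ^+ 2 <= y * y ^+ 2 by rewrite ler_pM2l// lerXn2r ?nnegrE ?ltW.
by rewrite -exprS; lra.
all: exact: ltW.
Qed.

Lemma near_itv d x y : 0 < d -> d <= 2^-1 -> 0 < x -> 0 < y -> ~~ far d x y ->
  (1 - d) * x < y < (1 + 2 * d) * x.
Proof.
move=> d0 d1 x0 y0; rewrite /far negb_or -!ltNge => /andP[h1 h2].
by rewrite h1/=; nra.
Qed.

Definition kM x y : R := if (0 < y < x) || (0 < x < y) then kerM x y else 0.
Definition kD x y : R := kM x y - kL x y.

Lemma mfun_kM : measfun2 R kM.
Proof. by rewrite /kM /kerM /sinh; mfun. Qed.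

Lemma mfun_kD : measfun2 R kD.
Proof. by have h1 := mfun_kM; have h2 := @mfun_kL R; rewrite /kD; mfun. Qed.

(** The poles of [kM] and [kL] on the diagonal cancel; only the bounded parts of the coth terms are
    left. *)
Lemma kM_lt x y : 0 < y -> y < x -> kD x y =
  (y / x) ^+ 3 * (langevin (x ^+ 2 - y ^+ 2) + langevin (x ^+ 2 + y ^+ 2)).
Proof.
move=> y0 yx; have x0 := lt_trans y0 yx.
have ab : y ^+ 2 < x ^+ 2 by rewrite ltrXn2r// ltW.
have b0 : 0 < y ^+ 2 by rewrite exprn_gt0.
have a0 : 0 < x ^+ 2 by rewrite exprn_gt0.
rewrite /kD /kM y0 yx/= /kerM [`|_|]ger0_norm; last by rewrite subr_ge0 ltW.
set K := (_^-1 - _^-1).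
have -> : K * (y ^+ 3 * sinh (x ^+ 2) / (x ^+ 3 * sinh (y ^+ 2))) =
   (y / x) ^+ 3 * (K * (sinh (x ^+ 2) / sinh (y ^+ 2))).
  by field; rewrite !gt_eqF// sinh_gt0.
rewrite /K sinhD_coth// kL_lt// /langevin.
have h := pow4_lt (ltW y0) yx.
have h1 : 0 < x ^+ 2 - y ^+ 2 by rewrite subr_gt0.
have h2 : 0 < x ^+ 2 + y ^+ 2 by rewrite addr_gt0.
have h3 := sinh_gt0 h1; have h4 := sinh_gt0 h2.
by field; rewrite !gt_eqF.
Qed.

(** Above the diagonal a third term appears. It is regular at x = y, but its part 2 / y^2 is needed
    for the 1 / u terms to add up to [kL]. *)
Lemma kM_gt x y : 0 < x -> x < y -> kD x y =
  (y / x) ^+ 3 * (langevin (y ^+ 2 - x ^+ 2) + langevin (x ^+ 2 + y ^+ 2)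
     - 2 * langevin (y ^+ 2)).
Proof.
move=> x0 xy; have y0 := lt_trans x0 xy.
have ab : x ^+ 2 < y ^+ 2 by rewrite ltrXn2r// ltW.
have b0 : 0 < y ^+ 2 by rewrite exprn_gt0.
have a0 : 0 < x ^+ 2 by rewrite exprn_gt0.
rewrite /kD /kM x0 xy (lt_gtF xy) orbT /kerM distrC [`|_|]ger0_norm; last by rewrite subr_ge0 ltW.
set K := (_^-1 - _^-1).
have -> : K * (y ^+ 3 * sinh (x ^+ 2) / (x ^+ 3 * sinh (y ^+ 2))) =
   (y / x) ^+ 3 * (K * (sinh (x ^+ 2) / sinh (y ^+ 2))).
  by field; rewrite !gt_eqF// sinh_gt0.
rewrite /K sinhD_coth2// kL_gt// /langevin.
have h := pow4_lt (ltW x0) xy.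
have h1 : 0 < y ^+ 2 - x ^+ 2 by rewrite subr_gt0.
have h2 : 0 < x ^+ 2 + y ^+ 2 by rewrite addr_gt0.
have h3 := sinh_gt0 h1; have h4 := sinh_gt0 h2; have h5 := sinh_gt0 b0.
by field; rewrite !gt_eqF.
Qed.

Lemma kM_ge0 x y : 0 <= kM x y.
Proof.
rewrite /kM; case: ifP => // h.
have [x0 y0] : 0 < x /\ 0 < y.
  by case/orP: h => /andP[h1 h2]; split=> //; exact: lt_trans h1 h2.
have b0 : 0 < y ^+ 2 by rewrite exprn_gt0.
have a0 : 0 < x ^+ 2 by rewrite exprn_gt0.
have ne : 0 < `|x ^+ 2 - y ^+ 2|.
  rewrite normr_gt0 subr_eq0 eqrXn2 ?ltW//.
  by case/orP: h => /andP[_ h]; rewrite ?(gt_eqF h) ?(lt_eqF h).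
rewrite /kerM mulr_ge0//; last first.
  by rewrite divr_ge0// mulr_ge0// ?exprn_ge0 ?sinh_ge0 ?ltW.
rewrite subr_ge0 lef_pV2 ?posrE ?sinh_gt0// ?addr_gt0//.
apply: sinh_mono; apply: le_trans (ler_normB _ _) _.
by rewrite !gtr0_norm.
Qed.

Lemma kM_eq0 x y : ~~ ((0 < x) && (0 < y)) -> kM x y = 0.
Proof.
move=> h; rewrite /kM ifF//; apply: contraNF h.
by case/orP => /andP[h1 h2]; rewrite h1 (lt_trans h1 h2).
Qed.

(** The exponentials have to cancel exactly. Doubling the angle, b = 2 s, compares numerator and
    denominator, while sinh a <= (a / s) sinh s retains the powers of x / y. The assumption gives a
    <= b / 4, hence a <= s and s <= b - a. *)
Lemma kM_tail x y : 0 < x -> 2 * x <= y -> kM x y <= 8 * (x / y ^+ 3).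
Proof.
move=> x0 xy; have xy' : x < y by lra.
have y0 := lt_trans x0 xy'.
have ab : x ^+ 2 < y ^+ 2 by rewrite ltrXn2r// ltW.
have b0 : 0 < y ^+ 2 by rewrite exprn_gt0.
have a0 : 0 < x ^+ 2 by rewrite exprn_gt0.
have x3 : 0 < x ^+ 3 by rewrite exprn_gt0.
have y3 : 0 < y ^+ 3 by rewrite exprn_gt0.
rewrite /kM x0 xy' orbT /kerM distrC [`|_|]ger0_norm; last by rewrite subr_ge0 ltW.
rewrite sinhD_mul//.
set a := x ^+ 2 in a0 ab *; set b := y ^+ 2 in b0 ab *.
have b4a : 4 * a <= b by rewrite /a /b; nra.
pose s := b / 2; have s0 : 0 < s by rewrite divr_gt0.
have bE : b = s + s by rewrite /s; lra.
have sb : sinh b = 2 * sinh s * cosh s.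
  rewrite bE !sinhE coshE expRD; have := expR_gt0 s => e0; field; rewrite gt_eqF//.
have cb : cosh b <= 2 * cosh s ^+ 2.
  have -> : 2 * cosh s ^+ 2 = cosh b + 1.
    rewrite bE !coshE expRD; have := expR_gt0 s => e0; field; rewrite gt_eqF//.
  by rewrite lerDl.
have ss := sinh_gt0 s0; have sa := sinh_gt0 a0; have sbg := sinh_gt0 b0.
have cs := cosh_ge1 s.
have l01 : 0 <= a / s <= 1.
  by rewrite divr_ge0 ?(ltW a0) ?(ltW s0)//= ler_pdivrMr// mul1r /s; lra.
have sale : sinh a <= a / s * sinh s.
  by have := sinh_scale_le l01 (ltW s0); rewrite divfK ?gt_eqF.
have sba : sinh s <= sinh (b - a) by apply: sinh_mono; rewrite /s; lra.
have sab : sinh b <= sinh (a + b) by apply: sinh_mono; lra.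
have g1 : 0 < sinh (b - a) by apply: lt_le_trans sba.
have g2 : 0 < sinh (a + b) by apply: lt_le_trans sab.
have y0' : y != 0 by rewrite gt_eqF.
have x0' : x != 0 by rewrite gt_eqF.
have -> : 2 * cosh b * sinh a / (sinh (b - a) * sinh (a + b)) *
   (y ^+ 3 * sinh a / (x ^+ 3 * sinh b)) =
   2 * (y / x) ^+ 3 * (sinh a ^+ 2 * cosh b / (sinh b * sinh (b - a) * sinh (a + b))).
  by field; rewrite !gt_eqF.
have p1 : 0 < sinh b * sinh (b - a) * sinh (a + b) by exact: mulr_gt0 (mulr_gt0 sbg g1) g2.
have p2 : 0 < sinh b * sinh s * sinh b by exact: mulr_gt0 (mulr_gt0 sbg ss) sbg.
have h1 : sinh a ^+ 2 * cosh b / (sinh b * sinh (b - a) * sinh (a + b)) <=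
   (a / s * sinh s) ^+ 2 * (2 * cosh s ^+ 2) / (sinh b * sinh s * sinh b).
  apply: ler_pM.
  - by rewrite mulr_ge0 ?sqr_ge0// (le_trans _ (cosh_ge1 _)).
  - by rewrite invr_ge0 ltW.
  - apply: ler_pM => //; rewrite ?sqr_ge0 ?(le_trans _ (cosh_ge1 _))//.
    case/andP: l01 => l0 l1; rewrite lerXn2r// nnegrE ?(ltW sa)//.
    by rewrite mulr_ge0// ltW.
  - rewrite lef_pV2 ?posrE//; apply: ler_pM => //; last by rewrite ler_pM2l.
      exact/ltW/(mulr_gt0 sbg ss).
    exact: ltW.
have h2 : (a / s * sinh s) ^+ 2 * (2 * cosh s ^+ 2) / (sinh b * sinh s * sinh b) =
   (a / s) ^+ 2 / (2 * sinh s).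
  by rewrite sb; field; rewrite !gt_eqF// (lt_le_trans ltr01).
have h3 : (a / s) ^+ 2 / (2 * sinh s) <= (a / s) ^+ 2 / (2 * s).
  have hs : 2 * s <= 2 * sinh s by rewrite ler_pM2l// sinh_ge// ltW.
  by rewrite ler_wpM2l ?sqr_ge0// lef_pV2 ?posrE//; apply: mulr_gt0.
have h4 : 2 * (y / x) ^+ 3 * ((a / s) ^+ 2 / (2 * s)) = 8 * (x / y ^+ 3).
  by rewrite /s /a /b; field; rewrite x0' y0'.
rewrite -h4; apply: ler_wpM2l; first by rewrite mulr_ge0// exprn_ge0// divr_ge0// ltW.
by apply: (le_trans h1); rewrite h2.
Qed.

(** A majorant of |kD|: 16 = 2^3 * 2 bounds the Langevin form for y < 2 x, and 11 = 8 + 3 adds the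
    tails of [kM] and [kL]. *)
Definition Db x y : R :=
  (if 0 < y < 2 * x then 16 else 0) +
  (if (0 < x) && (2 * x <= y) then 11 * (x / y ^+ 3) else 0).

Lemma Db_ge0 x y : 0 <= Db x y.
Proof.
rewrite /Db addr_ge0//; case: ifP => // /andP[x0 xy].
by rewrite mulr_ge0// divr_ge0 ?exprn_ge0//; lra.
Qed.

Lemma kD_bound x y : `|kD x y| <= Db x y.
Proof.
have D0 := Db_ge0 x y.
have [/andP[x0 y0]|h] := boolP ((0 < x) && (0 < y)); last first.
  by rewrite /kD kM_eq0// kL_eq0// subrr normr0.
have a0 : 0 < x ^+ 2 by rewrite exprn_gt0.
have b0 : 0 < y ^+ 2 by rewrite exprn_gt0.
have [y2|y2] := ltP y (2 * x).
  have -> : Db x y = 16 by rewrite /Db y0 y2/= x0 leNgt y2/= addr0.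
  have [yx|xy|<-] := ltgtP y x; last by rewrite /kD /kM /kL ltxx !andbF subrr normr0.
    have ab : y ^+ 2 < x ^+ 2 by rewrite ltrXn2r// ltW.
    rewrite kM_lt//.
    have /andP[l1 l2] : 0 <= langevin (x ^+ 2 - y ^+ 2) <= 1 by rewrite langevin_bound// subr_gt0.
    have /andP[l3 l4] : 0 <= langevin (x ^+ 2 + y ^+ 2) <= 1 by rewrite langevin_bound// addr_gt0.
    have q0 : 0 <= (y / x) ^+ 3 by rewrite exprn_ge0// divr_ge0// ltW.
    have q1 : (y / x) ^+ 3 <= 1.
      apply: exprn_ile1; first by rewrite divr_ge0// ltW.
      by rewrite ler_pdivrMr// mul1r ltW.
    rewrite normrM (ger0_norm q0) ger0_norm; last by lra.
    apply: (@le_trans _ _ (1 * 2)); last by lra.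
    by apply: ler_pM; lra.
  have ab : x ^+ 2 < y ^+ 2 by rewrite ltrXn2r// ltW.
  rewrite kM_gt//.
  have /andP[l1 l2] : 0 <= langevin (y ^+ 2 - x ^+ 2) <= 1 by rewrite langevin_bound// subr_gt0.
  have /andP[l3 l4] : 0 <= langevin (x ^+ 2 + y ^+ 2) <= 1 by rewrite langevin_bound// addr_gt0.
  have /andP[l5 l6] : 0 <= langevin (y ^+ 2) <= 1 by rewrite langevin_bound.
  have q0 : 0 <= (y / x) ^+ 3 by rewrite exprn_ge0// divr_ge0// ltW.
  have q1 : (y / x) ^+ 3 <= 2 ^+ 3.
    apply: lerXn2r; rewrite ?nnegrE ?divr_ge0 ?(ltW x0) ?(ltW y0)//.
    by rewrite ler_pdivrMr// ltW.
  rewrite normrM (ger0_norm q0).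
  have l : `|langevin (y ^+ 2 - x ^+ 2) + langevin (x ^+ 2 + y ^+ 2) - 2 * langevin (y ^+ 2)| <= 2.
    by rewrite ler_norml; lra.
  apply: (@le_trans _ _ (2 ^+ 3 * 2)); last by lra.
  by apply: ler_pM.
have xy : x < y by lra.
have -> : Db x y = 11 * (x / y ^+ 3).
  by rewrite /Db y0 ltNge y2/= x0 add0r.
have m := kM_tail x0 y2; have m0 := kM_ge0 x y; have l0 := kL_ge0 x y.
have l : kL x y <= 3 * (x / y ^+ 3).
  rewrite kL_gt//; have h := pow4_lt (ltW x0) xy.
  have y3 : 0 < y ^+ 3 by rewrite exprn_gt0.
  rewrite ler_pdivrMr// -!mulrA [leRHS]mulrA -mulrA mulrC.
  have -> : 3 * (x * (y ^- 3 * (y ^+ 4 - x ^+ 4))) = x / y ^+ 3 * (3 * (y ^+ 4 - x ^+ 4)).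
    by ring.
  have -> : x * y * 2 = x / y ^+ 3 * (2 * y ^+ 4) by field; rewrite gt_eqF.
  rewrite ler_pM2l ?divr_gt0//.
  have h16 : 16 * x ^+ 4 <= y ^+ 4.
    have -> : 16 = 2 ^+ 4 :> R by rewrite -natrX.
    by rewrite -exprMn lerXn2r// nnegrE; lra.
  have x4 : 0 < x ^+ 4 by rewrite exprn_gt0.
  lra.
by rewrite /kD ler_norml; lra.
Qed.

Lemma mfun_Db : measfun2 R Db.
Proof. by rewrite /Db; mfun. Qed.

Lemma NB_Db x : 0 < x -> NB mu (Db x) (32 * x + 11 * x^-1).
Proof.
move=> x0.
have h1 : NB mu (fun y => if 0 < y < 2 * x then 16 else 0) (32 * x).
  have -> : 32 * x = `|16| * (2 * x - 0) by rewrite ger0_norm// subr0; lra.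
  by apply: NB_itv; lra.
have h2 : NB mu (fun y => 11 * (if x < y then (y ^+ 2)^-1 else 0)) (`|11| * x^-1).
  by apply: NBZ; exact: NB_inv_sqr.
apply: NB_le (NBD h1 h2) _.
- exact: (mfun_section1 x mfun_Db).
- move=> y; rewrite ger0_norm ?Db_ge0//; apply: le_trans (ler_norm _).
  rewrite /Db lerD2l x0/=; case: ifP => h.
    rewrite ifT; last by lra.
    have y0 : 0 < y by lra.
    have y3 : 0 < y ^+ 3 by rewrite exprn_gt0.
    rewrite ler_pM2l// ler_pdivrMr// mulrC exprS mulfK ?gt_eqF ?exprn_gt0//; lra.
  by case: ifP => // _; rewrite mulr_ge0// invr_ge0 sqr_ge0.
- by rewrite ger0_norm.
Qed.

(** The mass of [Db x] is of order x at infinity and 1 / x at the origin; W absorbs both, and 43 =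
    32 + 11. *)
Lemma NB_W_kD x : NB mu (fun y => W x * kD x y) 43.
Proof.
have mk := mfun_section1 x mfun_kD; rewrite /= in mk.
have [x0|x0] := ltP 0 x; last first.
  rewrite /W ltNge x0/=.
  have -> : (fun y => 0 * kD x y) = (fun=> 0) by apply/funext => y; rewrite mul0r.
  exact: NB_0.
apply: NB_le (NBZ (W x) (NB_Db x0)) _.
- by mfun.
- move=> y; rewrite !normrM ler_wpM2l// (ger0_norm (Db_ge0 _ _)).
  exact: kD_bound.
- rewrite ger0_norm ?W_ge0//.
  have [h1 h2 h3] := mul_etaW_le1 (ltW x0).
  have -> : W x * (32 * x + 11 / x) = 32 * (x ^+ 3 * etaW x) + 11 * (x * etaW x).
    by rewrite /W x0; field; rewrite gt_eqF.
  lra.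
Qed.

(** Here 43 arises as 16 times the mass 2 of W, plus 11 from the region x <= y / 2. *)
Lemma NB_W_kD_adj y : NB mu (fun x => W x * kD x y) 43.
Proof.
have mk := mfun_section2 y mfun_kD; rewrite /= in mk; have mW := @mfun_W R.
have [y0|y0] := ltP 0 y; last first.
  have -> : (fun x => W x * kD x y) = (fun=> 0).
    by apply/funext => x; rewrite /kD kM_eq0 ?kL_eq0 ?subrr ?mulr0// negb_and -!leNgt y0 orbT.
  exact: NB_0.
have h1 := NBZ 16 (@NB_W R).
have h2 : NB mu (fun x => if 0 < x < y then 11 / y else 0) (`|11 / y| * (y - 0)).
  by apply: NB_itv; exact: ltW.
apply: NB_le (NBD h1 h2) _.
- by mfun.
- move=> x; rewrite normrM (ger0_norm (W_ge0 x)).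
  apply: (@le_trans _ _ (W x * Db x y)); first by rewrite ler_wpM2l ?W_ge0// kD_bound.
  apply: le_trans (ler_norm _); rewrite /Db mulrDr lerD//.
    by case: ifP => _; rewrite ?mulr0 mulrC// ?mulr_ge0// W_ge0.
  case: ifP => [/andP[x0 xy]|_]; last by rewrite mulr0; case: ifP => // _; rewrite divr_ge0// ltW.
  rewrite ifT; last by rewrite x0/=; lra.
  have [h3 h4 h5] := mul_etaW_le1 (ltW x0).
  have y3 : 0 < y ^+ 3 by rewrite exprn_gt0.
  have -> : W x * (11 * (x / y ^+ 3)) = 11 / y * ((x * etaW x) * (x / y) ^+ 2).
    by rewrite /W x0; field; rewrite gt_eqF.
  apply: ler_piMr; first by rewrite divr_ge0// ltW.
  apply: mulr_ile1 => //.
  + by rewrite mulr_ge0 ?ltW// etaW_gt0.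
  + exact: sqr_ge0.
  + apply: exprn_ile1; first by rewrite divr_ge0 ?(ltW x0) ?(ltW y0).
    by rewrite ler_pdivrMr// mul1r; lra.
- have a1 : `|16| = 16 :> R by rewrite ger0_norm.
  have a2 : `|11 / y| = 11 / y by rewrite ger0_norm// divr_ge0// ltW.
  rewrite a1 a2 subr0 divfK ?gt_eqF//; lra.
Qed.

End Kernels.

(** * Mollification by dilations *)

Section Smooth.
Variable R : realType.
Notation mu := (@lebesgue_measure R).
Implicit Types (f g u v : R -> R) (a b c d x y l : R).

(** Smoothness of finite order, by recursion on the order, so that sums, products and affine
    substitutions are handled by induction. *)
Fixpoint Csm n f : Prop :=
  (forall x, derivable f x 1) /\ if n is m.+1 then Csm m (derive1 f) else True.

Lemma CsmP f : (forall n, Csm n f) -> forall n x, derivable (derive1n n f) x 1.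
Proof.
move=> h n; elim: n f h => [|n IH] f h x; first by rewrite derive1n0; have [] := h 0%N.
by rewrite derive1Sn; apply: IH => m; have [] := h m.+1.
Qed.

Lemma CsmS n f : Csm n.+1 f -> Csm n f.
Proof. by elim: n f => [|n IH] f [h1 h2]; split=> //; apply: IH. Qed.

Lemma CsmD n f g : Csm n f -> Csm n g -> Csm n (fun x => f x + g x).
Proof.
elim: n f g => [|n IH] f g [f1 f2] [g1 g2]; split=> //; try by move=> x; apply: derivableD.
rewrite (_ : derive1 _ = fun x => derive1 f x + derive1 g x); first exact: IH.
by apply/funext => x; rewrite !derive1E deriveD.
Qed.

Lemma CsmM n f g : Csm n f -> Csm n g -> Csm n (fun x => f x * g x).
Proof.
elim: n f g => [|n IH] f g; first by move=> [f1 _] [g1 _]; split=> // x; apply: derivableM.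
move=> cf cg; have [f1 f2] := cf; have [g1 g2] := cg.
split; first by move=> x; apply: derivableM.
rewrite (_ : derive1 _ = fun x => f x * derive1 g x + derive1 f x * g x).
  by apply: CsmD; apply: IH => //; exact: CsmS.
by apply/funext => x; rewrite !derive1E deriveM// /GRing.scale/= [in X in _ + X]mulrC.
Qed.

Lemma Csm_cst n c : Csm n (fun _ => c).
Proof.
elim: n c => [|n IH] c; split=> //; try by move=> x; apply: derivable_cst.
rewrite (_ : derive1 _ = fun=> 0); first exact: IH.
by apply/funext => x; rewrite derive1_cst.
Qed.

Lemma Csm_affine n f a b : Csm n f -> Csm n (fun x => f (a * x + b)).
Proof.
elim: n f => [|n IH] f [f1 f2].
  split=> // x.
  have d2 : is_derive x 1 (fun y => a * y + b) a.
    by apply: is_derive_eq; rewrite /GRing.scale/=; ring.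
  have d1 : is_derive (a * x + b) 1 f (derive1 f (a * x + b)).
    by rewrite derive1E; apply/derivableP.
  by have [] := @is_derive1_comp _ f (fun y => a * y + b) x _ _ d1 d2.
have d x : is_derive x 1 (fun x => f (a * x + b)) (derive1 f (a * x + b) * a).
  have d2 : is_derive x 1 (fun y => a * y + b) a.
    by apply: is_derive_eq; rewrite /GRing.scale/=; ring.
  have d1 : is_derive (a * x + b) 1 f (derive1 f (a * x + b)).
    by rewrite derive1E; apply/derivableP.
  exact: (@is_derive1_comp _ f (fun y => a * y + b) x _ _ d1 d2).
split; first by move=> x; case: (d x).
rewrite (_ : derive1 _ = fun x => derive1 f (a * x + b) * a).
  by apply: CsmM; [exact: IH|exact: Csm_cst].
by apply/funext => x; rewrite derive1E derive_val.
Qed.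

(** The functions P(1/x) exp(-1/x) form a class stable under differentiation, the new polynomial
    being X^2 (P - P'). Smoothness of exp(-1/x) at 0 follows by induction inside the class. *)
Definition flat (P : {poly R}) x : R :=
  if 0 < x then P.[x^-1] * expR (- x^-1) else 0.

Lemma expRN_bound (y : R) m : 0 < y -> y ^+ m * expR (- y) <= m.+1`!%:R / y.
Proof.
move=> y0; rewrite expRN -ler_pdivlMr ?invr_gt0 ?expR_gt0// invrK.
have := expR_ge1Dxn m (ltW y0) => h.
have f0 : 0 < m.+1`!%:R :> R by rewrite ltr0n fact_gt0.
have : y ^+ m.+1 <= m.+1`!%:R * expR y.
  rewrite mulrC -ler_pdivrMr//; apply: le_trans h; lra.
rewrite exprSr => h2.
by rewrite mulrAC ler_pdivlMr.
Qed.

Lemma flat_bound P : exists2 C, 0 <= C & forall x, `|flat P x| <= C * `|x|.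
Proof.
exists (\sum_(i < size P) `|P`_i| * i.+1`!%:R).
  by apply: sumr_ge0 => i _; rewrite mulr_ge0.
move=> x; rewrite /flat; case: ltP => x0; last first.
  by rewrite normr0 mulr_ge0// sumr_ge0// => i _; rewrite mulr_ge0.
have xi : 0 < x^-1 by rewrite invr_gt0.
rewrite (gtr0_norm x0) normrM (ger0_norm (expR_ge0 _)) horner_coef.
apply: (@le_trans _ _ ((\sum_(i < size P) `|P`_i * x^-1 ^+ i|) * expR (- x^-1))).
  by rewrite ler_wpM2r ?expR_ge0// ler_norm_sum.
rewrite !mulr_suml; apply: ler_sum => i _.
rewrite normrM (ger0_norm (exprn_ge0 _ (ltW xi))) -!mulrA ler_wpM2l//.
by have := expRN_bound i xi; rewrite invrK.
Qed.

Lemma is_derive_flat P x :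
  is_derive x 1 (flat P) (flat ('X^2 * (P - P^`())) x).
Proof.
have [x0|x0|->] := ltgtP x 0.
- have -> : flat ('X^2 * (P - P^`())) x = 0 by rewrite /flat ltNge (ltW x0).
  apply: (@near_eq_is_derive _ _ _ (fun _ : R => 0 : R)).
  near=> z; have z0 : z < 0 by near: z; exact: lt_nbhsl.
  by rewrite /flat ltNge (ltW z0).
- have xn : x != 0 by rewrite gt_eqF.
  rewrite {2}/flat x0.
  apply: (@near_eq_is_derive _ _ _ (fun z : R => P.[z^-1] * expR (- z^-1))).
    near=> z; have z0 : 0 < z by near: z; exact: lt_nbhsr.
    by rewrite /flat z0.
  have dV : is_derive x 1 (@GRing.inv R) (- x ^- 2).
    have := @is_deriveV _ id x 1 1 xn (is_derive_id x 1).
    by move/is_derive_eq; apply; rewrite /GRing.scale/= mulr1.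
  have dP : is_derive x 1 (fun z => P.[z^-1]) (P^`().[x^-1] * - x ^- 2).
    exact: (@is_derive1_comp _ (horner P) (@GRing.inv R) x _ _ (is_derive_poly P x^-1) dV).
  have dN : is_derive x 1 (fun z : R => - z^-1) (x ^- 2).
    by apply: is_derive_eq; rewrite opprK.
  have dE : is_derive x 1 (fun z => expR (- z^-1)) (expR (- x^-1) * x ^- 2).
    exact: (@is_derive1_comp _ expR (fun z : R => - z^-1) x _ _ (is_derive_expR _) dN).
  apply: is_derive_eq; rewrite !hornerE /GRing.scale/= exprVn; ring.
- rewrite {2}/flat ltxx.
  (* At 0 the difference quotient belongs to the same class, with polynomial X P, and tends to 0 by
     [flat_bound]. *)
  apply/is_derive1_caratheodory; exists (flat ('X * P)); split.
  + move=> z; rewrite /flat ltxx subr0 subr0; case: ifP => [z0|_]; last by rewrite mul0r.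
    by rewrite !hornerE; field; rewrite gt_eqF.
  + have [C C0 hC] := flat_bound ('X * P).
    have f0 : flat ('X * P) 0 = 0 by rewrite /flat ltxx.
    apply/cvgrPdist_le => e e0; exists (e / (C + 1)); first by rewrite /= divr_gt0//; lra.
    move=> z; rewrite /= sub0r normrN f0 sub0r normrN => hz; apply: le_trans (hC z) _.
    move: hz; rewrite ltr_pdivlMr; last lra.
    by have := normr_ge0 z; nra.
  + by rewrite /flat ltxx.
Unshelve. all: by end_near. Qed.

Lemma Csm_flat n P : Csm n (flat P).
Proof.
elim: n P => [|n IH] P; split=> //; try by move=> x; case: (is_derive_flat P x).
rewrite (_ : derive1 _ = flat ('X^2 * (P - P^`()))); first exact: IH.
by apply/funext => x; rewrite derive1E; apply: derive_val; exact: is_derive_flat.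
Qed.

Lemma Csm_cont f : Csm 0 f -> continuous f.
Proof.
by move=> [h _] x; apply: differentiable_continuous; apply/derivable1_diffP.
Qed.

Lemma exists_bump : exists k : R -> R,
  [/\ forall n, Csm n k, forall x, 0 <= k x, forall x, 1 <= `|x| -> k x = 0
    & \int[mu]_x k x = 1].
Proof.
pose e := flat 1.
pose b x := e (1 * x + 1) * e (-1 * x + 1).
have e0 x : 0 <= e x.
  by rewrite /e /flat; case: ifP => // _; rewrite hornerC mul1r expR_ge0.
have sb n : Csm n b by apply: CsmM; apply: Csm_affine; exact: Csm_flat.
have b0 x : 0 <= b x by rewrite mulr_ge0.
have supp x : 1 <= `|x| -> b x = 0.
  have en z : z <= 0 -> e z = 0 by move=> z0; rewrite /e /flat ltNge z0.
  by rewrite ler_normr => /orP[h|h]; rewrite /b; [rewrite (en (-1 * x + 1))|rewrite (en (1 * x + 1))]; rewrite ?mulr0 ?mul0r//; lra.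
have mb : measfun b by apply: continuous_measurable_fun; exact: Csm_cont (sb 0%N).
have bi : L1 mu b.
  apply: (@L1_ext _ _ _ mu _ (fun x : R => if -1 < x < 1 then b x else 0)).
    have ble x : e x <= 1.
      rewrite /e /flat; case: ltP => // x0; rewrite hornerC mul1r -expR0 ler_expR.
      by rewrite oppr_le0 invr_ge0 ltW.
    apply: (@L1_itv_bd _ _ 1) => // x _.
    by rewrite ger0_norm// mulr_ile1.
  move=> x; case: ifP => // /negbT h; apply: supp.
  by rewrite ler_normr; move: h; rewrite negb_and -!leNgt => /orP[h|h]; apply/orP; [right|left]; lra.
have Ib : 0 < \int[mu]_x b x.
  pose m : R := expR (- 2) * expR (- 2).
  have m0 : 0 < m by rewrite mulr_gt0 ?expR_gt0.
  have h2 : e 2^-1 = expR (- 2) by rewrite /e /flat invr_gt0 ltr0n hornerC mul1r invrK.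
  have mono x : 2^-1 <= x -> expR (- 2) <= e x.
    move=> hx; have x0 : 0 < x by lra.
    rewrite /e /flat x0 hornerC mul1r ler_expR lerN2 -[leRHS]invrK lef_pV2 ?posrE//.
  have nb : NB mu (fun x => if 0 < x < 2^-1 then m else 0) (`|m| * (2^-1 - 0)) by apply: NB_itv; lra.
  have : \int[mu]_x (if 0 < x < 2^-1 then m else 0) <= \int[mu]_x b x.
    apply: intR_le => //; first exact: NB_L1 nb.
    move=> x; case: ifP => // /andP[x0 x1]; rewrite /m; apply: ler_pM; rewrite ?expR_ge0//.
      by apply: mono; lra.
    by apply: mono; lra.
  apply: lt_le_trans.
  rewrite -intR_itv Rintegral_cst//.
  have h := lebesgue_measure_itv (`]0, 2^-1[ : interval R); rewrite /= in h.
  rewrite [X in fine X]h lte_fin invr_gt0 ltr0n/= subr0 mulr_gt0// invr_gt0; lra.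
exists (fun x => b x * (\int[mu]_x b x)^-1); split.
- by move=> n; apply: CsmM => //; exact: Csm_cst.
- by move=> x; rewrite mulr_ge0// invr_ge0 ltW.
- by move=> x /supp ->; rewrite mul0r.
- transitivity (\int[mu]_x ((\int[mu]_x b x)^-1 * b x)); first by apply: intR_ext => x; rewrite mulrC.
  by rewrite intRZ// mulVf// gt_eqF.
Qed.

End Smooth.

Section AlmostEverywhere.
Context d (T : measurableType d) (R : realType) (m : {measure set T -> \bar R}).
Implicit Types P Q S : T -> Prop.

Lemma aeS P Q : {ae m, forall x, P x} -> (forall x, P x -> Q x) -> {ae m, forall x, Q x}.
Proof. by move=> h PQ; apply: filterS h => x; exact: PQ. Qed.

Lemma aeI P Q S : {ae m, forall x, P x} -> {ae m, forall x, Q x} ->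
  (forall x, P x -> Q x -> S x) -> {ae m, forall x, S x}.
Proof. by move=> h1 h2 PQ; apply: filterS2 h1 h2 => x; exact: PQ. Qed.

End AlmostEverywhere.

Section Mollifier.
Variable R : realType.
Notation mu := (@lebesgue_measure R).
Implicit Types (f g u v : R -> R) (a b c d e l m x y : R).

Definition bump : R -> R := sval (cid (@exists_bump R)).

Lemma bump_Csm n : Csm n bump.
Proof. by rewrite /bump; case: cid => /= k [h _ _ _]. Qed.

Lemma bump_ge0 x : 0 <= bump x.
Proof. by rewrite /bump; case: cid => /= k [_ h _ _]. Qed.

Lemma bump_out x : 1 <= `|x| -> bump x = 0.
Proof. by move: x; rewrite /bump; case: cid => /= k [_ _ h _]. Qed.

Lemma bump_int : \int[mu]_x bump x = 1.
Proof. by rewrite /bump; case: cid => /= k [_ _ _ h]. Qed.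

Lemma bump_cont : continuous bump.
Proof. exact: (Csm_cont (bump_Csm 0)). Qed.

Lemma mfun_bump : measfun bump.
Proof. by apply: continuous_measurable_fun; exact: bump_cont. Qed.

Lemma bounded_of_compact_supp f : continuous f -> (forall x, 1 <= `|x| -> f x = 0) ->
  exists2 C, 0 < C & forall x, `|f x| <= C.
Proof.
move=> cf f0.
have cn : {within `[-1, 1], continuous (fun x => `|f x|)}.
  by apply: continuous_subspaceT => x; apply: cvg_norm; exact: cf.
have [c _ hc] := @EVT_max R (fun x => `|f x|) (-1) 1 (ltac:(lra)) cn.
exists (`|f c| + 1); first by rewrite ltr_wpDl.
move=> x; have [x1|x1] := leP 1 `|x|; first by rewrite f0// normr0 addr_ge0.
apply: le_trans (hc x _) _; last by rewrite lerDl.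
by rewrite in_itv/= -ler_norml ltW.
Qed.

Lemma exists_bump_bound : exists C, [/\ 1 <= C, forall x, bump x <= C &
  forall x y, `|bump x - bump y| <= C * `|x - y|].
Proof.
have d x : is_derive x 1 bump (derive1 bump x).
  by rewrite derive1E; apply/derivableP; have [] := bump_Csm 0.
have cd : continuous (derive1 bump).
  by apply: Csm_cont; have [] := bump_Csm 1.
have d0 x : 1 < `|x| -> derive1 bump x = 0.
  move=> x1; have : is_derive x 1 bump 0.
    apply: (@near_eq_is_derive _ _ _ (fun _ : R => 0 : R)).
    have : \forall z \near x, 1 < `|z|.
      have := @norm_continuous _ R x => /cvgrPdist_lt /(_ (`|x| - 1)) h.
      have {}h := h (ltac:(by rewrite subr_gt0)).
      near=> z.
      have : `| `|x| - `|z| | < `|x| - 1 by near: z.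
      by rewrite ltr_norml => /andP[_]; lra.
    by apply: filterS => z /ltW h; rewrite bump_out.
  by move=> h; rewrite derive1E derive_val.
have [C1 C10 h1] := bounded_of_compact_supp bump_cont bump_out.
have [C2 C20 h2] : exists2 C, 0 < C & forall x, `|derive1 bump x| <= C.
  have cn : {within `[-1, 1], continuous (fun x => `|derive1 bump x|)}.
    by apply: continuous_subspaceT => x; apply: cvg_norm; exact: cd.
  have [c _ hc] := @EVT_max R (fun x => `|derive1 bump x|) (-1) 1 (ltac:(lra)) cn.
  exists (`|derive1 bump c| + 1); first by rewrite ltr_wpDl.
  move=> x; have [x1|x1] := ltP 1 `|x|; first by rewrite d0// normr0 addr_ge0.
  apply: le_trans (hc x _) _; last by rewrite lerDl.
  by rewrite in_itv/= -ler_norml.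
exists (1 + C1 + C2); split; first by lra.
  by move=> x; have := h1 x; rewrite ger0_norm ?bump_ge0//; lra.
move=> x y; wlog xy : x y / y <= x.
  move=> hw; have [yx|/ltW xy] := leP y x; first exact: hw.
  by rewrite distrC (distrC x); exact: hw.
have [|z _ ->] := @MVT_segment R bump (derive1 bump) y x xy (fun z _ => d z).
  by apply: continuous_subspaceT; exact: bump_cont.
rewrite normrM ler_wpM2r//; have := h2 z; lra.
Unshelve. all: by end_near. Qed.

Definition bC : R := sval (cid exists_bump_bound).

Lemma bC_ge1 : 1 <= bC.
Proof. by rewrite /bC; case: cid => /= k []. Qed.
Lemma bump_le x : bump x <= bC.
Proof. by rewrite /bC; case: cid => /= k []. Qed.
Lemma bump_lip x y : `|bump x - bump y| <= bC * `|x - y|.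
Proof. by move: x y; rewrite /bC; case: cid => /= k []. Qed.

(* The mollifier acts by dilations: ph e x m = kappa_e(m / x) / x with
   kappa_e(l) = bump ((l - 1) / e) / e. *)
Definition ph e x m : R :=
  if 0 < x then (e * x)^-1 * bump ((e * x)^-1 * m + - e^-1) else 0.

Lemma ph_ge0 e x m : 0 < e -> 0 <= ph e x m.
Proof.
move=> e0; rewrite /ph; case: ifP => // x0.
by rewrite mulr_ge0 ?bump_ge0// invr_ge0 ltW// mulr_gt0.
Qed.

Lemma ph_supp e x m : 0 < e -> 0 < x -> ph e x m != 0 -> (1 - e) * x < m < (1 + e) * x.
Proof.
move=> e0 x0; rewrite /ph x0 => h.
have : `|(e * x)^-1 * m + - e^-1| < 1.
  by rewrite ltNge; apply: contraNN h => /bump_out ->; rewrite mulr0.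
have -> : (e * x)^-1 * m + - e^-1 = (m - x) / (e * x) by field; rewrite !gt_eqF.
by rewrite normrM normfV (gtr0_norm (mulr_gt0 e0 x0)) ltr_pdivrMr ?mulr_gt0// mul1r ltr_norml; lra.
Qed.

Lemma ph_supp0 e x m : 0 < e -> e < 1 -> ph e x m != 0 -> 0 < m.
Proof.
move=> e0 e1 h; have x0 : 0 < x by move: h; rewrite /ph; case: ifP => //; rewrite eqxx.
case/andP: (ph_supp e0 x0 h) => h1 _; apply: le_lt_trans h1.
by rewrite mulr_ge0// ?ltW//; lra.
Qed.

Lemma ph_le e x m : 0 < e -> 0 < x -> ph e x m <= bC / (e * x).
Proof.
move=> e0 x0; rewrite /ph x0 mulrC ler_pM2r ?bump_le//.
by rewrite invr_gt0 mulr_gt0.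
Qed.

Lemma ph_lip e x m y : 0 < e -> 0 < x ->
  `|ph e x m - ph e x y| <= bC / (e * x) ^+ 2 * `|m - y|.
Proof.
move=> e0 x0; rewrite /ph x0 -mulrBr normrM.
have ex : 0 < (e * x)^-1 by rewrite invr_gt0 mulr_gt0.
rewrite (gtr0_norm ex).
apply: (@le_trans _ _ ((e * x)^-1 * (bC * `|(e * x)^-1 * m + - e^-1 - ((e * x)^-1 * y + - e^-1)|))).
  by rewrite ler_pM2l// bump_lip.
have -> : (e * x)^-1 * m - e^-1 - ((e * x)^-1 * y - e^-1) = (e * x)^-1 * (m - y) by ring.
rewrite normrM (gtr0_norm ex) le_eqVlt; apply/orP; left; apply/eqP.
by field; rewrite !gt_eqF.
Qed.

Lemma mfun_ph e : measfun2 R (ph e).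
Proof.
rewrite /ph; apply: mfun_ite; [by mfun| |by mfun].
apply: (@mfunM _ _ R (fun z : R * R => (e * z.1)^-1)
  (fun z : R * R => bump ((e * z.1)^-1 * z.2 + - e^-1))); first by mfun.
by apply: mfun_comp; [exact: mfun_bump|mfun].
Qed.

Lemma ph_test e x : 0 < e -> e < 1 -> 0 < x -> test_function (ph e x).
Proof.
move=> e0 e1 x0; split.
  apply: CsmP => n; rewrite /ph x0.
  apply: CsmM; first exact: Csm_cst.
  apply: Csm_affine; exact: bump_Csm.
exists ((1 - e) * x), ((1 + e) * x); split.
- by rewrite mulr_gt0//; lra.
- by rewrite ltr_pM2r//; lra.
- move=> m h; apply/eqP; apply: contraT => /(ph_supp e0 x0)/andP[h1 h2].
  by exfalso; apply: h; rewrite !ltW.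
Qed.

Lemma ph_int e x : 0 < e -> 0 < x -> \int[mu]_m ph e x m = 1.
Proof.
move=> e0 x0; have ex : 0 < (e * x)^-1 by rewrite invr_gt0 mulr_gt0.
transitivity (\int[mu]_m ((fun y => (e * x)^-1 * bump y) ((e * x)^-1 * m + - e^-1))).
  by apply: intR_ext => m; rewrite /ph x0.
have mb := mfun_bump.
rewrite (@intR_affine _ (e * x)^-1 (- e^-1) (fun y => (e * x)^-1 * bump y))//; last by mfun.
have bi : L1 mu bump.
  apply: (@L1_ext _ _ _ mu _ (fun x : R => if -1 < x < 1 then bump x else 0)).
    by apply: (@L1_itv_bd _ _ bC) => // y _; rewrite ger0_norm ?bump_le// bump_ge0.
  move=> y; case: ifP => // /negbT h; apply: bump_out.
  by rewrite ler_normr; move: h; rewrite negb_and -!leNgt => /orP[h|h]; apply/orP; [right|left]; lra.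
by rewrite intRZ// bump_int mulr1 mulVf// gt_eqF// invr_gt0.
Qed.

Lemma ph_L1 e x : 0 < e -> 0 < x -> L1 mu (ph e x).
Proof.
move=> e0 x0.
apply: (@L1_ext _ _ _ mu _ (fun m : R => if (1 - e) * x < m < (1 + e) * x then ph e x m else 0)).
  apply: (@L1_itv_bd _ _ (bC / (e * x))).
    exact: (mfun_section1 x (mfun_ph e)).
  by move=> y _; rewrite ger0_norm ?ph_le ?ph_ge0.
move=> m; case: ifP => // /negbT h; apply/eqP; apply: contraNT h; exact: ph_supp.
Qed.

(** The quotient by y^2 is the quantity that [kL_near_bound] requires to be Lipschitz. The power
    e^-2 found here is what the truncation distance has to beat. *)
Lemma ph_sqr_lip e x m y : 0 < e -> e <= 2^-1 -> 0 < x -> 0 < m -> 0 < y ->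
  `|ph e x y / y ^+ 2 - ph e x m / m ^+ 2| <= 20 * bC / (e ^+ 2 * x ^+ 4) * `|y - m|.
Proof.
move=> e0 e1 x0; have b1 := bC_ge1.
have low z : z <= x / 2 -> ph e x z = 0.
  move=> zx; apply/eqP; apply: contraT => /(ph_supp e0 x0)/andP[h _].
  by exfalso; nra.
wlog my : m y / m <= y.
  move=> hw m0 y0; have [my|/ltW ym] := leP m y; first exact: hw.
  by rewrite distrC (distrC y); exact: hw.
move=> m0 y0; rewrite (ger0_norm (x := y - m)) ?subr_ge0//.
have ym0 : 0 <= y - m by rewrite subr_ge0.
set K := bC / (e ^+ 2 * x ^+ 4).
have e2 : 0 < e ^+ 2 by rewrite exprn_gt0.
have x4 : 0 < x ^+ 4 by rewrite exprn_gt0.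
have x2 : 0 < x ^+ 2 by rewrite exprn_gt0.
have K0 : 0 < K by rewrite divr_gt0 ?mulr_gt0//; lra.
have -> : 20 * bC / (e ^+ 2 * x ^+ 4) * (y - m) = 20 * (K * (y - m)) by rewrite /K; ring.
have Ky : 0 <= K * (y - m) by rewrite mulr_ge0// ltW.
have [yx|yx] := leP y (x / 2).
  by rewrite !low ?(le_trans my)// !mul0r subrr normr0; lra.
have y2 : (y ^+ 2)^-1 <= 4 / x ^+ 2.
  have -> : 4 / x ^+ 2 = ((x / 2) ^+ 2)^-1 by field; rewrite gt_eqF.
  rewrite lef_pV2 ?posrE ?exprn_gt0//; last by rewrite divr_gt0.
  by rewrite lerXn2r ?nnegrE ?(ltW yx)// ?(le_trans _ (ltW yx))// ?divr_ge0// ltW.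
have h1 : `|ph e x y - ph e x m| / y ^+ 2 <= 4 * (K * (y - m)).
  have -> : 4 * (K * (y - m)) = (bC / (e * x) ^+ 2 * (y - m)) * (4 / x ^+ 2).
    by rewrite /K; field; rewrite !gt_eqF.
  apply: ler_pM => //; first by rewrite invr_ge0 sqr_ge0.
  by have := ph_lip m y e0 x0; rewrite distrC (distrC m) (ger0_norm ym0).
have yi : 0 < (y ^+ 2)^-1 by rewrite invr_gt0 exprn_gt0.
have [mx|mx] := leP m (x / 2).
  rewrite (low _ mx) mul0r subr0 normrM (gtr0_norm yi).
  by rewrite (low _ mx) subr0 in h1; lra.
(* The increment of [ph] contributes 4 and the increment of y^-2 contributes 16 to the constant
   20. *)
have -> : ph e x y / y ^+ 2 - ph e x m / m ^+ 2 =
  (ph e x y - ph e x m) / y ^+ 2 - ph e x m * ((m ^+ 2)^-1 - (y ^+ 2)^-1) by ring.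
apply: le_trans (ler_normB _ _) _; rewrite normrM (gtr0_norm yi).
suff h2 : `|ph e x m * ((m ^+ 2)^-1 - (y ^+ 2)^-1)| <= 16 * (K * (y - m)) by lra.
have dm : 0 <= (m ^+ 2)^-1 - (y ^+ 2)^-1.
  by rewrite subr_ge0 lef_pV2 ?posrE ?exprn_gt0// lerXn2r ?nnegrE ?(ltW m0) ?(ltW y0).
rewrite ger0_norm ?mulr_ge0 ?ph_ge0//.
have hx : 0 < x / 2 by rewrite divr_gt0.
have im : m^-1 <= 2 / x.
  by rewrite -[leRHS]invrK invf_div lef_pV2 ?posrE// ltW.
have iy : y^-1 <= 2 / x.
  by rewrite -[leRHS]invrK invf_div lef_pV2 ?posrE// ltW.
have m1 : 0 < m^-1 by rewrite invr_gt0.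
have y1 : 0 < y^-1 by rewrite invr_gt0.
have eq : (m ^+ 2)^-1 - (y ^+ 2)^-1 = (m^-1 * y^-1) * ((m^-1 + y^-1) * (y - m)).
  by field; rewrite !gt_eqF.
have h3 : m^-1 * y^-1 <= (2 / x) * (2 / x) by apply: ler_pM => //; exact: ltW.
have h4 : (m^-1 + y^-1) * (y - m) <= (4 / x) * (y - m).
  by rewrite ler_wpM2r//; lra.
have h5 : (m ^+ 2)^-1 - (y ^+ 2)^-1 <= (2 / x * (2 / x)) * (4 / x * (y - m)).
  rewrite eq; apply: ler_pM => //; first by rewrite mulr_ge0 ?ltW.
  by rewrite mulr_ge0// addr_ge0 ?ltW.
apply: (@le_trans _ _ (bC / (e * x) * ((2 / x * (2 / x)) * (4 / x * (y - m))))).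
  by apply: ler_pM => //; [exact: ph_ge0|exact: ph_le].
have -> : bC / (e * x) * (2 / x * (2 / x) * (4 / x * (y - m))) = (16 * e) * (K * (y - m)).
  by rewrite /K; field; rewrite !gt_eqF.
by rewrite ler_wpM2r//; lra.
Qed.

(** For fixed m the support in x has length at most 3 e m, and there the height is at most 2 bC / (e
    m). The product 6 bC does not depend on e. *)
Lemma NB_ph_weight (V : R -> R) K e m : measfun V -> 0 < e -> e <= 2^-1 ->
  0 <= V m -> 0 <= K ->
  (forall x, m / 2 < x < 2 * m -> 0 <= V x <= K * V m) ->
  NB mu (fun x => V x * ph e x m) (6 * bC * (K * V m)).
Proof.
move=> mV e0 e1 V0 K0 hV; have b1 := bC_ge1.
have KV : 0 <= K * V m by rewrite mulr_ge0.
have mp := mfun_section2 m (mfun_ph e); rewrite /= in mp.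
have [m0|m0] := ltP 0 m; last first.
  have -> : (fun x => V x * ph e x m) = (fun=> 0).
    apply/funext => x; have [->|h] := eqVneq (ph e x m) 0; first by rewrite mulr0.
    by have := ph_supp0 e0 (ltac:(lra)) h; rewrite ltNge m0.
  by apply: NB_0; rewrite mulr_ge0// mulr_ge0//; lra.
have h : NB mu (fun x => if (1 - e) * m < x < (1 + 2 * e) * m then (K * V m) * (bC / (e * (m / 2))) else 0)
   (`|(K * V m) * (bC / (e * (m / 2)))| * ((1 + 2 * e) * m - (1 - e) * m)).
  by apply: NB_itv; rewrite ler_pM2r//; lra.
apply: NB_le h _; first by mfun.
  move=> x; have [->|px] := eqVneq (ph e x m) 0; first by rewrite mulr0 normr0.
  have x0 : 0 < x by move: px; rewrite /ph; case: ifP => //; rewrite eqxx.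
  have /andP[h1 h2] := ph_supp e0 x0 px.
  have xl : (1 - e) * m < x by nra.
  have xu : x < (1 + 2 * e) * m by nra.
  rewrite xl xu/=.
  have /andP[V1 V2] : 0 <= V x <= K * V m by apply: hV; apply/andP; split; nra.
  have hb0 : 0 <= bC / (e * (m / 2)) by rewrite divr_ge0 ?mulr_ge0//; lra.
  rewrite (ger0_norm (mulr_ge0 V1 (ph_ge0 _ _ e0))) (ger0_norm (mulr_ge0 KV hb0)).
  apply: ler_pM => //; first exact: ph_ge0.
  apply: le_trans (ph_le _ e0 x0) _.
  rewrite ler_pM2l; last lra.
  by rewrite lef_pV2 ?posrE ?mulr_gt0// ?ler_pM2l//; nra.
rewrite ger0_norm; last first.
  by rewrite mulr_ge0// divr_ge0 ?mulr_ge0//; lra.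
rewrite le_eqVlt; apply/orP; left; apply/eqP.
by field; rewrite !gt_eqF.
Qed.

Lemma W_dil m x : 0 < m -> m / 2 < x < 2 * m -> 0 <= W x <= 64 * W m.
Proof.
move=> m0 /andP[h1 h2]; have x0 : 0 < x by lra.
rewrite W_ge0/= /W x0 m0 /etaW mulrA ler_pdivrMr ?etaW_den// mulrAC ler_pdivlMr ?etaW_den//.
have x2 : x ^+ 2 <= 4 * m ^+ 2.
  have -> : 4 * m ^+ 2 = (2 * m) ^+ 2 by ring.
  by rewrite lerXn2r ?nnegrE ?ltW// mulr_gt0.
have m4 : m ^+ 4 <= 16 * x ^+ 4.
  have -> : 16 * x ^+ 4 = (2 * x) ^+ 4 by ring.
  by rewrite lerXn2r ?nnegrE ?ltW// ?mulr_gt0//; lra.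
have p : 0 < m ^+ 2 by rewrite exprn_gt0.
have p2 : 0 < x ^+ 4 by rewrite exprn_gt0.
apply: (@le_trans _ _ (4 * m ^+ 2 * (16 * (1 + x ^+ 4)))); last by rewrite le_eqVlt; apply/orP; left; apply/eqP; ring.
apply: ler_pM => //; rewrite ?sqr_ge0//; last by lra.
exact/ltW/etaW_den.
Qed.

Lemma NB_W_ph e m : 0 < e -> e <= 2^-1 -> NB mu (fun x => W x * ph e x m) (384 * bC * W m).
Proof.
move=> e0 e1; have b1 := bC_ge1.
have -> : 384 * bC * W m = 6 * bC * (64 * W m) by ring.
apply: NB_ph_weight => //; [exact: mfun_W|exact: W_ge0|].
move=> x h; apply: W_dil => //; lra.
Qed.

Lemma NB_1_ph e m : 0 < e -> e <= 2^-1 -> NB mu (fun x => ph e x m) (6 * bC).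
Proof.
move=> e0 e1; have := @NB_ph_weight (fun=> 1) 1 e m (@mfun_cst _ _ R 1) e0 e1 ler01 ler01.
rewrite !mulr1 => h; apply: NB_le (h _) _ => //.
- exact: (mfun_section2 m (mfun_ph e)).
- by move=> x; rewrite mul1r.
- by move=> *; rewrite ler01 lexx.
Qed.

Definition Tm e g x : R := \int[mu]_m (ph e x m * g m).

Lemma mfun_Tm_int e g : measfun g ->
  measfun (fun z : R * R => ph e z.1 z.2 * g z.2).
Proof.
move=> mg; apply: (@mfunM _ _ R (fun z : R * R => ph e z.1 z.2) (fun z => g z.2)).
  exact: mfun_ph.
by apply: mfun_comp => //; mfun.
Qed.

Lemma mfun_Tm e g : measfun g -> measfun (Tm e g).
Proof.
move=> mg; exact: (@mfun_intR1 _ _ _ _ _ mu (fun z : R * R => ph e z.1 z.2 * g z.2) (mfun_Tm_int e mg)).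
Qed.

Lemma L1_ph e g x : 0 < e -> L1 mu g -> L1 mu (fun m => ph e x m * g m).
Proof.
move=> e0 gi; have [x0|x0] := ltP 0 x; last first.
  by apply: L1_ext (L1_0 mu) _ => m; rewrite /ph ltNge x0 mul0r.
apply: (@L1M _ _ _ mu (bC / (e * x))) => //.
  exact: (mfun_section1 x (mfun_ph e)).
by move=> m; rewrite ger0_norm ?ph_ge0// ph_le.
Qed.

Lemma Tm_bound e g C x : 0 < e -> measfun g -> 0 <= C ->
  (forall m, `|g m| <= C) -> `|Tm e g x| <= C.
Proof.
move=> e0 mg C0 gC; rewrite /Tm; have [x0|x0] := ltP 0 x; last first.
  rewrite intR_eq0 ?normr0// => m.
  by rewrite /ph ltNge x0 mul0r.
have pi := ph_L1 e0 x0; have mp := L1_meas pi.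
have fi : L1 mu (fun m => ph e x m * g m).
  apply: (@L1_le _ _ _ mu _ (fun m => C * ph e x m)); [by mfun| |exact: L1Z].
  by move=> m; rewrite normrM (ger0_norm (ph_ge0 _ _ e0)) mulrC ler_wpM2r ?ph_ge0.
apply: le_trans (intR_norm fi) _.
rewrite -[leRHS]mulr1 -(ph_int e0 x0) -intRZ//.
apply: intR_le; [exact: L1_norm|exact: L1Z|].
by move=> m; rewrite normrM (ger0_norm (ph_ge0 _ _ e0)) mulrC ler_wpM2r ?ph_ge0.
Qed.

Section WeightedBound.
Variables (V : R -> R) (K e : R) (g : R -> R).
Hypotheses (e0 : 0 < e) (mV : measfun V) (V0 : forall x, 0 <= V x).
Hypothesis hV : forall m, NB mu (fun x => V x * ph e x m) (K * V m).
Hypotheses (mg : measfun g) (gi : L1 mu (fun m => V m * g m)).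

Let F (z : R * R) := V z.1 * (ph e z.1 z.2 * g z.2).

Let L1_F : L1 (mu \x mu)%E F /\
  \int[(mu \x mu)%E]_z `|F z| <= \int[mu]_y (K * `|V y * g y|).
Proof.
have mF : measfun F.
  rewrite /F; apply: mfunM; last exact: mfun_Tm_int.
  by apply: mfun_comp => //; mfun.
apply: L1_prod_of2 => //; last exact/L1Z/L1_norm.
apply: aeW => m; rewrite /F/=.
apply: NB_le (NBZ (g m) (hV m)) _.
- exact: (mfun_section2 m mF).
- by move=> x; rewrite mulrA mulrC.
- by rewrite normrM (ger0_norm (V0 m)) mulrC mulrA.
Qed.

(** When only V g is integrable, the integral defining [Tm e g x] converges for almost every x;
    additivity of [Tm] is available only at such points. *)
Lemma Tm_section_L1 : {ae mu, forall x, V x != 0 -> L1 mu (fun m => ph e x m * g m)}.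
Proof.
apply: filterS (fub_ae1 L1_F.1) => x Fx Vx; apply: L1_ext (L1Z (V x)^-1 Fx) _ => m.
by rewrite /F/= mulrA mulVf// mul1r.
Qed.

Lemma NB_Tm : NB mu (fun x => V x * Tm e g x) (K * \int[mu]_m `|V m * g m|).
Proof.
have [FI FC] := L1_F.
have mT : measfun (fun x => V x * Tm e g x).
  by apply: mfunM => //; exact: mfun_Tm.
apply: (@NB_ae _ _ _ mu _ (fun x : R => \int[mu]_m F (x, m))) => //.
  apply: (aeS Tm_section_L1) => x Fx; rewrite /F/= /Tm; have [->|Vx] := eqVneq (V x) 0.
    by rewrite mul0r intR_eq0// => m; rewrite mul0r.
  by rewrite intRZ//; exact: Fx.
apply/NBP; split; first exact: fub_L11.
apply: le_trans (_ : \int[mu]_x \int[mu]_m `|F (x, m)| <= _).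
  apply: intR_le_ae; [exact/L1_norm/fub_L11|exact: fub_L11 (L1_norm FI)|].
  by apply: filterS (fub_ae1 FI) => x Fx; exact: intR_norm.
rewrite (fub_eq1 (L1_norm FI)); apply: le_trans FC _.
by rewrite intRZ//; exact: L1_norm.
Qed.

End WeightedBound.

End Mollifier.

Section MollifierLimit.
Variable R : realType.
Notation mu := (@lebesgue_measure R).
Implicit Types (f g u v : R -> R) (a b c d e l m x y : R).

(** The square leaves room for a logarithm: with truncation distance e^3 the product e log(1 / d) is
    still of order 1 / (n + 2), using only ln t <= t - 1. *)
Definition En n : R := (n.+2%:R ^+ 2)^-1.

Lemma En_gt0 n : 0 < En n.
Proof. by rewrite invr_gt0 exprn_gt0. Qed.

Lemma En_le n : En n <= n.+2%:R^-1 / 2.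
Proof.
rewrite /En expr2 invfM ler_pM2l ?invr_gt0//.
by rewrite lef_pV2 ?posrE// ler_nat.
Qed.

Lemma En_le4 n : En n <= 4^-1.
Proof.
rewrite /En lef_pV2 ?posrE ?exprn_gt0//; have -> : (4 : R) = 2%:R ^+ 2 by ring.
by rewrite lerXn2r ?nnegrE// ler_nat.
Qed.

Lemma En_cvg : En n @[n --> \oo] --> 0.
Proof.
apply: (@squeeze_cvgr _ _ _ _ (fun _ : nat => 0 : R) (fun n => n.+1%:R^-1)).
- near=> n; rewrite (ltW (En_gt0 n))/= (le_trans (En_le n))//.
  apply: (@le_trans _ _ (n.+2%:R^-1)).
    by rewrite ler_pdivrMr// ler_peMr// ?invr_ge0// ler1n.
  by rewrite lef_pV2 ?posrE// ler_nat.
- exact: cvg_cst.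
- exact: cvg_harmonic.
Unshelve. all: by end_near. Qed.

Lemma Tm_dev e g x : 0 < e -> 0 < x -> L1 mu g ->
  `|Tm e g x - g x| <= bC R / (e * x) *
     \int[mu]_m (if x - e * x < m < x + e * x then `|g m - g x| else 0).
Proof.
move=> e0 x0 gi; have mg := L1_meas gi; have pi := ph_L1 e0 x0; have mp := L1_meas pi.
have ex0 : 0 < e * x by rewrite mulr_gt0.
have pgi := L1_ph x e0 gi.
have fi : L1 mu (fun m : R => if x - e * x < m < x + e * x then `|g m - g x| else 0).
  apply: (@L1_le _ _ _ mu _ (fun m : R => `|g m| + (if x - e * x < m < x + e * x then `|g x| else 0))).
  - by mfun.
  - move=> m; case: ifP => _; last by rewrite normr0 addr0.
    by rewrite normr_id ler_normB.
  - apply: L1D; first exact: L1_norm.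
    by apply: (NB_L1 (NB_itv _ _)); lra.
have -> : Tm e g x - g x = \int[mu]_m (ph e x m * g m - g x * ph e x m).
  by rewrite intRB ?intRZ ?ph_int ?mulr1//; exact: L1Z.
have di : L1 mu (fun m => ph e x m * g m - g x * ph e x m) by apply: L1B => //; exact: L1Z.
apply: le_trans (intR_norm di) _; rewrite -intRZ//.
apply: intR_le; [exact: L1_norm|exact: L1Z|] => m.
have -> : ph e x m * g m - g x * ph e x m = ph e x m * (g m - g x) by ring.
rewrite normrM (ger0_norm (ph_ge0 x m e0)).
have [->|pm] := eqVneq (ph e x m) 0.
  by rewrite mul0r mulr_ge0// ?divr_ge0 ?(ltW ex0) ?(le_trans ler01 (bC_ge1 R))//; case: ifP.
have /andP[m1 m2] := ph_supp e0 x0 pm.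
have -> : x - e * x < m < x + e * x by apply/andP; split; lra.
by rewrite ler_wpM2r// ph_le.
Qed.

Lemma davgE g x r : 0 < r -> L1 mu g ->
  davg g x r = ((r *+ 2)^-1 *
    \int[mu]_m (if x - r < m < x + r then `|g m - g x| else 0))%:E.
Proof.
move=> r0 gi; have mg := L1_meas gi.
have fi : L1 mu (fun m : R => if x - r < m < x + r then `|g m - g x| else 0).
  apply: (@L1_le _ _ _ mu _ (fun m : R => `|g m| + (if x - r < m < x + r then `|g x| else 0))).
  - by mfun.
  - move=> m; case: ifP => _; last by rewrite normr0 addr0.
    by rewrite normr_id ler_normB.
  - apply: L1D; first exact: L1_norm.
    by apply: (NB_L1 (NB_itv _ _)); lra.
rewrite /davg /iavg (lebesgue_measure_ball _ (ltW r0)) inver mulrn_eq0/= gt_eqF//.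
rewrite EFinM; congr (_ * _)%E; rewrite L1_EFin// [LHS]integral_mkcond.
apply: eq_integral => m _; rewrite patchE.
have -> : (m \in (ball x r : set R)) = (x - r < m < x + r).
  by rewrite (ball_itv x r) mem_setE in_itv.
by case: ifP.
Qed.

(** The kernel lives on the ball of radius e x and is at most bC / (e x), so the error is at most 2
    bC times the mean deviation over the ball, which vanishes in the limit at Lebesgue points. *)
Lemma Tm_cvg g : L1 mu g -> {ae mu, forall x, 0 < x -> Tm (En n) g x @[n --> \oo] --> g x}.
Proof.
move=> gi; have lg : locally_integrable setT g by apply: open_integrable_locally => //; exact: openT.
apply: (aeS (lebesgue_differentiation lg)) => x lx x0.
have ex : En n * x @[n --> \oo] --> 0^'+.
  have h : En n * x @[n --> \oo] --> 0.
    by rewrite -[X in _ --> X](mul0r x); apply: cvgMl; exact: En_cvg.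
  move=> P hP; have [N _ HN] := h _ hP; exists N => // n /HN /=; apply.
  by rewrite mulr_gt0// En_gt0.
have {}lx := cvg_comp _ _ ex lx.
have {}lx : 2 * bC R * fine (davg g x (En n * x)) @[n --> \oo] --> 0.
  rewrite -[X in _ --> X](mulr0 (2 * bC R)); apply: cvgMr.
  exact: (fine_cvg lx).
apply/cvgrPdist_le => eps eps0; move/cvgrPdist_le : lx => /(_ _ eps0).
apply: filterS => n; rewrite sub0r normrN => h; rewrite distrC.
apply: le_trans h; have e0 := En_gt0 n; have r0 : 0 < En n * x by rewrite mulr_gt0.
apply: le_trans (Tm_dev e0 x0 gi) _; apply: le_trans (ler_norm _).
rewrite davgE//= le_eqVlt; apply/orP; left; apply/eqP.
by field; rewrite !gt_eqF.
Qed.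

(** A density argument: the mollifiers are bounded on L1(V dx) uniformly in n, so it suffices to
    treat the truncations [gk], bounded with bounded support, where dominated convergence
    applies. *)
Lemma Tm_L1_cvg (V : R -> R) K g : measfun V -> (forall x, 0 <= V x <= 1) -> 0 <= K ->
  (forall n m, NB mu (fun x => V x * ph (En n) x m) (K * V m)) ->
  measfun g -> (forall x, x <= 0 -> g x = 0) -> L1 mu (fun m => V m * g m) ->
  \int[mu]_x `|V x * (Tm (En n) g x - g x)| @[n --> \oo] --> 0.
Proof.
move=> mV V01 K0 hV mg g0 gi; have V0 x : 0 <= V x by have /andP[] := V01 x.
have V1 x : V x <= 1 by have /andP[] := V01 x.
pose gk k x := if (`|g x| <= k.+1%:R) && (x < k.+1%:R) then g x else 0.
have mgk k : measfun (gk k) by rewrite /gk; mfun.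
have gkb k x : `|gk k x| <= k.+1%:R.
  by rewrite /gk; case: ifP => [/andP[]//|_]; rewrite normr0.
have gkL k : L1 mu (gk k).
  apply: (@L1_ext _ _ _ mu _ (fun x : R => if 0 < x < k.+1%:R then gk k x else 0)).
    by apply: (@L1_itv_bd _ _ k.+1%:R).
  move=> x; case: ifP => // /negbT; rewrite negb_and -!leNgt /gk => /orP[x0|x0].
    by rewrite g0// if_same.
  by rewrite ltNge x0 andbF.
have VgL k : L1 mu (fun x => V x * gk k x).
  by apply: (@L1M _ _ _ mu 1) => // x; rewrite ger0_norm.
pose dk k x := g x - gk k x.
have mdk k : measfun (dk k) by rewrite /dk; have hk := mgk k; mfun.
have dkL k : L1 mu (fun x => V x * dk k x).
  by apply: L1_ext (L1B gi (VgL k)) _ => x; rewrite /dk mulrBr.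
have tail : \int[mu]_x `|V x * dk k x| @[k --> \oo] --> 0.
  rewrite -(@intR0 _ _ _ mu); apply: (@dct _ _ _ mu _ _ (fun x => `|V x * g x|)).
  - by move=> k; exact: L1_meas (L1_norm (dkL k)).
  - by mfun.
  - apply: aeW => x; apply/cvgrPdist_le => eps eps0; near=> k.
    rewrite /dk /gk ifT ?subrr ?mulr0 ?normr0 ?subr0 ?normr0 ?(ltW eps0)//.
    apply/andP; split; near: k.
      have := @nbhs_infty_gtr R `|g x|; apply: filterS => k /ltW/le_trans; apply.
      by rewrite ler_nat.
    have := @nbhs_infty_gtr R x; apply: filterS => k /lt_le_trans; apply.
    by rewrite ler_nat.
  - exact: L1_norm.
  - move=> k; apply: aeW => x; rewrite normr_id !normrM ler_wpM2l// /dk /gk.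
    by case: ifP => _; rewrite ?subrr ?subr0 ?normr0.
have e2 n : En n <= 2^-1 by apply: le_trans (En_le4 n) _; rewrite lef_pV2 ?posrE// ler_nat.
have main k : \int[mu]_x `|V x * (Tm (En n) (gk k) x - gk k x)| @[n --> \oo] --> 0.
  rewrite -(@intR0 _ _ _ mu).
  apply: (@dct _ _ _ mu _ _ (fun x : R => if 0 < x < 2 * k.+1%:R then 2 * k.+1%:R else 0)).
  - by move=> n; have h1 := mfun_Tm (En n) (mgk k); have h2 := mgk k; mfun.
  - by mfun.
  - apply: (aeS (Tm_cvg (gkL k))) => x hx; have [x0|x0] := ltP 0 x.
      rewrite -(normr0 R); apply: cvg_norm; rewrite -[X in _ --> X](mulr0 (V x)); apply: cvgMr.
      by rewrite -[X in _ --> X](subrr (gk k x)); apply: cvgB; [exact: hx|exact: cvg_cst].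
    apply: cvg_near_cst; apply: nearW => n.
    rewrite /gk g0// if_same subr0 /Tm intR_eq0 ?mulr0 ?normr0//.
    by move=> m; rewrite /ph ltNge x0 mul0r.
  - by apply: (NB_L1 (NB_itv _ _)); rewrite mulr_ge0.
  - move=> n; apply: aeW => x; rewrite normr_id normrM (ger0_norm (V0 x)).
    case: ifP => [_|/negbT].
      apply: (@le_trans _ _ (1 * (k.+1%:R + k.+1%:R))); last by rewrite mul1r; lra.
      apply: ler_pM => //; apply: le_trans (ler_normB _ _) _.
      by rewrite lerD// (Tm_bound x (En_gt0 n)).
    move=> hx; have -> : gk k x = 0.
      move: hx; rewrite negb_and -!leNgt /gk => /orP[x0|x0]; first by rewrite g0// if_same.
      rewrite [x < _]ltNge ifF//; apply/negbTE; rewrite negb_and negbK; apply/orP; right.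
      by apply: le_trans x0; rewrite ler_peMl// ler1n.
    rewrite subr0 (_ : Tm _ _ _ = 0) ?normr0 ?mulr0//.
    rewrite /Tm intR_eq0// => m.
    have [->|pm] := eqVneq (ph (En n) x m) 0; first by rewrite mul0r.
    have x0 : 0 < x by move: pm; rewrite /ph; case: ifP => //; rewrite eqxx.
    have /andP[h1 h2] := ph_supp (En_gt0 n) x0 pm.
    rewrite x0/= -leNgt in hx.
    rewrite /gk [m < _]ltNge ifF ?mulr0//; apply/negbTE; rewrite negb_and negbK; apply/orP; right.
    have := e2 n; have := En_gt0 n; nra.
apply/cvgrPdist_le => eps eps0.
have K1 : 0 < K + 1 by lra.
have ep : 0 < eps / 2 / (K + 1) by rewrite !divr_gt0.
have /cvgrPdist_le/(_ _ ep)[k _ /(_ k (leqnn k))/= hk] := tail.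
have {}hk : \int[mu]_x `|V x * dk k x| <= eps / 2 / (K + 1).
  by apply: le_trans hk; rewrite sub0r normrN ler_norm.
have /cvgrPdist_le/(_ (eps / 2) (ltac:(lra))) := main k.
apply: filterS => n; rewrite !sub0r !normrN => /(le_trans (ler_norm _)) hn.
rewrite ger0_norm; last exact: intR_ge0.
have e0 := En_gt0 n.
have [tL tb] : L1 mu (fun x => V x * Tm (En n) (dk k) x) /\
    \int[mu]_x `|V x * Tm (En n) (dk k) x| <= K * \int[mu]_m `|V m * dk k m|.
  by apply/NBP; apply: NB_Tm.
have sec : {ae mu, forall x, V x != 0 -> L1 mu (fun m => ph (En n) x m * dk k m)}.
  exact: (Tm_section_L1 mV V0 (hV n) (mdk k) (dkL k)).
have mL : L1 mu (fun x => V x * (Tm (En n) (gk k) x - gk k x)).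
  have tk : L1 mu (fun x => V x * Tm (En n) (gk k) x) by apply: (NB_L1 (c := K * _)); apply: NB_Tm.
  by apply: L1_ext (L1B tk (VgL k)) _ => x; rewrite mulrBr.
have TE : {ae mu, forall x, V x * (Tm (En n) g x - g x) =
   V x * (Tm (En n) (gk k) x - gk k x) + V x * Tm (En n) (dk k) x - V x * dk k x}.
  apply: (aeS sec) => x sx; have [->|Vx] := eqVneq (V x) 0; first by rewrite !mul0r; ring.
  have -> : Tm (En n) g x = Tm (En n) (gk k) x + Tm (En n) (dk k) x.
    rewrite /Tm -intRD; [|exact: L1_ph|exact: sx].
    by apply: intR_ext => m; rewrite /dk; ring.
  by rewrite /dk; ring.
have mT := mfun_Tm (En n) mg.
have SL := L1D (L1D (L1_norm mL) (L1_norm tL)) (L1_norm (dkL k)).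
apply: (@le_trans _ _ (\int[mu]_x (`|V x * (Tm (En n) (gk k) x - gk k x)| + `|V x * Tm (En n) (dk k) x| + `|V x * dk k x|))).
  have AE : {ae mu, forall x, `|V x * (Tm (En n) g x - g x)| <= `|V x * (Tm (En n) (gk k) x - gk k x)| + `|V x * Tm (En n) (dk k) x| + `|V x * dk k x|}.
    apply: (aeS TE) => x ->; apply: le_trans (ler_normB _ _) _.
    by rewrite lerD2r ler_normD.
  apply: intR_le_ae => //; apply/L1_norm; apply: (L1_le_ae _ AE SL); by mfun.
rewrite intRD; [|by apply: L1D; exact: L1_norm|exact: L1_norm].
rewrite intRD; [|exact: L1_norm|exact: L1_norm].
have kk : (K + 1) * \int[mu]_m `|V m * dk k m| <= eps / 2 by rewrite mulrC -ler_pdivlMr.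
lra.
Unshelve. all: by end_near. Qed.

End MollifierLimit.

(** * Commuting the mollifier with the jump operator *)

Section Commutator.
Variable R : realType.
Notation mu := (@lebesgue_measure R).
Notation bC := (bC R).
Implicit Types (f g u v phi : R -> R) (a b c d e l m x y z : R).

Definition Ladj phi m : R := \int[mu]_y (phi y * kL y m - phi m * kL m y).
Definition Ld d (G : R -> R) x : R := \int[mu]_y (kLd d x y * (G y - G x)).

(** Total jump rate at 1 of the truncated process; by homogeneity the rate at x is nd d / x. *)
Definition nd d : R := \int[mu]_t kLd d 1 t.
(** A crude pointwise bound of order 1 / d. It serves for integrability only; the error estimates
    use the logarithmic bound [nd_le]. *)
Definition Cd d : R := 32 / d + 4.

Lemma Cd_gt0 d : 0 < d -> 0 < Cd d.
Proof. by move=> d0; rewrite /Cd; have := divr_gt0 (ltr0n R 32) d0; lra. Qed.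

Lemma kLd_bd1 d t : 0 < d -> d < 1 -> kLd d 1 t <= Cd d /\ (0 < t -> kLd d 1 t <= Cd d / t ^+ 2).
Proof.
move=> d0 d1; have i0 : 0 < d^-1 by rewrite invr_gt0.
have h := kLd_bound1 t d0 d1.
have h1 : (if 0 < t < 1 - d / 2 then (1 - t)^-1 else 0) <= 2 / d.
  case: ifP => [/andP[_ t1]|_]; last by rewrite divr_ge0// ltW.
  by rewrite -[leRHS]invrK invf_div lef_pV2 ?posrE ?divr_gt0//; lra.
have h2 : (if 1 + d / 2 < t < 2 then (t - 1)^-1 else 0) <= 2 / d.
  case: ifP => [/andP[t1 _]|_]; last by rewrite divr_ge0// ltW.
  by rewrite -[leRHS]invrK invf_div lef_pV2 ?posrE ?divr_gt0//; lra.
have h3 : (if 1 < t then (t ^+ 2)^-1 else 0) <= 1.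
  by case: ifP => // t1; rewrite invf_le1 ?exprn_gt0 ?exprn_ege1 ?(ltW t1)//; lra.
rewrite /Cd; split; first by lra.
move=> t0; have t2 : 0 < t ^+ 2 by rewrite exprn_gt0.
have i2 : 0 < (t ^+ 2)^-1 by rewrite invr_gt0.
have h4 : (if 1 < t then (t ^+ 2)^-1 else 0) <= (t ^+ 2)^-1 by case: ifP => // _; exact: ltW.
have k (t1 : R) : t1 < 2 -> 0 < t1 -> 1 <= 4 * (t1 ^+ 2)^-1.
  by move=> t12 t10; rewrite ler_pdivlMr ?exprn_gt0// mul1r; nra.
have h5 : (if 0 < t < 1 - d / 2 then (1 - t)^-1 else 0) <= (8 / d) * (t ^+ 2)^-1.
  apply: le_trans (_ : (if 0 < t < 1 - d / 2 then 2 / d else 0) <= _).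
    by move: h1; case: ifP.
  case: ifP => [/andP[_ t1]|_]; last by rewrite !mulr_ge0// ltW.
  have := k t (ltac:(lra)) t0; nra.
have h6 : (if 1 + d / 2 < t < 2 then (t - 1)^-1 else 0) <= (8 / d) * (t ^+ 2)^-1.
  apply: le_trans (_ : (if 1 + d / 2 < t < 2 then 2 / d else 0) <= _).
    by move: h2; case: ifP.
  case: ifP => [/andP[_ t1]|_]; last by rewrite !mulr_ge0// ltW.
  have := k t t1 t0; nra.
have -> : (32 / d + 4) / t ^+ 2 = 2 * ((8 / d) * (t ^+ 2)^-1) + 2 * ((8 / d) * (t ^+ 2)^-1) + 4 * (t ^+ 2)^-1 by ring.
by lra.
Qed.

Lemma kLd_bdl d x y : 0 < d -> d < 1 -> 0 < x -> kLd d x y <= Cd d / x ^+ 2.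
Proof.
move=> d0 d1 x0; rewrite kLd_homog// mulrC ler_pM2r ?invr_gt0 ?exprn_gt0//.
by have [] := kLd_bd1 (x^-1 * y) d0 d1.
Qed.

Lemma kLd_bdr d x y : 0 < d -> d < 1 -> 0 < x -> 0 < y -> kLd d x y <= Cd d / y ^+ 2.
Proof.
move=> d0 d1 x0 y0; rewrite kLd_homog//.
have [_ /(_ _) h] := kLd_bd1 (x^-1 * y) d0 d1.
have -> : Cd d / y ^+ 2 = x ^- 2 * (Cd d / (x^-1 * y) ^+ 2) by field; rewrite !gt_eqF.
by rewrite ler_pM2l ?invr_gt0 ?exprn_gt0// h// mulr_gt0// invr_gt0.
Qed.

Lemma int_kLd d x : 0 < d -> d < 1 -> 0 < x -> \int[mu]_y kLd d x y = nd d / x.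
Proof.
move=> d0 d1 x0; have i0 : 0 < x^-1 by rewrite invr_gt0.
have m1 := mfun_section1 (1 : R) (mfun_kLd d).
transitivity (\int[mu]_y ((fun t => x ^- 2 * kLd d 1 t) (x^-1 * y))).
  by apply: intR_ext => y; rewrite -kLd_homog.
rewrite (@intR_dil _ x^-1 (fun t => x ^- 2 * kLd d 1 t))//; last first.
  by apply: mfunM => //; mfun.
rewrite intRZ; last exact: (NB_L1 (NB_kLd1 d0 d1)).
by rewrite -/(nd d); field; rewrite gt_eqF.
Qed.

Lemma nd_ge0 d : 0 <= nd d.
Proof. by apply: intR_ge0 => t; exact: kLd_ge0. Qed.

Lemma nd_le d : 0 < d -> d < 1 -> nd d <= 4 * - ln (d / 2) + 4.
Proof. by move=> d0 d1; apply: le_trans (ler_norm _) (NB_abs (NB_kLd1 d0 d1)). Qed.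

Lemma L1_kLd d x : 0 < d -> d < 1 -> 0 < x -> L1 mu (kLd d x).
Proof. by move=> d0 d1 x0; exact: (NB_L1 (NB_kLd d0 d1 x0)). Qed.

Lemma etaW_le_hb x : 0 < x -> etaW x <= hb x / 2.
Proof.
move=> x0; rewrite /hb x0/=; have [x1|x1] := ltP x 1; first by rewrite divff// etaW_le1.
rewrite mulrAC divff// mul1r /etaW lef_pV2 ?posrE ?etaW_den ?exprn_gt0//.
have : 1 <= x ^+ 2 by rewrite exprn_ege1.
have -> : x ^+ 4 = x ^+ 2 * x ^+ 2 by ring.
nra.
Qed.

(** Near part of the adjoint operator on [ph e x]. Its two terms stay under one integral because
    each alone diverges at the diagonal; in the far part [Fr] they can be separated. *)
Definition Nr d e x m : R :=
  \int[mu]_y (if far d m y then 0 else ph e x y * kL y m - ph e x m * kL m y).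
Definition Fr d e x m : R :=
  \int[mu]_y (ph e x y * kLd d y m) - ph e x m * \int[mu]_y kLd d m y.

Section Estimates.
Variables (d e : R).
Hypotheses (d0 : 0 < d) (d4 : d <= 4^-1) (e0 : 0 < e) (e4 : e <= 4^-1).

Let d1 : d < 1. Proof. by move: d4; lra. Qed.
Let e2 : e <= 2^-1. Proof. by move: e4; lra. Qed.
Let b1 : 1 <= bC. Proof. exact: bC_ge1. Qed.

Let ell x := 20 * bC / (e ^+ 2 * x ^+ 4).
Let ell_ge0 x : 0 < x -> 0 <= ell x.
Proof.
move=> x0; rewrite /ell divr_ge0 ?mulr_ge0 ?exprn_ge0 ?(ltW e0) ?(ltW x0)//.
by move: b1; lra.
Qed.

Lemma mfun_Nr_int : measfun (fun w : (R * R) * R =>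
  if far d w.1.2 w.2 then 0 else ph e w.1.1 w.2 * kL w.2 w.1.2 - ph e w.1.1 w.1.2 * kL w.1.2 w.2).
Proof.
apply: mfun_ite; last 2 first.
- by mfun.
- apply: mfunB; apply: mfunM; apply: mfun_curry; by [exact: mfun_ph|exact: mfun_kL|mfun].
- by apply: (mfun_curry (mfun_far d)); mfun.
Qed.

Lemma mfun_Nr : measfun2 R (Nr d e).
Proof.
exact: (@mfun_intR1 _ _ _ _ _ mu (fun w : (R * R) * R =>
  if far d w.1.2 w.2 then 0 else ph e w.1.1 w.2 * kL w.2 w.1.2 - ph e w.1.1 w.1.2 * kL w.1.2 w.2)
  mfun_Nr_int).
Qed.

Lemma near_int_le x m y : 0 < x -> 0 < m ->
  `|if far d m y then 0 else ph e x y * kL y m - ph e x m * kL m y| <=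
   if (1 - d) * m < y < (1 + 2 * d) * m then ell x * m else 0.
Proof.
move=> x0 m0; case: ifPn => [_|nf].
  by rewrite normr0; case: ifP => // _; rewrite mulr_ge0 ?ell_ge0// ltW.
have y0 : 0 < y.
  move: nf; rewrite /far negb_or -!ltNge => /andP[h _]; apply: le_lt_trans h.
  by rewrite mulr_ge0 ?(ltW m0)//; move: d1; lra.
rewrite (near_itv d0 _ m0 y0 nf); last by move: d4; lra.
apply: kL_near_bound => //; first exact: ell_ge0.
exact: ph_sqr_lip.
Qed.

Lemma near_int_L1 x m : 0 < x -> 0 < m ->
  NB mu (fun y => if far d m y then 0 else ph e x y * kL y m - ph e x m * kL m y)
    (ell x * m * (3 * d * m)).
Proof.
move=> x0 m0.
have h : NB mu (fun y : R => if (1 - d) * m < y < (1 + 2 * d) * m then ell x * m else 0)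
    (`|ell x * m| * ((1 + 2 * d) * m - (1 - d) * m)).
  by apply: NB_itv; rewrite ler_pM2r//; move: d0; lra.
apply: NB_le h _.
- exact: (mfun_section1 (x, m) mfun_Nr_int).
- move=> y; apply: le_trans (near_int_le y x0 m0) _; exact: ler_norm.
- rewrite (ger0_norm (mulr_ge0 (ell_ge0 x0) (ltW m0))).
  by rewrite le_eqVlt; apply/orP; left; apply/eqP; ring.
Qed.

Lemma Nr_le x m : 0 < x -> 0 < m ->
  `|Nr d e x m| <= if x / 4 < m < 4 * x then 60 * d * bC / (e ^+ 2 * x ^+ 4) * m ^+ 2 else 0.
Proof.
move=> x0 m0; case: ifPn => [_|h].
  apply: le_trans (NB_abs (near_int_L1 x0 m0)) _.
  by rewrite le_eqVlt; apply/orP; left; apply/eqP; rewrite /ell; ring.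
rewrite /Nr intR_eq0 ?normr0// => y.
case: ifPn => // nf.
have y0 : 0 < y.
  move: nf; rewrite /far negb_or -!ltNge => /andP[k _]; apply: le_lt_trans k.
  by rewrite mulr_ge0 ?(ltW m0)//; move: d1; lra.
have /andP[y1 y2] := near_itv d0 (ltac:(move: d4; lra)) m0 y0 nf.
have ex : e * x <= 4^-1 * x by rewrite ler_wpM2r// ltW.
have dm : d * m <= 4^-1 * m by rewrite ler_wpM2r// ltW.
have -> : ph e x m = 0.
  apply/eqP; apply: contraNT h => /(ph_supp e0 x0)/andP[h1 h2].
  by apply/andP; split; lra.
have -> : ph e x y = 0.
  apply/eqP; apply: contraNT h => /(ph_supp e0 x0)/andP[h1 h2].
  by apply/andP; split; lra.
by rewrite !mul0r subrr.
Qed.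

Lemma Nr_eq0 x m : ~~ ((0 < x) && (0 < m)) -> Nr d e x m = 0.
Proof.
rewrite negb_and -!leNgt => h.
rewrite /Nr intR_eq0// => y; case: ifP => // _.
case/orP : h => h; first by rewrite /ph !ltNge h/= !mul0r subrr.
by rewrite !kL_eq0 ?mulr0 ?subrr// negb_and -!leNgt h ?orbT.
Qed.

(** On the support m^2 <= 16 x^2, and W x / x^2 = etaW x is integrable. The result is proportional
    to d / e^2, uniformly in m. *)
Lemma NB_W_Nr m : NB mu (fun x => W x * Nr d e x m) (1920 * d * bC / e ^+ 2).
Proof.
have mN := mfun_section2 m mfun_Nr; rewrite /= in mN; have mW := @mfun_W R.
have e20 : 0 < e ^+ 2 by rewrite exprn_gt0.
have c0 : 0 <= 480 * d * bC / e ^+ 2.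
  apply: divr_ge0; last exact: ltW.
  apply: mulr_ge0; last exact: le_trans b1.
  by apply: mulr_ge0; [exact: ler0n|exact: ltW].
apply: NB_le (NBZ (480 * d * bC / e ^+ 2) (@NB_hb R)) _.
- by mfun.
- move=> x; have [/andP[x0 m0]|h] := boolP ((0 < x) && (0 < m)); last first.
    by rewrite Nr_eq0// mulr0 normr0.
  rewrite normrM (ger0_norm (W_ge0 x)) normrM (ger0_norm c0) (ger0_norm (hb_ge0 x)).
  apply: (@le_trans _ _ (W x * (60 * d * bC / (e ^+ 2 * x ^+ 4) * (16 * x ^+ 2)))).
    apply: ler_wpM2l; first exact: W_ge0.
    apply: le_trans (Nr_le x0 m0) _.
    have k0 : 0 <= 60 * d * bC / (e ^+ 2 * x ^+ 4).
      rewrite divr_ge0 ?mulr_ge0 ?(ltW d0) ?exprn_ge0 ?(ltW e0) ?(ltW x0)//.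
      by move: b1; lra.
    case: ifP => [/andP[_ h]|_]; last by rewrite mulr_ge0// mulr_ge0// sqr_ge0.
    rewrite ler_wpM2l//; have -> : 16 * x ^+ 2 = (4 * x) ^+ 2 by ring.
    by rewrite lerXn2r ?nnegrE ?(ltW h) ?(ltW m0)// mulr_ge0// ltW.
  rewrite /W x0.
  have -> : x ^+ 2 * etaW x * (60 * d * bC / (e ^+ 2 * x ^+ 4) * (16 * x ^+ 2)) =
     480 * d * bC / e ^+ 2 * (2 * etaW x) by field; rewrite !gt_eqF.
  by rewrite ler_wpM2l//; have := etaW_le_hb x0; lra.
- rewrite ger0_norm// le_eqVlt; apply/orP; left; apply/eqP.
  by field; rewrite gt_eqF.
Qed.

Lemma far_int_L1 x m : 0 < x -> NB mu (fun y => ph e x y * kLd d y m) (4 * Cd d / x ^+ 2).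
Proof.
move=> x0; have pi := ph_L1 e0 x0; have mp := L1_meas pi.
have mk := mfun_section2 m (mfun_kLd d); rewrite /= in mk.
have c0 : 0 <= 4 * Cd d / x ^+ 2.
  by rewrite divr_ge0 ?sqr_ge0// mulr_ge0// ltW// Cd_gt0.
apply: NB_le (NBZ (4 * Cd d / x ^+ 2) (L1_NB pi)) _.
- by mfun.
- move=> y; rewrite !normrM (ger0_norm (ph_ge0 x y e0)) (ger0_norm (kLd_ge0 _ _ _)).
  rewrite -!normrM ger0_norm// [leRHS]mulrC.
  have [->|py] := eqVneq (ph e x y) 0; first by rewrite !mul0r.
  have /andP[y1 _] := ph_supp e0 x0 py.
  have yx : x / 2 <= y by move: e2; nra.
  have y0 : 0 < y by lra.
  rewrite ler_wpM2l ?ph_ge0//; apply: le_trans (kLd_bdl _ d0 d1 y0) _.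
  have -> : 4 * Cd d / x ^+ 2 = Cd d / (x / 2) ^+ 2 by field; rewrite gt_eqF.
  rewrite ler_pM2l ?Cd_gt0// lef_pV2 ?posrE ?exprn_gt0 ?divr_gt0//.
  by rewrite lerXn2r ?nnegrE ?(ltW y0)// divr_ge0// ltW.
- rewrite ger0_norm//.
  have -> : \int[mu]_y `|ph e x y| = 1.
    by rewrite -(ph_int e0 x0); apply: intR_ext => y; rewrite ger0_norm ?ph_ge0.
  by rewrite mulr1.
Qed.

Lemma Ladj_ph x m : 0 < x -> 0 < m -> Ladj (ph e x) m = Nr d e x m + Fr d e x m.
Proof.
move=> x0 m0; have h1 := NB_L1 (near_int_L1 x0 m0); have h2 := NB_L1 (far_int_L1 m x0).
have h3 := L1_kLd d0 d1 m0.
rewrite /Nr /Fr -intRZ// -intRB//; last exact: L1Z.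
rewrite -intRD//; last by apply: L1B => //; exact: L1Z.
apply: intR_ext => y; rewrite /kLd (farC d y m).
by case: ifP => _; rewrite ?add0r// !mulr0 subrr addr0.
Qed.

Lemma Ladj_eq0 phi m : m <= 0 -> Ladj phi m = 0.
Proof.
move=> m0; rewrite /Ladj intR_eq0// => y.
by rewrite !kL_eq0 ?mulr0 ?subrr// negb_and -!leNgt m0 ?orbT.
Qed.

Lemma ph_eq0 x m : x <= 0 -> ph e x m = 0.
Proof. by move=> x0; rewrite /ph ltNge x0. Qed.

Lemma mfun_Ladj_ph : measfun (fun z : R * R => Ladj (ph e z.1) z.2).
Proof.
apply: (@mfun_intR1 _ _ _ _ _ mu (fun w : (R * R) * R =>
  ph e w.1.1 w.2 * kL w.2 w.1.2 - ph e w.1.1 w.1.2 * kL w.1.2 w.2)).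
apply: mfunB; apply: mfunM; apply: mfun_curry; by [exact: mfun_ph|exact: mfun_kL|mfun].
Qed.

Lemma W_gt0 x : 0 < x -> 0 < W x.
Proof.
by move=> x0; rewrite /W x0; apply: mulr_gt0; [exact: exprn_gt0|exact: etaW_gt0].
Qed.

Lemma W_ph x m : 0 < x -> ph e x m != 0 -> W x <= 64 * W m.
Proof.
move=> x0 pm; have /andP[h1 h2] := ph_supp e0 x0 pm.
have ex : e * x <= 4^-1 * x by rewrite ler_wpM2r// ltW.
have m0 : 0 < m by lra.
have /andP[//] : 0 <= W x <= 64 * W m by apply: W_dil => //; apply/andP; split; lra.
Qed.

Lemma W_kLd_le y m : 0 < y -> 0 < m -> W y * kLd d y m <= W m * (Cd d / y ^+ 2 + 2 / y + 2).
Proof.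
move=> y0 m0; have y2 : 0 < y ^+ 2 by rewrite exprn_gt0.
have m2 : 0 < m ^+ 2 by rewrite exprn_gt0.
have -> : W y * kLd d y m = W m * kLd d m y + m ^+ 2 * ((etaW y - etaW m) * kLd d m y).
  by rewrite /W y0 m0 mulrAC kLd_sym; ring.
rewrite -addrA mulrDr; apply: lerD.
  by apply: ler_wpM2l; [exact: W_ge0|exact: kLd_bdr].
apply: le_trans (_ : m ^+ 2 * (etaW m * (2 / y + 2)) <= _); last first.
  by rewrite /W m0 mulrA.
rewrite ler_pM2l//.
apply: le_trans (_ : `|etaW y - etaW m| * kL m y <= _).
  apply: (@le_trans _ _ (`|etaW y - etaW m| * kLd d m y)).
    by apply: ler_wpM2r; [exact: kLd_ge0|exact: ler_norm].
  by apply: ler_wpM2l => //; exact: kLd_le.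
apply: le_trans (kL_eta_bound y m0) _.
apply: ler_wpM2l; first exact/ltW/etaW_gt0.
apply: lerD.
  case: ifP => [/andP[_ ym]|_]; last by rewrite divr_ge0// ltW.
  by rewrite ler_pM2l// lef_pV2 ?posrE// ltW.
rewrite /hb y0/=; case: ifP => // y1; case: ifP => // y1'.
by rewrite ler_piMr// invf_le1// exprn_ege1.
Qed.

(** Domination by W, and not mere boundedness, will be needed: uniformly in its source, the kernel
    of the mild formula is controlled in L1(W dx) only. The conclusion does not involve d; the
    truncation is an auxiliary splitting. *)
Lemma Ladj_ph_le x : exists2 C, 0 <= C & forall m, `|Ladj (ph e x) m| <= C * W m.
Proof.
have [x0|x0] := ltP 0 x; last first.
  exists 0 => // m; rewrite mul0r /Ladj intR_eq0 ?normr0// => y.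
  by rewrite !ph_eq0// !mul0r subrr.
have x2 : 0 < x ^+ 2 by rewrite exprn_gt0.
have x4 : 0 < x ^+ 4 by rewrite exprn_gt0.
have c0 := Cd_gt0 d0; have Wx := W_gt0 x0.
have i0 : 0 < x^-1 by rewrite invr_gt0.
have iw : 0 < (W x)^-1 by rewrite invr_gt0.
pose A := 60 * d * bC / (e ^+ 2 * x ^+ 4).
have A0 : 0 <= A.
  rewrite /A; apply: divr_ge0; last by rewrite mulr_ge0// ?exprn_ge0 ?(ltW e0) ?(ltW x0).
  apply: mulr_ge0; last exact: le_trans b1.
  by apply: mulr_ge0; [exact: ler0n|exact: ltW].
pose C1 := A * (1 + (4 * x) ^+ 4).
have C10 : 0 <= C1 by rewrite mulr_ge0// addr_ge0// exprn_ge0// mulr_ge0// ltW.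
pose C2 := (4 * Cd d / x ^+ 2 + 4 / x + 2) * 64 / W x.
have C20 : 0 <= C2.
  apply: mulr_ge0; last exact: ltW.
  apply: mulr_ge0 => //; rewrite !addr_ge0// ?mulr_ge0 ?(ltW i0) ?(ltW c0)//.
  by rewrite invr_ge0 ltW.
pose C3 := bC / (e * x) * (nd d * (2 / x)) * 64 / W x.
have C30 : 0 <= C3.
  apply: mulr_ge0; last exact: ltW.
  apply: mulr_ge0 => //; apply: mulr_ge0.
    by apply: divr_ge0; [exact: le_trans b1|rewrite mulr_ge0// ltW].
  by rewrite mulr_ge0 ?nd_ge0// mulr_ge0// ltW.
exists (C1 + C2 + C3); first by rewrite !addr_ge0.
move=> m; have [m0|m0] := ltP 0 m; last first.
  by rewrite Ladj_eq0// normr0 mulr_ge0 ?W_ge0// !addr_ge0.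
rewrite Ladj_ph// /Fr int_kLd// addrA !mulrDl.
apply: le_trans (ler_normB _ _) _; apply: lerD.
  apply: le_trans (ler_normD _ _) _; apply: lerD.
    apply: le_trans (Nr_le x0 m0) _.
    case: ifP => [/andP[_ h]|_]; last by rewrite mulr_ge0 ?W_ge0.
    apply: (@le_trans _ _ (A * ((1 + (4 * x) ^+ 4) * W m))); last by rewrite mulrA.
    rewrite -/A; apply: ler_wpM2l; first exact: A0.
    rewrite /W m0 mulrCA ler_peMr ?sqr_ge0// /etaW ler_pdivlMr ?etaW_den// mul1r lerD2l.
    by rewrite lerXn2r ?nnegrE ?(ltW h) ?(ltW m0)// mulr_ge0// ltW.
  have pk := NB_L1 (far_int_L1 m x0).
  apply: le_trans (intR_norm pk) _.
  apply: (@le_trans _ _ (\int[mu]_y (C2 * W m * ph e x y))); last first.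
    by rewrite intRZ ?ph_int ?mulr1//; exact: ph_L1.
  apply: intR_le; [exact: L1_norm|exact/L1Z/ph_L1|] => y.
  rewrite normrM (ger0_norm (ph_ge0 x y e0)) (ger0_norm (kLd_ge0 _ _ _)) mulrC.
  have [->|py] := eqVneq (ph e x y) 0; first by rewrite !mulr0.
  apply: ler_wpM2r; first exact: ph_ge0.
  have /andP[h1 h2] := ph_supp e0 x0 py.
  have ex : e * x <= 4^-1 * x by rewrite ler_wpM2r// ltW.
  have y0 : 0 < y by lra.
  have hy := W_kLd_le y0 m0.
  have w1 := W_ph x0 py.
  have hb : Cd d / y ^+ 2 + 2 / y + 2 <= 4 * Cd d / x ^+ 2 + 4 / x + 2.
    rewrite lerD2r; apply: lerD.
      have -> : 4 * Cd d / x ^+ 2 = Cd d / (x / 2) ^+ 2 by field; rewrite gt_eqF.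
      rewrite ler_pM2l// lef_pV2 ?posrE ?exprn_gt0 ?divr_gt0//.
      by rewrite lerXn2r ?nnegrE ?(ltW y0) ?divr_ge0 ?(ltW x0)//; lra.
    have -> : 4 / x = 2 / (x / 2) by field; rewrite gt_eqF.
    by rewrite ler_pM2l// lef_pV2 ?posrE ?divr_gt0//; lra.
  have h3 : W x * kLd d y m <= 64 * (W m * (4 * Cd d / x ^+ 2 + 4 / x + 2)).
    apply: (@le_trans _ _ (64 * W y * kLd d y m)); first by rewrite ler_wpM2r ?kLd_ge0.
    rewrite -mulrA ler_pM2l//; apply: le_trans hy _.
    by apply: ler_wpM2l; [exact: W_ge0|].
  rewrite -(ler_pM2l Wx); apply: le_trans h3 _; rewrite le_eqVlt; apply/orP; left; apply/eqP.
  by rewrite /C2; field; rewrite !gt_eqF.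
have [->|pm] := eqVneq (ph e x m) 0; first by rewrite mul0r normr0 mulr_ge0 ?W_ge0.
have /andP[h1 h2] := ph_supp e0 x0 pm.
have ex : e * x <= 4^-1 * x by rewrite ler_wpM2r// ltW.
have n0 : 0 <= nd d / m by rewrite divr_ge0 ?nd_ge0// ltW.
rewrite (ger0_norm (mulr_ge0 (ph_ge0 x m e0) n0)).
apply: (@le_trans _ _ (bC / (e * x) * (nd d * (2 / x)))).
  apply: ler_pM => //; [exact: ph_ge0|exact: ph_le|].
  apply: ler_wpM2l; first exact: nd_ge0.
  by rewrite -[leRHS]invrK invf_div lef_pV2 ?posrE ?divr_gt0//; lra.
have -> : C3 * W m = bC / (e * x) * (nd d * (2 / x)) * (64 * W m / W x) by rewrite /C3; ring.
rewrite ler_peMr//.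
  apply: mulr_ge0; last by rewrite mulr_ge0 ?nd_ge0// mulr_ge0// ltW.
  by apply: divr_ge0; [exact: le_trans b1|rewrite mulr_ge0// ltW].
by rewrite ler_pdivlMr// mul1r; exact: W_ph pm.
Qed.

Lemma L1_Ladj_ph x g : L1 mu g -> L1 mu (fun m => g m * Ladj (ph e x) m).
Proof.
move=> gi; have [C C0 hC] := Ladj_ph_le x.
apply: (@L1_ext _ _ _ mu _ (fun m : R => Ladj (ph e x) m * g m)); last by move=> m; rewrite mulrC.
apply: (@L1M _ _ _ mu C) => //.
- exact: (mfun_section1 x mfun_Ladj_ph).
- move=> m; apply: le_trans (hC m) _; rewrite ler_piMr//; exact: W_le1.
Qed.

End Estimates.
End Commutator.

Lemma NB_norm d (T : measurableType d) (R : realType) (m : {measure set T -> \bar R})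
    (f : T -> R) c : NB m f c -> NB m (fun x => `|f x|) c.
Proof.
move=> /NBP[fi fc]; apply/NBP; split; first exact: L1_norm.
by apply: le_trans fc; rewrite le_eqVlt; apply/orP; left; apply/eqP; apply: intR_ext => x; rewrite normr_id.
Qed.

Section CommutatorBound.
Variable R : realType.
Notation mu := (@lebesgue_measure R).
Notation mu2 := (mu \x mu)%E.
Notation bC := (bC R).
Implicit Types (f g phi : R -> R) (a b c d e l m u x y z : R).

(** Gain term of the truncated operator; the loss term is nd d / y times g y. *)
Definition Phi d g y : R := \int[mu]_m (kLd d y m * g m).

Lemma ph_near e x m : 0 < e -> e <= 4^-1 -> 0 < x -> ph e x m != 0 ->
  [/\ 0 < m, `|m - x| <= e * x, m^-1 <= 2 / x & 0 <= m / x <= 2].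
Proof.
move=> e0 e4 x0 pm; have /andP[h1 h2] := ph_supp e0 x0 pm.
have ex : e * x <= 4^-1 * x by rewrite ler_wpM2r// ltW.
have m0 : 0 < m by lra.
split => //.
- by rewrite ler_norml; apply/andP; split; lra.
- by rewrite -[leRHS]invrK invf_div lef_pV2 ?posrE ?divr_gt0//; lra.
- by rewrite divr_ge0 ?(ltW m0) ?(ltW x0)//= ler_pdivrMr//; lra.
Qed.

Lemma near_bd (A x m : R) : 0 <= A -> 0 < m -> m < 4 * x -> A * m ^+ 2 <= A * (4 * x) ^+ 2.
Proof. by move=> A0 m0 mx; apply: ler_wpM2l => //; rewrite lerXn2r ?nnegrE ?(ltW m0)// ltW// (lt_trans m0). Qed.

Lemma Ncst_ge0 d e x : 0 < d -> 0 < e -> 0 < x -> 0 <= 60 * d * bC / (e ^+ 2 * x ^+ 4).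
Proof.
move=> d0 e0 x0; apply: divr_ge0; last by rewrite mulr_ge0// ?exprn_ge0 ?(ltW e0) ?(ltW x0).
apply: mulr_ge0; last exact: (le_trans ler01 (bC_ge1 R)).
by apply: mulr_ge0; [exact: ler0n|exact: ltW].
Qed.

Lemma NB_1_Tm e g : 0 < e -> e <= 2^-1 -> L1 mu g ->
  NB mu (Tm e g) (6 * bC * \int[mu]_m `|g m|).
Proof.
move=> e0 e2 gi; have mg := L1_meas gi.
have h := @NB_Tm R (fun=> 1) (6 * bC) e g (@mfun_cst _ _ R 1) (fun=> ler01).
have h1 m : NB mu (fun x => 1 * ph e x m) (6 * bC * 1).
  rewrite mulr1; apply: NB_le (NB_1_ph m e0 e2) _ => //.
    by have := mfun_section2 m (mfun_ph e) => /= ?; mfun.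
  by move=> x; rewrite mul1r.
have {h}h := h h1 mg (L1_ext gi (fun m => mul1r (g m))).
apply: NB_le h _.
- exact: mfun_Tm.
- by move=> x; rewrite mul1r.
- rewrite le_eqVlt; apply/orP; left; apply/eqP; congr (_ * _).
  by apply: intR_ext => m; rewrite mul1r.
Qed.

Section Fixed.
Variables (d e : R) (g : R -> R).
Hypotheses (d0 : 0 < d) (d4 : d <= 4^-1) (e0 : 0 < e) (e4 : e <= 4^-1) (gi : L1 mu g).

Let d1 : d < 1. Proof. by move: d4; lra. Qed.
Let e2 : e <= 2^-1. Proof. by move: e4; lra. Qed.
Let b1 : 1 <= bC. Proof. exact: bC_ge1. Qed.
Let mg : measfun g. Proof. exact: L1_meas gi. Qed.
Let I : R := \int[mu]_m `|g m|.
Let I0 : 0 <= I. Proof. by apply: intR_ge0. Qed.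
Let lnb : R := 4 * - ln (d / 2) + 10.

Lemma mfun_Phi_int : measfun (fun z : R * R => kLd d z.1 z.2 * g z.2).
Proof.
apply: (@mfunM _ _ R (fun z : R * R => kLd d z.1 z.2) (fun z : R * R => g z.2)); first exact: mfun_kLd.
by apply: mfun_comp => //; mfun.
Qed.

Lemma mfun_Phi : measfun (Phi d g).
Proof. exact: (@mfun_intR1 _ _ _ _ _ mu (fun z : R * R => kLd d z.1 z.2 * g z.2) mfun_Phi_int). Qed.

Lemma Phi_section x : 0 < x -> L1 mu (fun m => kLd d x m * g m).
Proof.
move=> x0; apply: (@L1M _ _ _ mu (Cd d / x ^+ 2)) => //.
  exact: (mfun_section1 x (mfun_kLd d)).
by move=> m; rewrite ger0_norm ?kLd_ge0 ?kLd_bdl.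
Qed.

Lemma Phi_eq0 x : x <= 0 -> Phi d g x = 0.
Proof.
move=> x0; rewrite /Phi intR_eq0// => m.
by rewrite kLd_eq0 ?mul0r// negb_and -leNgt x0.
Qed.

Lemma lnb_ge0 : 0 <= lnb.
Proof.
by apply: le_trans (NB_abs (NB_W_kLd_adj d0 d1 (ltr01 : 0 < 1 :> R))).
Qed.

Lemma NB_W_Phi : NB mu (fun x => W x * Phi d g x) (lnb * I).
Proof.
pose F (z : R * R) := W z.1 * (kLd d z.1 z.2 * g z.2).
have mW := @mfun_W R.
have mF : measfun F.
  apply: (@mfunM _ _ R (fun z : R * R => W z.1) (fun z : R * R => kLd d z.1 z.2 * g z.2)).
    by apply: mfun_comp => //; mfun.
  exact: mfun_Phi_int.
have [FI FC] : L1 mu2 F /\ \int[mu2]_z `|F z| <= \int[mu]_y (lnb * `|g y|).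
  apply: L1_prod_of2 => //; last exact/L1Z/L1_norm.
  apply: aeW => m; rewrite /F/=.
  have mk := mfun_section2 m mF; rewrite /= in mk.
  have [m0|m0] := ltP 0 m; last first.
    have -> : (fun x : R => W x * (kLd d x m * g m)) = fun=> 0.
      by apply/funext => x; rewrite kLd_eq0 ?mul0r ?mulr0// negb_and -!leNgt m0 orbT.
    by apply: NB_0; rewrite mulr_ge0// lnb_ge0.
  apply: NB_le (NBZ (g m) (NB_W_kLd_adj d0 d1 m0)) _ => //.
    by move=> x; rewrite mulrA mulrC.
  by rewrite mulrC.
have mT : measfun (fun x => W x * Phi d g x).
  by have := mfun_Phi => ?; mfun.
apply: (@NB_ae _ _ _ mu _ (fun x : R => \int[mu]_m F (x, m))) => //.
  apply: aeW => x; rewrite /F/=; have [x0|x0] := ltP 0 x.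
    by rewrite intRZ//; exact: Phi_section.
  rewrite Phi_eq0// mulr0 intR_eq0// => m.
  by rewrite kLd_eq0 ?mul0r ?mulr0// negb_and -leNgt x0.
apply/NBP; split; first exact: fub_L11.
apply: le_trans (_ : \int[mu]_x \int[mu]_m `|F (x, m)| <= _).
  apply: intR_le_ae; [exact/L1_norm/fub_L11|exact: fub_L11 (L1_norm FI)|].
  by apply: (aeS (fub_ae1 FI)) => x Fx; exact: intR_norm.
rewrite (fub_eq1 (L1_norm FI)); apply: le_trans FC _.
by rewrite intRZ//; exact: L1_norm.
Qed.

Lemma L1_ph_Phi x : 0 < x -> L1 mu (fun y => ph e x y * Phi d g y).
Proof.
move=> x0; have pi := ph_L1 e0 x0; have mp := L1_meas pi; have mP := mfun_Phi.
have c0 := Cd_gt0 d0.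
apply: (@L1_le _ _ _ mu _ (fun y : R => (4 * Cd d / x ^+ 2 * I) * ph e x y)); last exact: L1Z.
  by mfun.
move=> y; rewrite normrM (ger0_norm (ph_ge0 x y e0)) mulrC.
have [->|py] := eqVneq (ph e x y) 0; first by rewrite !mulr0.
apply: ler_wpM2r; first exact: ph_ge0.
have /andP[h1 h2] := ph_supp e0 x0 py.
have ex : e * x <= 4^-1 * x by rewrite ler_wpM2r// ltW.
have y0 : 0 < y by lra.
have pp := Phi_section y0.
apply: le_trans (intR_norm pp) _; rewrite -intRZ; last exact: L1_norm.
apply: intR_le; [exact: L1_norm|exact/L1Z/L1_norm|] => m.
rewrite normrM (ger0_norm (kLd_ge0 _ _ _)); apply: ler_wpM2r => //.
apply: le_trans (kLd_bdl _ d0 d1 y0) _.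
have -> : 4 * Cd d / x ^+ 2 = Cd d / (x / 2) ^+ 2 by field; rewrite gt_eqF.
rewrite ler_pM2l// lef_pV2 ?posrE ?exprn_gt0 ?divr_gt0//.
by rewrite lerXn2r ?nnegrE ?(ltW y0) ?divr_ge0 ?(ltW x0)//; lra.
Qed.

Lemma far_pairing x : 0 < x ->
  L1 mu (fun m => g m * \int[mu]_y (ph e x y * kLd d y m)) /\
  \int[mu]_m (g m * \int[mu]_y (ph e x y * kLd d y m)) = Tm e (Phi d g) x.
Proof.
move=> x0; pose F (z : R * R) := g z.1 * (ph e x z.2 * kLd d z.2 z.1).
have pi := ph_L1 e0 x0; have mp := L1_meas pi.
have mF : measfun F.
  apply: (@mfunM _ _ R (fun z : R * R => g z.1) (fun z : R * R => ph e x z.2 * kLd d z.2 z.1)).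
    by apply: mfun_comp => //; mfun.
  apply: (@mfunM _ _ R (fun z : R * R => ph e x z.2) (fun z : R * R => kLd d z.2 z.1)).
    by apply: mfun_comp => //; mfun.
  by apply: (mfun_curry (mfun_kLd d)); mfun.
have [FI _] : L1 mu2 F /\ \int[mu2]_z `|F z| <=
    \int[mu]_m (4 * Cd d / x ^+ 2 * `|g m|).
  apply: L1_prod_of1 => //; last exact/L1Z/L1_norm.
  apply: aeW => m; rewrite /F/= mulrC.
  apply: NBZ; exact: far_int_L1.
have E m : \int[mu]_y F (m, y) = g m * \int[mu]_y (ph e x y * kLd d y m).
  rewrite /F/= intRZ//; exact: (NB_L1 (far_int_L1 d0 d4 e0 e4 m x0)).
split; first by apply: L1_ext (fub_L11 FI) _ => m; rewrite E.
transitivity (\int[mu]_m \int[mu]_y F (m, y)); first by apply: intR_ext => m; rewrite E.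
rewrite (fub_swap FI) /Tm; apply: intR_ext => y; rewrite /F/=.
have [->|py] := eqVneq (ph e x y) 0.
  by rewrite mul0r intR_eq0// => m; rewrite mul0r mulr0.
have y0 : 0 < y.
  have /andP[h1 h2] := ph_supp e0 x0 py.
  have ex : e * x <= 4^-1 * x by rewrite ler_wpM2r// ltW.
  by lra.
rewrite /Phi -intRZ; last exact: Phi_section.
by apply: intR_ext => m; ring.
Qed.

Lemma Tm_dilE z : 0 < z -> Tm e g z = \int[mu]_l (ph e 1 l * g (l * z)).
Proof.
move=> z0; have mpg := L1_meas (L1_ph z e0 gi).
have := intR_dil z0 mpg; rewrite -/(Tm e g z) => h.
have -> : Tm e g z = z * (z^-1 * Tm e g z) by rewrite mulrA divff ?gt_eqF// mul1r.
rewrite -h -intRZ; last by apply: (@L1_dil _ z (fun m => ph e z m * g m)) => //; exact: L1_ph.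
apply: intR_ext => l; rewrite /ph z0 ltr01 mulr1 (mulrC l z).
have -> : (e * z)^-1 * (z * l) = e^-1 * l by field; rewrite !gt_eqF.
by field; rewrite !gt_eqF.
Qed.

(* The far operator commutes with dilations up to a power of the factor. *)
Lemma int_kLd_Tm x : 0 < x ->
  \int[mu]_z (kLd d x z * Tm e g z) = \int[mu]_u (ph e x u * (u / x * Phi d g u)).
Proof.
move=> x0; pose F (w : R * R) := kLd d x w.1 * (ph e 1 w.2 * g (w.2 * w.1)).
have p1 := ph_L1 e0 (ltr01 : 0 < 1 :> R); have mp := L1_meas p1.
have mk := mfun_section1 x (mfun_kLd d); rewrite /= in mk.
have mF : measfun F.
  apply: (@mfunM _ _ R (fun w : R * R => kLd d x w.1) (fun w : R * R => ph e 1 w.2 * g (w.2 * w.1))).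
    by apply: mfun_comp => //; mfun.
  apply: (@mfunM _ _ R (fun w : R * R => ph e 1 w.2) (fun w : R * R => g (w.2 * w.1))).
    by apply: mfun_comp => //; mfun.
  by apply: mfun_comp => //; mfun.
have cx : 0 <= Cd d / x ^+ 2 by rewrite divr_ge0 ?sqr_ge0// ltW// Cd_gt0.
have lpos l : ph e 1 l != 0 -> 2^-1 < l.
  by move=> pl; have /andP[h1 h2] := ph_supp e0 (ltr01 : 0 < 1 :> R) pl; move: e4; lra.
have sec l : 0 < l -> L1 mu (fun z => kLd d x z * g (l * z)).
  move=> l0; apply: (@L1M _ _ _ mu (Cd d / x ^+ 2)) => //.
    by move=> m; rewrite ger0_norm ?kLd_ge0 ?kLd_bdl.
  exact: L1_dil.
have [FI _] : L1 mu2 F /\ \int[mu2]_z `|F z| <=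
    \int[mu]_l (2 * (Cd d / x ^+ 2) * I * ph e 1 l).
  apply: L1_prod_of2 => //; last exact: L1Z.
  apply: aeW => l; have mFl := mfun_section2 l mF.
  have [pl|pl] := eqVneq (ph e 1 l) 0.
    rewrite pl mulr0; have -> : (fun z => F (z, l)) = fun=> 0.
      by apply/funext => z; rewrite /F/= pl mul0r mulr0.
    exact: NB_0.
  have l2 := lpos _ pl; have l0 : 0 < l by apply: lt_trans l2.
  have h := NBZ (Cd d / x ^+ 2 * ph e 1 l) (NB_dil l0 (L1_NB gi)).
  apply: NB_le h _ => //.
    move=> z; rewrite /F/= mulrA normrM [leRHS]normrM; apply: ler_wpM2r => //.
    rewrite (ger0_norm (mulr_ge0 (kLd_ge0 _ _ _) (ph_ge0 1 l e0))) (ger0_norm (mulr_ge0 cx (ph_ge0 1 l e0))).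
    by apply: ler_wpM2r; [exact: ph_ge0|exact: kLd_bdl].
  rewrite ger0_norm; last by rewrite mulr_ge0// ph_ge0.
  have -> : 2 * (Cd d / x ^+ 2) * I * ph e 1 l = Cd d / x ^+ 2 * ph e 1 l * (2 * I) by ring.
  apply: ler_wpM2l; first by rewrite mulr_ge0// ph_ge0.
  apply: ler_wpM2r => //.
  by rewrite -[leRHS]invrK lef_pV2 ?posrE ?invr_gt0// ltW.
transitivity (\int[mu]_z \int[mu]_l F (z, l)).
  apply: intR_ext => z; rewrite /F/=; have [z0|z0] := ltP 0 z; last first.
    rewrite kLd_eq0 ?mul0r; last by rewrite negb_and -!leNgt z0 orbT.
    by rewrite intR_eq0// => m; rewrite mul0r.
  rewrite Tm_dilE// intRZ//.
  apply: (@L1M _ _ _ mu (bC / (e * 1))) => //.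
    by move=> l; rewrite ger0_norm ?ph_ge0 ?ph_le.
  apply: L1_ext (L1_dil z0 gi) _ => l; by rewrite mulrC.
rewrite (fub_swap FI).
have mP := mfun_Phi; have mpx := L1_meas (ph_L1 e0 x0).
have mk2 : measfun (fun u => ph e x u * (u / x * Phi d g u)) by mfun.
have := intR_dil x0 mk2 => h.
have -> : \int[mu]_u (ph e x u * (u / x * Phi d g u)) =
    x * (x^-1 * \int[mu]_u (ph e x u * (u / x * Phi d g u))).
  by rewrite mulrA divff ?gt_eqF// mul1r.
rewrite -h -intRZ; last first.
  apply: (@L1_dil _ x (fun u => ph e x u * (u / x * Phi d g u))) => //.
  apply: (@L1_le _ _ _ mu _ (fun y : R => 2 * `|ph e x y * Phi d g y|)) => //; last exact/L1Z/L1_norm/L1_ph_Phi.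
  move=> u; rewrite mulrCA normrM; have [->|pu] := eqVneq (ph e x u) 0.
    by rewrite !mul0r normr0 !mulr0.
  have [_ _ _ /andP[u1 u2]] := ph_near e0 e4 x0 pu.
  by apply: ler_wpM2r => //; rewrite (ger0_norm u1).
apply: intR_ext => l; rewrite /F/=.
have phl : ph e x (x * l) = x^-1 * ph e 1 l.
  rewrite /ph x0 ltr01 mulr1.
  have -> : (e * x)^-1 * (x * l) = e^-1 * l by field; rewrite !gt_eqF.
  by field; rewrite !gt_eqF.
rewrite phl; have [pl|pl] := eqVneq (ph e 1 l) 0.
  rewrite pl mulr0 mul0r mulr0 intR_eq0// => m.
  by rewrite mul0r mulr0.
have l0 : 0 < l by apply: lt_trans (lpos _ pl).
have -> : x * (x^-1 * ph e 1 l * (x * l / x * Phi d g (x * l))) = ph e 1 l * (l * Phi d g (x * l)).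
  by field; rewrite gt_eqF.
transitivity (ph e 1 l * \int[mu]_z (kLd d x z * g (l * z))).
  by rewrite -intRZ; [apply: intR_ext => z; ring|exact: sec].
congr (_ * _).
have xl : 0 < x * l by rewrite mulr_gt0.
have mh : measfun (fun w => l ^+ 2 * (kLd d (x * l) w * g w)).
  by have := L1_meas (Phi_section xl) => ?; mfun.
(* Degree -2 of the kernel gives l^2 and the substitution gives 1 / l; the remaining factor l is u /
   x in the variable u = x l. *)
transitivity (\int[mu]_z ((fun w => l ^+ 2 * (kLd d (x * l) w * g w)) (l * z))).
  apply: intR_ext => z; rewrite mulrA; congr (_ * _).
  by rewrite (mulrC x) kLd_scale// mulrA divff ?mul1r// expf_neq0// gt_eqF.
rewrite (intR_dil l0 mh) intRZ; last exact: Phi_section.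
by rewrite /Phi; field; rewrite gt_eqF.
Qed.

Lemma Ld_Tm x : 0 < x -> Ld d (Tm e g) x =
  \int[mu]_u (ph e x u * (u / x * Phi d g u)) - nd d / x * Tm e g x.
Proof.
move=> x0; have ti := NB_L1 (NB_1_Tm e0 e2 gi); have mt := L1_meas ti.
have ki := L1_kLd d0 d1 x0; have mk := L1_meas ki.
rewrite -int_kLd_Tm// -int_kLd// -(mulrC (Tm e g x)) -intRZ// -intRB.
- by apply: intR_ext => y; rewrite mulrBr (mulrC (Tm e g x)).
- apply: (@L1M _ _ _ mu (Cd d / x ^+ 2)) => //.
  by move=> m; rewrite ger0_norm ?kLd_ge0 ?kLd_bdl.
- exact: L1Z.
Qed.

(* The error is small because kerL is homogeneous, so that the operator commutes
   with dilations up to a power of the factor. *)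
Lemma NB_commutator : NB mu
  (fun x => W x * (\int[mu]_m (g m * Ladj (ph e x) m) - Ld d (Tm e g) x))
  (1920 * d * bC / e ^+ 2 * I + 384 * bC * (e * (lnb * I)) + 2 * e * nd d * (6 * bC * I)).
Proof.
have mW := @mfun_W R; have mP := mfun_Phi; have mT := mfun_Tm e mg.
have mag : measfun (fun m => `|g m|) by mfun.
have maP : measfun (fun m => `|Phi d g m|) by mfun.
have gai := L1_norm gi.
have mLa : measfun (fun x => \int[mu]_m (g m * Ladj (ph e x) m)).
  apply: (@mfun_intR1 _ _ _ _ _ mu (fun z : R * R => g z.2 * Ladj (ph e z.1) z.2)).
  apply: (@mfunM _ _ R (fun z : R * R => g z.2) (fun z : R * R => Ladj (ph e z.1) z.2)).
    by apply: mfun_comp => //; mfun.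
  exact: mfun_Ladj_ph.
have mLd : measfun (Ld d (Tm e g)).
  apply: (@mfun_intR1 _ _ _ _ _ mu (fun z : R * R => kLd d z.1 z.2 * (Tm e g z.2 - Tm e g z.1))).
  apply: mfunM; first exact: mfun_kLd.
  by apply: mfunB; apply: (mfun_comp mT); mfun.
pose N x := \int[mu]_m (g m * Nr d e x m).
have mN := mfun_Nr d e.
have mNg : measfun (fun z : R * R => g z.2 * Nr d e z.1 z.2).
  apply: (@mfunM _ _ R (fun z : R * R => g z.2) (fun z : R * R => Nr d e z.1 z.2)) => //.
  by apply: mfun_comp => //; mfun.
have N1 : NB mu (fun x => W x * N x) (1920 * d * bC / e ^+ 2 * I).
  pose F (z : R * R) := W z.1 * (g z.2 * Nr d e z.1 z.2).
  have mF : measfun F.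
    apply: (@mfunM _ _ R (fun z : R * R => W z.1) (fun z : R * R => g z.2 * Nr d e z.1 z.2)) => //.
    by apply: mfun_comp => //; mfun.
  have [FI FC] : L1 mu2 F /\ \int[mu2]_z `|F z| <=
      \int[mu]_y (1920 * d * bC / e ^+ 2 * `|g y|).
    apply: L1_prod_of2 => //; last exact/L1Z/L1_norm.
    apply: aeW => m; have mk := mfun_section2 m mF; rewrite /F/= in mk *.
    apply: NB_le (NBZ (g m) (NB_W_Nr d0 d4 e0 e4 m)) _ => //.
      by move=> x; rewrite mulrCA.
    by rewrite mulrC.
  apply: (@NB_ae _ _ _ mu _ (fun x : R => \int[mu]_m F (x, m))).
  - have mNN : measfun N.
      exact: (@mfun_intR1 _ _ _ _ _ mu (fun z : R * R => g z.2 * Nr d e z.1 z.2) mNg).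
    by mfun.
  - apply: (aeS (fub_ae1 FI)) => x Fx; rewrite /F/=; have [->|Wx] := eqVneq (W x) 0.
      by rewrite mul0r intR_eq0// => m; rewrite mul0r.
    rewrite intRZ//; apply: L1_ext (L1Z (W x)^-1 Fx) _ => m.
    by rewrite /F/= mulrA mulVf// mul1r.
  apply/NBP; split; first exact: fub_L11.
  apply: le_trans (_ : \int[mu]_x \int[mu]_m `|F (x, m)| <= _).
    apply: intR_le_ae; [exact/L1_norm/fub_L11|exact: fub_L11 (L1_norm FI)|].
    by apply: (aeS (fub_ae1 FI)) => x Fx; exact: intR_norm.
  rewrite (fub_eq1 (L1_norm FI)); apply: le_trans FC _.
  by rewrite intRZ//; exact: L1_norm.
have PB := NB_W_Phi.
have N2 : NB mu (fun x => W x * Tm e (fun m => `|Phi d g m|) x) (384 * bC * (lnb * I)).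
  have [pl pb] := iffLR (NBP _ _ _) PB.
  have := @NB_Tm R (@W R) (384 * bC) e (fun m => `|Phi d g m|) mW (@W_ge0 R).
  move=> /(_ (fun m => NB_W_ph m e0 e2) maP) h.
  have h1 : L1 mu (fun m => W m * `|Phi d g m|).
    by apply: L1_ext (L1_norm pl) _ => m; rewrite normrM (ger0_norm (W_ge0 m)).
  apply: NB_le (h h1) _ => //.
    by have := L1_meas (NB_L1 (h h1)).
  apply: ler_wpM2l; first by rewrite mulr_ge0 ?ler0n// (le_trans ler01).
  apply: le_trans pb; rewrite le_eqVlt; apply/orP; left; apply/eqP.
  by apply: intR_ext => m; rewrite !normrM normr_id.
have N3 : NB mu (Tm e (fun m => `|g m|)) (6 * bC * I).
  apply: NB_le (NB_1_Tm e0 e2 gai) _ => //; first exact: mfun_Tm.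
  rewrite le_eqVlt; apply/orP; left; apply/eqP; congr (_ * _).
  by apply: intR_ext => m; rewrite normr_id.
have N2' := NBZ e N2; have N3' := NBZ (2 * e * nd d) N3.
have Tn0 (h : R -> R) x : (forall m, 0 <= h m) -> 0 <= Tm e h x.
  by move=> h0; apply: intR_ge0 => m; rewrite mulr_ge0 ?ph_ge0.
have S := NBD (NBD (NB_norm N1) N2') N3'.
apply: NB_le S _.
- by mfun.
- move=> x; have [x0|x0] := ltP 0 x; last first.
    by rewrite {1}/W ltNge x0/= mul0r normr0.
  have [lp lq] := far_pairing x0.
  have gN : L1 mu (fun m => g m * Nr d e x m).
    have [C C0 hC] := Ladj_ph_le d0 d4 e0 e4 x.
    pose B := 60 * d * bC / (e ^+ 2 * x ^+ 4) * (4 * x) ^+ 2.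
    apply: (@L1_ext _ _ _ mu _ (fun m : R => Nr d e x m * g m)); last by move=> m; rewrite mulrC.
    apply: (@L1M _ _ _ mu B); [exact: (mfun_section1 x mN)| |exact: gi].
    have A0 := Ncst_ge0 d0 e0 x0.
    move=> m; have [m0|m0] := ltP 0 m; last first.
      rewrite Nr_eq0 ?normr0; last by rewrite negb_and -!leNgt m0 orbT.
      by apply: mulr_ge0; [exact: A0|exact: sqr_ge0].
    apply: le_trans (Nr_le d0 d4 e0 e4 x0 m0) _; case: ifP => [/andP[_ h]|_].
      exact: near_bd.
    by apply: mulr_ge0; [exact: A0|exact: sqr_ge0].
  have pgm : L1 mu (fun m => nd d * (ph e x m * (g m / m))).
    apply: L1Z; apply: (@L1_le _ _ _ mu _ (fun m : R => 2 / x * `|ph e x m * g m|)).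
    - by have mp := L1_meas (ph_L1 e0 x0); mfun.
    - move=> m; rewrite mulrA normrM mulrC; have [->|pm] := eqVneq (ph e x m) 0.
        by rewrite !mul0r normr0 !mulr0.
      have [m0 _ im _] := ph_near e0 e4 x0 pm.
      by apply: ler_wpM2r; [exact: normr_ge0|rewrite gtr0_norm// invr_gt0].
    - exact/L1Z/L1_norm/L1_ph.
  have E1 : \int[mu]_m (g m * Ladj (ph e x) m) =
      N x + (Tm e (Phi d g) x - \int[mu]_m (nd d * (ph e x m * (g m / m)))).
    rewrite /N -lq -(intRB lp pgm) -(intRD gN (L1B lp pgm)).
    apply: intR_ext => m; have [m0|m0] := ltP 0 m.
      rewrite (Ladj_ph d0 d4 e0 e4 x0 m0) /Fr (int_kLd d0 d1 m0).
      by move: (Nr d e x m) (\int[mu]_y _) (nd d) => n1 n2 n3; ring.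
    rewrite Ladj_eq0// Nr_eq0; last by rewrite negb_and -!leNgt m0 orbT.
    have -> : ph e x m = 0.
      apply/eqP; apply: contraT => pm; have := ph_supp0 e0 (ltac:(move: e4; lra)) pm.
      by rewrite ltNge m0.
    rewrite intR_eq0//; first by ring.
    by move=> y; rewrite kLd_eq0 ?mulr0// negb_and -!leNgt m0 orbT.
  have pP := L1_ph_Phi x0.
  have pP2 : L1 mu (fun u => ph e x u * (u / x * Phi d g u)).
    apply: (@L1_le _ _ _ mu _ (fun y : R => 2 * `|ph e x y * Phi d g y|)); last exact/L1Z/L1_norm.
      by have mp := L1_meas (ph_L1 e0 x0); mfun.
    move=> u; rewrite mulrCA normrM; have [->|pu] := eqVneq (ph e x u) 0.
      by rewrite !mul0r normr0 !mulr0.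
    have [_ _ _ /andP[u1 u2]] := ph_near e0 e4 x0 pu.
    by apply: ler_wpM2r; [exact: normr_ge0|rewrite (ger0_norm u1)].
  have pg := L1_ph x e0 gi.
  (* Three errors: the near part, the gain term with the factor 1 - u / x, and the loss term with
     the factor 1 / x - 1 / m. On the support of [ph] these factors are at most e and 2 e / x. *)
  have -> : \int[mu]_m (g m * Ladj (ph e x) m) - Ld d (Tm e g) x = N x +
     \int[mu]_u (ph e x u * Phi d g u - ph e x u * (u / x * Phi d g u)) +
     \int[mu]_m (nd d / x * (ph e x m * g m) - nd d * (ph e x m * (g m / m))).
    rewrite E1 (Ld_Tm x0) (intRB pP pP2) (intRB (L1Z (nd d / x) pg) pgm) (intRZ (nd d / x) pg).
    rewrite -/(Tm e g x) -/(Tm e (Phi d g) x).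
    move: (N x) (Tm e g x) (Tm e (Phi d g) x) (nd d / x) => n1 n2 n3 n4.
    by move: (\int[mu]_x0 _) (\int[mu]_x0 _) => n5 n6; ring.
  have A1 : `|\int[mu]_u (ph e x u * Phi d g u - ph e x u * (u / x * Phi d g u))| <=
      e * Tm e (fun m => `|Phi d g m|) x.
    apply: le_trans (intR_norm (L1B pP pP2)) _.
    have pPa : L1 mu (fun m => ph e x m * `|Phi d g m|).
      by apply: L1_ext (L1_norm pP) _ => m; rewrite normrM (ger0_norm (ph_ge0 x m e0)).
    rewrite /Tm -intRZ//; apply: intR_le; [exact/L1_norm/L1B|exact: L1Z|] => u.
    have -> : ph e x u * Phi d g u - ph e x u * (u / x * Phi d g u) =
      (1 - u / x) * (ph e x u * Phi d g u) by ring.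
    rewrite normrM [`|ph e x u * Phi d g u|]normrM (ger0_norm (ph_ge0 x u e0)).
    have [->|pu] := eqVneq (ph e x u) 0; first by rewrite !mul0r !mulr0.
    apply: ler_wpM2r; first by rewrite mulr_ge0 ?ph_ge0.
    have [_ h _ _] := ph_near e0 e4 x0 pu.
    have -> : 1 - u / x = - ((u - x) / x) by field; rewrite gt_eqF.
    by rewrite normrN normrM normfV (gtr0_norm x0) ler_pdivrMr.
  have A2 : `|\int[mu]_m (nd d / x * (ph e x m * g m) - nd d * (ph e x m * (g m / m)))| <=
      2 * e * nd d / x * Tm e (fun m => `|g m|) x.
    apply: le_trans (intR_norm (L1B (L1Z _ pg) pgm)) _.
    have pga := L1_ph x e0 gai.
    rewrite /Tm -intRZ//; apply: intR_le; [by apply/L1_norm/L1B => //; exact: L1Z|exact: L1Z|] => m.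
    have -> : nd d / x * (ph e x m * g m) - nd d * (ph e x m * (g m / m)) =
      (nd d * (x^-1 - m^-1)) * (ph e x m * g m) by ring.
    rewrite normrM [`|ph e x m * g m|]normrM (ger0_norm (ph_ge0 x m e0)).
    have [->|pm] := eqVneq (ph e x m) 0; first by rewrite !mul0r !mulr0.
    apply: ler_wpM2r; first by rewrite mulr_ge0 ?ph_ge0.
    rewrite normrM (ger0_norm (nd_ge0 d)).
    have -> : 2 * e * nd d / x = nd d * (2 * e / x) by ring.
    apply: ler_wpM2l; first exact: nd_ge0.
    have [m0 h im _] := ph_near e0 e4 x0 pm.
    have -> : x^-1 - m^-1 = (m - x) * (m^-1 * x^-1) by field; rewrite !gt_eqF.
    have i0 : 0 <= m^-1 * x^-1 by rewrite mulr_ge0// invr_ge0 ltW.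
    rewrite normrM (ger0_norm i0).
    have -> : 2 * e / x = (e * x) * (2 / x * x^-1) by field; rewrite gt_eqF.
    apply: ler_pM => //; apply: ler_wpM2r => //.
    by rewrite invr_ge0 ltW.
  have T1 := Tn0 (fun m => `|Phi d g m|) x (fun=> normr_ge0 _).
  have T2 := Tn0 (fun m => `|g m|) x (fun=> normr_ge0 _).
  have nd0 := nd_ge0 d.
  apply: le_trans (ler_norm _); rewrite normrM (ger0_norm (W_ge0 x)).
  apply: (@le_trans _ _ (W x * (`|N x| + e * Tm e (fun m => `|Phi d g m|) x +
     2 * e * nd d / x * Tm e (fun m => `|g m|) x))).
    apply: ler_wpM2l; first exact: W_ge0.
    apply: le_trans (ler_normD _ _) _; apply: lerD => //.
    by apply: le_trans (ler_normD _ _) _; apply: lerD.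
  rewrite 2!mulrDr normrM (ger0_norm (W_ge0 x)); apply: lerD.
    by rewrite mulrCA.
  (* The factor 1 / x of the loss term is absorbed by W x <= x. *)
  have -> : W x * (2 * e * nd d / x * Tm e (fun m => `|g m|) x) =
    (W x / x) * (2 * e * nd d * Tm e (fun m => `|g m|) x) by ring.
  apply: ler_piMl; first by rewrite !mulr_ge0// ltW.
  by rewrite ler_pdivrMr// mul1r W_le// ltW.
- rewrite (ger0_norm (ltW e0)) ger0_norm; last by rewrite !mulr_ge0 ?nd_ge0// ltW.
  by rewrite le_eqVlt; apply/orP; left; apply/eqP; ring.
Qed.

End Fixed.

(* d_n = e_n^3 kills the near part, while e_n log (1 / d_n) still tends to 0. *)
Definition Dn n : R := En R n ^+ 3.
Lemma Dn_gt0 n : 0 < Dn n.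
Proof. by rewrite exprn_gt0// En_gt0. Qed.
Lemma Dn_le4 n : Dn n <= 4^-1.
Proof.
have h := En_le4 R n; have h0 := En_gt0 R n.
apply: le_trans (_ : En R n * (1 * 1) <= _); last by rewrite !mulr1.
have -> : Dn n = En R n * (En R n * En R n) by rewrite /Dn; ring.
have h1 : En R n <= 1 by lra.
by rewrite ler_pM2l//; apply: ler_pM => //; exact: ltW.
Qed.
Lemma Dn_lt1 n : Dn n < 1.
Proof. by have := Dn_le4 n; lra. Qed.

(** A round number above 1920 + 384 * (4 * 7 + 10) + 12 * (4 * 7 + 4) = 16896, the sum produced in
    [NB_commutator_n] by e <= t and e L <= 7 t with t = 1 / (n + 2). *)
Definition C0 : R := 30 * 30 * 20.
Definition wn n : R := C0 * bC / n.+2%:R.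

Lemma wn_cvg : wn n @[n --> \oo] --> 0.
Proof.
rewrite -[X in _ --> X](mulr0 (C0 * bC)); apply: cvgMr.
have := @cvg_harmonic R; rewrite -(cvg_shiftS (fun n => n.+1%:R^-1 : R)).
exact.
Qed.

Lemma NB_commutator_n n g : L1 mu g -> NB mu
  (fun x => W x * (\int[mu]_m (g m * Ladj (ph (En R n) x) m) - Ld (Dn n) (Tm (En R n) g) x))
  (wn n * \int[mu]_m `|g m|).
Proof.
move=> gi; have h := NB_commutator (Dn_gt0 n) (Dn_le4 n) (En_gt0 R n) (En_le4 R n) gi.
have b1 := bC_ge1 R; have I0 : 0 <= \int[mu]_m `|g m| by apply: intR_ge0.
have L1' := L1_meas (NB_L1 h).
apply: NB_le h _ => //.
set I := \int[mu]_m `|g m|; set e := En R n; set L := - ln (Dn n / 2).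
have e0 : 0 < e := En_gt0 R n.
have N2 : 1 <= n.+2%:R :> R by rewrite ler1n.
have iN : 0 < (n.+2%:R : R)^-1 by rewrite invr_gt0.
have eN : e * n.+2%:R = n.+2%:R^-1 by rewrite /e /En; field.
have e1 : e <= n.+2%:R^-1 by rewrite -eN ler_peMr// ltW.
(* The inverse of d / 2 is 2 (n + 2)^6, at most (n + 2)^7; then ln t <= t - 1. *)
have Ll : L <= 7 * n.+2%:R.
  rewrite /L -lnV; last by rewrite posrE divr_gt0// Dn_gt0.
  apply: (@le_trans _ _ (ln (n.+2%:R ^+ 7))).
    rewrite ler_ln ?posrE ?invr_gt0 ?divr_gt0 ?exprn_gt0 ?Dn_gt0//.
    have -> : (Dn n / 2)^-1 = 2 * n.+2%:R ^+ 6 by rewrite /Dn /En; field.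
    by rewrite [leRHS]exprS ler_wpM2r ?exprn_ge0// ler_nat.
  apply: (@le_trans _ _ (7 * ln (n.+2%:R : R))); first by rewrite lnXn// mulr_natl.
  rewrite ler_pM2l//.
  have N0 : 0 < (n.+2%:R : R) by [].
  have := @le_ln1Dx R (n.+2%:R - 1).
  rewrite addrCA subrr addr0 => k; apply: le_trans (k _) _; lra.
have Le : e * L <= 7 * n.+2%:R^-1.
  rewrite -eN; have -> : 7 * (e * n.+2%:R) = e * (7 * n.+2%:R) by ring.
  by rewrite ler_pM2l.
have ndl := nd_le (Dn_gt0 n) (Dn_lt1 n); rewrite -/L in ndl.
have -> : 1920 * Dn n * bC / e ^+ 2 * I + 384 * bC * (e * ((4 * L + 10) * I)) +
   2 * e * nd (Dn n) * (6 * bC * I) =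
   (bC * I) * (1920 * e + 384 * (4 * (e * L) + 10 * e) + 12 * (e * nd (Dn n))).
  by rewrite /Dn -/e; field; rewrite gt_eqF.
have -> : wn n * I = (bC * I) * (C0 * n.+2%:R^-1) by rewrite /wn; ring.
apply: ler_wpM2l; first by rewrite mulr_ge0// (le_trans ler01).
have h1 : e * nd (Dn n) <= e * (4 * L + 4) by rewrite ler_pM2l.
set t := n.+2%:R^-1 in e1 Le *; set eL := e * L in Le h1 *; set en := e * nd _ in h1 *.
have h2 : en <= 4 * eL + 4 * e by apply: le_trans h1 _; rewrite /eL; lra.
rewrite /C0; lra.
Qed.

End CommutatorBound.

(** * Propagation of weighted bounds along the equation *)

Section IntervalIntegral.
Variable R : realType.
Notation mu := (@lebesgue_measure R).
Implicit Types (f g b : R -> R) (r s t u x : R).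

Definition Ic b s t : R := \int[mu]_r (if s < r < t then b r else 0).

Lemma ae_neq (a : R) : {ae mu, forall x, x != a}.
Proof.
exists [set a]; split; [exact: measurable_set1|exact: lebesgue_measure_set1|].
by move=> x /= /negP; rewrite negbK => /eqP.
Qed.

Lemma Ic_sub b s t s' t' : L1 mu (fun r => if s < r < t then b r else 0) ->
  s <= s' -> t' <= t -> L1 mu (fun r => if s' < r < t' then b r else 0).
Proof.
move=> bi ss tt; have mb := L1_meas bi.
apply: (@L1_le _ _ _ mu _ (fun r : R => `|if s < r < t then b r else 0|)); last exact: L1_norm.
  have -> : (fun r => if s' < r < t' then b r else 0) =
      (fun r => if s' < r < t' then (if s < r < t then b r else 0) else 0).
    apply/funext => r; case: ifP => // /andP[h1 h2].
    by rewrite (le_lt_trans ss h1) (lt_le_trans h2 tt).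
  by mfun.
move=> r; case: ifP => [/andP[h1 h2]|_]; last by rewrite normr0.
by rewrite (le_lt_trans ss h1) (lt_le_trans h2 tt).
Qed.

Lemma Ic_split b s t u : s <= t -> t <= u ->
  L1 mu (fun r => if s < r < u then b r else 0) -> Ic b s u = Ic b s t + Ic b t u.
Proof.
move=> st tu bi; have h1 := Ic_sub bi (lexx s) tu; have h2 := Ic_sub bi st (lexx u).
rewrite /Ic -intRD//; apply: intR_ae; [exact: (L1_meas bi)|exact: (L1_meas (L1D h1 h2))|].
apply: (aeS (ae_neq t)) => r rt.
have [rt1|rt1] := ltP r t.
  by rewrite (lt_le_trans rt1 tu) (ltNge t r) (ltW rt1)/= addr0.
have {rt rt1}tr : t < r by rewrite lt_neqAle eq_sym rt.
by rewrite (le_lt_trans st tr) tr/= add0r.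
Qed.

Lemma Ic_norm b s t : L1 mu (fun r => if s < r < t then b r else 0) ->
  `|Ic b s t| <= Ic (fun r => `|b r|) s t.
Proof.
move=> bi; apply: le_trans (intR_norm bi) _; rewrite le_eqVlt; apply/orP; left; apply/eqP.
by apply: intR_ext => r; case: ifP => //; rewrite normr0.
Qed.

Lemma Ic_empty b s : Ic b s s = 0.
Proof.
rewrite /Ic intR_eq0// => r.
by case: ifP => // /andP[h1 h2]; have := lt_trans h1 h2; rewrite ltxx.
Qed.

Lemma Ic_small b s t eps : L1 mu (fun r => if s < r < t then b r else 0) -> 0 < eps ->
  exists2 dl, 0 < dl & forall s' t', s <= s' -> s' <= t' -> t' <= t -> t' - s' < dl ->
    Ic (fun r => `|b r|) s' t' < eps.
Proof.
move=> bi eps0; have [dl [dl0 h]] := integral_normr_continuous bi eps0.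
exists dl => // s' t' ss st tt dd.
have := h `]s', t'[%classic (measurable_itv _).
have hm := lebesgue_measure_itv (`]s', t'[ : interval R); rewrite /= in hm.
rewrite [X in (X < _)%E]hm.
have mm : ((if (s'%:E < t'%:E)%E then t'%:E - s'%:E else 0) < dl%:E)%E.
  by case: ifP => _; rewrite lte_fin.
move=> /(_ mm); rewrite intR_itv; apply: le_lt_trans.
rewrite le_eqVlt; apply/orP; left; apply/eqP; apply: intR_ext => r.
case: ifP => // /andP[h1 h2].
by rewrite (le_lt_trans ss h1) (lt_le_trans h2 tt).
Qed.

End IntervalIntegral.

Section ChainRule.
Variable R : realType.
Notation mu := (@lebesgue_measure R).
Variables (J j a b : R -> R) (Lj s0 S : R).
Hypothesis s0S : s0 <= S.
Hypothesis Jsub : forall x y, J x + j x * (y - x) <= J y.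
Hypothesis jlip : forall x y, `|j x - j y| <= Lj * `|x - y|.
Hypothesis bi : L1 mu (fun r => if s0 < r < S then b r else 0).
Hypothesis aE : forall t, s0 <= t <= S -> a t = a s0 + Ic b s0 t.

Lemma chain_bai : L1 mu (fun r => if s0 < r < S then `|b r| else 0).
Proof. by apply: L1_ext (L1_norm bi) _ => r; case: ifP => //; rewrite normr0. Qed.

Lemma chain_diff t t' : s0 <= t -> t <= t' -> t' <= S -> a t' - a t = Ic b t t'.
Proof.
move=> st tt tS; rewrite (aE (t := t)) ?st ?(le_trans tt)//.
rewrite (aE (t := t')) ?tS ?(le_trans st)//.
rewrite (Ic_split st tt); last exact: (Ic_sub bi).
by ring.
Qed.

Lemma chain_mj : measfun j.
Proof.
apply: continuous_measurable_fun => x; apply/cvgrPdist_le => eps eps0.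
have L0 : 0 <= Lj by have := jlip 1 0; rewrite subr0 normr1 mulr1; exact: le_trans.
have d0 : 0 < eps / (Lj + 1) by rewrite divr_gt0//; lra.
have h : \forall y \near x, `|x - y| <= eps / (Lj + 1).
  by have /cvgrPdist_le := (@cvg_id _ (nbhs x)); apply.
apply: filterS h => y hy; apply: le_trans (jlip _ _) _.
apply: (@le_trans _ _ ((Lj + 1) * (eps / (Lj + 1)))); last by rewrite mulrC divfK// gt_eqF//; lra.
by apply: ler_pM => //; lra.
Qed.

Lemma chain_bound : exists2 K, 0 <= K & forall t, s0 <= t <= S -> `|j (a t)| <= K.
Proof.
have L0 : 0 <= Lj by have := jlip 1 0; rewrite subr0 normr1 mulr1; exact: le_trans.
pose M := Ic (fun r => `|b r|) s0 S.
have M0 : 0 <= M by apply: intR_ge0 => r; case: ifP.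
exists (`|j (a s0)| + Lj * M); first by rewrite addr_ge0// mulr_ge0.
move=> t /andP[st tS].
have -> : j (a t) = j (a s0) + (j (a t) - j (a s0)) by ring.
apply: le_trans (ler_normD _ _) _; rewrite lerD2l.
apply: le_trans (jlip _ _) _; apply: ler_wpM2l => //.
rewrite chain_diff//; apply: le_trans (Ic_norm (Ic_sub bi (lexx _) tS)) _.
rewrite /M (Ic_split st tS chain_bai) lerDl; apply: intR_ge0 => r; by case: ifP.
Qed.

Lemma chain_L1 : L1 mu (fun r => if s0 < r < S then j (a r) * b r else 0).
Proof.
have [K K0 hK] := chain_bound.
(* The hypotheses describe a on [s0, S] only; A is a measurable function on the line that agrees
   with it there. *)
pose A t := a s0 + \int[mu]_r (if s0 < r < t then (if s0 < r < S then b r else 0) else 0).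
have mA : measfun A.
  have mb := L1_meas bi.
  apply: mfunD; first exact: mfun_cst.
  apply: (@mfun_intR1 _ _ _ _ _ mu (fun z : R * R => if s0 < z.2 < z.1 then (if s0 < z.2 < S then b z.2 else 0) else 0)).
  apply: mfun_ite; [by mfun| |by mfun].
  by apply: (mfun_comp mb); mfun.
have EA t : s0 <= t <= S -> A t = a t.
  move=> tt; rewrite aE// /A; congr (_ + _); apply: intR_ext => r.
  case/andP: tt => st tS; case: ifP => // /andP[h1 h2].
  by rewrite h1 (lt_le_trans h2 tS).
apply: (@L1_le _ _ _ mu _ (fun r : R => K * `|if s0 < r < S then b r else 0|)).
- have -> : (fun r => if s0 < r < S then j (a r) * b r else 0) =
     (fun r => j (A r) * (if s0 < r < S then b r else 0)).
    apply/funext => r; case: ifP => [/andP[h1 h2]|_]; last by rewrite mulr0.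
    by rewrite EA// !ltW.
  apply: mfunM; last exact: (L1_meas bi).
  exact: (mfun_comp chain_mj mA).
- move=> r; case: ifP => [/andP[h1 h2]|_]; last by rewrite normr0 mulr0.
  by rewrite normrM ler_wpM2r// hK// !ltW.
- exact/L1Z/L1_norm.
Qed.

(** On a short interval convexity gives J(a t') - J(a t) <= j(a t') (a t' - a t). Replacing j(a t')
    by j(a r) costs Lj times the oscillation of a, which absolute continuity of the integral makes
    small on a fine partition. Neither J nor a is differentiated. *)
Lemma chain_convex : L1 mu (fun r => if s0 < r < S then j (a r) * b r else 0) /\
  J (a S) <= J (a s0) + \int[mu]_r (if s0 < r < S then j (a r) * b r else 0).
Proof.
split; first exact: chain_L1.
have L0 : 0 <= Lj by have := jlip 1 0; rewrite subr0 normr1 mulr1; exact: le_trans.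
set B := Ic (fun r => `|b r|) s0 S.
have B0 : 0 <= B by apply: intR_ge0 => r; case: ifP.
rewrite -/(Ic (fun r => j (a r) * b r) s0 S).
apply/ler_addgt0Pr => eps eps0.
have e0 : 0 < eps / (Lj * B + 1) by rewrite divr_gt0// ltr_wpDl// mulr_ge0.
set ep := eps / (Lj * B + 1) in e0.
have [dl dl0 hdl] := Ic_small bi e0.
have step t t' : s0 <= t -> t <= t' -> t' <= S -> t' - t < dl ->
    J (a t') <= J (a t) + Ic (fun r => j (a r) * b r) t t' + Lj * ep * Ic (fun r => `|b r|) t t'.
  move=> st tt tS td.
  have bi' := Ic_sub bi st tS; have bai' := Ic_sub chain_bai st tS; have jab' := Ic_sub chain_L1 st tS.
  have h := Jsub (a t') (a t).
  have h2 : j (a t') * (a t' - a t) <= Ic (fun r => j (a r) * b r) t t' + Lj * ep * Ic (fun r => `|b r|) t t'.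
    rewrite chain_diff// /Ic -!intRZ// -intRD//; last exact: L1Z.
    apply: intR_le; [exact: L1Z|by apply: L1D => //; exact: L1Z|] => r.
    case: ifP => [/andP[h1 h3]|_]; last by rewrite !mulr0 addr0.
    have -> : j (a t') * b r = j (a r) * b r + (j (a t') - j (a r)) * b r by ring.
    rewrite lerD2l; apply: le_trans (ler_norm _) _; rewrite normrM ler_wpM2r//.
    apply: le_trans (jlip _ _) _; apply: ler_wpM2l => //.
    have sr : s0 <= r by rewrite (le_trans st)// ltW.
    rewrite chain_diff//; last exact: ltW.
    apply: le_trans (Ic_norm (Ic_sub bi sr tS)) _; apply: ltW; apply: hdl => //; first exact: ltW.
    by apply: le_lt_trans td; lra.
  lra.
have [N N0] : exists2 N : nat, (0 < N)%N & (S - s0) / N%:R < dl.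
  have [N hN] : exists N : nat, (S - s0) / dl < N%:R.
    by exists (Num.bound ((S - s0) / dl)); apply: archi_boundP; rewrite divr_ge0 ?subr_ge0// ltW.
  exists N.+1 => //; rewrite ltr_pdivrMr//.
  move: hN; rewrite ltr_pdivrMr// => hN; apply: lt_trans hN _.
  by rewrite mulrC ltr_pM2l// ltr_nat.
set q := (S - s0) / N%:R => hq.
have q0 : 0 <= q by rewrite divr_ge0// subr_ge0.
have Nq : N%:R * q = S - s0 by rewrite mulrC divfK// gt_eqF// ltr0n.
have ti (i : nat) : (i <= N)%N -> s0 <= s0 + i%:R * q <= S.
  move=> iN; rewrite lerDl mulr_ge0//=.
  have : i%:R * q <= N%:R * q by rewrite ler_wpM2r// ler_nat.
  by rewrite Nq; lra.
have main (i : nat) : (i <= N)%N -> J (a (s0 + i%:R * q)) <= J (a s0) +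
    Ic (fun r => j (a r) * b r) s0 (s0 + i%:R * q) + Lj * ep * Ic (fun r => `|b r|) s0 (s0 + i%:R * q).
  elim: i => [_|i IH iN]; first by rewrite mul0r addr0 !Ic_empty mulr0 !addr0.
  have /andP[t1 t2] := ti _ (ltnW iN); have /andP[t3 t4] := ti _ iN.
  have tt : s0 + i%:R * q <= s0 + i.+1%:R * q by rewrite lerD2l ler_wpM2r// ler_nat.
  have td : s0 + i.+1%:R * q - (s0 + i%:R * q) < dl by rewrite -natr1; lra.
  have := step _ _ t1 tt t4 td; have := IH (ltnW iN).
  rewrite (Ic_split t1 tt (Ic_sub chain_bai (lexx _) t4)) (Ic_split t1 tt (Ic_sub chain_L1 (lexx _) t4)).
  lra.
have := main N (leqnn N); rewrite Nq addrC subrK -/B.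
have hh : Lj * ep * B <= eps.
  rewrite /ep; have -> : Lj * (eps / (Lj * B + 1)) * B = eps * (Lj * B) / (Lj * B + 1) by ring.
  have LB : 0 <= Lj * B by rewrite mulr_ge0.
  by rewrite ler_pdivrMr ?ler_pM2l//; lra.
by lra.
Qed.

End ChainRule.

Section Gronwall.
Variable R : realType.
Notation mu := (@lebesgue_measure R).

(** U is measurable and bounded, with no continuity. Inserting a bound K exp(2 C t) returns (A + K /
    2) exp(2 C t), so iteration from K = 2 A + M halves the excess over 2 A at each turn. *)
Lemma gronwall (U : R -> R) (A C M S : R) : 0 <= A -> 0 < C -> 0 <= M -> 0 < S ->
  measfun U -> (forall t, 0 < t <= S -> 0 <= U t <= M) ->
  (forall t, 0 < t <= S -> U t <= A + C * Ic U 0 t) ->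
  U S <= 2 * A * expR (2 * C * S).
Proof.
move=> A0 C0 M0 S0 mU UM hU.
have C2 : 0 < 2 * C by rewrite mulr_gt0.
have dE (x : R) : is_derive x (1 : R) (fun r => (2 * C)^-1 * expR (2 * C * r)) (expR (2 * C * x)).
  have h : is_derive x (1 : R) (fun r => 2 * C * r) (2 * C).
    by apply: is_derive_eq; rewrite /GRing.scale/= mulr1.
  have h2 := is_derive1_comp (is_derive_expR (2 * C * x)) h.
  have h3 : is_derive x (1 : R) (fun r => (2 * C)^-1 * expR (2 * C * r))
      ((2 * C)^-1 *: (expR (2 * C * x) * (2 * C))) by exact: (is_deriveZ _ h2).
  apply: (is_derive_eq h3); rewrite /GRing.scale/= mulrCA mulVf ?mulr1//.
  by rewrite gt_eqF.
have mE : measfun (fun r : R => expR (2 * C * r)) by mfun.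
have cE (x : R) : {for x, continuous (fun r : R => expR (2 * C * r))}.
  apply: continuous_comp; last exact: continuous_expR.
  by apply: cvgMr; exact: cvg_id.
have key (n : nat) : forall t, 0 < t <= S -> U t <= (2 * A + M / 2 ^+ n) * expR (2 * C * t).
  elim: n => [|n IH] t tS.
    rewrite expr0 divr1; have /andP[_ h] := UM t tS.
    have e1 : 1 <= expR (2 * C * t).
      rewrite -[leLHS]expR0 ler_expR; apply: mulr_ge0; [exact: (ltW C2)|case/andP: tS => t0 _; exact: ltW].
    apply: (le_trans h); rewrite -[leLHS]mulr1; apply: ler_pM => //; lra.
  set K := 2 * A + M / 2 ^+ n in IH.
  have K0 : 0 <= K by rewrite addr_ge0 ?mulr_ge0// invr_ge0 exprn_ge0.
  have /andP[t0 tS'] := tS.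
  have hI : Ic U 0 t <= K * ((2 * C)^-1 * expR (2 * C * t)).
    have ftc := @NB_ftc R _ _ 0 t t0 mE (fun x _ => expR_ge0 _) (fun x _ => cE x) (fun x _ => dE x).
    have fl := NB_L1 ftc.
    have ul : L1 mu (fun r => if 0 < r < t then U r else 0).
      apply: (@L1_itv_bd _ _ M) => // r /andP[r0 rt].
      have /andP[u0 u1] := UM r (ltac:(by rewrite r0 (le_trans (ltW rt) tS'))).
      by rewrite ger0_norm.
    apply: (@le_trans _ _ (K * \int[mu]_r (if 0 < r < t then expR (2 * C * r) else 0))).
      rewrite -intRZ//; apply: intR_le => //; first exact: L1Z.
      move=> r; case: ifP => [/andP[r0 rt]|_]; last by rewrite mulr0.
      by apply: IH; rewrite r0 (le_trans (ltW rt) tS').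
    apply: ler_wpM2l => //; apply: le_trans (le_trans (ler_norm _) (NB_abs ftc)) _.
    by rewrite gerBl mulr_ge0 ?expR_ge0// invr_ge0 ltW.
  apply: le_trans (hU t tS) _.
  have e1 : 1 <= expR (2 * C * t) by rewrite -[leLHS]expR0 ler_expR; apply: mulr_ge0; [exact: (ltW C2)|exact: ltW].
  apply: (@le_trans _ _ (A * expR (2 * C * t) + C * (K * ((2 * C)^-1 * expR (2 * C * t))))).
    by apply: lerD; [rewrite ler_peMr|rewrite ler_pM2l].
  rewrite le_eqVlt; apply/orP; left; apply/eqP; rewrite /K exprS; field.
  by rewrite expf_neq0 ?gt_eqF.
set E := expR _.
have E0 : 0 <= E := expR_ge0 _.
have lim : (2 * A + M / 2 ^+ n) * E @[n --> \oo] --> 2 * A * E.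
  apply: cvgMl; rewrite -[X in _ --> X]addr0; apply: cvgD; first exact: cvg_cst.
  rewrite -[X in _ --> X](mulr0 M); apply: cvgMr.
  have := @cvg_geometric R 1 (2^-1) (ltac:(rewrite ger0_norm ?invr_ge0// invf_lt1// ltr1n//)).
  rewrite /geometric/= => h; apply: cvg_trans h; apply: near_eq_cvg.
  by near=> n; rewrite mul1r exprVn.
apply: (@ler_cvg_to _ _ _ _ (fun _ : nat => U S) _ _ _ (cvg_cst _) lim).
by near=> n; apply: key; rewrite S0 lexx.
Unshelve. all: by end_near. Qed.

End Gronwall.

Section Kato.
Variable R : realType.
Notation mu := (@lebesgue_measure R).
Notation mu2 := (mu \x mu)%E.
Implicit Types (f g h G : R -> R) (a b c d e l m x y z r s t nu : R).

(** A convex approximation of |a|, within nu of it, whose derivative [jn] is Lipschitz as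
    [chain_convex] requires. *)
Definition Jn nu a : R := Num.sqrt (a ^+ 2 + nu ^+ 2) - nu.
Definition jn nu a : R := a / Num.sqrt (a ^+ 2 + nu ^+ 2).

Section Regularized.
Variable nu : R.
Hypothesis nu0 : 0 < nu.
Let q a := Num.sqrt (a ^+ 2 + nu ^+ 2).

Lemma Jn_arg a : 0 < a ^+ 2 + nu ^+ 2.
Proof. by rewrite ltr_wpDl ?sqr_ge0// exprn_gt0. Qed.
Lemma q_gt0 a : 0 < q a.
Proof. by rewrite sqrtr_gt0 Jn_arg. Qed.
Lemma q_sqr a : q a ^+ 2 = a ^+ 2 + nu ^+ 2.
Proof. by rewrite sqr_sqrtr// ltW// Jn_arg. Qed.
Lemma q_nu a : nu <= q a.
Proof.
rewrite -(@ler_pXn2r _ 2)// ?nnegrE ?(ltW nu0) ?(ltW (q_gt0 a))// q_sqr.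
by rewrite lerDr sqr_ge0.
Qed.
Lemma q_abs a : `|a| <= q a.
Proof.
rewrite -(@ler_pXn2r _ 2)// ?nnegrE ?(ltW (q_gt0 a))// q_sqr -normrX ger0_norm ?sqr_ge0//.
by rewrite lerDl sqr_ge0.
Qed.
Lemma q_le a : q a <= `|a| + nu.
Proof.
have n0 := normr_ge0 a.
rewrite -(@ler_pXn2r _ 2)// ?nnegrE ?(ltW (q_gt0 a)) ?addr_ge0 ?(ltW nu0)//.
rewrite q_sqr sqrrD -normrX (ger0_norm (sqr_ge0 a)) -addrA lerD2l lerDr.
by rewrite mulrn_wge0// mulr_ge0// ltW.
Qed.

Lemma Jn_ge0 a : 0 <= Jn nu a.
Proof. by rewrite subr_ge0 q_nu. Qed.
Lemma Jn_le a : Jn nu a <= `|a|.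
Proof. by rewrite lerBlDr q_le. Qed.
Lemma Jn_ge a : `|a| - nu <= Jn nu a.
Proof. by rewrite lerD2r q_abs. Qed.
Lemma jn_le1 a : `|jn nu a| <= 1.
Proof.
by rewrite /jn normrM normfV -/(q a) (gtr0_norm (q_gt0 a)) ler_pdivrMr ?q_gt0// mul1r q_abs.
Qed.
Lemma Jn_sub a b : Jn nu a + jn nu a * (b - a) <= Jn nu b.
Proof.
rewrite /Jn /jn -/(q a) -/(q b); have qa := q_gt0 a; have qb := q_gt0 b.
have sa := q_sqr a; have sb := q_sqr b.
suff h : a * b + nu ^+ 2 <= q a * q b.
  have -> : q a - nu + a / q a * (b - a) = (a * b + (q a ^+ 2 - a ^+ 2)) / q a - nu.
    by field; rewrite gt_eqF.
  rewrite lerD2r ler_pdivrMr// sa [q b * _]mulrC; move: h; lra.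
have p0 : 0 <= q a * q b by rewrite mulr_ge0// ltW.
apply: le_trans (ler_norm _) _.
rewrite -(@ler_pXn2r _ 2)// ?nnegrE// -normrX ger0_norm ?sqr_ge0// exprMn sa sb.
rewrite -subr_ge0.
have -> : (a ^+ 2 + nu ^+ 2) * (b ^+ 2 + nu ^+ 2) - (a * b + nu ^+ 2) ^+ 2 =
  (nu * (a - b)) ^+ 2 by ring.
exact: sqr_ge0.
Qed.
Lemma q_lip a b : `|q a - q b| <= `|a - b|.
Proof.
have qa := q_gt0 a; have qb := q_gt0 b; have p0 : 0 < q a + q b by rewrite addr_gt0.
have -> : q a - q b = ((a - b) * (a + b)) / (q a + q b).
  apply: (canRL (mulfK _)); first by rewrite gt_eqF.
  have := q_sqr a; have := q_sqr b; move: (q a) (q b) => u v h1 h2.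
  have -> : (u - v) * (u + v) = u ^+ 2 - v ^+ 2 by ring.
  by rewrite h1 h2; ring.
rewrite normrM normfV (gtr0_norm p0) ler_pdivrMr// normrM ler_wpM2l//.
by apply: le_trans (ler_normD _ _) _; apply: lerD; exact: q_abs.
Qed.
Lemma jn_lip a b : `|jn nu a - jn nu b| <= 2 / nu * `|a - b|.
Proof.
have qa := q_gt0 a; have qb := q_gt0 b; have ni : 0 < nu^-1 by rewrite invr_gt0.
have ia : (q a)^-1 <= nu^-1 by rewrite lef_pV2 ?posrE// q_nu.
have ia0 : 0 < (q a)^-1 by rewrite invr_gt0.
have -> : jn nu a - jn nu b = (a - b) * (q a)^-1 - (q a)^-1 * (jn nu b * (q a - q b)).
  by rewrite /jn -/(q a) -/(q b); field; rewrite !gt_eqF.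
apply: le_trans (ler_normB _ _) _.
have -> : 2 / nu * `|a - b| = `|a - b| * nu^-1 + nu^-1 * `|a - b| by ring.
apply: lerD; rewrite normrM (gtr0_norm ia0).
  by apply: ler_wpM2l.
apply: ler_pM => //; first exact: ltW.
rewrite normrM -[leRHS]mul1r; apply: ler_pM => //; [exact: jn_le1|exact: q_lip].
Qed.
Lemma mfun_q : measfun q.
Proof.
have m2 : measfun (fun a : R => a ^+ 2 + nu ^+ 2) by mfun.
have ms : measfun (@Num.sqrt R).
  by apply: continuous_measurable_fun; exact: sqrt_continuous.
exact: (mfun_comp ms m2).
Qed.
Lemma mfun_Jn : measfun (Jn nu).
Proof. have mq := mfun_q; rewrite /Jn -/q; exact: (mfunB mq (@mfun_cst _ _ R nu)). Qed.
Lemma mfun_jn : measfun (jn nu).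
Proof. have mq := mfun_q; have h := mfunV mq; apply: mfunM => //; exact: measurable_id. Qed.

End Regularized.

Section FarOperator.
Variables (d : R) (G : R -> R).
Hypotheses (d0 : 0 < d) (d4 : d <= 4^-1) (Gi : L1 mu G).

Lemma fo_d1 : d < 1. Proof. by move: d4; lra. Qed.
Let L := - ln (d / 2).
Let mG : measfun G. Proof. exact: L1_meas Gi. Qed.

Lemma fo_L : 0 <= 4 * L + 4.
Proof. exact: le_trans (NB_abs (NB_W_kLd d0 fo_d1 (ltr01 : 0 < 1 :> R))). Qed.

Lemma LdE x : 0 < x -> Ld d G x = Phi d G x - nd d / x * G x.
Proof.
move=> x0; have ki := L1_kLd d0 fo_d1 x0; have pi := Phi_section d0 d4 Gi x0.
rewrite /Phi -(int_kLd d0 fo_d1 x0) -(mulrC (G x)) -(intRZ (G x) ki) -(intRB pi (L1Z (G x) ki)).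
by apply: intR_ext => y; rewrite mulrBr (mulrC (G x)).
Qed.

Lemma mfun_Ld : measfun (Ld d G).
Proof.
apply: (@mfun_intR1 _ _ _ _ _ mu (fun z : R * R => kLd d z.1 z.2 * (G z.2 - G z.1))).
apply: mfunM; first exact: mfun_kLd.
by apply: mfunB; apply: (mfun_comp mG); mfun.
Qed.

Lemma NB_W_Ld : NB mu (fun x => W x * Ld d G x) ((8 * L + 14) * \int[mu]_x `|G x|).
Proof.
have mL := mfun_Ld; have mW := @mfun_W R.
have h := NBD (NB_norm (NB_W_Phi d0 d4 Gi)) (NB_norm (NBZ (nd d) (L1_NB Gi))).
apply: NB_le h _; first by mfun.
- move=> x; have [x0|x0] := ltP 0 x; last by rewrite {1}/W ltNge x0/= mul0r normr0.
  rewrite LdE// mulrBr; apply: le_trans (ler_normB _ _) _; apply: le_trans (ler_norm _); apply: lerD => //.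
  have -> : W x * (nd d / x * G x) = (W x / x) * (nd d * G x) by ring.
  have w0 : 0 <= W x / x by apply: divr_ge0; [exact: W_ge0|exact: ltW].
  rewrite normrM (ger0_norm w0); apply: ler_piMl => //.
  by rewrite ler_pdivrMr// mul1r W_le// ltW.
- have I0 : 0 <= \int[mu]_x `|G x| by apply: intR_ge0.
  rewrite (ger0_norm (nd_ge0 d)) -mulrDl; apply: ler_wpM2r => //.
  by have := nd_le d0 fo_d1; rewrite -/L; lra.
Qed.

(** Convexity gives j(G) Ld G <= Ld (J o G) pointwise. Transposing the operator onto W leaves x^2
    times the integral of the increments of [etaW], bounded by 6 W uniformly in d. *)
Lemma kato_Ld (J j : R -> R) : measfun J -> measfun j ->
  (forall a b, J a + j a * (b - a) <= J b) -> (forall a, 0 <= J a <= `|a|) ->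
  (forall a, `|j a| <= 1) ->
  L1 mu (fun x => W x * (j (G x) * Ld d G x)) /\
  \int[mu]_x (W x * (j (G x) * Ld d G x)) <= 6 * \int[mu]_x (W x * J (G x)).
Proof.
move=> mJ mj Jsub J0 j1; have mW := @mfun_W R; have mL := mfun_Ld.
have mk := @mfun_kLd R d.
have mJG : measfun (fun x => J (G x)) by exact: (mfun_comp mJ mG).
have mjG : measfun (fun x => j (G x)) by exact: (mfun_comp mj mG).
have JGi : L1 mu (fun x => J (G x)).
  apply: (@L1_le _ _ _ mu _ (fun x : R => `|G x|)) => //; last exact: L1_norm.
  by move=> x; have /andP[h1 h2] := J0 (G x); rewrite ger0_norm.
have WJi : L1 mu (fun x => W x * J (G x)).
  by apply: (@L1M _ _ _ mu 1) => // x; rewrite ger0_norm ?W_ge0 ?W_le1.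
pose F1 (z : R * R) := W z.1 * kLd d z.1 z.2 * J (G z.2).
pose F2 (z : R * R) := W z.1 * kLd d z.1 z.2 * J (G z.1).
have mWk : measfun (fun z : R * R => W z.1 * kLd d z.1 z.2).
  by apply: mfunM => //; apply: (mfun_comp mW); mfun.
have mF1 : measfun F1.
  by apply: mfunM => //; apply: (mfun_comp mJG); mfun.
have mF2 : measfun F2.
  by apply: mfunM => //; apply: (mfun_comp mJG); mfun.
have k0 x y : y <= 0 -> kLd d x y = 0 by move=> y0; rewrite kLd_eq0// negb_and -!leNgt y0 orbT.
have [F1i _] : L1 mu2 F1 /\ \int[mu2]_z `|F1 z| <= \int[mu]_y ((4 * L + 10) * J (G y)).
  apply: L1_prod_of2 => //; last exact: L1Z.
  apply: aeW => y; have [y0|y0] := ltP 0 y; last first.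
    have -> : (fun x => F1 (x, y)) = fun=> 0.
      by apply/funext => x; rewrite /F1/= k0// mulr0 mul0r.
    by apply: NB_0; have /andP[h1 _] := J0 (G y); apply: mulr_ge0 => //; have := fo_L; lra.
  have /andP[h1 _] := J0 (G y).
  apply: NB_le (NBZ (J (G y)) (NB_W_kLd_adj d0 fo_d1 y0)) _.
  - exact: (mfun_section2 y mF1).
  - by move=> x; rewrite /F1/= mulrC.
  - by rewrite ger0_norm// mulrC.
have [F2i _] : L1 mu2 F2 /\ \int[mu2]_z `|F2 z| <= \int[mu]_x ((4 * L + 4) * J (G x)).
  apply: L1_prod_of1 => //; last exact: L1Z.
  apply: aeW => x; have /andP[h1 _] := J0 (G x); have [x0|x0] := ltP 0 x; last first.
    have -> : (fun y => F2 (x, y)) = fun=> 0.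
      by apply/funext => y; rewrite /F2/= /W ltNge x0/= !mul0r.
    by apply: NB_0; apply: mulr_ge0 => //; exact: fo_L.
  apply: NB_le (NBZ (J (G x)) (NB_W_kLd d0 fo_d1 x0)) _.
  - exact: (mfun_section1 x mF2).
  - by move=> y; rewrite /F2/= mulrC.
  - by rewrite ger0_norm// mulrC.
have lhsi : L1 mu (fun x => W x * (j (G x) * Ld d G x)).
  apply: (@L1_le _ _ _ mu _ (fun x : R => `|W x * Ld d G x|)); last exact: (L1_norm (NB_L1 NB_W_Ld)).
    by mfun.
  move=> x; rewrite mulrCA normrM; apply: ler_piMl => //; exact: j1.
split => //.
have F1s := fub_L12 F1i; have F1r := fub_L11 F1i; have F2r := fub_L11 F2i.
apply: (@le_trans _ _ (\int[mu]_x (\int[mu]_y F1 (x, y) - \int[mu]_y F2 (x, y)))).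
  apply: intR_le_ae => //; first exact: L1B.
  apply: (aeI (fub_ae1 F1i) (fub_ae1 F2i)) => x f1 f2; rewrite -intRB//.
  have [x0|x0] := ltP 0 x; last first.
    rewrite {1}/W ltNge x0/= mul0r intR_eq0// => y.
    by rewrite /F1 /F2/= /W ltNge x0/= !mul0r subrr.
  have pi := Phi_section d0 d4 Gi x0; have ki := L1_kLd d0 fo_d1 x0.
  have gi : L1 mu (fun y => kLd d x y * (G y - G x)).
    by apply: L1_ext (L1B pi (L1Z (G x) ki)) _ => y; ring.
  rewrite mulrA /Ld -intRZ//; apply: intR_le; [exact: L1Z|exact: L1B|] => y.
  have -> : W x * j (G x) * (kLd d x y * (G y - G x)) = W x * kLd d x y * (j (G x) * (G y - G x)) by ring.
  have -> : F1 (x, y) - F2 (x, y) = W x * kLd d x y * (J (G y) - J (G x)) by rewrite /F1 /F2/= mulrBr.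
  apply: ler_wpM2l; first by rewrite mulr_ge0 ?W_ge0 ?kLd_ge0.
  by have := Jsub (G x) (G y); lra.
rewrite intRB//.
(* The variables are exchanged in the gain term alone, which makes J (G x) a common factor. *)
have -> : \int[mu]_x \int[mu]_y F1 (x, y) = \int[mu]_x \int[mu]_y F1 (y, x).
  exact: (fub_swap F1i).
rewrite -intRB//; rewrite -intRZ//; apply: intR_le_ae; [exact: L1B|exact: L1Z|].
apply: (aeI (fub_ae2 F1i) (fub_ae1 F2i)) => x f1 f2; rewrite -intRB//.
have [x0|x0] := ltP 0 x; last first.
  rewrite {1}/W ltNge x0/= mul0r mulr0 intR_eq0// => y.
  rewrite /F1 /F2/= k0//; have -> : W x = 0 by rewrite /W ltNge x0.
  by rewrite mulr0 !mul0r subrr.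
have /andP[h1 _] := J0 (G x).
have E : NB mu (fun y => (etaW y - etaW x) * kLd d x y) (6 * etaW x).
  apply: NB_le (NB_kL_eta x0) _ => //.
  - by have h2 := mfun_section1 x mk; have h3 := @mfun_etaW R; mfun.
  - move=> y; rewrite !normrM; apply: ler_wpM2l => //.
    rewrite (ger0_norm (kLd_ge0 _ _ _)) (ger0_norm (kL_ge0 _ _)); exact: kLd_le.
have -> : \int[mu]_y (F1 (y, x) - F2 (x, y)) =
    J (G x) * (x ^+ 2 * \int[mu]_y ((etaW y - etaW x) * kLd d x y)).
  rewrite -(intRZ (x ^+ 2) (NB_L1 E)) -intRZ; last exact/L1Z/(NB_L1 E).
  apply: intR_ext => y; rewrite /F1 /F2/= -mulrBl mulrC; congr (_ * _).
  have [y0|y0] := ltP 0 y; last first.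
    have kx : kLd d y x = 0 by rewrite kLd_eq0// negb_and -leNgt y0.
    by rewrite kx k0// !mulr0 subrr.
  have sy := kLd_sym d x y; rewrite /W x0 y0.
  have -> : y ^+ 2 * etaW y * kLd d y x = etaW y * (y ^+ 2 * kLd d y x) by ring.
  by rewrite -sy; ring.
have -> : 6 * (W x * J (G x)) = J (G x) * (x ^+ 2 * (6 * etaW x)) by rewrite /W x0; ring.
apply: ler_wpM2l => //; apply: ler_wpM2l; first exact: sqr_ge0.
exact: le_trans (ler_norm _) (NB_abs E).
Qed.

End FarOperator.

Section Propagation.
Variables (h : R -> R -> R) (S y B : R).
Hypotheses (S0 : 0 < S) (y0 : 0 < y) (B0 : 0 <= B).
Hypothesis mh : measfun2 R h.
Hypothesis hB : forall s, 0 < s <= S -> NB mu (h s) B.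
Hypothesis weak : forall n s x, 0 < s <= S -> 0 < x ->
  Tm (En R n) (h s) x = ph (En R n) x y +
    Ic (fun r => \int[mu]_m (h r m * Ladj (ph (En R n) x) m)) 0 s.

Let b1 : 1 <= bC R. Proof. exact: bC_ge1. Qed.

Section Step.
Variable n : nat.
Let e := En R n.
Let d := Dn R n.
Let e0 : 0 < e := En_gt0 R n.
Let e4 : e <= 4^-1 := En_le4 R n.
Let d0 : 0 < d := Dn_gt0 R n.
Let d4 : d <= 4^-1 := Dn_le4 R n.
Let G s x := Tm e (h s) x.
Let b s x := \int[mu]_m (h s m * Ladj (ph e x) m).
(** The mollification scale also regularizes the absolute value, so that a single limit removes
    both. *)
Let J := Jn e.
Let j := jn e.

Lemma kt_e2 : e <= 2^-1. Proof. by move: e4; lra. Qed.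

Lemma kt_mG : measfun2 R G.
Proof.
apply: (@mfun_intR1 _ _ _ _ _ mu (fun w : (R * R) * R => ph e w.1.2 w.2 * h w.1.1 w.2)).
by apply: mfunM; apply: mfun_curry; by [exact: mfun_ph|exact: mh|mfun].
Qed.

Lemma kt_mb : measfun2 R b.
Proof.
apply: (@mfun_intR1 _ _ _ _ _ mu (fun w : (R * R) * R => h w.1.1 w.2 * Ladj (ph e w.1.2) w.2)).
apply: mfunM; first by apply: (mfun_curry mh); mfun.
by apply: (@mfun_curry _ _ _ _ _ _ _ _ (fun x => Ladj (ph e x)) _ _ (mfun_Ladj_ph e)); mfun.
Qed.

Lemma kt_GL s : 0 < s <= S -> NB mu (G s) (6 * bC R * B).
Proof.
move=> sS; have /NBP[hi hb] := hB sS.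
have /NBP[gi gb] := NB_1_Tm e0 kt_e2 hi.
apply/NBP; split => //; apply: le_trans gb _.
by apply: ler_wpM2l => //; rewrite mulr_ge0// (le_trans ler01).
Qed.

Let U t := \int[mu]_x (W x * J (G t x)).
(** A bound for the weighted mass of the mollified Dirac mass at y, plus the commutator error
    accumulated up to time S. *)
Let A := 384 * bC R * W y + S * (wn R n * B).

Lemma kt_WJL s : 0 < s <= S -> L1 mu (fun x => W x * J (G s x)).
Proof.
move=> sS; have gi := NB_L1 (kt_GL sS); have mg := L1_meas gi.
have mW := @mfun_W R; have mJG := mfun_comp (mfun_Jn e) mg.
apply: (@L1_le _ _ _ mu _ (fun x : R => `|G s x|)); [by mfun| |exact: L1_norm].
move=> x; rewrite normrM (ger0_norm (W_ge0 x)) (ger0_norm (Jn_ge0 e0 _)).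
rewrite -[leRHS]mul1r; apply: ler_pM; [exact: W_ge0|exact: Jn_ge0|exact: W_le1|exact: Jn_le].
Qed.

Lemma kt_U s : 0 < s <= S -> 0 <= U s <= 6 * bC R * B.
Proof.
move=> sS; apply/andP; split.
  by apply: intR_ge0 => x; rewrite mulr_ge0 ?W_ge0 ?Jn_ge0.
have /NBP[gi gb] := kt_GL sS; apply: le_trans gb.
apply: intR_le; [exact: kt_WJL|exact: L1_norm|] => x.
rewrite -[leRHS]mul1r; apply: ler_pM; [exact: W_ge0|exact: Jn_ge0|exact: W_le1|exact: Jn_le].
Qed.

Lemma kt_mU : measfun U.
Proof.
have mW := @mfun_W R.
apply: (@mfun_intR1 _ _ _ _ _ mu (fun z : R * R => W z.2 * J (G z.1 z.2))).
apply: mfunM; first by apply: (mfun_comp mW); mfun.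
exact: (mfun_comp (mfun_Jn e) kt_mG).
Qed.

Let Kb := wn R n * B + (8 * - ln (d / 2) + 14) * (6 * bC R * B).

Lemma kt_wnB : 0 <= wn R n * B.
Proof.
apply: mulr_ge0 => //; apply: mulr_ge0; last by rewrite invr_ge0.
by apply: mulr_ge0; [rewrite /C0 !mulr_ge0//|exact: le_trans b1].
Qed.

Lemma kt_comm s : 0 < s <= S -> NB mu (fun x => W x * (b s x - Ld d (G s) x)) (wn R n * B).
Proof.
move=> sS; have /NBP[hi hb] := hB sS.
have /NBP[ci cb] := NB_commutator_n n hi.
apply/NBP; split => //; apply: le_trans cb _; apply: ler_wpM2l => //.
apply: mulr_ge0; last by rewrite invr_ge0.
by apply: mulr_ge0; [rewrite /C0 !mulr_ge0//|exact: le_trans b1].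
Qed.

Lemma kt_jb s : 0 < s <= S -> L1 mu (fun x => W x * (j (G s x) * b s x)) /\
  \int[mu]_x `|W x * (j (G s x) * b s x)| <= Kb /\
  \int[mu]_x (W x * (j (G s x) * b s x)) <= wn R n * B + 6 * U s.
Proof.
move=> sS; have gi := NB_L1 (kt_GL sS); have mg := L1_meas gi.
have mjG := mfun_comp (mfun_jn e) mg.
have [ki kle] := kato_Ld d0 d4 gi (mfun_Jn e) (mfun_jn e) (Jn_sub e0)
  (fun a => ltac:(by rewrite Jn_ge0// Jn_le)) (jn_le1 e0).
have c := kt_comm sS; have ci := NB_L1 c.
have cj : NB mu (fun x => j (G s x) * (W x * (b s x - Ld d (G s) x))) (wn R n * B).
  apply: NB_le c _ => //; first by have mc := L1_meas ci; mfun.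
  by move=> x; rewrite normrM; apply: ler_piMl => //; exact: jn_le1.
have E x : W x * (j (G s x) * b s x) =
    j (G s x) * (W x * (b s x - Ld d (G s) x)) + W x * (j (G s x) * Ld d (G s) x) by ring.
have L1s : L1 mu (fun x => W x * (j (G s x) * b s x)).
  by apply: L1_ext (L1D (NB_L1 cj) ki) _ => x; rewrite E.
split => //; split.
  have hW := NB_W_Ld d0 d4 gi.
  have hW2 : NB mu (fun x => W x * Ld d (G s) x) ((8 * - ln (d / 2) + 14) * (6 * bC R * B)).
    have /NBP[w1 w2] := hW; apply/NBP; split => //; apply: le_trans w2 _.
    apply: ler_wpM2l; last by have /NBP[] := kt_GL sS.
    have k : 0 <= 4 * - ln (d / 2) + 4 := fo_L d0 d4.
    by move: k; move: (ln (d / 2)) => q; lra.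
  have /NBP[_ hh] := NBD (NB_norm cj) (NB_norm hW2); apply: le_trans hh.
  have mm := L1_norm (L1D (NB_L1 (NB_norm cj)) (NB_L1 (NB_norm hW2))).
  apply: intR_le; [exact: L1_norm|exact: mm|] => x.
  rewrite E; apply: le_trans (ler_normD _ _) _; apply: le_trans (ler_norm _); apply: lerD => //.
  by rewrite mulrCA normrM; apply: ler_piMl => //; exact: jn_le1.
have -> : \int[mu]_x (W x * (j (G s x) * b s x)) =
    \int[mu]_x (j (G s x) * (W x * (b s x - Ld d (G s) x))) +
    \int[mu]_x (W x * (j (G s x) * Ld d (G s) x)).
  by rewrite -(intRD (NB_L1 cj) ki); apply: intR_ext => x; rewrite E.
by apply: lerD kle; exact: le_trans (ler_norm _) (NB_abs cj).
Qed.

Lemma kt_bL x t : 0 < x -> 0 < t <= S -> L1 mu (fun r => if 0 < r < t then b r x else 0).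
Proof.
move=> x0 /andP[t0 tS]; have [C C0 hC] := Ladj_ph_le d0 d4 e0 e4 x.
apply: (@L1_itv_bd _ _ (C * B)); first exact: (mfun_section2 x kt_mb).
move=> r /andP[r0 rt]; have /NBP[hi hb] := hB (ltac:(by rewrite r0 (le_trans (ltW rt) tS)) : 0 < r <= S).
apply: le_trans (intR_norm (L1_Ladj_ph d0 d4 e0 e4 x hi)) _.
apply: (@le_trans _ _ (C * \int[mu]_m `|h r m|)); last exact: ler_wpM2l.
rewrite -intRZ; last exact: L1_norm.
apply: intR_le; [exact/L1_norm/(L1_Ladj_ph d0 d4 e0 e4)|exact/L1Z/L1_norm|] => m.
rewrite normrM mulrC; apply: ler_wpM2r => //; apply: le_trans (hC m) _.
by apply: ler_piMr => //; exact: W_le1.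
Qed.

(** The convex chain rule is applied in time at each fixed x and then integrated against W dx. The
    time derivative is Ld (G s) up to the commutator, to which Kato's inequality applies. *)
Lemma kt_step t : 0 < t <= S -> U t <= A + 6 * Ic U 0 t.
Proof.
move=> tS; have /andP[t0 tS'] := tS; have mW := @mfun_W R.
have rS r : 0 < r < t -> 0 < r <= S by move=> /andP[r0 rt]; rewrite r0 (le_trans (ltW rt) tS').
have chain x : 0 < x ->
    L1 mu (fun r => if 0 < r < t then j (G r x) * b r x else 0) /\
    J (G t x) <= J (ph e x y) + \int[mu]_r (if 0 < r < t then j (G r x) * b r x else 0).
  (* At s = 0 the curve is given the value of the mollified Dirac mass at y, the right limit in the
     weak equation. *)
  move=> x0; pose a s := if 0 < s then G s x else ph e x y.
  have aE s : 0 <= s <= t -> a s = a 0 + Ic (fun r => b r x) 0 s.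
    rewrite {2}/a ltxx le_eqVlt => /andP[/predU1P[<-|s0] st].
      by rewrite /a ltxx Ic_empty addr0.
    by rewrite /a s0; apply: weak => //; rewrite s0 (le_trans st tS').
  have [c1 c2] := chain_convex (ltW t0) (Jn_sub e0) (jn_lip e0) (kt_bL x0 tS) aE.
  have EE r : (if 0 < r < t then jn e (a r) * b r x else 0) = (if 0 < r < t then j (G r x) * b r x else 0).
    by case: ifP => // /andP[r0 _]; rewrite /a r0.
  split; first by apply: L1_ext c1 _ => r; rewrite EE.
  move: c2; rewrite /a t0 ltxx -/a => c2; apply: le_trans c2 _.
  by rewrite lerD2l le_eqVlt; apply/orP; left; apply/eqP; apply: intR_ext => r; rewrite -EE.
pose F (z : R * R) := if 0 < z.2 < t then W z.1 * (j (G z.2 z.1) * b z.2 z.1) else 0.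
have mF : measfun F.
  apply: mfun_ite; [by mfun| |by mfun].
  apply: mfunM; first by apply: (mfun_comp mW); mfun.
  apply: mfunM; last by apply: (mfun_curry kt_mb); mfun.
  have m1 : measfun (fun z : R * R => G z.2 z.1) by apply: (mfun_curry kt_mG); mfun.
  exact: (mfun_comp (mfun_jn e) m1).
have Kb0 : 0 <= Kb.
  by have [_ [h1 _]] := kt_jb tS; apply: le_trans h1; apply: intR_ge0.
have [FI _] : L1 mu2 F /\ \int[mu2]_z `|F z| <= \int[mu]_r (if 0 < r < t then Kb else 0).
  apply: L1_prod_of2 => //; last by apply: (NB_L1 (NB_itv _ _)); exact: ltW.
  apply: aeW => r; rewrite /F/=; case: ifPn => hr; last exact: NB_0.
  by have [h1 [h2 _]] := kt_jb (rS r hr); apply/NBP.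
have Wp := NB_W_ph y e0 kt_e2.
have WJp : L1 mu (fun x => W x * J (ph e x y)).
  have mp := mfun_section2 y (mfun_ph e); rewrite /= in mp.
  have mJp := mfun_comp (mfun_Jn e) mp.
  apply: (@L1_le _ _ _ mu _ (fun x : R => `|W x * ph e x y|)); [by mfun| |exact/L1_norm/(NB_L1 Wp)].
  move=> x; rewrite !normrM (ger0_norm (W_ge0 x)) (ger0_norm (Jn_ge0 e0 _)).
  by apply: ler_wpM2l; [exact: W_ge0|exact: Jn_le].
have F1 := fub_L11 FI; have F2 := fub_L12 FI.
apply: (@le_trans _ _ (\int[mu]_x (W x * J (ph e x y) + \int[mu]_r F (x, r)))).
  apply: (intR_le (kt_WJL tS) (L1D WJp F1)) => x.
  have [x0|x0] := ltP 0 x; last first.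
    rewrite /F /W ltNge x0/= !mul0r add0r intR_eq0// => r.
    by rewrite mul0r if_same.
  have [c1 c2] := chain x x0.
  have -> : \int[mu]_r F (x, r) = W x * \int[mu]_r (if 0 < r < t then j (G r x) * b r x else 0).
    rewrite -(intRZ (W x) c1); apply: intR_ext => r; rewrite /F/=.
    by case: ifP => // _; rewrite mulr0.
  by rewrite -mulrDr; apply: ler_wpM2l; [exact: W_ge0|].
rewrite (intRD WJp F1) /A -addrA; apply: lerD.
  apply: le_trans (NB_abs Wp); apply: le_trans (ler_norm _).
  apply: (intR_le WJp (NB_L1 Wp)) => x; apply: ler_wpM2l; first exact: W_ge0.
  by apply: le_trans (Jn_le e0 _) _; rewrite ger0_norm// ph_ge0.
rewrite (fub_swap FI).
have ci := NB_itv (wn R n * B) (ltW t0).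
have Ui : L1 mu (fun r => if 0 < r < t then U r else 0).
  apply: (@L1_itv_bd _ _ (6 * bC R * B)); first exact: kt_mU.
  by move=> r hr; have /andP[u0 u1] := kt_U (rS r hr); rewrite ger0_norm.
apply: (@le_trans _ _ (\int[mu]_r ((if 0 < r < t then wn R n * B else 0) + 6 * (if 0 < r < t then U r else 0)))).
  apply: (intR_le F2 (L1D (NB_L1 ci) (L1Z 6 Ui))) => r; rewrite /F/=; case: ifPn => hr; last by rewrite intR0 mulr0 addr0.
  by have [_ [_ h3]] := kt_jb (rS r hr).
rewrite (intRD (NB_L1 ci) (L1Z 6 Ui)) (intRZ 6 Ui).
rewrite lerD2r; apply: le_trans (ler_norm _) _; apply: le_trans (NB_abs ci) _.
by rewrite subr0 (ger0_norm kt_wnB) mulrC; apply: ler_wpM2r => //; exact: kt_wnB.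
Qed.

Lemma kt_bound : NB mu (fun x => W x * J (G S x)) (2 * A * expR (2 * 6 * S)).
Proof.
have SS : 0 < S <= S by rewrite S0 lexx.
have A0 : 0 <= A.
  apply: addr_ge0; last by apply: mulr_ge0; [exact: ltW|exact: kt_wnB].
  apply: mulr_ge0; last exact: W_ge0.
  by apply: mulr_ge0; [exact: ler0n|exact: le_trans b1].
apply/NBP; split; first exact: kt_WJL.
have M0 : 0 <= 6 * bC R * B by have /andP[h1 h2] := kt_U SS; exact: le_trans h2.
have := gronwall A0 (ltr0n R 6) M0 S0 kt_mU kt_U kt_step.
apply: le_trans; rewrite le_eqVlt; apply/orP; left; apply/eqP; apply: intR_ext => x.
by rewrite ger0_norm// mulr_ge0 ?W_ge0 ?Jn_ge0.
Qed.

End Step.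

(** The a priori bound B enters only through the commutator error, which vanishes with n. The bound
    that survives is proportional to W y, and this is what makes it usable for all sources y at
    once. *)
Lemma kato_bound : NB mu (fun x => W x * h S x) (2 * (384 * bC R * W y) * expR (2 * 6 * S)).
Proof.
have SS : 0 < S <= S by rewrite S0 lexx.
have hi := NB_L1 (hB SS); have mhS := L1_meas hi; have mW := @mfun_W R.
suff H : NB mu (fun x => W x * `|h S x|) (2 * (384 * bC R * W y) * expR (2 * 6 * S)).
  apply: NB_le H _ => //; first by mfun.
  by move=> x; rewrite !normrM normr_id.
apply: (fatouR kt_bound); first by mfun.
- apply: (aeS (Tm_cvg hi)) => x hx; have [x0|x0] := ltP 0 x; last first.
    by rewrite /W ltNge x0/= mul0r; apply: cvg_near_cst; apply: nearW => n; rewrite mul0r.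
  apply: cvgMr; have hx2 : `|Tm (En R n) (h S) x| @[n --> \oo] --> `|h S x| by apply: cvg_norm; exact: hx.
  apply: (@squeeze_cvgr _ _ _ _ (fun n => `|Tm (En R n) (h S) x| - En R n)
    (fun n => `|Tm (En R n) (h S) x|)) => //.
  + by apply: nearW => n; rewrite Jn_ge ?Jn_le ?En_gt0.
  + rewrite -[X in _ --> X]subr0; apply: cvgB; [exact: hx2|exact: En_cvg].
- apply: cvgMl; apply: cvgMr; rewrite -[X in _ --> X]addr0; apply: cvgD; first exact: cvg_cst.
  rewrite -[X in _ --> X](mulr0 S); apply: cvgMr; rewrite -[X in _ --> X](mul0r B); apply: cvgMl.
  exact: wn_cvg.
Qed.

End Propagation.
End Kato.

(** * Cut-offs in time *)

Section SmoothStep.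
Variable R : realType.
Notation mu := (@lebesgue_measure R).
Implicit Types (f g a b : R -> R) (s t x d C : R).

Definition stepK x : R := \int[mu]_(t in [set` Interval -oo%O (BRight x)]) bump t.

Lemma bump_L1 : L1 mu (@bump R).
Proof.
apply: (@L1_ext _ _ _ mu _ (fun x : R => if -1 < x < 1 then bump x else 0)).
  apply: (@L1_itv_bd _ _ (bC R)); first exact: mfun_bump.
  by move=> y _; rewrite ger0_norm ?bump_le// bump_ge0.
move=> y; case: ifP => // /negbT h; apply: bump_out.
by rewrite ler_normr; move: h; rewrite negb_and -!leNgt => /orP[h|h]; apply/orP; [right|left]; lra.
Qed.

Lemma stepKE x : stepK x = \int[mu]_t (if t <= x then bump t else 0).
Proof.
rewrite /stepK Rintegral_mkcond; apply: intR_ext => t.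
by rewrite patchE mem_setE in_itv/=.
Qed.

Lemma stepK_L1 x : L1 mu (fun t => if t <= x then bump t else 0).
Proof.
have mb := @mfun_bump R.
apply: (@L1_le _ _ _ mu _ (@bump R)); [by mfun| |exact: bump_L1].
by move=> t; case: ifP => _; rewrite ?normr0 ?bump_ge0// ger0_norm ?bump_ge0.
Qed.

Lemma stepK_01 x : 0 <= stepK x <= 1.
Proof.
rewrite stepKE; apply/andP; split.
  by apply: intR_ge0 => t; case: ifP => // _; exact: bump_ge0.
rewrite -(@bump_int R); apply: intR_le; [exact: stepK_L1|exact: bump_L1|] => t.
by case: ifP => // _; exact: bump_ge0.
Qed.

Lemma stepK_left x : x <= -1 -> stepK x = 0.
Proof.
move=> x1; rewrite stepKE intR_eq0// => t.
case: ifP => // tx; apply: bump_out; rewrite ler_normr; apply/orP; right; lra.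
Qed.

Lemma stepK_right x : 1 <= x -> stepK x = 1.
Proof.
move=> x1; rewrite stepKE -(@bump_int R); apply: intR_ext => t.
case: ifPn => //; rewrite -ltNge => tx; rewrite bump_out// ler_normr; apply/orP; left; lra.
Qed.

Lemma stepK_derive x : derivable stepK x 1 /\ derive1 stepK x = bump x.
Proof.
apply: (@continuous_FTC1 R (@bump R) -oo%O x (x + 1)); rewrite ?ltrDl//.
- by apply: (@integrableS _ _ _ mu setT) => //; exact: bump_L1.
- exact: ltNyr.
- exact: bump_cont.
Qed.

Lemma Csm_stepK n : Csm n stepK.
Proof.
have d x : derivable stepK x 1 by have [] := stepK_derive x.
have e : derive1 stepK = @bump R by apply/funext => x; have [] := stepK_derive x.
by case: n => [|n]; split => //; rewrite e; exact: bump_Csm.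
Qed.

(** An approximate Dirac mass at t. The derivative of [hat], a smooth version of the indicator of
    (t0, t1), is the difference of two of them, so testing with [hat] recovers the values at t0 and
    t1. *)
Definition rho d t s : R := d^-1 * bump (d^-1 * s + - (t / d)).
Definition hat d t0 t1 s : R := stepK (d^-1 * s + - (t0 / d)) + -1 * stepK (d^-1 * s + - (t1 / d)).

Lemma rho_cvg a t (dn : nat -> R) D C : (forall n, 0 < dn n <= D) -> dn n @[n --> \oo] --> 0 ->
  measfun a -> (forall s, `|s - t| <= D -> `|a s| <= C) ->
  a s @[s --> t] --> a t ->
  \int[mu]_s (rho (dn n) t s * a s) @[n --> \oo] --> a t.
Proof.
move=> dD d0 ma aC ca; have mb := @mfun_bump R.
have E n : \int[mu]_s (rho (dn n) t s * a s) = \int[mu]_v (bump v * a (dn n * v + t)).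
  have /andP[dn0 _] := dD n.
  have mf : measfun (fun s => rho (dn n) t s * a s).
    apply: mfunM => //; apply: mfunM; first exact: mfun_cst.
    by apply: (mfun_comp mb); mfun.
  have := intR_affine t dn0 mf => h.
  have -> : \int[mu]_s (rho (dn n) t s * a s) = dn n * ((dn n)^-1 * \int[mu]_s (rho (dn n) t s * a s)).
    by rewrite mulrA divff ?gt_eqF// mul1r.
  rewrite -h; have md : measfun (fun v => bump v * a (dn n * v + t)).
    by apply: mfunM => //; apply: (mfun_comp ma); mfun.
  have -> : \int[mu]_x (rho (dn n) t (dn n * x + t) * a (dn n * x + t)) =
      \int[mu]_x ((dn n)^-1 * (bump x * a (dn n * x + t))).
    apply: intR_ext => v; rewrite /rho mulrA.
    have -> : (dn n)^-1 * (dn n * v + t) - t / dn n = v by field; rewrite gt_eqF.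
    by [].
  rewrite intRZ; first by rewrite mulrA divff ?gt_eqF// mul1r.
  apply: (@L1_le _ _ _ mu _ (fun v : R => C * bump v)) => //; last exact/L1Z/bump_L1.
  move=> v; rewrite normrM (ger0_norm (bump_ge0 v)) mulrC.
  have [v1|v1] := leP 1 `|v|; first by rewrite bump_out// !mulr0.
  apply: ler_wpM2r; first exact: bump_ge0.
  have /andP[_ dnD] := dD n.
  apply: aC; rewrite addrK normrM (gtr0_norm dn0); apply: le_trans dnD.
  by apply: ler_piMr; exact: ltW.
have -> : (fun n => \int[mu]_s (rho (dn n) t s * a s)) = (fun n => \int[mu]_v (bump v * a (dn n * v + t))).
  by apply/funext => n; exact: E.
have -> : a t = \int[mu]_v (bump v * a t).
  rewrite -[LHS]mulr1 -(@bump_int R) -intRZ; last exact: bump_L1.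
  by apply: intR_ext => v; rewrite mulrC.
apply: (@dct _ _ _ mu _ _ (fun v : R => C * bump v)).
- by move=> n; apply: mfunM => //; apply: (mfun_comp ma); mfun.
- by apply: mfunM => //; mfun.
- apply: aeW => v; apply: cvgMr.
  have lim : dn n * v + t @[n --> \oo] --> t.
    rewrite -[X in _ --> X]add0r; apply: cvgD; last exact: cvg_cst.
    by rewrite -[X in _ --> X](mul0r v); apply: cvgMl.
  exact: (cvg_comp _ a lim ca).
- exact/L1Z/bump_L1.
- move=> n; apply: aeW => v; rewrite normrM (ger0_norm (bump_ge0 v)) mulrC.
  have /andP[dn0 dnD] := dD n.
  have [v1|v1] := leP 1 `|v|; first by rewrite bump_out// !mulr0.
  apply: ler_wpM2r; first exact: bump_ge0.
  apply: aC; rewrite addrK normrM (gtr0_norm dn0); apply: le_trans dnD.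
  by apply: ler_piMr; exact: ltW.
Qed.

Section Hat.
Variables (d t0 t1 : R).
Hypotheses (d0 : 0 < d) (t01 : t0 <= t1) (dt : d < t0).

Lemma hat_arg s t : d^-1 * s + - (t / d) = (s - t) / d.
Proof. by field; rewrite gt_eqF. Qed.

Lemma hat_out s : ~ (t0 - d <= s <= t1 + d) -> hat d t0 t1 s = 0.
Proof.
rewrite /hat !hat_arg => h.
have [s1|s1] := ltP s (t0 - d).
  by rewrite !stepK_left ?mulr0 ?addr0// ler_pdivrMr//; move: t01; lra.
have [s2|s2] := ltP (t1 + d) s.
  by rewrite !stepK_right ?mulr1 ?subrr// ler_pdivlMr//; move: t01; lra.
by case: h; rewrite s1 s2.
Qed.

Lemma hat_bd s : `|hat d t0 t1 s| <= 1.
Proof.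
rewrite /hat !hat_arg; have /andP[h1 h2] := stepK_01 ((s - t0) / d).
have /andP[h3 h4] := stepK_01 ((s - t1) / d).
by rewrite mulN1r ler_norml; apply/andP; split; lra.
Qed.

Lemma hat_test : test_function (hat d t0 t1).
Proof.
split.
  apply: CsmP => n; apply: CsmD; first exact/Csm_affine/Csm_stepK.
  by apply: CsmM; [exact: Csm_cst|exact/Csm_affine/Csm_stepK].
exists (t0 - d), (t1 + d); split; last exact: hat_out; move: d0 t01 dt; lra.
Qed.

Lemma hat_derive s : derive1 (hat d t0 t1) s = rho d t0 s - rho d t1 s.
Proof.
have key t x : is_derive x 1 (fun s => stepK (d^-1 * s + - (t / d))) (rho d t x).
  have d2 : is_derive x 1 (fun y => d^-1 * y + - (t / d)) d^-1.
    by apply: is_derive_eq; rewrite /GRing.scale/=; ring.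
  have d1 : is_derive (d^-1 * x + - (t / d)) 1 stepK (bump (d^-1 * x + - (t / d))).
    by have [h1 h2] := stepK_derive (d^-1 * x + - (t / d)); rewrite -h2 derive1E; apply/derivableP.
  have := @is_derive1_comp _ stepK (fun y => d^-1 * y + - (t / d)) x _ _ d1 d2.
  by move=> h; apply: (is_derive_eq h); rewrite mulrC.
have k0 := key t0 s; have k1 := key t1 s.
have h : is_derive s 1 (hat d t0 t1) (rho d t0 s + -1 *: rho d t1 s).
  exact: (is_deriveD k0 (is_deriveZ (-1) k1)).
by rewrite derive1E derive_val /GRing.scale/= mulN1r.
Qed.

End Hat.

Lemma hat_cvg t0 t1 s (dn : nat -> R) : t0 <= t1 -> (forall n, 0 < dn n) -> dn n @[n --> \oo] --> 0 ->
  s != t0 -> s != t1 ->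
  hat (dn n) t0 t1 s @[n --> \oo] --> (if t0 < s < t1 then 1 else 0 : R).
Proof.
move=> t01 d0 dc st0 st1.
have small c : 0 < c -> \forall n \near \oo, dn n <= c.
  move=> c0; move/cvgrPdist_le : dc => /(_ _ c0); apply: filterS => n.
  by rewrite sub0r normrN => h; apply: le_trans (ler_norm _) h.
have a0 : 0 < `|s - t0| by rewrite normr_gt0 subr_eq0.
have a1 : 0 < `|s - t1| by rewrite normr_gt0 subr_eq0.
apply: cvg_near_cst; near=> n.
have h0 : dn n <= `|s - t0| by near: n; exact: small.
have h1 : dn n <= `|s - t1| by near: n; exact: small.
have K t : dn n <= `|s - t| -> stepK ((s - t) / dn n) = if t < s then 1 else 0.
  have [ts|ts] := ltP t s => h.
    by rewrite stepK_right// ler_pdivlMr// mul1r; move: h; rewrite gtr0_norm// subr_gt0.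
  by rewrite stepK_left// ler_pdivrMr//; move: h; rewrite ler0_norm ?subr_le0//; lra.
rewrite /hat !hat_arg ?K//.
case: (ltP t0 s) => s0 /=; last first.
  by rewrite ltNge (le_trans s0 t01)/= mulr0 addr0.
by have [s1|s1|e] := ltgtP s t1; rewrite ?mulr1 ?subrr ?mulr0 ?addr0//; move: st1; rewrite e eqxx.
Unshelve. all: by end_near. Qed.

(** Widths of at most t / 2, which keep the supports of the cut-offs inside the positive half
    line. *)
Definition dl t (n : nat) : R := t / n.+2%:R.
Lemma dl_gt0 t n : 0 < t -> 0 < dl t n.
Proof. by move=> t0; rewrite divr_gt0. Qed.
Lemma dl_le t n : 0 < t -> dl t n <= t / 2.
Proof. by move=> t0; rewrite ler_pM2l// lef_pV2 ?posrE// ler_nat. Qed.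
Lemma dl_cvg t : dl t n @[n --> \oo] --> 0.
Proof.
rewrite -[X in _ --> X](mulr0 t); apply: cvgMr.
by have := @cvg_harmonic R; rewrite -(cvg_shiftS (fun n => n.+1%:R^-1 : R)).
Qed.

(* du Bois-Reymond *)
Lemma weak_derivative_Ic a b t0 t1 C : 0 < t0 -> t0 <= t1 ->
  measfun a -> measfun b ->
  (forall s, t0 / 2 <= s <= 2 * t1 -> `|a s| <= C /\ `|b s| <= C) ->
  a s @[s --> t0] --> a t0 -> a s @[s --> t1] --> a t1 ->
  (forall eta, test_function eta ->
    \int[mu]_(s in `]0, +oo[%classic) (derive1 eta s * a s) =
    - \int[mu]_(s in `]0, +oo[%classic) (eta s * b s)) ->
  a t1 = a t0 + Ic b t0 t1.
Proof.
move=> t00 t01 ma mb bd c0 c1 H.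
have d0 n := dl_gt0 n t00; have dle n := dl_le n t00; have dc := dl_cvg t0.
have dlt n : dl t0 n < t0 by apply: le_lt_trans (dle n) _; lra.
have dD n : 0 < dl t0 n <= t0 / 2 by rewrite d0 dle.
have r0 : \int[mu]_s (rho (dl t0 n) t0 s * a s) @[n --> \oo] --> a t0.
  apply: (@rho_cvg a t0 (dl t0) (t0 / 2) C) => // s; rewrite ler_norml => /andP[h1 h2].
  by have [] := bd s (ltac:(apply/andP; split; lra)).
have r1 : \int[mu]_s (rho (dl t0 n) t1 s * a s) @[n --> \oo] --> a t1.
  apply: (@rho_cvg a t1 (dl t0) (t0 / 2) C) => // s; rewrite ler_norml => /andP[h1 h2].
  by have [] := bd s (ltac:(apply/andP; split; lra)).
have mh n : measfun (hat (dl t0 n) t0 t1).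
  apply: continuous_measurable_fun; apply: Csm_cont.
  apply: CsmD; first exact/Csm_affine/Csm_stepK.
  by apply: CsmM; [exact: Csm_cst|exact/Csm_affine/Csm_stepK].
have hb : \int[mu]_s (hat (dl t0 n) t0 t1 s * b s) @[n --> \oo] --> Ic b t0 t1.
  apply: (@dct _ _ _ mu _ _ (fun s : R => if t0 / 4 < s < 2 * t1 + 1 then `|C| else 0)).
  - by move=> n; apply: mfunM; [exact: mh|exact: mb].
  - by mfun.
  - apply: (aeI (ae_neq t0) (ae_neq t1)) => s s0 s1.
    have h := hat_cvg t01 d0 dc s0 s1.
    have -> : (if t0 < s < t1 then b s else 0) = (if t0 < s < t1 then 1 else 0) * b s.
      by case: ifP; rewrite ?mul1r ?mul0r.
    exact: cvgMl.
  - by apply: (NB_L1 (NB_itv _ _)); lra.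
  - move=> n; apply: aeW => s; have dn := dle n.
    have [h|h] := boolP (t0 - dl t0 n <= s <= t1 + dl t0 n); last first.
      rewrite hat_out ?mul0r ?normr0//; last exact/negP.
      by case: ifP.
    have [s1 s2] : t0 / 2 <= s /\ s <= 2 * t1 by move/andP : h => [h1 h2]; split; lra.
    have -> : t0 / 4 < s < 2 * t1 + 1 by apply/andP; split; lra.
    rewrite normrM -[leRHS]mul1r; apply: ler_pM => //; first exact: hat_bd.
    by have [_ k] := bd s (ltac:(by rewrite s1 s2)); apply: le_trans k (ler_norm _).
have rL n t : (t == t0) || (t == t1) -> L1 mu (fun s => rho (dl t0 n) t s * a s).
  move=> tt; have mbp := @mfun_bump R.
  have mr : measfun (rho (dl t0 n) t).
    by apply: mfunM; [exact: mfun_cst|apply: (mfun_comp mbp); mfun].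
  apply: (@L1_ext _ _ _ mu _ (fun s : R => if t - dl t0 n < s < t + dl t0 n then rho (dl t0 n) t s * a s else 0)).
    apply: (@L1_itv_bd _ _ ((dl t0 n)^-1 * bC R * C)); first exact: mfunM.
    move=> s /andP[h1 h2]; have dn := dle n.
    have [k _] : `|a s| <= C /\ `|b s| <= C.
      by apply: bd; apply/andP; case/orP: tt => /eqP tt; subst t; split; lra.
    rewrite normrM; apply: ler_pM => //.
    rewrite ger0_norm ?mulr_ge0 ?bump_ge0 ?invr_ge0 ?(ltW (d0 n))//.
    by rewrite ler_pM2l ?invr_gt0// bump_le.
  move=> s; case: ifPn => //; rewrite negb_and -!leNgt => h.
  rewrite /rho bump_out ?mulr0 ?mul0r// (hat_arg (d0 n) _ _) normrM normfV (gtr0_norm (d0 n)) ler_pdivlMr// mul1r.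
  by rewrite ler_normr; apply/orP; case/orP: h => h; [right|left]; lra.
have key n : \int[mu]_s (rho (dl t0 n) t0 s * a s) - \int[mu]_s (rho (dl t0 n) t1 s * a s) =
    - \int[mu]_s (hat (dl t0 n) t0 t1 s * b s).
  have := H _ (hat_test (d0 n) t01 (dlt n)); rewrite !intR_Rpos.
  rewrite -(intRB (rL n t0 (ltac:(by rewrite eqxx))) (rL n t1 (ltac:(by rewrite eqxx orbT)))) => h.
  have -> : \int[mu]_s (rho (dl t0 n) t0 s * a s - rho (dl t0 n) t1 s * a s) =
      \int[mu]_x (if 0 < x then derive1 (hat (dl t0 n) t0 t1) x * a x else 0).
    apply: intR_ext => s; rewrite -mulrBl -hat_derive; case: ifPn => //; rewrite -leNgt => s0.
    have out t : t0 <= t -> rho (dl t0 n) t s = 0.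
      move=> tt; rewrite /rho bump_out ?mulr0// (hat_arg (d0 n) _ _) normrM normfV (gtr0_norm (d0 n)).
      rewrite ler_pdivlMr// mul1r ler_normr; apply/orP; right; have := dlt n; lra.
    by rewrite hat_derive !out// subrr mul0r.
  rewrite h; congr (- _); apply: intR_ext => s; case: ifPn => //; rewrite -leNgt => s0.
  rewrite hat_out ?mul0r//; apply/negP; rewrite negb_and -ltNge; apply/orP; left.
  by have := dlt n; lra.
have L : a t0 - a t1 = - Ic b t0 t1.
  have h1 : (fun n => \int[mu]_s (rho (dl t0 n) t0 s * a s) - \int[mu]_s (rho (dl t0 n) t1 s * a s)) @ \oo --> a t0 - a t1.
    exact: cvgB r0 r1.
  have h2 : (fun n => - \int[mu]_s (hat (dl t0 n) t0 t1 s * b s)) @ \oo --> - Ic b t0 t1.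
    exact: cvgN hb.
  have E := funext key; rewrite E in h1.
  exact: (cvg_unique _ h1 h2).
by move: L; lra.
Qed.

End SmoothStep.

(** * The fundamental solution *)

Section UniformBoundedness.
Variable R : realType.
Notation mu := (@lebesgue_measure R).
Implicit Types (f g h phi : R -> R).

(** A continuous substitute for the sign of h: g / (|g| + dd), where g is a continuous L1
    approximation of h on a large interval. *)
Lemma continuous_norming h eta : L1 mu h -> 0 < eta -> exists phi : R -> R,
  [/\ continuous phi, forall x, `|phi x| <= 1 & \int[mu]_x `|h x| - eta <= \int[mu]_x (h x * phi x)].
Proof.
move=> hi eta0; have mh := L1_meas hi.
pose tl (n : nat) x := if - n%:R < x < n%:R then 0 else `|h x|.
have tlL n : L1 mu (tl n).
  apply: (@L1_le _ _ _ mu _ (fun x : R => `|h x|)); [by rewrite /tl; mfun| |exact: L1_norm].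
  by move=> x; rewrite /tl; case: ifP => _; rewrite ?normr0 ?normr_id.
have tl0 : \int[mu]_x tl n x @[n --> \oo] --> 0.
  rewrite -(@intR0 _ _ _ mu); apply: (@dct _ _ _ mu _ _ (fun x : R => `|h x|)).
  - by move=> n; exact: L1_meas (tlL n).
  - by mfun.
  - apply: aeW => x; apply: cvg_near_cst.
    have := @nbhs_infty_gtr R `|x|; apply: filterS => n.
    by rewrite /tl ltr_norml => ->.
  - exact: L1_norm.
  - by move=> n; apply: aeW => x; rewrite /tl; case: ifP => _; rewrite ?normr0 ?normr_id.
have e8 : 0 < eta / 8 by rewrite divr_gt0.
have /cvgrPdist_le/(_ _ e8)[n _ /(_ n (leqnn n))/=] := tl0.
rewrite sub0r normrN => /(le_trans (ler_norm _)) htl.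
pose E : set R := `]- n%:R, n%:R[%classic.
have n0 : 0 <= n%:R :> R by [].
have mE : measurable E by exact: measurable_itv.
have muE : (mu E < +oo)%E.
  have hm := lebesgue_measure_itv (`]- n%:R, n%:R[ : interval R); rewrite /= in hm.
  by rewrite [X in (X < _)%E]hm; case: ifP => _; rewrite ?ltry.
have hE : mu.-integrable E (EFin \o h).
  by apply: (@integrableS _ _ _ mu setT); [exact: measurableT|exact: mE|by []|exact: hi].
have [g_ [cg gi gc]] := approximation_continuous_integrable mE muE hE.
have [k hk] : exists k, \int[mu]_x (if - n%:R < x < n%:R then `|h x - g_ k x| else 0) <= eta / 8.
  move/fine_cvgP : gc => [_ gc]; move/cvgrPdist_le : gc => /(_ _ e8)[k _ /(_ k (leqnn k))/=].
  rewrite sub0r normrN => /(le_trans (ler_norm _)) H; exists k; apply: le_trans H.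
  by rewrite -intR_itv.
set g := g_ k in hk; have cgk : continuous g := cg k.
have mg : measfun g by exact: continuous_measurable_fun.
(* Over the interval of length 2 n the regularized sign costs at most eta / 4; the tail of h and its
   approximation each cost twice eta / 8. *)
pose dd := eta / 4 / (2 * n%:R + 1).
have d0 : 0 < dd by rewrite divr_gt0 ?divr_gt0// ltr_wpDl// mulr_ge0.
have den x : 0 < `|g x| + dd by rewrite ltr_wpDl.
pose phi x := g x / (`|g x| + dd).
have cphi : continuous phi.
  move=> x; apply: cvgM; first exact: cgk.
  apply: cvgV; first by rewrite gt_eqF.
  by apply: cvgD; [apply: cvg_norm; exact: cgk|exact: cvg_cst].
have phi1 x : `|phi x| <= 1.
  rewrite /phi normrM normfV (gtr0_norm (den x)) ler_pdivrMr// mul1r.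
  by rewrite lerDl ltW.
exists phi; split => //.
have mphi : measfun phi by exact: continuous_measurable_fun.
have hp : L1 mu (fun x => h x * phi x).
  apply: (@L1_ext _ _ _ mu _ (fun x : R => phi x * h x)); last by move=> x; rewrite mulrC.
  by apply: (@L1M _ _ _ mu 1).
have giE : L1 mu (fun x => if - n%:R < x < n%:R then `|h x - g x| else 0).
  have hL : L1 mu (fun x => if - n%:R < x < n%:R then h x else 0) := iffLR (L1_itv _ _ _) hE.
  have gL : L1 mu (fun x => if - n%:R < x < n%:R then g x else 0) := iffLR (L1_itv _ _ _) (gi k).
  apply: L1_ext (L1_norm (L1B hL gL)) _ => x.
  by case: ifP => //; rewrite subrr normr0.
have nn : - n%:R <= n%:R :> R by lra.
have di := NB_itv dd nn.
have sum := L1D (L1Z 2 (tlL n)) (L1D (L1Z 2 giE) (NB_L1 di)).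
have pt x : `|h x| <= h x * phi x + (2 * tl n x + (2 * (if - n%:R < x < n%:R then `|h x - g x| else 0) +
    (if - n%:R < x < n%:R then dd else 0))).
  rewrite /tl; case: ifP => _.
    rewrite mulr0 add0r.
    have h1 : `|g x| - dd <= g x * phi x.
      rewrite /phi mulrA ler_pdivlMr//.
      have -> : g x * g x = `|g x| * `|g x| by rewrite -normrM ger0_norm// -expr2 sqr_ge0.
      have := sqr_ge0 dd; rewrite expr2; set q := `|g x|; lra.
    have h2 : - `|h x - g x| <= (h x - g x) * phi x.
      apply: (@le_trans _ _ (- `|(h x - g x) * phi x|)).
        by rewrite lerN2 normrM ler_piMr.
      by rewrite lerNl; have := ler_norm (- ((h x - g x) * phi x)); rewrite normrN.
    have h3 : `|h x| <= `|h x - g x| + `|g x|.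
      by have := ler_normD (h x - g x) (g x); rewrite subrK.
    have -> : h x * phi x = g x * phi x + (h x - g x) * phi x by ring.
    by lra.
  rewrite mulr0 !addr0.
  have h2 : - `|h x| <= h x * phi x.
    apply: (@le_trans _ _ (- `|h x * phi x|)).
      by rewrite lerN2 normrM ler_piMr.
    by rewrite lerNl; have := ler_norm (- (h x * phi x)); rewrite normrN.
  lra.
have := intR_le (L1_norm hi) (L1D hp sum) pt.
rewrite (intRD hp sum) (intRD (L1Z 2 (tlL n)) (L1D (L1Z 2 giE) (NB_L1 di))).
rewrite (intRD (L1Z 2 giE) (NB_L1 di)) (intRZ 2 (tlL n)) (intRZ 2 giE).
have := le_trans (ler_norm _) (NB_abs di).
have : `|dd| * (n%:R - - n%:R) <= eta / 4.
  rewrite (gtr0_norm d0) /dd opprK.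
  have -> : eta / 4 / (2 * n%:R + 1) * (n%:R + n%:R) = (eta / 4) * ((2 * n%:R) / (2 * n%:R + 1)) by ring.
  rewrite ler_piMr//; first by rewrite divr_ge0// ltW.
  by rewrite ler_pdivrMr ?mul1r//; lra.
lra.
Qed.

(* Banach-Steinhaus by a gliding hump: sum_k +-3^-k phi_k with phi_k norming. *)
Lemma uniform_boundedness (T : Type) (h : T -> R -> R) : (forall s, L1 mu (h s)) ->
  (forall phi : R -> R, continuous phi -> (exists C, forall x, `|phi x| <= C) ->
     exists M, forall s, `|\int[mu]_x (h s x * phi x)| <= M) ->
  exists B, forall s, \int[mu]_x `|h s x| <= B.
Proof.
move=> hL wb; apply: contrapT => nB.
have big (B : R) : exists s, B < \int[mu]_x `|h s x|.
  apply: contrapT => /forallNP H; apply: nB; exists B => s.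
  by rewrite leNgt; apply/negP; exact: H.
pose s_ (k : nat) := sval (cid (big (4 ^+ k))).
have sP k : 4 ^+ k < \int[mu]_x `|h (s_ k) x| by rewrite /s_; case: cid.
pose N k := \int[mu]_x `|h (s_ k) x|.
have N0 k : 0 < N k by apply: lt_trans (sP k); rewrite exprn_gt0.
have ex k := continuous_norming (hL (s_ k)) (divr_gt0 (N0 k) (ltr0n R 4)).
pose f_ k := sval (cid (ex k)).
have fP k : [/\ continuous (f_ k), forall x, `|f_ k x| <= 1 &
    N k - N k / 4 <= \int[mu]_x (h (s_ k) x * f_ k x)] by rewrite /f_; case: cid.
pose T_ k (phi : R -> R) := \int[mu]_x (h (s_ k) x * phi x).
pose q k : R := (3 ^+ k)^-1.
have q0 k : 0 < q k by rewrite invr_gt0 exprn_gt0.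
have q3 k : q k.+1 = q k / 3 by rewrite /q exprS invfM mulrC.
(* The sign is chosen so that the earlier terms cannot cancel the new one: whatever T_k P is, one of
   the two signs keeps the modulus at least q T_k f. *)
pose sg k (P : R -> R) : R := if q k * T_ k (f_ k) <= `|T_ k P + q k * T_ k (f_ k)| then 1 else -1.
pose P := fix P k : R -> R := if k is k'.+1 then (fun x => P k' x + sg k' (P k') * q k' * f_ k' x) else (fun=> 0).
have sg1 k : `|sg k (P k)| = 1 by rewrite /sg; case: ifP => _; rewrite ?normrN normr1.
have PS k x : P k.+1 x = P k x + sg k (P k) * q k * f_ k x by [].
have cP k : continuous (P k).
  elim: k => [|k IH] x; first exact: cvg_cst.
  apply: cvgD; first exact: IH.
  by apply: cvgMr; have [cf _ _] := fP k; exact: cf.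
have step k x : `|P k.+1 x - P k x| <= q k.
  have [_ f1 _] := fP k.
  rewrite PS addrAC subrr add0r !normrM sg1 mul1r (gtr0_norm (q0 k)).
  by rewrite ler_piMr// ltW.
have diff k m x : `|P (k + m)%N x - P k x| <= 3 / 2 * (q k - q (k + m)%N).
  elim: m => [|m IH]; first by rewrite addn0 !subrr normr0 mulr0.
  have -> : P (k + m.+1)%N x - P k x = (P (k + m).+1 x - P (k + m)%N x) + (P (k + m)%N x - P k x).
    by rewrite addnS; ring.
  apply: le_trans (ler_normD _ _) _; have := step (k + m)%N x; rewrite addnS q3; lra.
have diff' k m x : (k <= m)%N -> `|P m x - P k x| <= 3 / 2 * q k.
  move=> km; have := diff k (m - k)%N x; rewrite subnKC// => h1; apply: le_trans h1 _.
  by have := q0 m; lra.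
have qc : q k @[k --> \oo] --> 0.
  have := @cvg_geometric R 1 (3^-1) (ltac:(rewrite ger0_norm ?invr_ge0// invf_lt1// ltr1n//)).
  rewrite /geometric/= => hg; apply: cvg_trans hg; apply: near_eq_cvg.
  by near=> n; rewrite mul1r /q exprVn.
have Pc x : cvgn (P ^~ x).
  apply: cauchy_cvg; apply/cauchy_exP => e e0.
  have /cvgrPdist_lt/(_ _ (divr_gt0 e0 (ltr0n R 2)))[k _ /(_ k (leqnn k))/=] := qc.
  rewrite sub0r normrN (gtr0_norm (q0 k)) => qk.
  exists (P k x); exists k => // m /= km; rewrite /ball/= distrC.
  by apply: le_lt_trans (diff' k m x km) _; lra.
pose phi x := limn (P ^~ x).
have phiP k x : `|phi x - P k x| <= 3 / 2 * q k.
  have h1 : `|P m x - P k x| @[m --> \oo] --> `|phi x - P k x|.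
    by apply: cvg_norm; apply: cvgB; [exact: Pc|exact: cvg_cst].
  apply: (@ler_cvg_to _ _ _ _ (fun m => `|P m x - P k x|) (fun _ : nat => 3 / 2 * q k) _ _ h1 (cvg_cst _)).
  by near=> m; apply: diff'; near: m; exact: nbhs_infty_ge.
have cphi : continuous phi.
  move=> x; apply/cvgrPdist_le => e e0.
  have e4 : 0 < e / 6 by rewrite divr_gt0.
  have /cvgrPdist_lt/(_ _ e4)[k _ /(_ k (leqnn k))/=] := qc.
  rewrite sub0r normrN (gtr0_norm (q0 k)) => qk.
  have e2 : 0 < e / 2 by rewrite divr_gt0.
  have /cvgrPdist_le/(_ _ e2) := cP k x; apply: filterS => y hy.
  have -> : phi x - phi y = (phi x - P k x) + (P k x - P k y) - (phi y - P k y) by ring.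
  apply: le_trans (ler_normB _ _) _.
  have := ler_normD (phi x - P k x) (P k x - P k y).
  have := phiP k x; have := phiP k y; lra.
have q00 : q 0%N = 1 by rewrite /q expr0 invr1.
have phib x : `|phi x| <= 3 / 2.
  by have := phiP 0%N x; rewrite /= subr0 q00 mulr1.
have [M hM] := wb phi cphi (ex_intro _ _ phib).
have Pb k x : `|P k x| <= 3 / 2.
  have := diff' 0%N k x (leq0n k); rewrite /= subr0 q00; lra.
have TL k (p : R -> R) C : continuous p -> (forall x, `|p x| <= C) -> L1 mu (fun x => h (s_ k) x * p x).
  move=> cp pC; apply: (@L1_ext _ _ _ mu _ (fun x : R => p x * h (s_ k) x)); last by move=> x; rewrite mulrC.
  by apply: (@L1M _ _ _ mu C) => //; exact: continuous_measurable_fun.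
(* The partial sum through the k-th hump gives at least 3/4 q N against h (s_ k), and all later
   humps give at most 3/2 * (q / 3) * N = q N / 2. So M bounds a fixed multiple of q N. *)
have key k : q k * (N k / 4) - q k * (N k / 4) / 3 <= M.
  have [cf f1 fN] := fP k.
  have L1P := TL k _ _ (cP k) (Pb k); have L1f := TL k _ _ cf f1.
  have L1S := TL k _ _ (cP k.+1) (Pb k.+1).
  have EP : T_ k (P k.+1) = T_ k (P k) + sg k (P k) * (q k * T_ k (f_ k)).
    rewrite /T_ mulrA -(intRZ (sg k (P k) * q k) L1f) -(intRD L1P (L1Z _ L1f)).
    by apply: intR_ext => x; rewrite PS; ring.
  have Tf : 3 / 4 * N k <= T_ k (f_ k) by move: fN; rewrite -/(T_ k (f_ k)); lra.
  have big1 : q k * T_ k (f_ k) <= `|T_ k (P k.+1)|.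
    rewrite EP /sg; case: ifPn => [|]; first by rewrite mul1r.
    rewrite -ltNge mulN1r; set A := T_ k (P k); set Bq := q k * _ => hlt.
    have B0 : 0 <= Bq by rewrite mulr_ge0 ?(ltW (q0 k))//; have := N0 k; lra.
    have Aneg : A < 0.
      by rewrite ltNge; apply/negP => A0; move: hlt; rewrite ger0_norm ?addr_ge0//; lra.
    by rewrite ler0_norm; lra.
  have df : `|T_ k phi - T_ k (P k.+1)| <= 3 / 2 * q k.+1 * N k.
    have L1p := TL k _ _ cphi phib.
    rewrite /T_ -(intRB L1p L1S) /N -(intRZ _ (L1_norm (hL (s_ k)))).
    apply: le_trans (intR_norm (L1B L1p L1S)) _.
    apply: (intR_le (L1_norm (L1B L1p L1S)) (L1Z _ (L1_norm (hL (s_ k))))) => x.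
    by rewrite -mulrBr normrM mulrC ler_wpM2r.
  have := hM (s_ k); rewrite -/(T_ k phi).
  have h1 : `|T_ k (P k.+1)| <= `|T_ k phi| + `|T_ k phi - T_ k (P k.+1)|.
    have := ler_normB (T_ k phi) (T_ k phi - T_ k (P k.+1)).
    by rewrite opprB addrCA subrr addr0.
  have h2 : q k * (3 / 4 * N k) <= q k * T_ k (f_ k) by rewrite ler_pM2l.
  rewrite q3 in df; move: df.
  have -> : 3 / 2 * (q k / 3) * N k = (q k * N k) / 2 by field.
  have -> : q k * (N k / 4) - q k * (N k / 4) / 3 = (q k * N k) / 6 by field.
  have e3 : q k * (3 / 4 * N k) = 3 / 4 * (q k * N k) by ring.
  have qN : 0 <= q k * N k by rewrite mulr_ge0 ?(ltW (q0 k)) ?(ltW (N0 k)).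
  rewrite e3 in h2; lra.
(* Because N k > 4^k, the product exceeds (4/3)^k, which grows at least linearly. *)
have grow (k : nat) : k%:R / 3 <= q k * N k.
  apply: (@le_trans _ _ (q k * 4 ^+ k)); last by rewrite ler_pM2l// ltW.
  have -> : q k * 4 ^+ k = (4 / 3) ^+ k by rewrite /q expr_div_n mulrC.
  have -> : (4 / 3 : R) = 1 + 3^-1 by field.
  have b : 0 <= (3^-1 : R) by rewrite invr_ge0.
  elim: k => [|k IH]; first by rewrite mul0r.
  have k1 : 1 <= (1 + 3^-1 : R) ^+ k by apply: exprn_ege1; lra.
  rewrite exprS mulrDl mul1r -natr1 mulrDl mul1r; apply: lerD => //.
  by rewrite ler_peMr.
have [k hk] : exists k : nat, 18 * `|M| < k%:R.
  by exists (Num.bound (18 * `|M|)); apply: archi_boundP; rewrite mulr_ge0.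
have := key k; have := grow k; have := ler_norm M.
have -> : q k * (N k / 4) - q k * (N k / 4) / 3 = (q k * N k) / 6 by field.
lra.
Unshelve. all: by end_near. Qed.

End UniformBoundedness.

Section Restriction.
Variable R : realType.
Notation mu := (@lebesgue_measure R).

Lemma mfun_Qpos (F : R * R -> R) :
  measurable_fun (`]0, +oo[%classic `*` `]0, +oo[%classic : set (R * R)) F ->
  measfun (fun z : R * R => if (0 < z.1) && (0 < z.2) then F z else 0).
Proof.
move=> mF; have mQ : measurable (`]0, +oo[%classic `*` `]0, +oo[%classic : set (R * R)).
  by apply: measurableX; exact: measurable_itv.
have := iffLR (measurable_restrictT F mQ) mF; congr (measfun _).
apply/funext => z; rewrite patchE.
have -> : (z \in (`]0, +oo[%classic `*` `]0, +oo[%classic : set (R * R))) = (0 < z.1) && (0 < z.2).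
  apply/idP/idP; first by rewrite inE/= !in_itv/= !andbT => -[-> ->].
  by move=> /andP[h1 h2]; rewrite inE/= !in_itv/= !andbT.
by [].
Qed.

Lemma L1_continuous_near (I : set R) (h : R -> R -> R) t eps : L1_continuous I h -> I t -> 0 < eps ->
  \forall s \near t, I s ->
    \int[mu]_x `|(if 0 < x then h s x else 0) - (if 0 < x then h t x else 0)| <= eps.
Proof.
move=> [_ hc] It eps0; move/cvgrPdist_le : (hc t It) => /(_ _ eps0).
rewrite near_withinE; apply: filterS => s H Is; have := H Is.
rewrite sub0r normrN; apply: le_trans; apply: le_trans (ler_norm _).
rewrite intR_Rpos le_eqVlt; apply/orP; left; apply/eqP; apply: intR_ext => x.
by case: ifP => //; rewrite subrr normr0.
Qed.

End Restriction.

Section FundamentalSolution.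
Variable R : realType.
Notation mu := (@lebesgue_measure R).
Variable Lam : R -> R -> R.
Hypothesis HF : fundamental_solution Lam.
Implicit Types (s t r x y m : R) (phi psi : R -> R).

Definition Lam0 s x : R := if (0 < s) && (0 < x) then Lam s x else 0.

Lemma mfun_Lam0 : measfun2 R Lam0.
Proof. by have [mL _ _ _] := HF; exact: (mfun_Qpos mL). Qed.

Lemma Lam0_L1 s : L1 mu (Lam0 s).
Proof.
have [s0|s0] := ltP 0 s; last first.
  by apply: L1_ext (L1_0 mu) _ => x; rewrite /Lam0 ltNge s0.
have [_ [Li _] _ _] := HF; have h := Li s (ltac:(by rewrite /= in_itv/= s0)).
by apply: L1_ext (iffLR (L1_Rpos _) h) _ => x; rewrite /Lam0 s0.
Qed.

Lemma Lam0_cont t eps : 0 < t -> 0 < eps ->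
  \forall s \near t, \int[mu]_x `|Lam0 s x - Lam0 t x| <= eps.
Proof.
move=> t0 eps0; have [_ Lc _ _] := HF.
have h := @L1_continuous_near R _ Lam t eps Lc (ltac:(by rewrite /= in_itv/= t0)) eps0.
have p : \forall s \near t, 0 < s by exact: lt_nbhsr.
apply: filterS2 h p => s H s0; have {}H := H (ltac:(by rewrite /= in_itv/= s0)).
apply: le_trans H; rewrite le_eqVlt; apply/orP; left; apply/eqP; apply: intR_ext => x.
by rewrite /Lam0 s0 t0.
Qed.

Lemma pair_L1 s psi C : measfun psi -> (forall x, `|psi x| <= C) ->
  L1 mu (fun x => Lam0 s x * psi x).
Proof.
move=> mp pC; apply: (@L1_ext _ _ _ mu _ (fun x : R => psi x * Lam0 s x)); last by move=> x; rewrite mulrC.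
by apply: (@L1M _ _ _ mu C) => //; exact: Lam0_L1.
Qed.

Lemma pair_cont psi C t : measfun psi -> (forall x, `|psi x| <= C) -> 0 < t ->
  (\int[mu]_x (Lam0 s x * psi x)) @[s --> t] --> \int[mu]_x (Lam0 t x * psi x).
Proof.
move=> mp pC t0; have C0 : 0 <= C := le_trans (normr_ge0 _) (pC 0).
apply/cvgrPdist_le => eps eps0.
have e1 : 0 < eps / (C + 1) by rewrite divr_gt0//; lra.
apply: filterS (Lam0_cont t0 e1) => s hs.
rewrite -(intRB (pair_L1 t mp pC) (pair_L1 s mp pC)).
apply: le_trans (intR_norm (L1B (pair_L1 t mp pC) (pair_L1 s mp pC))) _.
have dL := L1_norm (L1B (Lam0_L1 s) (Lam0_L1 t)).
apply: (@le_trans _ _ (C * \int[mu]_x `|Lam0 s x - Lam0 t x|)).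
  rewrite -(intRZ C dL); apply: (intR_le (L1_norm (L1B (pair_L1 t mp pC) (pair_L1 s mp pC))) (L1Z C dL)) => x.
  by rewrite -mulrBl normrM mulrC distrC ler_wpM2r.
apply: (@le_trans _ _ (C * (eps / (C + 1)))); first exact: ler_wpM2l.
by rewrite mulrA ler_pdivrMr; [nra|lra].
Qed.

Lemma pair_init phi C : continuous phi -> (forall x, `|phi x| <= C) ->
  (\int[mu]_x (Lam0 s x * phi x)) @[s --> 0^'+] --> phi 1.
Proof.
move=> cp pC; have [_ _ _ Li] := HF.
have h := Li phi (continuous_subspaceT cp) (ex_intro _ C (fun x _ => pC x)).
apply: cvg_trans h; apply: near_eq_cvg.
near=> s; have s0 : 0 < s by near: s; exact: nbhs_right_gt.
rewrite intR_Rpos; apply: intR_ext => x; rewrite /Lam0 s0/=.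
by case: ifP => //; rewrite mul0r.
Unshelve. all: by end_near. Qed.

Lemma Lam0_unif S : 0 < S -> exists2 B, 0 <= B & forall s, 0 < s <= S -> NB mu (Lam0 s) B.
Proof.
move=> S0; pose h s x := if s <= S then Lam0 s x else 0.
have hL s : L1 mu (h s).
  by rewrite /h; case: (s <= S); [exact: Lam0_L1|exact: L1_0].
have [|B hB] := @uniform_boundedness R R h hL.
  move=> phi cp [C pC]; have mp : measfun phi by exact: continuous_measurable_fun.
  pose F s := \int[mu]_x (Lam0 s x * phi x).
  have /cvgrPdist_le/(_ _ ltr01) := pair_init cp pC.
  rewrite near_withinE => -[d /= d0 hd].
  have n0 s : 0 < s -> s < d -> `|F s| <= `|phi 1| + 1.
    move=> s0 sd; have /(_ s0) k := hd s (ltac:(by rewrite /= sub0r normrN gtr0_norm)).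
    have -> : F s = phi 1 - (phi 1 - F s) by ring.
    by apply: le_trans (ler_normB _ _) _; rewrite lerD2l.
  pose sg := Num.min (d / 2) S.
  have sg0 : 0 < sg by rewrite lt_min S0 divr_gt0.
  have sgS : sg <= S by rewrite ge_min lexx orbT.
  have sgd : sg < d by rewrite gt_min; apply/orP; left; lra.
  have cF : {within `[sg, S], continuous (fun s => `|F s|)}.
    apply: continuous_in_subspaceT => s; rewrite inE/= in_itv/= => /andP[s1 _].
    apply: cvg_norm; apply: (pair_cont mp pC); exact: lt_le_trans s1.
  have [c _ hc] := EVT_max sgS cF.
  have h0 (x : R) : `|phi 1| + 1 <= `|phi 1| + 1 + `|F c|  by rewrite lerDl.
  exists (`|phi 1| + 1 + `|F c|) => s.
  have z0 : (0 : R) <= `|phi 1| + 1 + `|F c| by rewrite !addr_ge0.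
  have [sS|sS] := leP s S; last first.
    rewrite intR_eq0 ?normr0// => x.
    by rewrite /h leNgt sS/= mul0r.
  have [s0|s0] := ltP 0 s; last first.
    rewrite intR_eq0 ?normr0// => x.
    by rewrite /h sS /Lam0 ltNge s0/= mul0r.
  have -> : \int[mu]_x (h s x * phi x) = F s by apply: intR_ext => x; rewrite /h sS.
  have [s1|s1] := ltP s sg.
    by apply: le_trans (n0 s s0 (lt_trans s1 sgd)) (h0 0).
  have := hc s (ltac:(by rewrite in_itv/= s1)).
  by move=> /le_trans; apply; rewrite lerDr addr_ge0.
exists (Num.max B 0); first by rewrite le_max lexx orbT.
move=> s /andP[s0 sS]; apply/NBP; split; first exact: Lam0_L1.
apply: (@le_trans _ _ B); last by rewrite le_max lexx.
apply: le_trans (hB s); rewrite le_eqVlt; apply/orP; left; apply/eqP.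
by apply: intR_ext => x; rewrite /h sS.
Qed.

Lemma jump_op_adjE phi m : measfun phi -> 0 < m -> jump_op_adj (@kerL R) phi m = Ladj phi m.
Proof.
move=> mp m0; rewrite /jump_op_adj intR_Rpos.
have mk1 := mfun_section1 m (@mfun_kL R); have mk2 := mfun_section2 m (@mfun_kL R).
rewrite /= in mk1 mk2.
apply: intR_ae.
- apply: mfun_ite; [by mfun| |by mfun].
  by apply: mfunB; apply: mfunM; [|rewrite /kerL; mfun| |rewrite /kerL; mfun].
- by apply: mfunB; mfun.
apply: (aeS (ae_neq m)) => y ym; case: ifPn => [y0|]; last first.
  rewrite -leNgt => y0; rewrite !kL_eq0 ?mulr0 ?subrr// negb_and -!leNgt y0 ?orbT//.
by rewrite !kerLE// eq_sym.
Qed.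

Section Weak.
Variables (n : nat) (x : R).
Hypothesis x0 : 0 < x.
Let e := En R n.
Let phi := ph e x.
Let e0 : 0 < e := En_gt0 R n.
Let e4 : e <= 4^-1 := En_le4 R n.
Let a s := \int[mu]_m (Lam0 s m * phi m).
Let b s := \int[mu]_m (Lam0 s m * Ladj phi m).

Lemma wk_cphi : continuous phi.
Proof.
have -> : phi = fun m => (e * x)^-1 * bump ((e * x)^-1 * m + - e^-1).
  by apply/funext => m; rewrite /phi /ph x0.
apply: Csm_cont; apply: CsmM; first exact: Csm_cst.
apply: Csm_affine; exact: bump_Csm.
Qed.

Lemma wk_phib m : `|phi m| <= bC R / (e * x).
Proof. by rewrite ger0_norm ?ph_ge0 ?ph_le. Qed.

Lemma wk_mphi : measfun phi.
Proof. exact: continuous_measurable_fun wk_cphi. Qed.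

Lemma wk_psib : exists C, forall m, `|Ladj phi m| <= C.
Proof.
have [C C0 hC] := Ladj_ph_le (Dn_gt0 R 0) (Dn_le4 R 0) e0 e4 x.
by exists C => m; apply: le_trans (hC m) _; rewrite ler_piMr// W_le1.
Qed.

Lemma wk_mpsi : measfun (Ladj phi).
Proof. exact: (mfun_section1 x (mfun_Ladj_ph e)). Qed.

Lemma wk_ma : measfun a.
Proof.
apply: (@mfun_intR1 _ _ _ _ _ mu (fun z : R * R => Lam0 z.1 z.2 * phi z.2)).
by apply: mfunM; [exact: mfun_Lam0|apply: (mfun_comp wk_mphi); mfun].
Qed.

Lemma wk_mb : measfun b.
Proof.
apply: (@mfun_intR1 _ _ _ _ _ mu (fun z : R * R => Lam0 z.1 z.2 * Ladj phi z.2)).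
by apply: mfunM; [exact: mfun_Lam0|apply: (mfun_comp wk_mpsi); mfun].
Qed.

Lemma wk_bound S : 0 < S -> exists C, forall s, 0 < s <= S -> `|a s| <= C /\ `|b s| <= C.
Proof.
move=> S0; have [B B0 hB] := Lam0_unif S0; have [C hC] := wk_psib.
have C0 : 0 <= C := le_trans (normr_ge0 _) (hC 0).
have C10 : 0 <= bC R / (e * x) := le_trans (normr_ge0 _) (wk_phib 0).
exists ((bC R / (e * x) + C) * B) => s sS; have /NBP[_ hs] := hB s sS.
have key psi D : measfun psi -> (forall m, `|psi m| <= D) ->
    `|\int[mu]_m (Lam0 s m * psi m)| <= D * B.
  move=> mp pD; have D0 : 0 <= D := le_trans (normr_ge0 _) (pD 0).
  have pl := pair_L1 s mp pD; apply: le_trans (intR_norm pl) _.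
  apply: (@le_trans _ _ (D * \int[mu]_m `|Lam0 s m|)); last exact: ler_wpM2l.
  have ll := L1_norm (Lam0_L1 s); rewrite -(intRZ D ll).
  apply: (intR_le (L1_norm pl) (L1Z D ll)) => m.
  by rewrite normrM mulrC ler_wpM2r.
split.
  by apply: le_trans (key _ _ wk_mphi wk_phib) _; rewrite ler_wpM2r// lerDl.
by apply: le_trans (key _ _ wk_mpsi hC) _; rewrite ler_wpM2r// lerDr.
Qed.

(** The distributional equation relates two positive times. The lower one is sent to 0 with the weak
    initial condition, while the uniform L1 bound makes b integrable at 0. *)
Lemma weak_Lam0 s : 0 < s -> L1 mu (fun r => if 0 < r < s then b r else 0) /\
  a s = phi 1 + Ic b 0 s.
Proof.
move=> s0; have [C hC] := wk_bound (mulr_gt0 (ltr0n R 2) s0).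
have bi : L1 mu (fun r => if 0 < r < s then b r else 0).
  apply: (@L1_itv_bd _ _ C); first exact: wk_mb.
  by move=> r /andP[r0 rs]; have [_ ->] := hC r (ltac:(apply/andP; split; lra)).
split => //.
have [_ _ Lw _] := HF.
have step t0 : 0 < t0 -> t0 <= s -> a s = a t0 + Ic b t0 s.
  move=> t00 t0s; have [D hD] := wk_psib.
  apply: (@weak_derivative_Ic R a b t0 s C) => //; [exact: wk_ma|exact: wk_mb| | | |].
  - by move=> r /andP[r1 r2]; apply: hC; apply/andP; split; lra.
  - exact: (pair_cont wk_mphi wk_phib).
  - exact: (pair_cont wk_mphi wk_phib).
  move=> eta teta; have e1 : e < 1 by move: e4; lra.
  have tphi : test_function phi by exact: ph_test.
  pose A r := \int[mu]_(m in `]0, +oo[%classic) (Lam r m * phi m).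
  pose A' r := \int[mu]_(m in `]0, +oo[%classic) (Lam r m * jump_op_adj (@kerL R) phi m).
  have H : \int[mu]_(r in `]0, +oo[%classic) (derive1 eta r * A r) =
    - \int[mu]_(r in `]0, +oo[%classic) (eta r * A' r) := Lw eta phi teta tphi.
  have EA r : 0 < r -> A r = a r.
    move=> r0; rewrite /A intR_Rpos; apply: intR_ext => m.
    by rewrite /Lam0 r0/=; case: ifP => //; rewrite mul0r.
  have EA' r : 0 < r -> A' r = b r.
    move=> r0; rewrite /A' intR_Rpos; apply: intR_ext => m.
    rewrite /Lam0 r0/=; case: ifPn => [m0|_]; last by rewrite mul0r.
    by rewrite (jump_op_adjE wk_mphi m0).
  have congr_Rpos (f1 f2 : R -> R) : (forall r, 0 < r -> f1 r = f2 r) ->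
      \int[mu]_(r in `]0, +oo[%classic) f1 r = \int[mu]_(r in `]0, +oo[%classic) f2 r.
    move=> ff; rewrite (intR_Rpos f1) (intR_Rpos f2); apply: intR_ext => r.
    by case: ifP => // /ff.
  have h1 := @congr_Rpos (fun r => derive1 eta r * a r) (fun r => derive1 eta r * A r)
    (fun r (p : 0 < r) => congr1 (fun z => derive1 eta r * z) (esym (EA r p))).
  have h2 := @congr_Rpos (fun r => eta r * A' r) (fun r => eta r * b r)
    (fun r (p : 0 < r) => congr1 (fun z => eta r * z) (EA' r p)).
  exact: (etrans h1 (etrans H (congr1 (fun z => - z) h2))).
apply/eqP; rewrite -subr_eq0 -normr_le0; apply/ler_addgt0Pr => eps eps0; rewrite add0r.
have e2 : 0 < eps / 2 by rewrite divr_gt0.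
have /cvgrPdist_le/(_ _ e2) := pair_init wk_cphi wk_phib.
rewrite near_withinE => -[d /= d0 hd].
have [dd dd0 hdd] := Ic_small bi e2.
pose t0 := Num.min (Num.min (d / 2) (dd / 2)) s.
have t00 : 0 < t0 by rewrite !lt_min s0 !divr_gt0.
have t0s : t0 <= s by rewrite ge_min lexx orbT.
have t0d : t0 < d by rewrite !gt_min; apply/orP; left; apply/orP; left; lra.
have t0dd : t0 - 0 < dd by rewrite subr0 !gt_min; apply/orP; left; apply/orP; right; lra.
rewrite (step t0 t00 t0s) (Ic_split (ltW t00) t0s bi).
have -> : a t0 + Ic b t0 s - (phi 1 + (Ic b 0 t0 + Ic b t0 s)) = - (phi 1 - a t0) - Ic b 0 t0 by ring.
apply: le_trans (ler_normB _ _) _; rewrite normrN.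
have h1 := hd t0 (ltac:(by rewrite /= sub0r normrN gtr0_norm)) t00.
have h2 := hdd 0 t0 (lexx 0) (ltW t00) t0s t0dd.
have h3 := Ic_norm (Ic_sub bi (lexx 0) t0s).
rewrite -/(a t0) in h1; lra.
Qed.

End Weak.

(** Solution at time s started from the Dirac mass at y. The operator is homogeneous of degree -1,
    so time scales like length. *)
Definition Hk y s x : R := y^-1 * Lam0 (s / y) (x / y).

Lemma mfun_Hk : measfun (fun w : (R * R) * R => Hk w.1.1 w.1.2 w.2).
Proof. by apply: mfunM; [mfun|apply: (mfun_curry mfun_Lam0); mfun]. Qed.

Lemma Hk_L1 y s : 0 < y -> L1 mu (Hk y s).
Proof.
move=> y0; have i0 : 0 < y^-1 by rewrite invr_gt0.
apply: (@L1_ext _ _ _ mu _ (fun x : R => y^-1 * Lam0 (s / y) (y^-1 * x))).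
  exact/L1Z/(L1_dil i0)/Lam0_L1.
by move=> x; rewrite /Hk (mulrC x).
Qed.

Lemma int_Hk y s psi C : 0 < y -> measfun psi -> (forall x, `|psi x| <= C) ->
  \int[mu]_x (Hk y s x * psi x) = \int[mu]_t (Lam0 (s / y) t * psi (y * t)).
Proof.
move=> y0 mp pC; have i0 : 0 < y^-1 by rewrite invr_gt0.
have mpy : measfun (fun t => psi (y * t)) by apply: (mfun_comp mp); mfun.
have fL := pair_L1 (s / y) mpy (fun t => pC (y * t)).
have := intR_dil i0 (L1_meas fL); rewrite invrK => h.
transitivity (\int[mu]_x (y^-1 * (Lam0 (s / y) (y^-1 * x) * psi (y * (y^-1 * x))))).
  apply: intR_ext => x; rewrite /Hk (mulrC x).
  have -> : y * (y^-1 * x) = x by rewrite mulrA divff ?mul1r// gt_eqF.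
  by ring.
rewrite (intRZ y^-1 (L1_dil i0 fL)) h mulrA mulVf ?mul1r//.
by rewrite gt_eqF.
Qed.

Lemma NB_Hk y s B : 0 < y -> NB mu (Lam0 (s / y)) B -> NB mu (Hk y s) B.
Proof.
move=> y0 hB; have i0 : 0 < y^-1 by rewrite invr_gt0.
have mH := L1_meas (Hk_L1 s y0).
apply: NB_le (NBZ y^-1 (NB_dil i0 hB)) _ => //.
- by move=> x; rewrite /Hk mulrC (mulrC x) mulrC.
- by rewrite invrK (gtr0_norm i0) mulrA mulVf ?mul1r// gt_eqF.
Qed.

Lemma ph_scale e x y m : 0 < e -> 0 < x -> 0 < y -> ph e x (y * m) = y^-1 * ph e (x / y) m.
Proof.
move=> e0 x0 y0; have xy : 0 < x / y by rewrite divr_gt0.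
rewrite /ph x0 xy; have -> : (e * (x / y))^-1 * m = (e * x)^-1 * (y * m) by field; rewrite !gt_eqF.
by field; rewrite !gt_eqF.
Qed.

Lemma Ladj_int_L1 e x m : 0 < e -> e <= 4^-1 -> 0 < x ->
  L1 mu (fun y => ph e x y * kL y m - ph e x m * kL m y).
Proof.
move=> e0 e4 x0; have [m0|m0] := ltP 0 m; last first.
  apply: L1_ext (L1_0 mu) _ => y.
  by rewrite !kL_eq0 ?mulr0 ?subrr// negb_and -!leNgt m0 ?orbT.
have d0 := Dn_gt0 R 0; have d4 := Dn_le4 R 0.
have h1 := NB_L1 (near_int_L1 d0 d4 e0 e4 x0 m0).
have h2 := NB_L1 (far_int_L1 d0 d4 e0 e4 m x0).
have h3 := L1_kLd d0 (Dn_lt1 R 0) m0.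
apply: L1_ext (L1D h1 (L1B h2 (L1Z (ph e x m) h3))) _ => y.
rewrite /kLd (farC (Dn R 0) y m).
by case: ifP => _; rewrite ?add0r// !mulr0 subrr addr0.
Qed.

Lemma Ladj_scale e x y m : 0 < e -> e <= 4^-1 -> 0 < x -> 0 < y ->
  Ladj (ph e (x / y)) m = y ^+ 2 * Ladj (ph e x) (y * m).
Proof.
move=> e0 e4 x0 y0; rewrite /Ladj; have xy : 0 < x / y by rewrite divr_gt0.
have mk1 := mfun_section1 (y * m) (@mfun_kL R); have mk2 := mfun_section2 (y * m) (@mfun_kL R).
have mp := mfun_section1 x (mfun_ph e); rewrite /= in mk1 mk2 mp.
have mf : measfun (fun z => ph e x z * kL z (y * m) - ph e x (y * m) * kL (y * m) z).
  by mfun.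
have h := intR_dil y0 mf.
have -> : \int[mu]_z (ph e x z * kL z (y * m) - ph e x (y * m) * kL (y * m) z) =
    y * (y^-1 * \int[mu]_z (ph e x z * kL z (y * m) - ph e x (y * m) * kL (y * m) z)).
  by rewrite mulrA divff ?mul1r// gt_eqF.
rewrite -h mulrA -exprSr.
have E z : ph e x (y * z) * kL (y * z) (y * m) - ph e x (y * m) * kL (y * m) (y * z) =
    y ^- 3 * (ph e (x / y) z * kL z m - ph e (x / y) m * kL m z).
  by rewrite !kL_scale// !ph_scale//; field; rewrite gt_eqF.
have -> : \int[mu]_z (ph e x (y * z) * kL (y * z) (y * m) - ph e x (y * m) * kL (y * m) (y * z)) =
   \int[mu]_z (y ^- 3 * (ph e (x / y) z * kL z m - ph e (x / y) m * kL m z)).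
  by apply: intR_ext => z; exact: E.
rewrite (intRZ (y ^- 3) (Ladj_int_L1 m e0 e4 xy)) mulrA divff ?mul1r//.
by rewrite gt_eqF// exprn_gt0.
Qed.

Lemma weak_Hk n x y s : 0 < x -> 0 < y -> 0 < s ->
  Tm (En R n) (Hk y s) x = ph (En R n) x y +
    Ic (fun r => \int[mu]_m (Hk y r m * Ladj (ph (En R n) x) m)) 0 s.
Proof.
move=> x0 y0 s0; have e0 := En_gt0 R n; have xy : 0 < x / y by rewrite divr_gt0.
have i0 : 0 < y^-1 by rewrite invr_gt0.
have sy : 0 < s / y by rewrite divr_gt0.
have [bi E] := weak_Lam0 n xy sy.
have [C hC] := wk_psib n x.
transitivity (\int[mu]_m (Hk y s m * ph (En R n) x m)).
  by apply: intR_ext => m; rewrite mulrC.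
rewrite (int_Hk s y0 (wk_mphi n x0) (wk_phib n x0)).
transitivity (y^-1 * \int[mu]_m (Lam0 (s / y) m * ph (En R n) (x / y) m)).
  rewrite -intRZ; last exact: (pair_L1 _ (wk_mphi n xy) (wk_phib n xy)).
  by apply: intR_ext => m; rewrite ph_scale//; ring.
rewrite E mulrDr; congr (_ + _).
  by rewrite -ph_scale// mulr1.
have mb := L1_meas bi.
rewrite /Ic -(intRZ y^-1 bi).
have mf : measfun (fun q : R => y^-1 * (if 0 < q < s / y then
    \int[mu]_m (Lam0 q m * Ladj (ph (En R n) (x / y)) m) else 0)) by mfun.
have h := intR_dil i0 mf; rewrite invrK in h.
have yy (I : R) : I = y^-1 * (y * I) by rewrite mulrA mulVf ?mul1r// gt_eqF.
rewrite [LHS]yy -h -intRZ; last exact: (L1_dil i0 (L1Z y^-1 bi)).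
apply: intR_ext => r.
have -> : (0 < y^-1 * r < s / y) = (0 < r < s).
  by rewrite pmulr_rgt0// mulrC ltr_pM2r.
have [/andP[r0 _]|hr] := boolP (0 < r < s); last by rewrite !mulr0.
have mL := wk_mpsi n x.
have ry : y^-1 * r = r / y by rewrite mulrC.
rewrite (int_Hk r y0 mL hC) ry.
have mLy : measfun (fun t => Ladj (ph (En R n) x) (y * t)) by apply: (mfun_comp mL); mfun.
have pl := pair_L1 (r / y) mLy (fun t => hC (y * t)).
have -> : \int[mu]_m (Lam0 (r / y) m * Ladj (ph (En R n) (x / y)) m) =
    y ^+ 2 * \int[mu]_t (Lam0 (r / y) t * Ladj (ph (En R n) x) (y * t)).
  rewrite -(intRZ (y ^+ 2) pl); apply: intR_ext => t.
  by rewrite (Ladj_scale t e0 (En_le4 R n) x0 y0) mulrCA.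
move: (\int[mu]_t _) => I.
by field; rewrite gt_eqF.
Qed.

Definition KW s : R := 2 * (384 * bC R) * expR (2 * 6 * s).

Lemma NB_W_Hk y s : 0 < y -> 0 < s -> NB mu (fun x => W x * Hk y s x) (KW s * W y).
Proof.
move=> y0 s0; have sy : 0 < s / y by rewrite divr_gt0.
(* B depends on s / y and is not uniform as y tends to 0; the conclusion of [kato_bound] no longer
   contains it. *)
have [B B0 hB] := Lam0_unif sy.
have mH : measfun2 R (Hk y).
  by apply: mfunM; [mfun|apply: (mfun_curry mfun_Lam0); mfun].
have hH r : 0 < r <= s -> NB mu (Hk y r) B.
  move=> /andP[r0 rs]; apply: (NB_Hk y0); apply: hB.
  by rewrite divr_gt0//= ler_pM2r// invr_gt0.
have wk n r x : 0 < r <= s -> 0 < x -> Tm (En R n) (Hk y r) x = ph (En R n) x y +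
    Ic (fun r => \int[mu]_m (Hk y r m * Ladj (ph (En R n) x) m)) 0 r.
  by move=> /andP[r0 _] x0; exact: weak_Hk.
have := kato_bound s0 B0 mH hH wk.
have -> : 2 * (384 * bC R * W y) * expR (2 * 6 * s) = KW s * W y by rewrite /KW; ring.
by [].
Qed.

Lemma KW_ge0 s : 0 <= KW s.
Proof.
apply: mulr_ge0; last exact: expR_ge0.
by apply: mulr_ge0; [exact: ler0n|apply: mulr_ge0; [exact: ler0n|exact: (le_trans ler01 (bC_ge1 R))]].
Qed.

Lemma KW_mono s t : s <= t -> KW s <= KW t.
Proof.
move=> st; apply: ler_wpM2l; last by rewrite ler_expR; lra.
by apply: mulr_ge0; [exact: ler0n|apply: mulr_ge0; [exact: ler0n|exact: (le_trans ler01 (bC_ge1 R))]].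
Qed.

End FundamentalSolution.

(** * From the mild solution to the averaged equation *)

Section AlmostEverywhereProduct.
Context d1 d2 (T1 : measurableType d1) (T2 : measurableType d2) (R : realType).
Context (m1 : {sigma_finite_measure set T1 -> \bar R}).
Context (m2 : {sigma_finite_measure set T2 -> \bar R}).

Lemma NB0_ae d (T : measurableType d) (m : {measure set T -> \bar R}) (f : T -> R) :
  NB m f 0 -> {ae m, forall x, f x = 0}.
Proof.
move=> [mf f0].
have h : (\int[m]_x `|(EFin \o f) x| = 0)%E.
  apply/eqP; rewrite eq_le; apply/andP; split; first exact: f0.
  by apply: integral_ge0 => x _; first [exact: abse_ge0 | rewrite lee_fin].
have mf' : measfun (EFin \o f) by exact/measurable_EFinP.
have := iffLR (ae_eq_integral_abs m measurableT mf') h.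
by apply: filterS => x /(_ I) [].
Qed.

Lemma ae_sections (P : T1 * T2 -> Prop) : {ae (m1 \x m2)%E, forall z, P z} ->
  {ae m1, forall x, {ae m2, forall y, P (x, y)}}.
Proof.
move=> [A [mA A0 PA]].
have h : (\int[m1]_x `|(m2 \o xsection A) x| = 0)%E.
  rewrite -[RHS]A0; apply: eq_integral => x _; rewrite gee0_abs//.
have ms : measfun (m2 \o xsection A) by exact: measurable_fun_xsection.
have := iffLR (ae_eq_integral_abs m1 measurableT ms) h.
apply: filterS => x /(_ I) hx; exists (xsection A x); split => //.
  exact: measurable_xsection.
by move=> y nP; rewrite xsectionP; apply: PA.
Qed.

Lemma ae_of_sections (F : T1 * T2 -> R) : measfun F ->
  {ae m1, forall x, {ae m2, forall y, F (x, y) = 0}} -> NB (m1 \x m2)%E F 0.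
Proof.
move=> mF h; have [Fi Fb] : L1 (m1 \x m2)%E F /\ \int[(m1 \x m2)%E]_z `|F z| <= \int[m1]_x (0 : R).
  apply: L1_prod_of1 => //; last exact: L1_0.
  apply: (aeS h) => x hx; apply: NB_ae hx _; first exact: (mfun_section1 x mF).
  exact: NB_0.
by apply/NBP; split => //; rewrite intR0 in Fb.
Qed.

(** Joint measurability is what allows the two almost everywhere quantifiers to be exchanged. For
    this reason pointwise properties are coded below as the vanishing of a measurable function. *)
Lemma ae_swap (F : T1 * T2 -> R) : measfun F ->
  {ae m1, forall x, {ae m2, forall y, F (x, y) = 0}} ->
  {ae m2, forall y, {ae m1, forall x, F (x, y) = 0}}.
Proof.
move=> mF h; have /NBP[Fi Fb] := ae_of_sections mF h.
have F2 := fub_L12 (L1_norm Fi).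
have e2 : NB m2 (fun y => \int[m1]_x `|F (x, y)|) 0.
  apply/NBP; split => //; apply: le_trans Fb.
  rewrite -(fub_eq2 (L1_norm Fi)) le_eqVlt; apply/orP; left; apply/eqP; apply: intR_ext => y.
  by rewrite ger0_norm//; apply: intR_ge0.
apply: (aeI (NB0_ae e2) (fub_ae2 Fi)) => y y0 yi; apply: NB0_ae; apply/NBP; split => //.
by rewrite y0.
Qed.

End AlmostEverywhereProduct.

Section KernelOperator.
Variable R : realType.
Notation mu := (@lebesgue_measure R).
Notation mu2 := (mu \x mu)%E.
Implicit Types (g : R -> R) (x y : R).

Definition Pop (K : R -> R -> R) g x : R := \int[mu]_y (K x y * (g y - g x)).

Section Bound.
Variables (K : R -> R -> R) (g : R -> R).
Hypothesis mK : measfun2 R K.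
Hypothesis KD : forall x y, `|K x y| <= `|kD x y|.
Hypothesis gi : L1 mu g.
Let mg : measfun g. Proof. exact: L1_meas gi. Qed.

(** Stated for every kernel dominated by [kD], since it will be applied to [kD], to its truncations
    and to the truncation error. Each of g y and g x contributes 43. *)
Lemma Pop_prod_L1 : L1 mu2 (fun z : R * R => W z.1 * (K z.1 z.2 * (g z.2 - g z.1))) /\
  \int[mu2]_z `|W z.1 * (K z.1 z.2 * (g z.2 - g z.1))| <= 86 * \int[mu]_x `|g x|.
Proof.
have mWK : measfun (fun z : R * R => W z.1 * K z.1 z.2).
  by apply: mfunM => //; apply: (mfun_comp (@mfun_W R)); mfun.
pose F1 (z : R * R) := W z.1 * K z.1 z.2 * g z.2.
pose F2 (z : R * R) := W z.1 * K z.1 z.2 * g z.1.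
have mF1 : measfun F1 by apply: mfunM => //; apply: (mfun_comp mg); mfun.
have mF2 : measfun F2 by apply: mfunM => //; apply: (mfun_comp mg); mfun.
have [F1i F1b] : L1 mu2 F1 /\ \int[mu2]_z `|F1 z| <= \int[mu]_y (43 * `|g y|).
  apply: L1_prod_of2 => //; last exact/L1Z/L1_norm.
  apply: aeW => y; apply: NB_le (NBZ (g y) (NB_W_kD_adj y)) _.
  - exact: (mfun_section2 y mF1).
  - move=> x; rewrite /F1/= mulrC !normrM; apply: ler_wpM2l => //; exact: ler_wpM2l.
  - by rewrite mulrC.
have [F2i F2b] : L1 mu2 F2 /\ \int[mu2]_z `|F2 z| <= \int[mu]_x (43 * `|g x|).
  apply: L1_prod_of1 => //; last exact/L1Z/L1_norm.
  apply: aeW => x; apply: NB_le (NBZ (g x) (NB_W_kD x)) _.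
  - exact: (mfun_section1 x mF2).
  - move=> y; rewrite /F2/= mulrC !normrM; apply: ler_wpM2l => //; exact: ler_wpM2l.
  - by rewrite mulrC.
have E (z : R * R) : W z.1 * (K z.1 z.2 * (g z.2 - g z.1)) = F1 z - F2 z by rewrite /F1 /F2; ring.
have Fi : L1 mu2 (fun z : R * R => W z.1 * (K z.1 z.2 * (g z.2 - g z.1))).
  by apply: L1_ext (L1B F1i F2i) _ => z; exact: E.
split => //; have gn := L1_norm gi.
rewrite (intRZ 43 gn) in F1b; rewrite (intRZ 43 gn) in F2b.
apply: (@le_trans _ _ (\int[mu2]_z (`|F1 z| + `|F2 z|))).
  apply: (intR_le (L1_norm Fi) (L1D (L1_norm F1i) (L1_norm F2i))) => z.
  by rewrite E; exact: ler_normB.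
rewrite (intRD (L1_norm F1i) (L1_norm F2i)); lra.
Qed.

Lemma Pop_eq0 x : x <= 0 -> Pop K g x = 0.
Proof.
move=> x0; rewrite /Pop intR_eq0// => y.
suff -> : K x y = 0 by rewrite mul0r.
apply/eqP; rewrite -normr_le0; apply: le_trans (KD x y) _.
by rewrite /kD kM_eq0 ?kL_eq0 ?subrr ?normr0// negb_and -!leNgt x0.
Qed.

Lemma mfun_Pop : measfun (Pop K g).
Proof.
apply: (@mfun_intR1 _ _ _ _ _ mu (fun z : R * R => K z.1 z.2 * (g z.2 - g z.1))).
by apply: mfunM => //; apply: mfunB; apply: (mfun_comp mg); mfun.
Qed.

Lemma Pop_section : {ae mu, forall x, L1 mu (fun y => K x y * (g y - g x))}.
Proof.
have [Fi _] := Pop_prod_L1; apply: (aeS (fub_ae1 Fi)) => x h.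
have [x0|x0] := ltP 0 x; last first.
  apply: L1_ext (L1_0 mu) _ => y; suff -> : K x y = 0 by rewrite mul0r.
  apply/eqP; rewrite -normr_le0; apply: le_trans (KD x y) _.
  by rewrite /kD kM_eq0 ?kL_eq0 ?subrr ?normr0// negb_and -!leNgt x0.
have Wx := W_gt0 x0; apply: L1_ext (L1Z (W x)^-1 h) _ => y /=.
by rewrite mulrA mulVf ?mul1r// gt_eqF.
Qed.

Lemma Pop_W x : L1 mu (fun y => K x y * (g y - g x)) ->
  W x * Pop K g x = \int[mu]_y (W x * (K x y * (g y - g x))).
Proof. by move=> h; rewrite intRZ. Qed.

Lemma NB_W_Pop : NB mu (fun x => W x * Pop K g x) (86 * \int[mu]_x `|g x|).
Proof.
have [Fi Fb] := Pop_prod_L1; have mP := mfun_Pop; have mW := @mfun_W R.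
apply: (@NB_ae _ _ _ mu _ (fun x : R => \int[mu]_y (W x * (K x y * (g y - g x))))); first by mfun.
  by apply: (aeS Pop_section) => x h; rewrite Pop_W.
have F1 := fub_L11 Fi; apply/NBP; split; first exact: F1.
apply: le_trans Fb; rewrite -(fub_eq1 (L1_norm Fi)).
apply: (intR_le_ae (L1_norm F1) (fub_L11 (L1_norm Fi))).
by apply: (aeS (fub_ae1 Fi)) => x h; exact: intR_norm.
Qed.

End Bound.

Lemma kME x y : 0 < x -> 0 < y -> y != x -> kerM x y = kM x y.
Proof. by move=> x0 y0 yx; rewrite /kM y0 x0/=; case: ltgtP yx => //; rewrite ?eqxx. Qed.

Section Domain.
Variables (g : R -> R) (x : R).
Let G y := if 0 < y then g y else 0.
Hypothesis x0 : 0 < x.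
Hypothesis mG : measfun G.

Lemma jump_opE (k kz : R -> R -> R) : measfun (kz x) ->
  (forall y, ~~ (0 < y) -> kz x y = 0) ->
  (forall y, 0 < y -> y != x -> k x y = kz x y) -> jump_op_defined k g x ->
  L1 mu (fun y => kz x y * (G y - G x)) /\ jump_op k g x = Pop kz G x.
Proof.
move=> mk kz0 kE /L1_Rpos h; rewrite /jump_op intR_Rpos.
have mz : measfun (fun y => kz x y * (G y - G x)).
  by apply: mfunM => //; apply: mfunB => //; exact: mfun_cst.
have AE : {ae mu, forall y, kz x y * (G y - G x) = if 0 < y then (g y - g x) * k x y else 0}.
  apply: (aeS (ae_neq x)) => y yx; case: (boolP (0 < y)) => y0; last by rewrite kz0// mul0r.
  by rewrite kE// /G y0 x0 mulrC.
split; first by apply: L1_ae h; [exact: mz | exact: AE].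
by apply: (intR_ae (L1_meas h) mz); apply: (aeS AE) => y ->.
Qed.

Lemma calLE : jump_op_defined (@kerM R) g x ->
  L1 mu (fun y => kM x y * (G y - G x)) /\ calL g x = Pop (@kM R) G x.
Proof.
apply: jump_opE; first exact: (mfun_section1 x (@mfun_kM R)).
- by move=> y y0; rewrite kM_eq0// negb_and y0 orbT.
- by move=> y y0 yx; exact: kME.
Qed.

Lemma opLE : jump_op_defined (@kerL R) g x ->
  L1 mu (fun y => kL x y * (G y - G x)) /\ opL g x = Pop (@kL R) G x.
Proof.
apply: jump_opE; first exact: (mfun_section1 x (@mfun_kL R)).
- by move=> y y0; rewrite kL_eq0// negb_and y0 orbT.
- by move=> y y0 yx; rewrite kerLE// eq_sym.
Qed.

(** Only where both singular integrals converge absolutely may the difference be taken under the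
    integral sign. *)
Lemma perturbationE : jump_op_defined (@kerM R) g x -> jump_op_defined (@kerL R) g x ->
  perturbation g x = Pop (@kD R) G x.
Proof.
move=> /calLE[iM eM] /opLE[iL eL]; rewrite /perturbation eM eL -(intRB iM iL).
by apply: intR_ext => y; rewrite /kD mulrBl.
Qed.

End Domain.

End KernelOperator.

Section StrongSolution.
Variable R : realType.
Notation mu := (@lebesgue_measure R).
Notation mu2 := (mu \x mu)%E.
Implicit Types (s t r x y m tau sigma : R).
Variables (u0 : R -> R) (f : R -> R -> R).
Hypothesis SS : strong_solution u0 f.
Hypothesis u0i : mu.-integrable `]0, +oo[%classic (fun x => (u0 x)%:E).

Definition uu x : R := if 0 < x then u0 x else 0.
(** At s = 0 this is 0 and not u0; the initial datum enters through the limit [FF_init]. *)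
Definition FF s x : R := if (0 < s) && (0 < x) then f s x else 0.
Definition kk s x : R := if (0 < s) && (0 < x) then calL (f s) x else 0.
Definition PP s x : R := Pop (@kD R) (FF s) x.

Lemma uu_L1 : L1 mu uu. Proof. exact: (iffLR (L1_Rpos _) u0i). Qed.

Lemma mfun_FF : measfun2 R FF.
Proof. by have [mL _ _ _ _] := SS; exact: (mfun_Qpos mL). Qed.

Lemma mfun_kk : measfun2 R kk.
Proof. by have [_ _ _ _ [_ [[mL _] _]]] := SS; exact: (mfun_Qpos mL). Qed.

Lemma mfun_FFs s : measfun (FF s).
Proof. exact: (mfun_section1 s mfun_FF). Qed.

Lemma FF_eq0 s x : ~~ ((0 < s) && (0 < x)) -> FF s x = 0.
Proof. by rewrite /FF => /negbTE ->. Qed.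

Lemma FFE s : 0 < s -> (fun x => if 0 < x then f s x else 0) = FF s.
Proof. by move=> s0; apply/funext => x; rewrite /FF s0. Qed.

Lemma FF_L1 s : L1 mu (FF s).
Proof.
have [s0|s0] := ltP 0 s; last first.
  by apply: L1_ext (L1_0 mu) _ => x; rewrite /FF ltNge s0.
have [_ [Li _] _ _ _] := SS; have h := Li s (ltac:(by rewrite /= in_itv/= (ltW s0))).
by rewrite -FFE//; exact: (iffLR (L1_Rpos _) h).
Qed.

Lemma FF_cont t eps : 0 < t -> 0 < eps ->
  \forall s \near t, \int[mu]_x `|FF s x - FF t x| <= eps.
Proof.
move=> t0 eps0; have [_ Lc _ _ _] := SS.
have h := @L1_continuous_near R _ f t eps Lc (ltac:(by rewrite /= in_itv/= (ltW t0))) eps0.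
have p : \forall s \near t, 0 < s by exact: lt_nbhsr.
apply: filterS2 h p => s H s0; have {}H := H (ltac:(by rewrite /= in_itv/= (ltW s0))).
by rewrite -!FFE.
Qed.

Lemma FF_init eps : 0 < eps ->
  \forall s \near 0^'+, \int[mu]_x `|FF s x - uu x| <= eps.
Proof.
move=> eps0; have [_ Lc _ f0 _] := SS; have [Li _] := Lc.
have i0 : `[(0:R), +oo[%classic (0:R) by rewrite /= in_itv/= lexx.
have h := @L1_continuous_near R _ f 0 eps Lc i0 eps0.
have L0 := iffLR (L1_Rpos _) (Li 0 i0).
rewrite near_withinE; apply: filterS h => s h s0.
have {}h := h (ltac:(by rewrite /= in_itv/= (ltW s0))).
apply: le_trans h; rewrite le_eqVlt; apply/orP; left; apply/eqP; apply: intR_ae.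
- exact: (L1_meas (L1_norm (L1B (FF_L1 s) uu_L1))).
- exact: (L1_meas (L1_norm (L1B (iffLR (L1_Rpos _) (Li s (ltac:(by rewrite /= in_itv/= (ltW s0))))) L0))).
apply: (aeS f0) => x fx; rewrite /FF s0 /uu/=; case: (boolP (0 < x)) => // x0.
by rewrite fx.
Qed.

Lemma FF_norm_cont t : 0 < t -> (\int[mu]_x `|FF s x|) @[s --> t] --> \int[mu]_x `|FF t x|.
Proof.
move=> t0; apply/cvgrPdist_le => eps eps0; apply: filterS (FF_cont t0 eps0) => s hs.
have a := L1_norm (FF_L1 s); have b := L1_norm (FF_L1 t).
rewrite -(intRB b a); apply: le_trans (intR_norm (L1B b a)) _; apply: le_trans hs.
apply: (intR_le (L1_norm (L1B b a)) (L1_norm (L1B (FF_L1 s) (FF_L1 t)))) => x.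
by apply: le_trans (ler_dist_dist _ _) _; rewrite distrC.
Qed.

Lemma FF_unif T : exists2 B, 0 <= B & forall s, s <= T -> NB mu (FF s) B.
Proof.
pose N s := \int[mu]_x `|FF s x|.
have /FF_init := @ltr01 R; rewrite near_withinE => -[e /= e0 he].
have n0 s : s < e -> N s <= \int[mu]_x `|uu x| + 1.
  move=> se; have I0 : 0 <= \int[mu]_x `|uu x| by exact: intR_ge0.
  have [s0|s0] := ltP 0 s; last first.
    rewrite /N intR_eq0; last first.
      by move=> x; rewrite FF_eq0 ?normr0// ltNge s0.
    by apply: addr_ge0.
  have /(_ s0) k := he s (ltac:(by rewrite /= sub0r normrN gtr0_norm)).
  have dL := L1B (FF_L1 s) uu_L1.
  apply: le_trans (_ : _ <= \int[mu]_x `|uu x| + \int[mu]_x `|FF s x - uu x|) _; last by rewrite lerD2l.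
  rewrite -(intRD (L1_norm uu_L1) (L1_norm dL)).
  apply: (intR_le (L1_norm (FF_L1 s)) (L1D (L1_norm uu_L1) (L1_norm dL))) => x.
  by rewrite -[in leLHS](subrK (uu x) (FF s x)) addrC; exact: ler_normD.
pose T' := Num.max T (e / 2).
have eT : e / 2 <= T' by rewrite le_max lexx orbT.
have e20 : 0 < e / 2 by rewrite divr_gt0.
have cF : {within `[e / 2, T'], continuous N}.
  apply: continuous_in_subspaceT => t; rewrite inE/= in_itv/= => /andP[h _].
  exact: (FF_norm_cont (lt_le_trans e20 h)).
have [c _ hc] := EVT_max eT cF.
have Nge s : 0 <= N s by exact: intR_ge0.
exists (N c + (\int[mu]_x `|uu x| + 1)).
  by rewrite !addr_ge0//; exact: intR_ge0.
move=> s sT; apply/NBP; split; first exact: FF_L1.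
have [se|se] := ltP s e; first by apply: le_trans (n0 s se) _; rewrite lerDr.
apply: le_trans (hc s _) _; last first.
  by rewrite lerDl addr_ge0//; exact: intR_ge0.
rewrite in_itv/= le_max sT/= andbT; lra.
Qed.

Lemma kk_L1 T : L1 mu2 (fun z : R * R => if z.1 < T then kk z.1 z.2 else 0).
Proof.
have [T0|T0] := ltP 0 T; last first.
  apply: L1_ext (L1_0 _) _ => z; case: (boolP (z.1 < T)) => // zT.
  by rewrite /kk ltNge (le_trans (ltW zT) T0).
have [_ _ _ _ [_ [_ [kL _]]]] := SS; have {}kL := kL T T0.
have : mu2.-integrable setT ((fun z : R * R => (calL (f z.1) z.2)%:E) \_
    (`]0, T[%classic `*` `]0, +oo[%classic)).
  by apply: (iffLR (integrable_mkcond _ _)) kL; apply: measurableX; exact: measurable_itv.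
congr (_.-integrable setT _).
apply/funext => z; rewrite patchE /kk.
have -> : (z \in (`]0, T[%classic `*` `]0, +oo[%classic : set (R * R))) = (0 < z.1 < T) && (0 < z.2).
  apply/idP/idP; first by rewrite inE/= !in_itv/= !andbT => -[-> ->].
  by move=> /andP[h1 h2]; rewrite inE/= !in_itv/= !andbT.
by rewrite /=; case: (0 < z.1); case: (z.1 < T); case: (0 < z.2).
Qed.

Lemma mfun_PP : measfun2 R PP.
Proof.
apply: (@mfun_intR1 _ _ _ _ _ mu (fun w : (R * R) * R => kD w.1.2 w.2 * (FF w.1.1 w.2 - FF w.1.1 w.1.2))).
apply: mfunM; first by apply: (mfun_curry (@mfun_kD R)); mfun.
by apply: mfunB; apply: (mfun_curry mfun_FF); mfun.
Qed.

Lemma PP_eq0 s x : x <= 0 -> PP s x = 0.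
Proof. exact: Pop_eq0. Qed.

Lemma NB_W_PP s : NB mu (fun x => W x * PP s x) (86 * \int[mu]_x `|FF s x|).
Proof. by apply: NB_W_Pop => //; [exact: mfun_kD | exact: FF_L1]. Qed.

Section Perturbation.
Hypothesis hL : {ae mu2, forall z : R * R, 0 < z.1 -> 0 < z.2 ->
     jump_op_defined (@kerL R) (f z.1) z.2}.

Lemma pert_ae : {ae mu2, forall z : R * R, 0 < z.1 -> 0 < z.2 ->
  perturbation (f z.1) z.2 = PP z.1 z.2}.
Proof.
have [_ _ _ _ [h _]] := SS; apply: (aeI h hL) => z hz1 hz2 z1 z2.
have mG : measfun (fun y => if 0 < y then f z.1 y else 0).
  by rewrite FFE//; exact: mfun_FFs.
by have := perturbationE z2 mG (hz1 z1 z2) (hz2 z1 z2); rewrite FFE.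
Qed.

End Perturbation.

Lemma W_PP_L1 T : exists2 C, 0 <= C &
  NB mu2 (fun z : R * R => if 0 < z.1 < T then W z.2 * PP z.1 z.2 else 0) C.
Proof.
have [B B0 hB] := FF_unif T.
have mF : measfun (fun z : R * R => if 0 < z.1 < T then W z.2 * PP z.1 z.2 else 0).
  apply: mfun_ite; [by mfun| |by mfun].
  by apply: mfunM; [apply: (mfun_comp (@mfun_W R)); mfun|exact: mfun_PP].
have h : L1 mu (fun s => if 0 < s < T then 86 * B else 0).
  have [T0|T0] := leP 0 T; first exact: (NB_L1 (NB_itv (86 * B) T0)).
  apply: L1_ext (L1_0 mu) _ => s; case: (boolP (0 < s < T)) => // /andP[a b].
  by have := lt_trans a (lt_trans b T0); rewrite ltxx.
have [Fi Fb] : L1 mu2 (fun z : R * R => if 0 < z.1 < T then W z.2 * PP z.1 z.2 else 0) /\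
  \int[mu2]_z `|if 0 < z.1 < T then W z.2 * PP z.1 z.2 else 0| <=
  \int[mu]_s (if 0 < s < T then 86 * B else 0).
  apply: (@L1_prod_of1 _ _ _ _ _ mu mu (fun z : R * R => if 0 < z.1 < T then W z.2 * PP z.1 z.2 else 0)) => //.
  apply: aeW => s /=; case: (boolP (0 < s < T)) => [/andP[_ sT]|_]; last exact: NB_0.
  have /NBP[h1 h2] := NB_W_PP s; apply/NBP; split => //; apply: le_trans h2 _.
  by rewrite ler_pM2l; [have /NBP[] := hB s (ltW sT)|].
exists (\int[mu]_s (if 0 < s < T then 86 * B else 0)); last exact/NBP.
by apply: intR_ge0 => s; case: (0 < s < T) => //; rewrite mulr_ge0.
Qed.

End StrongSolution.

Lemma NB_eq0 d (T : measurableType d) (R : realType) (m : {measure set T -> \bar R}) (f : T -> R) :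
  (forall x, f x = 0) -> NB m f 0.
Proof. by move=> f0; rewrite (_ : f = fun=> 0); [exact: NB_0|apply/funext]. Qed.

Lemma NB_ext d (T : measurableType d) (R : realType) (m : {measure set T -> \bar R})
    (f g : T -> R) c c' : NB m g c -> (forall x, f x = g x) -> c <= c' -> NB m f c'.
Proof.
move=> /NBP[hL hb] fg cc; rewrite (_ : f = g); last exact/funext.
by apply/NBP; split => //; exact: le_trans hb cc.
Qed.

Section ProductMeasure.
Context d1 d2 (T1 : measurableType d1) (T2 : measurableType d2) (R : realType).
Variable m1 : {sigma_finite_measure set T1 -> \bar R}.
Variable m2 : {sigma_finite_measure set T2 -> \bar R}.

Lemma product_sigma_finite : sigma_finite setT (m1 \x m2)%E.
Proof.
have /sigma_finiteP[A [TA /nondecreasing_seqP ndA Aoo]] := sigma_finiteT m1.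
have /sigma_finiteP[B [TB /nondecreasing_seqP ndB Boo]] := sigma_finiteT m2.
exists (fun n => A n `*` B n); last first.
  move=> n; have [mA Afin] := Aoo n; have [mB Bfin] := Boo n; split; first exact: measurableX.
  by rewrite product_measure1E// lte_mul_pinfty// ge0_fin_numE.
apply/seteqP; split => // -[x y] _.
have : [set: T1] x by []. rewrite TA => -[n _ Ax].
have : [set: T2] y by []. rewrite TB => -[k _ By].
exists (maxn n k) => //; split => /=.
- by move: x Ax; apply/subsetPset/(iffLR (nondecreasing_seqP _) ndA)/leq_maxl.
- by move: y By; apply/subsetPset/(iffLR (nondecreasing_seqP _) ndB)/leq_maxr.
Qed.

(* The library's sigma-finite structure on products is not found by canonical
   structure inference, which blocks products of three factors. *)
Definition prodm : {sigma_finite_measure set (T1 * T2)%type -> \bar R} :=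
  HB.pack_for {sigma_finite_measure set (T1 * T2)%type -> \bar R} (product_measure1 m1 m2)
    (@Measure_isSigmaFinite.Build _ _ _ (m1 \x m2)%E product_sigma_finite).
End ProductMeasure.

Section MildSolution.
Variable R : realType.
Notation mu := (@lebesgue_measure R).
Notation mu2 := (prodm mu mu).
Implicit Types (s t r x y m tau sigma : R) (psi : R -> R).
Variables (Lam : R -> R -> R) (u0 : R -> R) (f : R -> R -> R).
Hypothesis HF : fundamental_solution Lam.
Hypothesis SS : strong_solution u0 f.
Hypothesis MS : mild_solution Lam u0 f.
Hypothesis u0i : mu.-integrable `]0, +oo[%classic (fun x => (u0 x)%:E).

Notation u := (uu u0).
Notation F := (FF f).
Notation P := (PP f).
Notation H := (Hk Lam).

Lemma mfun_H d (T : measurableType d) (a b c : T -> R) : measfun a ->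
  measfun b -> measfun c -> measfun (fun z => H (a z) (b z) (c z)).
Proof.
move=> ma mb mc.
exact: (@mfun_comp _ _ _ _ _ _ (fun w : (R * R) * R => H w.1.1 w.1.2 w.2)
  (fun z => (a z, b z, c z)) (mfun_Hk HF) (mfun_pair (mfun_pair ma mb) mc)).
Qed.

Let mP := mfun_PP SS.
Let mF := mfun_FF SS.
Let ui : L1 mu u. Proof. exact: uu_L1 u0i. Qed.
Let mu_ : measfun u. Proof. exact: L1_meas ui. Qed.

Definition Npsi psi s y : R := \int[mu]_x (H y s x * psi x).

Lemma u_eq0 y : y <= 0 -> u y = 0. Proof. by move=> y0; rewrite /uu ltNge y0. Qed.

Section Fixed.
Variables (psi : R -> R) (C : R).
Hypothesis mpsi : measfun psi.
Hypothesis psiW : forall x, `|psi x| <= C * W x.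

Let C0 : 0 <= C.
Proof. have W1 := W_gt0 (@ltr01 R); rewrite -(pmulr_lge0 _ W1); exact: le_trans (normr_ge0 _) (psiW 1). Qed.

Lemma NB_Hk_psi y s : 0 < y -> 0 < s -> NB mu (fun x => H y s x * psi x) (C * (KW s * W y)).
Proof.
move=> y0 s0; have h := NBZ C (NB_W_Hk HF y0 s0); rewrite ger0_norm// in h.
apply: (@NB_le _ _ _ mu _ _ (fun x : R => C * (W x * H y s x)) _ _ _ h); first by apply: mfunM => //; exact: (L1_meas (Hk_L1 HF s y0)).
  by move=> x; rewrite !normrM mulrA mulrC (ger0_norm C0) (ger0_norm (W_ge0 x)) ler_wpM2r.
exact: lexx.
Qed.

Lemma Npsi_le y s : 0 < y -> 0 < s -> `|Npsi psi s y| <= C * (KW s * W y).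
Proof. by move=> y0 s0; exact: NB_abs (NB_Hk_psi y0 s0). Qed.

Lemma mfun_Npsi : measfun2 R (Npsi psi).
Proof.
apply: (@mfun_intR1 _ _ _ _ _ mu (fun w : (R * R) * R => H w.1.2 w.1.1 w.2 * psi w.2)).
apply: mfunM; last by apply: (mfun_comp mpsi); mfun.
by apply: mfun_H; mfun.
Qed.

Section Time.
Variable tau : R.
Hypothesis tau0 : 0 < tau.

Lemma mild_prod_u : L1 (mu \x mu)%E (fun z : R * R => psi z.1 * (H z.2 tau z.1 * u z.2)).
Proof.
have [|||//] := @L1_prod_of2 _ _ _ _ _ mu mu (fun z : R * R => psi z.1 * (H z.2 tau z.1 * u z.2))
  (fun y => C * KW tau * `|u y|).
- apply: mfunM; first by apply: (mfun_comp mpsi); mfun.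
  apply: mfunM; last by apply: (mfun_comp mu_); mfun.
  by apply: mfun_H; mfun.
- apply: aeW => y; have [y0|y0] := ltP 0 (y : R); last first.
    rewrite u_eq0// normr0 mulr0.
    by apply: NB_eq0 => x; rewrite !mulr0.
  apply: (NB_ext (NBZ (u y) (NB_Hk_psi y0 tau0))); first by move=> x /=; ring.
  rewrite mulrC ler_wpM2r// mulrA ler_piMr ?W_le1//.
  by rewrite mulr_ge0// KW_ge0.
- exact/L1Z/L1_norm.
Qed.

Lemma mild_prod_P : L1 (mu \x mu2)%E (fun w : R * (R * R) =>
  psi w.1 * (if 0 < w.2.1 < tau then H w.2.2 (tau - w.2.1) w.1 * P w.2.1 w.2.2 else 0)).
Proof.
have [K K0 hK] := W_PP_L1 SS u0i tau.
have [|||//] := @L1_prod_of2 _ _ _ _ _ mu mu2 (fun w : R * (R * R) =>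
  psi w.1 * (if 0 < w.2.1 < tau then H w.2.2 (tau - w.2.1) w.1 * P w.2.1 w.2.2 else 0))
  (fun w => C * KW tau * `|if 0 < w.1 < tau then W w.2 * P w.1 w.2 else 0|).
- apply: mfunM; first by apply: (mfun_comp mpsi); mfun.
  apply: mfun_ite; [by mfun| |by mfun].
  apply: mfunM; last by apply: (mfun_curry mP); mfun.
  by apply: mfun_H; mfun.
- apply: aeW => -[sg y] /=; case: (boolP (0 < sg < tau)) => [/andP[s0 s1]|_]; last first.
    rewrite normr0 mulr0.
    by apply: NB_eq0 => x; rewrite !mulr0.
  have [y0|y0] := ltP 0 y; last first.
    rewrite PP_eq0// mulr0 normr0 mulr0.
    by apply: NB_eq0 => x; rewrite !mulr0.
  have ts0 : 0 < tau - sg by rewrite subr_gt0.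
  apply: (NB_ext (NBZ (P sg y) (NB_Hk_psi y0 ts0))); first by move=> x /=; ring.
  rewrite normrM (ger0_norm (W_ge0 y)).
  have -> : C * KW tau * (W y * `|P sg y|) = `|P sg y| * (C * (KW tau * W y)) by ring.
  apply: ler_wpM2l => //; apply: ler_wpM2l => //; apply: ler_wpM2r; first exact: W_ge0.
  by apply: KW_mono; rewrite lerBlDr lerDl ltW.
- exact/L1Z/L1_norm/(NB_L1 hK).
Qed.

End Time.
End Fixed.

Lemma ae_pert_sections : {ae mu, forall s, {ae mu, forall y, 0 < s -> 0 < y ->
  perturbation (f s) y = P s y}}.
Proof. by have [hL _] := MS; exact: (ae_sections (pert_ae SS hL)). Qed.

Let mW : measfun (@W R). Proof. exact: mfun_W. Qed.
Let WW (x : R) : `|W x| <= 1 * W x. Proof. by rewrite mul1r ger0_norm// W_ge0. Qed.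

Section Time.
Variable tau : R.
Hypothesis tau0 : 0 < tau.

Lemma mild_kernel : {ae mu, forall x, 0 < x ->
  [/\ L1 mu (fun y => H y tau x * u y),
      L1 mu2 (fun w : R * R => if 0 < w.1 < tau then H w.2 (tau - w.1) x * P w.1 w.2 else 0) &
      F tau x = \int[mu]_y (H y tau x * u y) +
        \int[mu2]_w (if 0 < w.1 < tau then H w.2 (tau - w.1) x * P w.1 w.2 else 0)]}.
Proof.
have [_ /(_ tau tau0) hM] := MS.
have a1 := fub_ae1 (mild_prod_u mW WW tau0).
have a2 := fub_ae1 (mild_prod_P mW WW tau).
apply: (aeI hM (aeI a1 a2 (fun x p q => conj p q))) => x {hM a1 a2} hM [a1 a2] x0.
have [d1 d2 d3 E] := hM x0; rewrite /= in a1 a2.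
have Wx := W_gt0 x0; have Wn : W x != 0 by rewrite gt_eqF.
have b1 : L1 mu (fun y => H y tau x * u y).
  by apply: L1_ext (L1Z (W x)^-1 a1) _ => y; rewrite mulrA mulVf// mul1r.
have b2 : L1 mu2 (fun w : R * R => if 0 < w.1 < tau then H w.2 (tau - w.1) x * P w.1 w.2 else 0).
  by apply: L1_ext (L1Z (W x)^-1 a2) _ => y; rewrite mulrA mulVf// mul1r.
split => //; rewrite /FF tau0 x0/= E; congr (_ + _).
  rewrite /semigroup intR_Rpos; apply: intR_ext => y; case: (boolP (0 < y)) => y0; last first.
    by rewrite u_eq0 ?mulr0// leNgt.
  by rewrite /semigroup_integrand /Hk /Lam0 /uu y0 !divr_gt0//=; ring.
rewrite intR_itv -(fub_eq1 b2); apply: intR_ae.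
- exact: (L1_meas (iffLR (L1_itv _ _ _) d3)).
- exact: (L1_meas (fub_L11 b2)).
apply: (aeI d2 ae_pert_sections) => s hs hp /=.
case: (boolP (0 < s < tau)) => [st|_]; last by rewrite intR0.
have {}hs := hs st; have /andP[s0 s1] := st.
rewrite /semigroup intR_Rpos; apply: intR_ae.
- exact: (L1_meas (iffLR (L1_Rpos _) hs)).
- apply: mfunM; last exact: (mfun_section1 s mP).
  by apply: mfun_H; mfun.
apply: (aeS hp) => y {}hp; case: (boolP (0 < y)) => y0; last first.
  by rewrite PP_eq0 ?mulr0// leNgt.
have ts0 : 0 < tau - s by rewrite subr_gt0.
by rewrite /semigroup_integrand hp// /Hk /Lam0 !divr_gt0//=; ring.
Qed.

Lemma mild_pairing psi C : measfun psi -> (forall x, `|psi x| <= C * W x) ->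
  \int[mu]_x (F tau x * psi x) = \int[mu]_y (u y * Npsi psi tau y) +
    \int[mu2]_w (if 0 < w.1 < tau then P w.1 w.2 * Npsi psi (tau - w.1) w.2 else 0).
Proof.
move=> mp pW; have p1 := mild_prod_u mp pW tau0; have p2 := mild_prod_P mp pW tau.
transitivity (\int[mu]_x ((\int[mu]_y (psi x * (H y tau x * u y))) +
  \int[mu2]_w (psi x * (if 0 < w.1 < tau then H w.2 (tau - w.1) x * P w.1 w.2 else 0)))).
  apply: intR_ae.
  - by apply: mfunM => //; exact: (mfun_FFs SS tau).
  - by apply: mfunD; [exact: (L1_meas (fub_L11 p1))|exact: (L1_meas (fub_L11 p2))].
  apply: (aeS mild_kernel) => x h; have [x0|x0] := ltP 0 x; last first.
    have -> : psi x = 0.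
      by apply/eqP; rewrite -normr_le0; apply: le_trans (pW x) _; rewrite /W ltNge x0 mulr0.
    rewrite mulr0 intR_eq0; last by move=> y; rewrite mul0r.
    by rewrite intR_eq0 ?addr0// => y; rewrite mul0r.
  by have [h1 h2 ->] := h x0; rewrite (intRZ _ h1) (intRZ _ h2); ring.
rewrite (intRD (fub_L11 p1) (fub_L11 p2)) (fub_swap p1) (fub_swap p2); congr (_ + _).
  apply: intR_ext => y; have [y0|y0] := ltP 0 y; last first.
    by rewrite u_eq0// mul0r intR_eq0// => x; rewrite !mulr0.
  rewrite /Npsi -(intRZ _ (NB_L1 (NB_Hk_psi mp pW y0 tau0))).
  by apply: intR_ext => x /=; ring.
apply: intR_ext => -[s y] /=; case: (boolP (0 < s < tau)) => [/andP[s0 s1]|_]; last first.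
  by rewrite intR_eq0// => x; rewrite mulr0.
have [y0|y0] := ltP 0 y; last first.
  by rewrite PP_eq0// mul0r intR_eq0// => x; rewrite !mulr0.
have ts0 : 0 < tau - s by rewrite subr_gt0.
rewrite /Npsi -(intRZ _ (NB_L1 (NB_Hk_psi mp pW y0 ts0))).
by apply: intR_ext => x /=; ring.
Qed.

End Time.
End MildSolution.

Section WeakForm.
Variable R : realType.
Notation mu := (@lebesgue_measure R).
Notation mu2 := (prodm mu mu).
Implicit Types (s r y m tau sigma : R).
Variables (Lam : R -> R -> R) (u0 : R -> R) (f : R -> R -> R).
Hypothesis HF : fundamental_solution Lam.
Hypothesis SS : strong_solution u0 f.
Hypothesis MS : mild_solution Lam u0 f.
Hypothesis u0i : mu.-integrable `]0, +oo[%classic (fun x => (u0 x)%:E).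

Notation u := (uu u0).
Notation F := (FF f).
Notation P := (PP f).

Lemma ph_W n (x : R) : 0 < x -> exists2 C, 0 <= C & forall m, `|ph (En R n) x m| <= C * W m.
Proof.
move=> x0; have e0 := En_gt0 R n; have b1 := bC_ge1 R.
have B0 : 0 <= bC R / (En R n * x) by rewrite divr_ge0//; [lra|exact: mulr_ge0 (ltW e0) (ltW x0)].
have Wx := W_gt0 x0.
exists (bC R / (En R n * x) * (64 / W x)).
  by apply: mulr_ge0 => //; rewrite divr_ge0 ?ler0n// ltW.
move=> m; have [->|pm] := eqVneq (ph (En R n) x m) 0.
  rewrite normr0; apply: mulr_ge0 (W_ge0 m); apply: mulr_ge0 => //.
  by rewrite divr_ge0 ?ler0n// ltW.
have h := W_ph e0 (En_le4 R n) x0 pm.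
apply: le_trans (wk_phib n x0 m) _; move: (bC R / _) B0 => B B0.
apply: (@le_trans _ _ (B * 1)); first by rewrite mulr1.
by rewrite -mulrA; apply: ler_wpM2l => //; rewrite mulrAC ler_pdivlMr// mul1r.
Qed.

Section Fixed.
Variables (n : nat) (x t : R).
Hypothesis x0 : 0 < x.
Hypothesis t0 : 0 < t.
Let phi := ph (En R n) x.
Let lam := Ladj phi.
Let N := Npsi Lam lam.

Let mphi : measfun phi. Proof. exact: (wk_mphi n x0). Qed.
Let mlam : measfun lam. Proof. exact: (wk_mpsi n x). Qed.

Lemma wf_lamW : exists2 C, 0 <= C & forall m, `|lam m| <= C * W m.
Proof. exact: (Ladj_ph_le (Dn_gt0 R n) (Dn_le4 R n) (En_gt0 R n) (En_le4 R n) x). Qed.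

Lemma wf_Npsi y s : 0 < y -> 0 < s -> Npsi Lam phi s y = phi y + Ic (fun r => N r y) 0 s.
Proof.
move=> y0 s0; rewrite -(weak_Hk HF n x0 y0 s0); apply: intR_ext => m; exact: mulrC.
Qed.

(** Contributions of the initial datum and, in [G2], of the perturbation emitted at an earlier time,
    to the pairing of F with [lam] at an intermediate time r. *)
Let G1 (z : R * R) := if 0 < z.2 < t then u z.1 * N z.2 z.1 else 0.
Let G2 (z : (R * R) * R) :=
  if (0 < z.1.1) && (z.1.1 < z.2 < t) then P z.1.1 z.1.2 * N (z.2 - z.1.1) z.1.2 else 0.

Let mN : measfun2 R N. Proof. exact: (mfun_Npsi HF mlam). Qed.
Let mP : measfun2 R P. Proof. exact: mfun_PP SS. Qed.
Let ui : L1 mu u. Proof. exact: uu_L1 u0i. Qed.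

Lemma wf_G1 : L1 (mu \x mu)%E G1.
Proof.
have [C C0 hC] := wf_lamW.
have mu_ := L1_meas ui.
have mG : measfun G1.
  apply: mfun_ite; [by mfun| |by mfun].
  apply: mfunM; first by apply: (mfun_comp mu_); mfun.
  by apply: (mfun_curry mN); mfun.
have [||//] := @L1_prod_of1 _ _ _ _ _ mu mu G1 (fun y => C * KW t * t * `|u y|) mG; last exact/L1Z/L1_norm.
apply: aeW => y; have [y0|y0] := ltP 0 (y : R); last first.
  rewrite u_eq0// normr0 mulr0; apply: NB_eq0 => s.
  by rewrite /G1/= u_eq0// mul0r; case: ifP.
apply: (@NB_le _ _ _ mu _ _ (fun s : R => if 0 < s < t then `|u y| * (C * KW t) else 0) _ _ _ (NB_itv _ (ltW t0))).
- exact: (mfun_section1 y mG).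
- move=> s; rewrite /G1/=; case: (boolP (0 < s < t)) => [/andP[s0 st]|_]; last by rewrite normr0.
  have CK : 0 <= C * KW t by apply: (mulr_ge0 C0); exact: KW_ge0.
  rewrite normrM (normrM `|u y|) normr_id (ger0_norm CK).
  apply: ler_wpM2l => //; apply: le_trans (Npsi_le HF mlam hC y0 s0) _; apply: ler_wpM2l => //.
  apply: le_trans (_ : _ <= KW s * 1) _; first by apply: ler_wpM2l; [exact: KW_ge0|exact: W_le1].
  by rewrite mulr1; apply: KW_mono; exact: ltW.
- have CK : 0 <= C * KW t by apply: (mulr_ge0 C0); exact: KW_ge0.
  rewrite subr0 ger0_norm; last exact: mulr_ge0 (normr_ge0 _) CK.
  move: (KW t) => k; by rewrite le_eqVlt; apply/orP; left; apply/eqP; ring.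
Qed.

Lemma wf_G2 : L1 (mu2 \x mu)%E G2.
Proof.
have [C C0 hC] := wf_lamW.
have [K K0 hK] := W_PP_L1 SS u0i t.
have mG : measfun G2.
  apply: mfun_ite; [by mfun| |by mfun].
  apply: mfunM; first by apply: (mfun_curry mP); mfun.
  by apply: (mfun_curry mN); mfun.
have [||//] := @L1_prod_of1 _ _ _ _ _ mu2 mu G2
    (fun w => C * KW t * t * `|if 0 < w.1 < t then W w.2 * P w.1 w.2 else 0|) mG; last first.
  exact/L1Z/L1_norm/(NB_L1 hK).
apply: aeW => -[s y] /=; have [y0|y0] := ltP 0 (y : R); last first.
  rewrite PP_eq0// mulr0 (_ : (if _ then 0 else 0) = 0 :> R); last by case: ifP.
  by rewrite normr0 mulr0; apply: NB_eq0 => r; rewrite /G2/= PP_eq0// mul0r; case: ifP.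
case: (boolP (0 < s < t)) => [/andP[s0 st]|st]; last first.
  rewrite normr0 mulr0; apply: NB_eq0 => r; rewrite /G2/=; case: (boolP ((0 < s) && (s < r < t))) => //.
  by move=> /andP[a /andP[b c]]; move: st; rewrite a (lt_trans b c).
apply: (@NB_le _ _ _ mu _ _ (fun r : R => if 0 < r < t then `|P s y| * (C * KW t * W y) else 0) _ _ _ (NB_itv _ (ltW t0))).
- exact: (mfun_section1 (s, y) mG).
- move=> r; rewrite /G2/=; case: (boolP ((0 < s) && (s < r < t))) => [/andP[_ /andP[sr rt]]|_]; last by rewrite normr0.
  have CK : 0 <= C * KW t * W y.
    by apply: mulr_ge0; [apply: (mulr_ge0 C0); exact: KW_ge0|exact: W_ge0].
  rewrite (lt_trans s0 sr) rt/= normrM (normrM `|P s y|) normr_id (ger0_norm CK).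
  have rs : 0 < r - s by rewrite subr_gt0.
  apply: ler_wpM2l => //; apply: le_trans (Npsi_le HF mlam hC y0 rs) _.
  rewrite -mulrA; apply: ler_wpM2l => //.
  by apply: ler_wpM2r; [exact: W_ge0|apply: KW_mono; lra].
- have CK : 0 <= C * KW t * W y.
    by apply: mulr_ge0; [apply: (mulr_ge0 C0); exact: KW_ge0|exact: W_ge0].
  rewrite subr0 ger0_norm; last exact: mulr_ge0 (normr_ge0 _) CK.
  rewrite normrM (ger0_norm (W_ge0 y)); move: (KW t) => k.
  by rewrite le_eqVlt; apply/orP; left; apply/eqP; ring.
Qed.

Lemma wf_N_L1 y t' : 0 < y -> L1 mu (fun r => if 0 < r < t' then N r y else 0).
Proof.
move=> y0; have [C C0 hC] := wf_lamW.
apply: (@L1_itv_bd R (fun r => N r y) (C * (KW t' * W y))); first exact: (mfun_section2 y mN).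
move=> r /andP[r0 rt]; apply: le_trans (Npsi_le HF mlam hC y0 r0) _.
apply: ler_wpM2l => //; apply: ler_wpM2r; first exact: W_ge0.
by apply: KW_mono; exact: ltW.
Qed.

Lemma wf_G1_int y : \int[mu]_r G1 (y, r) = u y * Ic (fun r => N r y) 0 t.
Proof.
have [y0|y0] := ltP 0 y; last first.
  rewrite u_eq0// mul0r intR_eq0// => r.
  by rewrite /G1/= u_eq0// mul0r; case: ifP.
rewrite /Ic -(intRZ (u y) (wf_N_L1 t y0)); apply: intR_ext => r; rewrite /G1/=.
by case: (boolP (0 < r < t)) => _; rewrite ?mulr0.
Qed.

Lemma wf_G2_int (w : R * R) : \int[mu]_r G2 (w, r) =
  if 0 < w.1 < t then P w.1 w.2 * Ic (fun r => N r w.2) 0 (t - w.1) else 0.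
Proof.
have z0 : (forall r, G2 (w, r) = 0) -> \int[mu]_r G2 (w, r) = 0.
  by move=> h; rewrite intR_eq0.
have [y0|y0] := ltP 0 w.2; last first.
  rewrite z0; first by rewrite PP_eq0// mul0r; case: ifP.
  by move=> r; rewrite /G2/= PP_eq0// mul0r; case: ifP.
case: (boolP (0 < w.1 < t)) => [/andP[w0 wt]|wt]; last first.
  rewrite z0// => r; rewrite /G2/=; case: (boolP ((0 < w.1) && (w.1 < r < t))) => //.
  by move=> /andP[a /andP[b c]]; move: wt; rewrite a (lt_trans b c).
(* The elapsed time since the emission at w.1 becomes the integration variable. *)
have h := wf_N_L1 (t - w.1) y0.
rewrite /Ic -(intR_shift (- w.1) (L1_meas h)) -(intRZ _ (L1_shift (- w.1) h)).
apply: intR_ext => r; rewrite /G2/= w0/= subr_gt0 ltrBlDr subrK.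
by case: (boolP (w.1 < r < t)) => _; rewrite ?mulr0.
Qed.

Lemma wf_P : L1 mu2 (fun w : R * R => if 0 < w.1 < t then P w.1 w.2 * phi w.2 else 0).
Proof.
have [C C0 hC] := ph_W n x0; have [K K0 hK] := W_PP_L1 SS u0i t.
have mp2 : measfun (fun w : R * R => phi w.2) by apply: (mfun_comp mphi); mfun.
apply: (@L1_le _ _ _ mu2 _ (fun w : R * R => C * `|if 0 < w.1 < t then W w.2 * P w.1 w.2 else 0|)); last first.
- exact/L1Z/L1_norm/(NB_L1 hK).
- move=> w; case: (boolP (0 < w.1 < t)) => _; last by rewrite normr0 mulr0.
  rewrite !normrM (ger0_norm (W_ge0 _)) mulrC mulrA ler_wpM2r//; exact: hC.
- apply: mfun_ite; [by mfun| |by mfun]; apply: mfunM => //; exact: mP.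
Qed.

Let cP r := \int[mu]_y (P r y * phi y).
Let cF r := \int[mu]_m (F r m * lam m).

Lemma wf_cP : L1 mu (fun r => if 0 < r < t then cP r else 0) /\
  \int[mu2]_w (if 0 < w.1 < t then P w.1 w.2 * phi w.2 else 0) = Ic cP 0 t.
Proof.
have E r : (if 0 < r < t then cP r else 0) =
    \int[mu]_y (if 0 < r < t then P r y * phi y else 0).
  by case: ifP => //; rewrite intR0.
split; first by apply: L1_ext (fub_L11 (wf_P : L1 (mu \x mu)%E _)) _ => r; exact: E.
by rewrite /Ic -(fub_eq1 (wf_P : L1 (mu \x mu)%E _)); apply: intR_ext => r; rewrite E.
Qed.

Lemma wf_cF_E r : 0 < r < t -> cF r = \int[mu]_y G1 (y, r) + \int[mu2]_w G2 (w, r).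
Proof.
move=> rt; have /andP[r0 rt'] := rt; have [C C0 hC] := wf_lamW.
rewrite /cF (mild_pairing HF SS MS u0i r0 mlam hC); congr (_ + _).
  by apply: intR_ext => y; rewrite /G1/= rt.
by apply: intR_ext => w; rewrite /G2/= rt' andbT.
Qed.

Lemma wf_cF : L1 mu (fun r => if 0 < r < t then cF r else 0) /\
  Ic cF 0 t = \int[mu]_y \int[mu]_r G1 (y, r) + \int[mu2]_w \int[mu]_r G2 (w, r).
Proof.
have E r : (if 0 < r < t then cF r else 0) = \int[mu]_y G1 (y, r) + \int[mu2]_w G2 (w, r).
  case: (boolP (0 < r < t)) => rt; first exact: wf_cF_E.
  rewrite intR_eq0 ?add0r; last by move=> y; rewrite /G1/= (negbTE rt).
  rewrite intR_eq0// => w; rewrite /G2/=.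
  case: (boolP ((0 < w.1) && (w.1 < r < t))) => // /andP[a /andP[b c]].
  by move: rt; rewrite (lt_trans a b) c.
have h1 := fub_L12 wf_G1; have h2 := fub_L12 wf_G2.
split; first by apply: L1_ext (L1D h1 h2) _ => r; exact: E.
rewrite (fub_swap wf_G1) (fub_swap wf_G2) -(intRD h1 h2).
by apply: intR_ext => r; exact: E.
Qed.

(** Duhamel's principle in weak form. The weak equation of the kernel is inserted into the mild
    formula; exchanging the time integrals over s < r < t recombines the pieces into the pairing of
    F at time r. *)
Lemma weak_F : [/\ L1 mu (fun r => if 0 < r < t then cF r else 0),
   L1 mu (fun r => if 0 < r < t then cP r else 0) &
   Tm (En R n) (F t) x = Tm (En R n) u x + Ic (fun r => cF r + cP r) 0 t].
Proof.
have [hF eF] := wf_cF; have [hP eP] := wf_cP; split => //.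
have [C C0 hC] := ph_W n x0.
have -> : Ic (fun r => cF r + cP r) 0 t = Ic cF 0 t + Ic cP 0 t.
  by rewrite /Ic -(intRD hF hP); apply: intR_ext => r; case: ifP => //; rewrite addr0.
have TmE g : Tm (En R n) g x = \int[mu]_m (g m * phi m).
  by apply: intR_ext => m; exact: mulrC.
rewrite !TmE (mild_pairing HF SS MS u0i t0 mphi hC) eF -eP.
have h1 := fub_L11 wf_G1; have h2 := fub_L11 wf_G2.
have hu : L1 mu (fun y => u y * phi y).
  by apply: L1_ext (L1_ph x (En_gt0 R n) ui) _ => y; exact: mulrC.
have -> : \int[mu]_y (u y * Npsi Lam phi t y) = \int[mu]_y (u y * phi y) + \int[mu]_y \int[mu]_r G1 (y, r).
  rewrite -(intRD hu h1); apply: intR_ext => y; rewrite wf_G1_int.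
  have [y0|y0] := ltP 0 y; first by rewrite wf_Npsi// mulrDr.
  by rewrite u_eq0// !mul0r addr0.
rewrite -!addrA; congr (_ + _); congr (_ + _); rewrite -(intRD h2 wf_P); apply: intR_ext => w.
rewrite wf_G2_int; case: (boolP (0 < w.1 < t)) => [/andP[w0 wt]|_]; last by rewrite addr0.
have [y0|y0] := ltP 0 w.2; last by rewrite PP_eq0// !mul0r addr0.
have tw : 0 < t - w.1 by rewrite subr_gt0.
by rewrite (wf_Npsi y0 tw) mulrDr addrC.
Qed.

End Fixed.

End WeakForm.

Lemma NB_int1 d1 d2 (T1 : measurableType d1) (T2 : measurableType d2) (R : realType)
    (m1 : {sigma_finite_measure set T1 -> \bar R}) (m2 : {sigma_finite_measure set T2 -> \bar R})
    (F : T1 * T2 -> R) c : NB (m1 \x m2)%E F c -> NB m1 (fun x => \int[m2]_y F (x, y)) c.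
Proof.
move=> /NBP[Fi Fb]; have F1 := fub_L11 Fi; apply/NBP; split => //; apply: le_trans Fb.
rewrite -(fub_eq1 (L1_norm Fi)); apply: (intR_le_ae (L1_norm F1) (fub_L11 (L1_norm Fi))).
by apply: (aeS (fub_ae1 Fi)) => x h; exact: intR_norm.
Qed.

Lemma NB_int2 d1 d2 (T1 : measurableType d1) (T2 : measurableType d2) (R : realType)
    (m1 : {sigma_finite_measure set T1 -> \bar R}) (m2 : {sigma_finite_measure set T2 -> \bar R})
    (F : T1 * T2 -> R) c : NB (m1 \x m2)%E F c -> NB m2 (fun y => \int[m1]_x F (x, y)) c.
Proof.
move=> /NBP[Fi Fb]; have F1 := fub_L12 Fi; apply/NBP; split => //; apply: le_trans Fb.
rewrite -(fub_eq2 (L1_norm Fi)); apply: (intR_le_ae (L1_norm F1) (fub_L12 (L1_norm Fi))).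
by apply: (aeS (fub_ae2 Fi)) => x h; exact: intR_norm.
Qed.

Lemma inc_alg (R : realType) (a b A B C I : R) :
  A + a - (B + b) = - (C + I) -> a - b + I = - A + B - C.
Proof. lra. Qed.

(** * Comparison of the strong and the mild solution *)

Section Increment.
Variable R : realType.
Notation mu := (@lebesgue_measure R).
Notation mu2 := (mu \x mu)%E.
Implicit Types (s r x y m d : R).

Lemma rho_L1 d t : 0 < d -> L1 mu (rho d t).
Proof. by move=> d0; apply: L1Z; apply: (L1_affine _ _ (@bump_L1 R)); rewrite invr_gt0. Qed.

Lemma rho_ge0 d t s : 0 < d -> 0 <= rho d t s.
Proof. by move=> d0; rewrite mulr_ge0 ?bump_ge0// invr_ge0 ltW. Qed.

Lemma rho_int d t : 0 < d -> \int[mu]_s rho d t s = 1.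
Proof.
move=> d0; have i0 : 0 < d^-1 by rewrite invr_gt0.
rewrite /rho (intRZ _ (L1_affine (- (t / d)) i0 (@bump_L1 R))).
by rewrite (intR_affine _ i0 (@mfun_bump R)) bump_int invrK mulr1 mulVf// gt_eqF.
Qed.

Lemma rho_out d t s : 0 < d -> d <= `|s - t| -> rho d t s = 0.
Proof.
move=> d0 h; rewrite /rho bump_out ?mulr0//.
have -> : d^-1 * s + - (t / d) = (s - t) / d by ring.
by rewrite normrM normfV (gtr0_norm d0) ler_pdivlMr// mul1r.
Qed.

Lemma mfun_rho d t : measfun (rho d t).
Proof. have mb := @mfun_bump R; by apply: mfunM; [mfun|apply: (mfun_comp mb); mfun]. Qed.

Lemma mfun_hat d t0 t1 : measfun (hat d t0 t1).
Proof.
apply: continuous_measurable_fun; apply: Csm_cont.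
apply: CsmD; first exact/Csm_affine/Csm_stepK.
by apply: CsmM; [exact: Csm_cst|exact/Csm_affine/Csm_stepK].
Qed.

Variables (u0 : R -> R) (f : R -> R -> R).
Hypothesis SS : strong_solution u0 f.
Hypothesis u0i : mu.-integrable `]0, +oo[%classic (fun x => (u0 x)%:E).
Notation F := (FF f).
Notation k := (kk f).

Let mF : measfun2 R F. Proof. exact: mfun_FF SS. Qed.
Let mk : measfun2 R k. Proof. exact: mfun_kk SS. Qed.

Definition Nd t s := \int[mu]_x `|F s x - F t x|.

Lemma Nd_L1 t s : L1 mu (fun x => F s x - F t x).
Proof. exact: L1B (FF_L1 SS s) (FF_L1 SS t). Qed.

Lemma mfun_Nd t : measfun (Nd t).
Proof.
apply: (@mfun_intR1 _ _ _ _ _ mu (fun z : R * R => `|F z.1 z.2 - F t z.2|)).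
apply: mfun_norm; apply: mfunB => //.
by apply: (mfun_comp (mfun_FFs SS t)); mfun.
Qed.

Lemma Nd_cont t : 0 < t -> Nd t s @[s --> t] --> Nd t t.
Proof.
move=> t0; have -> : Nd t t = 0.
  by rewrite /Nd intR_eq0// => x; rewrite subrr normr0.
apply/cvgrPdist_le => eps eps0; apply: filterS (FF_cont SS t0 eps0) => s hs.
by rewrite sub0r normrN ger0_norm//; exact: intR_ge0.
Qed.

Lemma Nd_le T : exists2 B, 0 <= B & forall t s, t <= T -> s <= T -> Nd t s <= B.
Proof.
have [B B0 hB] := FF_unif SS u0i T; exists (B + B); first exact: addr_ge0.
move=> t s tT sT; have h := NBD (hB s sT) (NBZ (-1) (hB t tT)); rewrite normrN1 mul1r in h.
have {h} [_ h] := iffLR (NBP _ _ _) h; apply: le_trans h; rewrite le_eqVlt; apply/orP; left; apply/eqP.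
by apply: intR_ext => x; rewrite mulN1r.
Qed.

Section Times.
Variables (t0 t1 : R).
Hypothesis t00 : 0 < t0.
Hypothesis t01 : t0 <= t1.
Let d n := dl t0 n.
Let T := t1 + t0.
Let d0 n : 0 < d n. Proof. exact: dl_gt0. Qed.
Let d2 n : d n <= t0 / 2. Proof. exact: dl_le. Qed.
Let dlt n : d n < t0. Proof. by move: (d2 n) t00; lra. Qed.

Let G t n (z : R * R) := rho (d n) t z.1 * (F z.1 z.2 - F t z.2).

Lemma inc_G t n : t <= t1 -> L1 mu2 (G t n) /\
  \int[mu2]_z `|G t n z| <= \int[mu]_s (rho (d n) t s * Nd t s).
Proof.
move=> tt; have mG : measfun (G t n).
  apply: mfunM; first by apply: (mfun_comp (mfun_rho (d n) t)); mfun.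
  by apply: mfunB => //; apply: (mfun_comp (mfun_FFs SS t)); mfun.
apply: (@L1_prod_of1 _ _ _ _ _ mu mu (G t n) (fun s => rho (d n) t s * Nd t s) mG).
- apply: aeW => s; apply: (NB_ext (NBZ (rho (d n) t s) (L1_NB (Nd_L1 t s)))) => //.
  by rewrite ger0_norm//; exact: rho_ge0.
- have [B B0 hB] := Nd_le T.
  apply: (@L1_le _ _ _ mu _ (fun s : R => B * rho (d n) t s)).
  + by apply: mfunM; [exact: mfun_rho|exact: mfun_Nd].
  + suff key (s : R) : `|rho (d n) t s * Nd t s| <= B * rho (d n) t s by exact: key.
    have N0 : 0 <= Nd t s by exact: intR_ge0.
    rewrite normrM (ger0_norm (rho_ge0 t s (d0 n))) (ger0_norm N0) mulrC.
    have [sT|sT] := leP s T.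
      by apply: ler_wpM2r; [exact: rho_ge0|apply: hB => //; apply: le_trans tt _; rewrite lerDl ltW].
    have q := ltW (dlt n).
    rewrite rho_out ?mulr0//; apply: le_trans (ler_norm _); apply: (le_trans q); rewrite lerBrDr.
    by apply: le_trans (ltW sT); rewrite /T addrC lerD2r.
  + exact/L1Z/rho_L1.
Qed.

Let c t n := \int[mu]_s (rho (d n) t s * Nd t s).

Lemma inc_c t : t0 <= t -> t <= t1 -> c t n @[n --> \oo] --> 0.
Proof.
move=> tt0 tt1; have tp : 0 < t := lt_le_trans t00 tt0.
have -> : 0 = Nd t t.
  by rewrite /Nd intR_eq0// => x; rewrite subrr normr0.
have [B B0 hB] := Nd_le T.
apply: (@rho_cvg R (Nd t) t d (t0 / 2) B).
- by move=> n; rewrite d0 d2.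
- exact: dl_cvg.
- exact: mfun_Nd.
- move=> s; rewrite ler_norml => /andP[h1 h2]; rewrite ger0_norm; last exact: intR_ge0.
  by apply: hB; rewrite /T; lra.
- exact: Nd_cont.
Qed.

Let kT (z : R * R) := if z.1 < T then k z.1 z.2 else 0.
Let kTi : L1 mu2 kT. Proof. exact: kk_L1 SS T. Qed.
Let hm n s := hat (d n) t0 t1 s - (if t0 < s < t1 then 1 else 0).

Lemma inc_mhm n : measfun (hm n).
Proof. by apply: mfunB; [exact: mfun_hat|mfun]. Qed.

Lemma inc_hm_le n s : `|hm n s| <= 2.
Proof.
have h := hat_bd t0 t1 (d0 n) s; rewrite /hm; apply: le_trans (ler_normB _ _) _.
case: (t0 < s < t1); rewrite ?normr1 ?normr0; lra.
Qed.

Lemma inc_Z n : L1 mu2 (fun z : R * R => hm n z.1 * kT z).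
Proof.
apply: (@L1M _ _ _ mu2 2 (fun z : R * R => hm n z.1) kT) => //.
- by apply: (mfun_comp (inc_mhm n)); mfun.
- by move=> z; exact: inc_hm_le.
Qed.

Let zn n := \int[mu2]_z `|hm n z.1 * kT z|.

Lemma inc_zn : zn n @[n --> \oo] --> 0.
Proof.
rewrite -(@intR0 _ _ R mu2).
apply: (@dct _ _ _ mu2 _ _ (fun z : R * R => 2 * `|kT z|)).
- by move=> n; exact: (L1_meas (L1_norm (inc_Z n))).
- exact: mfun_cst.
- have h1 : {ae mu2, forall z : R * R, z.1 != t0 /\ z.1 != t1}.
    pose b (z : R * R) := (z.1 <= t0) && (t0 <= z.1) || ((z.1 <= t1) && (t1 <= z.1)).
    have mb : measfun (fun z : R * R => if b z then 1 else 0 : R) by rewrite /b; mfun.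
    have h : NB mu2 (fun z : R * R => if b z then 1 else 0 : R) 0.
      apply: (@ae_of_sections _ _ _ _ _ mu mu _ mb); apply: (aeI (ae_neq t0) (ae_neq t1)) => s a1 a2.
      by apply: aeW => y; rewrite /b/= -!eq_le (negbTE a1) (negbTE a2).
    apply: (aeS (NB0_ae h)) => z; rewrite /b -!eq_le.
    by case: (z.1 == t0); case: (z.1 == t1) => //= e; have := oner_neq0 R; rewrite e eqxx.
  apply: (aeS h1) => z [a b]; have h := hat_cvg t01 d0 (@dl_cvg R t0) a b.
  have e : hm n z.1 * kT z @[n --> \oo] --> 0 * kT z.
    apply: cvgMl; rewrite -(subrr (if t0 < z.1 < t1 then 1 else 0 : R)).
    by apply: cvgB => //; exact: cvg_cst.
  have e2 : `|hm n z.1 * kT z| @[n --> \oo] --> `|0 * kT z| := cvg_norm e.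
  by rewrite mul0r normr0 in e2; exact: e2.
- exact/L1Z/L1_norm.
- by move=> n; apply: aeW => z; rewrite normr_id normrM ler_wpM2r// inc_hm_le.
Qed.

Let D x := F t0 x - F t1 x + Ic (fun r => k r x) t0 t1.

Lemma inc_weak n : {ae mu, forall x, 0 < x ->
  \int[mu]_s ((rho (d n) t0 s - rho (d n) t1 s) * F s x) = - \int[mu]_s (hat (d n) t0 t1 s * k s x)}.
Proof.
have [_ _ _ _ [_ [_ [_ [w [hw [mw _] _ hae]]]]]] := SS.
pose D' (z : R * R) := (if (0 < z.1) && (0 < z.2) then w z.1 z.2 else 0) - k z.1 z.2.
have mD : measfun D' by apply: mfunB => //; exact: (mfun_Qpos mw).
have aD : {ae mu, forall s, {ae mu, forall x, D' (s, x) = 0}}.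
  apply: (@ae_sections _ _ _ _ _ mu mu (fun z => D' z = 0)); apply: (aeS hae) => z hz.
  rewrite /D' /kk; case: (boolP (0 < z.1)) => z1; case: (boolP (0 < z.2)) => z2; rewrite ?subrr//.
  by rewrite hz// subrr.
apply: (aeI (hw _ (hat_test (d0 n) t01 (dlt n))) (@ae_swap _ _ _ _ _ mu mu _ mD aD)) => x h aDx x0.
have [_ i2 E] := h x0.
rewrite (intR_Rpos (fun s => derive1 (hat (d n) t0 t1) s * f s x)) in E.
rewrite (intR_Rpos (fun s => hat (d n) t0 t1 s * w s x)) in E.
transitivity (\int[mu]_s (if 0 < s then derive1 (hat (d n) t0 t1) s * f s x else 0)).
  apply: intR_ext => s; rewrite hat_derive /FF x0 andbT.
  by case: (boolP (0 < s)) => _; rewrite ?mulr0.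
rewrite E; congr (- _); apply: intR_ae.
- exact: (L1_meas (iffLR (L1_Rpos _) i2)).
- by apply: mfunM; [exact: mfun_hat|exact: (mfun_section2 x mk)].
apply: (aeS aDx) => s; rewrite /D'/= x0 andbT /kk x0 andbT.
by case: (boolP (0 < s)) => _; rewrite ?mulr0// => /eqP; rewrite subr_eq0 => /eqP ->.
Qed.

Lemma inc_D n : {ae mu, forall x, D x =
  - (\int[mu]_s G t0 n (s, x)) + (\int[mu]_s G t1 n (s, x)) - \int[mu]_s (hm n s * kT (s, x))}.
Proof.
have a := aeI (fub_ae2 (inc_G n t01).1) (fub_ae2 (inc_G n (lexx t1)).1) (fun x p q => conj p q).
apply: (aeI (inc_weak n) (aeI a (fub_ae2 kTi) (fun x p q => conj p q))) => x hw [[a0 a1] ak].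
have [x0|x0] := ltP 0 x; last first.
  have F0 s : F s x = 0 by rewrite FF_eq0// [0 < x]ltNge x0 andbF.
  have k0 s : k s x = 0 by rewrite /kk [0 < x]ltNge x0 andbF.
  have Z (g : R -> R) : (forall s, g s = 0) -> \int[mu]_s g s = 0.
    by move=> g0; rewrite intR_eq0.
  have -> : \int[mu]_s G t0 n (s, x) = 0 by apply: Z => s; rewrite /G/= !F0 subrr mulr0.
  have -> : \int[mu]_s G t1 n (s, x) = 0 by apply: Z => s; rewrite /G/= !F0 subrr mulr0.
  have -> : \int[mu]_s (hm n s * kT (s, x)) = 0.
    by apply: Z => s; rewrite /kT/= k0; case: ifP; rewrite mulr0.
  rewrite /D !F0 /Ic Z; last by move=> s; rewrite k0; case: ifP.
  by rewrite !oppr0 !addr0.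
have {}hw := hw x0; rewrite /= in a0 a1 ak.
have r0 := rho_L1 t0 (d0 n); have r1 := rho_L1 t1 (d0 n).
have E1 : \int[mu]_s ((rho (d n) t0 s - rho (d n) t1 s) * F s x) =
    \int[mu]_s G t0 n (s, x) + F t0 x - (\int[mu]_s G t1 n (s, x) + F t1 x).
  have -> : F t0 x = \int[mu]_s (F t0 x * rho (d n) t0 s) by rewrite (intRZ _ r0) rho_int// mulr1.
  have -> : F t1 x = \int[mu]_s (F t1 x * rho (d n) t1 s) by rewrite (intRZ _ r1) rho_int// mulr1.
  rewrite -(intRD a0 (L1Z (F t0 x) r0)) -(intRD a1 (L1Z (F t1 x) r1)).
  rewrite -(intRB (L1D a0 (L1Z (F t0 x) r0)) (L1D a1 (L1Z (F t1 x) r1))).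
  by apply: intR_ext => s; rewrite /G/=; ring.
have hZ : L1 mu (fun s => hm n s * kT (s, x)).
  by apply: (@L1M _ _ _ mu 2) => //; [exact: inc_mhm|exact: inc_hm_le].
have hI : L1 mu (fun s => (if t0 < s < t1 then 1 else 0) * kT (s, x)).
  by apply: (@L1M _ _ _ mu 1) => //; [mfun|move=> s; case: ifP; rewrite ?normr1 ?normr0].
have E2 : \int[mu]_s (hat (d n) t0 t1 s * k s x) = \int[mu]_s (hm n s * kT (s, x)) + Ic (fun r => k r x) t0 t1.
  have -> : Ic (fun r => k r x) t0 t1 = \int[mu]_s ((if t0 < s < t1 then 1 else 0) * kT (s, x)).
    apply: intR_ext => s; rewrite /kT/=; case: (boolP (t0 < s < t1)) => [/andP[_ st]|_]; rewrite ?mul0r ?mul1r//.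
    by rewrite (lt_trans st)// /T ltrDl.
  rewrite -(intRD hZ hI); apply: intR_ext => s; rewrite /hm -mulrDl subrK /kT/=.
  have [sT|sT] := ltP s T => //; rewrite hat_out ?mul0r//; apply/negP.
  by rewrite negb_and -!ltNge; apply/orP; right; apply: lt_le_trans sT; rewrite /T ltrD2l dlt.
by rewrite E1 E2 in hw; exact: inc_alg hw.
Qed.

(** At fixed x nothing is known about continuity in time, so the values at t0 and t1 cannot be
    recovered pointwise from the weak derivative. The cut-offs are removed in L1(dx) instead, where
    F is continuous in time; the defect D has norm at most three terms that tend to 0. *)
Lemma increment : {ae mu, forall x, F t1 x = F t0 x + Ic (fun r => k r x) t0 t1}.
Proof.
have h n : NB mu D (c t0 n + c t1 n + zn n).
  have [g0 b0] := inc_G n t01; have [g1 b1] := inc_G n (lexx t1); have gz := inc_Z n.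
  have N0 : NB mu (fun x => \int[mu]_s G t0 n (s, x)) (c t0 n).
    by apply: NB_int2; apply/NBP.
  have N1 : NB mu (fun x => \int[mu]_s G t1 n (s, x)) (c t1 n).
    by apply: NB_int2; apply/NBP.
  have NZ : NB mu (fun x => \int[mu]_s (hm n s * kT (s, x))) (zn n).
    by apply: (@NB_int2 _ _ _ _ _ mu mu (fun z : R * R => hm n z.1 * kT z)); apply/NBP.
  have N := NBD (NBD (NBZ (-1) N0) N1) (NBZ (-1) NZ).
  rewrite normrN1 !mul1r in N.
  apply: NB_ae N; last by apply: (aeS (inc_D n)) => x E; rewrite E !mulN1r.
  apply: mfunD; first by apply: mfunB; exact: (mfun_FFs SS _).
  suff h : measfun (fun z : R * R => if t0 < z.1 < t1 then k z.1 z.2 else 0).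
    exact: (mfun_intR2 mu h).
  by apply: mfun_ite; [mfun|exact: mk|mfun].
have lim : c t0 n + c t1 n + zn n @[n --> \oo] --> (0 : R).
  have -> : (0 : R) = 0 + 0 + 0 by rewrite !addr0.
  apply: cvgD inc_zn; apply: cvgD; exact: inc_c.
have Di : L1 mu D := NB_L1 (h 0%N).
have : NB mu D 0.
  apply/NBP; split => //; apply: (cvgr_to_ge lim).
  by apply: nearW => n; have [_] := iffLR (NBP _ _ _) (h n).
move=> /NB0_ae; apply: filterS => x; rewrite /D; lra.
Qed.

End Times.
End Increment.

Section ZeroOfIntervals.
Variable R : realType.
Notation mu := (@lebesgue_measure R).

Lemma int_cst_itv (c s t : R) : s <= t -> \int[mu]_m (if s < m < t then c else 0) = c * (t - s).
Proof.
move=> st; rewrite -(intR_itv s t (fun=> c)) Rintegral_cst ?measurable_itv//.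
congr (_ * _); rewrite [X in fine X]lebesgue_measure_itv/= lte_fin; case: ltP => // ts.
by rewrite (_ : t - s = 0)//; apply/eqP; rewrite subr_eq0 eq_le ts st.
Qed.

(** At a Lebesgue point the value is the limit of the means over small intervals, which all
    vanish. *)
Lemma zero_of_intervals (g : R -> R) (a b : R) : L1 mu g ->
  (forall s t, a < s -> s <= t -> t < b -> Ic g s t = 0) ->
  {ae mu, forall x, a < x < b -> g x = 0}.
Proof.
move=> gi g0; have mg := L1_meas gi.
have lg : locally_integrable setT g by apply: open_integrable_locally => //; exact: openT.
suff key (x : R) : lebesgue_pt g x -> a < x < b -> g x = 0.
  by apply: (aeS (lebesgue_differentiation lg)) => x; exact: key.
move=> lx /andP[ax xb].
pose t := Num.min (x - a) (b - x).
have t0 : 0 < t by rewrite lt_min !subr_gt0 ax.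
have dt n : dl t n < t by apply: le_lt_trans (dl_le n t0) _; lra.
have ex : dl t n @[n --> \oo] --> 0^'+.
  have h := @dl_cvg R t.
  move=> P hP; have [N _ HN] := h _ hP; exists N => // n /HN /=; apply.
  exact: dl_gt0.
have {}lx := cvg_comp _ _ ex lx.
have {}lx : fine (davg g x (dl t n)) @[n --> \oo] --> 0 by exact: (fine_cvg lx).
apply/eqP; rewrite -normr_le0; apply: (cvgr_to_ge lx); apply: nearW => n.
have r0 := dl_gt0 n t0; move: (dt n); move: (dl t n) r0 => r r0; rewrite lt_min => /andP[ra rb].
have gL : L1 mu (fun m => if x - r < m < x + r then g m else 0).
  by apply: (@L1_ext _ _ _ mu _ (fun m : R => (if x - r < m < x + r then 1 else 0) * g m));
    [apply: (@L1M _ _ _ mu 1) => //; [mfun|move=> m; case: ifP; rewrite ?normr1 ?normr0]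
    |move=> m; case: ifP; rewrite ?mul1r ?mul0r].
have cL : L1 mu (fun m => if x - r < m < x + r then g x else 0).
  by apply: (NB_L1 (NB_itv _ _)); lra.
have dL := L1_norm (L1B gL cL).
rewrite davgE//=.
have -> : \int[mu]_m (if x - r < m < x + r then `|g m - g x| else 0) =
   \int[mu]_m `|(if x - r < m < x + r then g m else 0) - (if x - r < m < x + r then g x else 0)|.
  by apply: intR_ext => m; case: ifP => // _; rewrite subrr normr0.
apply: (@le_trans _ _ ((r *+ 2)^-1 * `|\int[mu]_m ((if x - r < m < x + r then g m else 0) - (if x - r < m < x + r then g x else 0))|)); last first.
  by apply: ler_wpM2l; [rewrite invr_ge0 mulrn_wge0// ltW|exact: (intR_norm (L1B gL cL))].
rewrite (intRB gL cL) int_cst_itv; last lra.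
have -> : \int[mu]_m (if x - r < m < x + r then g m else 0) = 0 by apply: g0; lra.
rewrite sub0r normrN normrM (_ : x + r - (x - r) = r *+ 2); last by rewrite mulr2n; ring.
have r2 : 0 < r *+ 2 by rewrite mulrn_wgt0.
by rewrite (gtr0_norm r2) mulrCA mulVf ?mulr1// gt_eqF.
Qed.

End ZeroOfIntervals.

Section AveragedEquation.
Variable R : realType.
Notation mu := (@lebesgue_measure R).
Notation mu2 := (mu \x mu)%E.
Implicit Types (s r y m : R).
Variables (Lam : R -> R -> R) (u0 : R -> R) (f : R -> R -> R).
Hypothesis HF : fundamental_solution Lam.
Hypothesis SS : strong_solution u0 f.
Hypothesis MS : mild_solution Lam u0 f.
Hypothesis u0i : mu.-integrable `]0, +oo[%classic (fun x => (u0 x)%:E).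

Notation F := (FF f).
Notation P := (PP f).
Notation k := (kk f).

Let mF : measfun2 R F. Proof. exact: mfun_FF SS. Qed.
Let mk : measfun2 R k. Proof. exact: mfun_kk SS. Qed.
Let mP : measfun2 R P. Proof. exact: mfun_PP SS. Qed.

Section Fixed.
Variables (n : nat).
Let e := En R n.
Let cF (x : R) r := \int[mu]_m (F r m * Ladj (ph e x) m).
Let cP (x : R) r := \int[mu]_m (P r m * ph e x m).
Let D x r := Tm e (k r) x - (cF x r + cP x r).

Lemma ae_mD : measfun2 R D.
Proof.
apply: mfunB; last apply: mfunD.
- apply: (@mfun_intR1 _ _ _ _ _ mu (fun w : (R * R) * R => ph e w.1.1 w.2 * k w.1.2 w.2)).
  by apply: mfunM; [apply: (mfun_curry (@mfun_ph R e)); mfun|apply: (mfun_curry mk); mfun].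
- apply: (@mfun_intR1 _ _ _ _ _ mu (fun w : (R * R) * R => F w.1.2 w.2 * Ladj (ph e w.1.1) w.2)).
  apply: mfunM; first by apply: (mfun_curry mF); mfun.
  suff ml : measfun (fun w : (R * R) * R => (w.1.1, w.2)).
    exact: (mfun_comp (mfun_Ladj_ph e) ml).
  by mfun.
- apply: (@mfun_intR1 _ _ _ _ _ mu (fun w : (R * R) * R => P w.1.2 w.2 * ph e w.1.1 w.2)).
  by apply: mfunM; [apply: (mfun_curry mP); mfun|apply: (mfun_curry (@mfun_ph R e)); mfun].
Qed.

Section Point.
Variable x : R.
Hypothesis x0 : 0 < x.

Lemma ae_kph T : L1 mu2 (fun z : R * R => ph e x z.2 * (if z.1 < T then k z.1 z.2 else 0)).
Proof.
apply: (@L1M _ _ _ mu2 (bC R / (e * x)) (fun z : R * R => ph e x z.2)).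
- by have h := wk_mphi n x0; apply: (mfun_comp h); mfun.
- by move=> z; exact: wk_phib.
- exact: kk_L1 SS T.
Qed.

Lemma ae_Tk_L1 T : L1 mu (fun r => if r < T then Tm e (k r) x else 0).
Proof.
apply: L1_ext (fub_L11 (ae_kph T)) _ => r /=; case: (boolP (r < T)) => _ //.
by rewrite intR_eq0// => m; rewrite mulr0.
Qed.

Lemma ae_Tk t0 t1 : 0 < t0 -> t0 <= t1 ->
  Tm e (F t1) x - Tm e (F t0) x = Ic (fun r => Tm e (k r) x) t0 t1.
Proof.
move=> t00 t01; have e0 := En_gt0 R n.
have a1 := L1_ph x e0 (FF_L1 SS t1); have a0 := L1_ph x e0 (FF_L1 SS t0).
rewrite /Tm -(intRB a1 a0).
pose G (z : R * R) := (if t0 < z.1 < t1 then 1 else 0) * (ph e x z.2 * (if z.1 < t1 then k z.1 z.2 else 0)).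
have Gi : L1 mu2 G.
  apply: (@L1M _ _ _ mu2 1 (fun z : R * R => if t0 < z.1 < t1 then 1 else 0)).
  - by mfun.
  - by move=> z; case: ifP; rewrite ?normr1 ?normr0.
  - exact: ae_kph.
have -> : Ic (fun r => \int[mu]_m (ph e x m * k r m)) t0 t1 = \int[mu]_r \int[mu]_m G (r, m).
  apply: intR_ext => r; rewrite /G/=; case: (boolP (t0 < r < t1)) => [/andP[_ ->]|_].
    by apply: intR_ext => m; rewrite mul1r.
  by rewrite intR_eq0// => m; rewrite mul0r.
rewrite (fub_swap Gi); apply: intR_ae.
- exact: (L1_meas (L1B a1 a0)).
- exact: (L1_meas (fub_L12 Gi)).
have ki := kk_L1 SS t1.
apply: (aeI (increment SS u0i t00 t01) (fub_ae2 ki)) => m E ki' /=; rewrite /= in ki'.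
have kL : L1 mu (fun r => if t0 < r < t1 then k r m else 0).
  apply: (@L1_ext _ _ _ mu _ (fun r : R => (if t0 < r < t1 then 1 else 0) * (if r < t1 then k r m else 0))).
    by apply: (@L1M _ _ _ mu 1) => //; [mfun|move=> r; case: ifP; rewrite ?normr1 ?normr0].
  by move=> r; case: (boolP (t0 < r < t1)) => [/andP[_ ->]|_]; rewrite ?mul1r ?mul0r.
rewrite -mulrBr E addrAC subrr add0r /Ic -(intRZ _ kL); apply: intR_ext => r; rewrite /G/=.
by case: (boolP (t0 < r < t1)) => [/andP[_ ->]|_]; rewrite ?mul1r ?mul0r ?mulr0.
Qed.

(** The increment of Tm e (F t) x between two positive times is computed twice, from the strong
    equation and from the mild one. The two time integrands have equal integrals over every
    interval, hence agree almost everywhere. *)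
Lemma ae_D0 : {ae mu, forall r, 0 < r -> D x r = 0}.
Proof.
have wF t (t0 : 0 < t) := weak_F HF SS MS u0i n x0 t0.
have DL t : L1 mu (fun r => if 0 < r < t then D x r else 0).
  have [t0|t0] := ltP 0 t; last first.
    apply: L1_ext (L1_0 mu) _ => r; case: (boolP (0 < r < t)) => // /andP[a b].
    by have := lt_trans a (lt_le_trans b t0); rewrite ltxx.
  have [h1 h2 _] := wF t t0.
  have h3 : L1 mu (fun r => if 0 < r < t then Tm e (k r) x else 0).
    apply: (@L1_ext _ _ _ mu _ (fun r : R => (if 0 < r < t then 1 else 0) * (if r < t then Tm e (k r) x else 0))).
      apply: (@L1M _ _ _ mu 1); [by mfun|by move=> r; case: ifP; rewrite ?normr1 ?normr0|exact: ae_Tk_L1].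
    by move=> r; case: (boolP (0 < r < t)) => [/andP[_ ->]|_]; rewrite ?mul1r ?mul0r.
  apply: L1_ext (L1B h3 (L1D h1 h2)) _ => r; case: (boolP (0 < r < t)) => _ //.
  by rewrite addr0 subr0.
suff h N : {ae mu, forall r, 0 < r < N.+1%:R -> D x r = 0}.
  have := ae_foralln h; apply: filterS => r hr r0; apply: (hr (Num.bound r)).
  by rewrite r0 (lt_trans (archi_boundP (ltW r0)))// ltr_nat.
pose g r := if 0 < r < N.+1%:R then D x r else 0.
suff hg s t : 0 < s -> s <= t -> t < N.+1%:R -> Ic g s t = 0.
  apply: (aeS (zero_of_intervals (DL N.+1%:R) hg)) => r hr rN.
  by have := hr rN; rewrite rN.
move=> s0 st tN; have t0 := lt_le_trans s0 st.
have -> : Ic g s t = Ic (D x) s t.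
  apply: intR_ext => r; case: (boolP (s < r < t)) => // /andP[a b].
  by rewrite /g (lt_trans s0 a) (lt_trans b tN).
have [h1 h2 E1] := wF t t0; have [_ _ E0] := wF s s0.
have hb : L1 mu (fun r => if 0 < r < t then cF x r + cP x r else 0).
  by apply: L1_ext (L1D h1 h2) _ => r; case: (boolP (0 < r < t)) => _ //; rewrite addr0.
have hb' := Ic_sub hb (ltW s0) (lexx t).
have hD := Ic_sub (DL t) (ltW s0) (lexx t).
have E := ae_Tk s0 st.
rewrite (Ic_split (ltW s0) st hb) in E1.
rewrite E1 E0 in E.
have Es : Ic (fun r => Tm e (k r) x) s t = Ic (D x) s t + Ic (fun r => cF x r + cP x r) s t.
  rewrite /Ic -(intRD hD hb'); apply: intR_ext => r; case: (boolP (s < r < t)) => _; last by rewrite addr0.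
  by rewrite /D subrK.
rewrite Es in E; move: E; rewrite -/e -/(cF x) -/(cP x).
move: (Ic (D x) s t) (Ic _ 0 s) (Ic _ s t) => A B C; lra.
Qed.

End Point.

(** The quantifiers are exchanged because the sequel works at a fixed time r; the exceptional set of
    x may depend on r. *)
Lemma averaged_equation_n : {ae mu, forall r, 0 < r -> {ae mu, forall x, 0 < x ->
  Tm e (k r) x = cF x r + cP x r}}.
Proof.
pose G (z : R * R) := if (0 < z.1) && (0 < z.2) then D z.1 z.2 else 0.
have mG : measfun G by apply: mfun_ite; [mfun|exact: ae_mD|mfun].
have h : {ae mu, forall x, {ae mu, forall r, G (x, r) = 0}}.
  apply: aeW => x; have [x0|x0] := ltP 0 (x : R); last by apply: aeW => r; rewrite /G/= ltNge x0.
  by apply: (aeS (ae_D0 x0)) => r hr; rewrite /G/=; case: (boolP ((0 < x) && (0 < r))) => // /andP[_ /hr].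
apply: (aeS (@ae_swap _ _ _ _ _ mu mu _ mG h)) => r hr r0; apply: (aeS hr) => x.
rewrite /G/= => hx x0; move: hx; rewrite x0 r0/= /D => /eqP; rewrite subr_eq0 => /eqP; exact.
Qed.

End Fixed.

Lemma averaged_equation : {ae mu, forall r, 0 < r -> forall n, {ae mu, forall x, 0 < x ->
  Tm (En R n) (k r) x = \int[mu]_m (F r m * Ladj (ph (En R n) x) m) +
    \int[mu]_m (P r m * ph (En R n) x m)}}.
Proof. by have := ae_foralln averaged_equation_n; apply: filterS => r h r0 n; exact: h. Qed.

End AveragedEquation.

(** * Dissipation *)

Section Dissipation.
Variable R : realType.
Notation mu := (@lebesgue_measure R).
Notation mu2 := (mu \x mu)%E.
Implicit Types (s r x y m a b : R).

Section SymmetricKernel.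
Variables (K : R -> R -> R) (A : R) (G : R -> R).
Hypothesis mK : measfun2 R K.
Hypothesis KA : forall x, NB mu (fun y => W x * K x y) A.
Hypothesis KA' : forall y, NB mu (fun x => W x * K x y) A.
Hypothesis Gi : L1 mu G.
Let mG : measfun G. Proof. exact: L1_meas Gi. Qed.

Lemma schur : NB mu2 (fun z : R * R => W z.1 * (K z.1 z.2 * (G z.2 - G z.1)))
  (2 * A * \int[mu]_x `|G x|).
Proof.
have mWK : measfun (fun z : R * R => W z.1 * K z.1 z.2).
  by apply: mfunM => //; apply: (mfun_comp (@mfun_W R)); mfun.
pose F1 (z : R * R) := W z.1 * K z.1 z.2 * G z.2.
pose F2 (z : R * R) := W z.1 * K z.1 z.2 * G z.1.
have mF1 : measfun F1 by apply: mfunM => //; apply: (mfun_comp mG); mfun.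
have mF2 : measfun F2 by apply: mfunM => //; apply: (mfun_comp mG); mfun.
have Gn := L1_norm Gi.
have h1 : NB mu2 F1 (A * \int[mu]_x `|G x|).
  rewrite -(intRZ A Gn); apply/NBP.
  apply: (@L1_prod_of2 _ _ _ _ _ mu mu F1 (fun y => A * `|G y|) mF1); last exact: L1Z.
  apply: aeW => y; apply: (NB_ext (NBZ (G y) (KA' y))); last by rewrite mulrC.
  by move=> x; rewrite mulrC.
have h2 : NB mu2 F2 (A * \int[mu]_x `|G x|).
  rewrite -(intRZ A Gn); apply/NBP.
  apply: (@L1_prod_of1 _ _ _ _ _ mu mu F2 (fun y => A * `|G y|) mF2); last exact: L1Z.
  apply: aeW => x; apply: (NB_ext (NBZ (G x) (KA x))); last by rewrite mulrC.
  by move=> y; rewrite mulrC.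
apply: (NB_ext (NBD h1 (NBZ (-1) h2))); first by move=> z; rewrite /F1 /F2; ring.
by rewrite normrN1 mul1r -mulrA; move: (A * _) => q; lra.
Qed.

Lemma mfun_PopK : measfun (Pop K G).
Proof.
apply: (@mfun_intR1 _ _ _ _ _ mu (fun z : R * R => K z.1 z.2 * (G z.2 - G z.1))).
by apply: mfunM => //; apply: mfunB; apply: (mfun_comp mG); mfun.
Qed.

Section Pairing.
Variables (nw v : R -> R) (Jb : R).
Hypothesis mnw : measfun nw.
Hypothesis nwW : forall x, 0 <= nw x <= 4 * W x.
Hypothesis mv : measfun v.
Hypothesis vb : forall x, `|v x| <= Jb.

Let H (z : R * R) := v z.1 * (nw z.1 * (K z.1 z.2 * (G z.2 - G z.1))).

Lemma pair_H : L1 mu2 H.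
Proof.
have J0 : 0 <= Jb := le_trans (normr_ge0 _) (vb 0).
have /NB_L1 Fi := schur.
apply: (@L1_le _ _ _ mu2 _ (fun z : R * R => (Jb * 4) * `|W z.1 * (K z.1 z.2 * (G z.2 - G z.1))|)).
- apply: mfunM; first by apply: (mfun_comp mv); mfun.
  apply: mfunM; first by apply: (mfun_comp mnw); mfun.
  by apply: mfunM => //; apply: mfunB; apply: (mfun_comp mG); mfun.
- move=> z; have /andP[n0 n4] := nwW z.1.
  rewrite /H normrM (normrM (nw _)) (ger0_norm n0) (normrM (W _)) (ger0_norm (W_ge0 _)) -mulrA.
  apply: ler_pM => //; first by apply: mulr_ge0.
  by rewrite mulrA; apply: ler_wpM2r.
- exact/L1Z/L1_norm.
Qed.

Lemma pair_PopE : L1 mu (fun x => v x * (nw x * Pop K G x)) /\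
  \int[mu]_x (v x * (nw x * Pop K G x)) = \int[mu2]_z H z.
Proof.
have mPP : measfun (fun x => v x * (nw x * Pop K G x)).
  by apply: mfunM => //; apply: mfunM => //; exact: mfun_PopK.
have E : {ae mu, forall x, v x * (nw x * Pop K G x) = \int[mu]_y H (x, y)}.
  have /NB_L1 Fi := schur; apply: (aeS (fub_ae1 Fi)) => x h.
  have [x0|x0] := ltP 0 (x : R); last first.
    have n0 : nw x = 0.
      by apply/eqP; rewrite eq_le; have := nwW x; rewrite /W ltNge x0/= mulr0 => /andP[-> ->].
    by rewrite n0 mul0r mulr0 intR_eq0// => y; rewrite /H/= n0 mul0r mulr0.
  have Wn : W x != 0 by rewrite gt_eqF// W_gt0.
  have h' : L1 mu (fun y => K x y * (G y - G x)).
    by apply: L1_ext (L1Z (W x)^-1 h) _ => y; rewrite /= mulrA mulVf// mul1r.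
  by rewrite -(intRZ _ h') -(intRZ _ (L1Z _ h')).
split; first by apply: L1_ae (fub_L11 pair_H); [exact: mPP|exact: E].
by rewrite -(fub_eq1 pair_H); apply: intR_ae; [exact: mPP|exact: (L1_meas (fub_L11 pair_H))|exact: E].
Qed.

End Pairing.

Section Monotone.
Variables (nw j : R -> R) (Jb : R).
Hypothesis mnw : measfun nw.
Hypothesis nwW : forall x, 0 <= nw x <= 4 * W x.
Hypothesis mj : measfun j.
Hypothesis jb : forall a, `|j a| <= Jb.
Hypothesis jm : forall a b, a <= b -> j a <= j b.
Hypothesis Ksym : forall x y, nw x * K x y = nw y * K y x.
Variable b : R * R -> R.
Hypothesis mb : measfun b.
Hypothesis b_ge0 : forall z, 0 <= b z.
Hypothesis b_le : forall z, b z <= nw z.1 * K z.1 z.2.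

Let Q (z : R * R) := (j (G z.1) - j (G z.2)) * (G z.1 - G z.2).

Lemma Q_ge0 z : 0 <= Q z.
Proof.
rewrite /Q; have [h|h] := leP (G z.1) (G z.2).
  by rewrite -mulrNN; apply: mulr_ge0; rewrite oppr_ge0 subr_le0//; exact: jm.
by apply: mulr_ge0; rewrite subr_ge0; [exact/jm/ltW|exact: ltW].
Qed.

(* Symmetrizing in (x, y) turns the pairing into a Dirichlet form. *)
Lemma dissipation : L1 mu2 (fun z => b z * Q z) /\
  \int[mu]_x (j (G x) * (nw x * Pop K G x)) <= - (\int[mu2]_z (b z * Q z)) / 2.
Proof.
have mv : measfun (fun x => j (G x)) by exact: (mfun_comp mj mG).
have vb x : `|j (G x)| <= Jb by exact: jb.
have Hi := pair_H mnw nwW mv vb; have [_ ->] := pair_PopE mnw nwW mv vb.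
set H := (X in L1 _ X) in Hi *.
have Hs : L1 mu2 (fun z => H (z.2, z.1)) := L1_prod_swap Hi.
have Es : \int[mu2]_z H (z.2, z.1) = \int[mu2]_z H z.
  by rewrite -(fub_eq1 Hs) -(fub_eq2 Hi).
have mQ : measfun Q.
  have m1 : measfun (fun z : R * R => G z.1) by apply: (mfun_comp mG); mfun.
  have m2 : measfun (fun z : R * R => G z.2) by apply: (mfun_comp mG); mfun.
  apply: mfunM; last exact: mfunB.
  by apply: mfunB; [exact: (mfun_comp mj m1)|exact: (mfun_comp mj m2)].
have E z : H z + H (z.2, z.1) = - (nw z.1 * K z.1 z.2 * Q z).
  have -> : H (z.2, z.1) = j (G z.2) * (nw z.2 * K z.2 z.1) * (G z.1 - G z.2) by rewrite /H/=; ring.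
  by rewrite -Ksym /H /Q; ring.
have S := L1D Hi Hs.
(* Since Q is nonnegative, any part b of the symmetric kernel may be kept; it will be a constant on
   a box away from the diagonal. *)
have bQ z : b z * Q z <= - (H z + H (z.2, z.1)).
  by rewrite E opprK; apply: ler_wpM2r; [exact: Q_ge0|exact: b_le].
have bQi : L1 mu2 (fun z => b z * Q z).
  apply: (@L1_le _ _ _ mu2 _ (fun z => - (H z + H (z.2, z.1)))); [exact: mfunM| |exact: L1N].
  by move=> z; rewrite ger0_norm; [exact: bQ|apply: mulr_ge0; [exact: b_ge0|exact: Q_ge0]].
split => //; have := intR_le bQi (L1N S) bQ; rewrite (intRN S) (intRD Hi Hs) Es.
have alg (h q : R) : q <= - (h + h) -> h <= - q / 2 by lra.
exact: alg.
Qed.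

End Monotone.
End SymmetricKernel.

End Dissipation.

Lemma ae_prod1 d1 d2 (T1 : measurableType d1) (T2 : measurableType d2) (R : realType)
    (m1 : {sigma_finite_measure set T1 -> \bar R}) (m2 : {sigma_finite_measure set T2 -> \bar R})
    (P : T1 -> Prop) : {ae m1, forall x, P x} -> {ae (m1 \x m2)%E, forall z : T1 * T2, P z.1}.
Proof.
move=> [A [mA A0 PA]]; exists (A `*` setT); split; first exact: measurableX.
  have -> : (m1 \x m2)%E (A `*` setT) = (m1 A * m2 setT)%E by exact: product_measure1E.
  by have -> : m1 A = 0%E := A0; rewrite mul0e.
by move=> z nP; split => //; exact: PA.
Qed.

Lemma ae_prod2 d1 d2 (T1 : measurableType d1) (T2 : measurableType d2) (R : realType)
    (m1 : {sigma_finite_measure set T1 -> \bar R}) (m2 : {sigma_finite_measure set T2 -> \bar R})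
    (P : T2 -> Prop) : {ae m2, forall x, P x} -> {ae (m1 \x m2)%E, forall z : T1 * T2, P z.2}.
Proof.
move=> [A [mA A0 PA]]; exists (setT `*` A); split; first exact: measurableX.
  have -> : (m1 \x m2)%E (setT `*` A) = (m1 setT * m2 A)%E by exact: product_measure1E.
  by have -> : m2 A = 0%E := A0; rewrite mule0.
by move=> z nP; split => //; exact: PA.
Qed.

Section Energy.
Variable R : realType.
Notation mu := (@lebesgue_measure R).
Notation mu2 := (mu \x mu)%E.
Implicit Types (s r x y m a b : R).

Lemma Tm_bound_ae e g C x : 0 < e -> L1 mu g -> 0 <= C ->
  {ae mu, forall m, `|g m| <= C} -> `|Tm e g x| <= C.
Proof.
move=> e0 gi C0 gC; have mg := L1_meas gi.
pose g' m := if `|g m| <= C then g m else 0.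
have mg' : measfun g' by rewrite /g'; mfun.
have -> : Tm e g x = Tm e g' x.
  have mp := mfun_section1 x (@mfun_ph R e); rewrite /= in mp.
  by apply: intR_ae; [exact: mfunM|exact: mfunM|apply: (aeS gC) => m h; rewrite /g' h].
apply: Tm_bound => // m; rewrite /g'; case: (boolP (`|g m| <= C)) => //; by rewrite normr0.
Qed.

Lemma Dn_cvg : Dn R n @[n --> \oo] --> (0 : R).
Proof.
apply: (@squeeze_cvgr _ _ _ _ (fun _ : nat => 0 : R) (fun n => En R n)).
- apply: nearW => n; rewrite (ltW (Dn_gt0 R n))/=.
  have e0 := En_gt0 R n; have e1 : En R n <= 1 by have := En_le4 R n; lra.
  have -> : Dn R n = En R n * (En R n * En R n) by rewrite /Dn; ring.
  by apply: (ler_piMr (ltW e0)); apply: mulr_ile1 => //; exact: ltW.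
- exact: cvg_cst.
- exact: En_cvg.
Qed.

Lemma far_eventually x y : 0 < x -> 0 < y -> x != y -> \forall n \near \oo, far (Dn R n) x y.
Proof.
have key a b : 0 < a -> a < b -> \forall n \near \oo, a <= (1 - Dn R n) * b.
  move=> a0 ab; have b0 := lt_trans a0 ab.
  have q0 : 0 < 1 - a / b by rewrite subr_gt0 ltr_pdivrMr// mul1r.
  have /cvgrPdist_lt/(_ _ q0) := Dn_cvg; apply: filterS => n.
  rewrite sub0r normrN gtr0_norm ?Dn_gt0// => dn.
  have h : a / b <= 1 - Dn R n by lra.
  by rewrite ler_pdivrMr// in h.
move=> x0 y0; rewrite neq_lt => /orP[xy|yx].
- by apply: filterS (key x y x0 xy) => n h; rewrite /far h orbT.
- by apply: filterS (key y x y0 yx) => n h; rewrite /far h.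
Qed.

Lemma far_neq d x y : 0 < d -> 0 < x -> far d x y -> x != y.
Proof.
move=> d0 x0; apply: contraTneq => <-; rewrite /far orbb -ltNge mulrBl mul1r ltrBlDr ltrDl.
exact: mulr_gt0.
Qed.

Lemma schur_kLd d : 0 < d -> d < 1 -> let A := 4 * - ln (d / 2) + 10 in
  0 <= A /\ (forall x, NB mu (fun y => W x * kLd d x y) A) /\ (forall y, NB mu (fun x => W x * kLd d x y) A).
Proof.
move=> d0 d1 A; have A0 : 0 <= A.
  have : ln (d / 2) <= 0 by apply: ln_le0; lra.
  by rewrite /A; lra.
split => //; split => x.
- have [x0|x0] := ltP 0 x.
    by apply: (NB_ext (NB_W_kLd d0 d1 x0)) => //; rewrite /A; lra.
  by apply: (NB_ext (NB_eq0 mu (fun _ : R => erefl (0 : R)))) => // y; rewrite kLd_eq0 ?mulr0// ltNge x0.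
- have [x0|x0] := ltP 0 x.
    by apply: (NB_ext (NB_W_kLd_adj d0 d1 x0)) => //; rewrite /A.
  by apply: (NB_ext (NB_eq0 mu (fun _ : R => erefl (0 : R)))) => // y; rewrite kLd_eq0 ?mulr0// [0 < x]ltNge x0 andbF.
Qed.

Definition kDd d x y : R := if far d x y then kD x y else 0.
Definition kMd d x y : R := if far d x y then kM x y else 0.

Lemma mfun_kDd d : measfun2 R (kDd d).
Proof. by apply: mfun_ite; [exact: mfun_far|exact: mfun_kD|mfun]. Qed.

Lemma kMdE d x y : kMd d x y = kLd d x y + kDd d x y.
Proof. by rewrite /kMd /kLd /kDd; case: (far d x y); rewrite ?addr0// /kD addrC subrK. Qed.

Lemma kDd_le d x y : `|kDd d x y| <= `|kD x y|.
Proof. by rewrite /kDd; case: (far d x y) => //; rewrite normr0. Qed.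

Lemma schur_kDd d : (forall x, NB mu (fun y => W x * kDd d x y) 43) /\
  (forall y, NB mu (fun x => W x * kDd d x y) 43).
Proof.
have h x y : `|W x * kDd d x y| <= `|W x * kD x y|.
  by rewrite !normrM; apply: ler_wpM2l => //; exact: kDd_le.
have mm : measfun (fun z : R * R => W z.1 * kDd d z.1 z.2).
  by apply: mfunM; [apply: (mfun_comp (@mfun_W R)); mfun|exact: mfun_kDd].
split => x.
- by apply: (NB_le _ _ (NB_W_kD x)); [exact: (mfun_section1 x mm)|exact: h|exact: lexx].
- by apply: (NB_le _ _ (NB_W_kD_adj x)); [exact: (mfun_section2 x mm)|move=> y; exact: h|exact: lexx].
Qed.

Lemma schur_kMd d : 0 < d -> d < 1 -> let A := 4 * - ln (d / 2) + 10 + 43 in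
  (forall x, NB mu (fun y => W x * kMd d x y) A) /\ (forall y, NB mu (fun x => W x * kMd d x y) A).
Proof.
move=> d0 d1 A; have [_ [h1 h2]] := schur_kLd d0 d1; have [h3 h4] := schur_kDd d.
split => x.
- by apply: (NB_ext (NBD (h1 x) (h3 x))) => // y; rewrite kMdE mulrDr.
- by apply: (NB_ext (NBD (h2 x) (h4 x))) => // y; rewrite kMdE mulrDr.
Qed.

Section WeightedLimit.
Variables (nw : R -> R) (Jb : R).
Hypothesis mnw : measfun nw.
Hypothesis nwW : forall x, 0 <= nw x <= 4 * W x.

(* Only the weighted L1 convergence of X_ and pointwise convergence of v_ are
   available, hence the product limit is split. *)
Lemma weighted_cvg (v_ X_ : nat -> R -> R) (v X : R -> R) (c_ : nat -> R) :
  (forall n, measfun (v_ n)) -> measfun v ->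
  (forall n x, `|v_ n x| <= Jb) -> (forall x, `|v x| <= Jb) ->
  {ae mu, forall x, 0 < x -> v_ n x @[n --> \oo] --> v x} ->
  measfun X -> L1 mu (fun x => W x * X x) ->
  (forall n, NB mu (fun x => W x * (X_ n x - X x)) (c_ n)) -> c_ n @[n --> \oo] --> 0 ->
  (forall n, measfun (X_ n)) ->
  L1 mu (fun x => v x * (nw x * X x)) /\
  \int[mu]_x (v_ n x * (nw x * X_ n x)) @[n --> \oo] --> \int[mu]_x (v x * (nw x * X x)).
Proof.
move=> mv_ mv vb_ vb vc mX Xi hX c0 mX_.
have J0 : 0 <= Jb := le_trans (normr_ge0 _) (vb 0).
have dom (q Y : R -> R) : measfun q -> (forall x, `|q x| <= Jb) ->
    measfun Y -> forall x, `|q x * (nw x * Y x)| <= Jb * 4 * `|W x * Y x|.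
  move=> mq qb mY x; have /andP[n0 n4] := nwW x.
  rewrite normrM (normrM (nw _)) (ger0_norm n0) (normrM (W _)) (ger0_norm (W_ge0 _)) -mulrA.
  apply: ler_pM => //; first by apply: mulr_ge0.
  by rewrite mulrA; apply: ler_wpM2r.
have domL (q Y : R -> R) : measfun q -> (forall x, `|q x| <= Jb) ->
    measfun Y -> L1 mu (fun x => W x * Y x) -> L1 mu (fun x => q x * (nw x * Y x)).
  move=> mq qb mY Yi; apply: (@L1_le _ _ _ mu _ (fun x : R => Jb * 4 * `|W x * Y x|)).
  - by apply: mfunM => //; exact: mfunM.
  - exact: dom.
  - exact/L1Z/L1_norm.
split; first exact: domL.
have mXn n : measfun (fun x => X_ n x - X x) by exact: mfunB.
have A n : L1 mu (fun x => v_ n x * (nw x * (X_ n x - X x))) := domL _ _ (mv_ n) (vb_ n) (mXn n) (NB_L1 (hX n)).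
have B n : L1 mu (fun x => v_ n x * (nw x * X x)) := domL _ _ (mv_ n) (vb_ n) mX Xi.
have E : (fun n => \int[mu]_x (v_ n x * (nw x * X_ n x))) =
    (fun n => \int[mu]_x (v_ n x * (nw x * (X_ n x - X x))) + \int[mu]_x (v_ n x * (nw x * X x))).
  apply/funext => n; rewrite -(intRD (A n) (B n)); apply: intR_ext => x; ring.
rewrite E -[X in _ --> X]add0r; apply: cvgD.
  have c0' : Jb * 4 * c_ n @[n --> \oo] --> 0.
    by rewrite -[X in _ --> X](mulr0 (Jb * 4)); apply: cvgMr.
  apply/cvgrPdist_le => eps eps0; move/cvgrPdist_le : c0' => /(_ _ eps0).
  apply: filterS => n; rewrite !sub0r !normrN => h; apply: le_trans h; apply: le_trans (ler_norm _).
  apply: le_trans (intR_norm (A n)) _.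
  have [h1 h2] := iffLR (NBP _ _ _) (hX n).
  apply: (@le_trans _ _ (\int[mu]_x (Jb * 4 * `|W x * (X_ n x - X x)|))).
    by apply: (intR_le (L1_norm (A n)) (L1Z _ (L1_norm h1))); apply: dom.
  by rewrite (intRZ _ (L1_norm h1)); apply: ler_wpM2l => //; exact: mulr_ge0.
apply: (@dct _ _ _ mu _ _ (fun x : R => Jb * 4 * `|W x * X x|)).
- by move=> n; exact: L1_meas (B n).
- by apply: mfunM => //; exact: mfunM.
- apply: (aeS vc) => x hx; have [x0|x0] := ltP 0 (x : R); last first.
    have n0 : nw x = 0.
      by apply/eqP; rewrite eq_le; have := nwW x; rewrite /W ltNge x0/= mulr0 => /andP[-> ->].
    by rewrite n0 mul0r mulr0; under eq_fun do rewrite mulr0; exact: cvg_cst.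
  exact: cvgMl (hx x0).
- exact/L1Z/L1_norm.
- by move=> n; apply: aeW => x; apply: dom.
Qed.

End WeightedLimit.

Section Limit.
Variables (g k nw : R -> R) (C : R).
Notation P := (Pop (@kD R) g).
Hypothesis gi : L1 mu g.
Hypothesis ki : L1 mu k.
Hypothesis g0 : forall x, x <= 0 -> g x = 0.
Hypothesis k0 : forall x, x <= 0 -> k x = 0.
Hypothesis C0 : 0 <= C.
Hypothesis gC : {ae mu, forall x, `|g x| <= C}.
Hypothesis eqn : forall n, {ae mu, forall x, 0 < x ->
  Tm (En R n) k x = \int[mu]_m (g m * Ladj (ph (En R n) x) m) +
    \int[mu]_m (P m * ph (En R n) x m)}.
Hypothesis mnw : measfun nw.
Hypothesis nwW : forall x, 0 <= nw x <= 4 * W x.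
Hypothesis nwS : forall x y, nw x * kM x y = nw y * kM y x.

Let gn n x := Tm (En R n) g x.
(** The part of [calL f] that the homogeneous operator L has to account for. *)
Let h x := k x - P x.
Let mg : measfun g. Proof. exact: L1_meas gi. Qed.
Let mk : measfun k. Proof. exact: L1_meas ki. Qed.
Let mP : measfun P. Proof. exact: mfun_Pop (@mfun_kD R) gi. Qed.
Let mgn n : measfun (gn n). Proof. exact: mfun_Tm. Qed.
Let mh : measfun h. Proof. exact: mfunB. Qed.
Let mW : measfun (@W R). Proof. exact: mfun_W. Qed.

Lemma lim_WP : L1 mu (fun x => W x * P x).
Proof. exact: (NB_L1 (NB_W_Pop (@mfun_kD R) (fun x y => lexx _) gi)). Qed.

Lemma lim_Wk : L1 mu (fun x => W x * k x).
Proof. by apply: (@L1M _ _ _ mu 1) => // x; rewrite ger0_norm ?W_ge0// W_le1. Qed.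

Lemma lim_Wh : L1 mu (fun x => W x * h x).
Proof. by apply: L1_ext (L1B lim_Wk lim_WP) _ => x; rewrite mulrBr. Qed.

Lemma lim_gn_L1 n : L1 mu (gn n).
Proof. by apply: (NB_L1 (NB_1_Tm (En_gt0 R n) _ gi)); have := En_le4 R n; lra. Qed.

Lemma lim_gn_cvg : {ae mu, forall x, 0 < x -> gn n x @[n --> \oo] --> g x}.
Proof. exact: Tm_cvg. Qed.

Lemma lim_gn_bd n x : `|gn n x| <= C.
Proof. exact: Tm_bound_ae (En_gt0 R n) gi C0 gC. Qed.

Lemma En_le2 n : En R n <= 2^-1. Proof. by have := En_le4 R n; lra. Qed.

Lemma lim_gn_L1cvg : \int[mu]_x `|gn n x - g x| @[n --> \oo] --> 0.
Proof.
have b1 := bC_ge1 R; have b6 : 0 <= 6 * bC R by lra.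
have V01 (x : R) : 0 <= (fun=> 1 : R) x <= 1 by rewrite ler01 lexx.
have hV n m : NB mu (fun x => (fun=> 1 : R) x * ph (En R n) x m) (6 * bC R * (fun=> 1 : R) m).
  by apply: (NB_ext (NB_1_ph m (En_gt0 R n) (En_le2 n))) => [x|]; rewrite ?mul1r ?mulr1.
have g1 : L1 mu (fun m => (fun=> 1 : R) m * g m) by apply: L1_ext gi _ => x; rewrite mul1r.
have H := Tm_L1_cvg (@mfun_cst _ _ R 1) V01 b6 hV mg g0 g1.
apply: cvg_trans H; apply: near_eq_cvg; apply: nearW => n.
by apply: intR_ext => x; rewrite mul1r.
Qed.

Lemma lim_h0 x : x <= 0 -> h x = 0.
Proof. by move=> x0; rewrite /h k0// Pop_eq0// subr0. Qed.

Lemma lim_Th_cvg : \int[mu]_x `|W x * (Tm (En R n) h x - h x)| @[n --> \oo] --> 0.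
Proof.
have b1 := bC_ge1 R.
apply: (@Tm_L1_cvg R (@W R) (384 * bC R) h mW).
- by move=> x; rewrite W_ge0 W_le1.
- by apply: mulr_ge0; [exact: ler0n|lra].
- by move=> n m; exact: NB_W_ph (En_gt0 R n) (En_le2 n).
- exact: mh.
- exact: lim_h0.
- exact: lim_Wh.
Qed.

Lemma lim_Th n : {ae mu, forall x, 0 < x ->
  Tm (En R n) h x = \int[mu]_m (g m * Ladj (ph (En R n) x) m)}.
Proof.
have e0 := En_gt0 R n.
have hW m : NB mu (fun x => W x * ph (En R n) x m) (384 * bC R * W m) := NB_W_ph m e0 (En_le2 n).
have s := Tm_section_L1 mW (@W_ge0 R) hW mP lim_WP.
apply: (aeI (eqn n) s) => x E sx x0; have {}sx := sx (ltac:(by rewrite gt_eqF ?W_gt0)).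
have -> : Tm (En R n) h x = Tm (En R n) k x - Tm (En R n) P x.
  rewrite /Tm -(intRB (L1_ph x e0 ki) sx); apply: intR_ext => m; exact: mulrBr.
rewrite (E x0).
have -> : \int[mu]_m (P m * ph (En R n) x m) = Tm (En R n) P x.
  by apply: intR_ext => m; exact: mulrC.
exact: addrK.
Qed.

Let tau n := wn R n * \int[mu]_m `|g m| + \int[mu]_x `|W x * (Tm (En R n) h x - h x)|.

(** The mollification of h equals the pairing of g with the adjoint, by the averaged equation. The
    commutator estimate replaces that pairing by the truncated operator on mollified g, and
    mollification of h converges in L1(W dx). *)
Lemma lim_Ld n : NB mu (fun x => W x * (Ld (Dn R n) (gn n) x - h x)) (tau n).
Proof.
have N1 := NB_commutator_n n gi.
have N2 : NB mu (fun x => W x * (Tm (En R n) h x - h x)) (\int[mu]_x `|W x * (Tm (En R n) h x - h x)|).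
  apply: L1_NB; have b := NB_Tm mW (@W_ge0 R) (fun m => NB_W_ph m (En_gt0 R n) (En_le2 n)) mh lim_Wh.
  by apply: L1_ext (L1B (NB_L1 b) lim_Wh) _ => x; rewrite mulrBr.
have N := NBD (NBZ (-1) N1) N2; rewrite normrN1 mul1r in N.
apply: NB_ae N.
  by apply: mfunM => //; apply: mfunB => //; apply: mfun_Ld; exact: lim_gn_L1.
apply: (aeS (lim_Th n)) => x E; have [x0|x0] := ltP 0 (x : R); last first.
  have W0 : W x = 0 by rewrite /W ltNge x0.
  have z (a b c : R) : 0 * a = -1 * (0 * b) + 0 * c by rewrite !mul0r mulr0 addr0.
  by rewrite W0; exact: z.
by rewrite (E x0) /gn; ring.
Qed.

Lemma lim_tau : tau n @[n --> \oo] --> 0.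
Proof.
rewrite -[X in _ --> X]addr0; apply: cvgD lim_Th_cvg.
by rewrite -[X in _ --> X](mul0r (\int[mu]_m `|g m|)); apply: cvgMl; exact: wn_cvg.
Qed.

Let kF n x y := kDd (Dn R n) x y - kD x y.
Let zn n := \int[mu2]_z `|W z.1 * (kF n z.1 z.2 * (g z.2 - g z.1))|.

Lemma kF_le n x y : `|kF n x y| <= `|kD x y|.
Proof. by rewrite /kF /kDd; case: (far _ x y); rewrite ?subrr ?normr0// sub0r normrN. Qed.

Lemma mfun_kF n : measfun2 R (kF n).
Proof. by apply: mfunB; [exact: mfun_kDd|exact: mfun_kD]. Qed.

Lemma ae_offdiag : {ae mu2, forall z : R * R, z.1 != z.2}.
Proof.
pose b (z : R * R) := (z.1 <= z.2) && (z.2 <= z.1).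
have mb : measfun (fun z : R * R => if b z then 1 else 0 : R) by rewrite /b; mfun.
have e : NB mu2 (fun z : R * R => if b z then 1 else 0 : R) 0.
  apply: (@ae_of_sections _ _ _ _ _ mu mu _ mb); apply: aeW => x.
  by apply: (aeS (ae_neq x)) => y yx; rewrite /b/= -eq_le eq_sym (negbTE yx).
apply: (aeS (NB0_ae e)) => z; rewrite /b -eq_le; case: eqP => //= _ e1.
by have := oner_neq0 R; rewrite e1 eqxx.
Qed.

Lemma lim_zn : zn n @[n --> \oo] --> 0.
Proof.
have [Fi _] := Pop_prod_L1 (@mfun_kD R) (fun x y => lexx _) gi.
rewrite -(@intR0 _ _ R mu2).
apply: (@dct _ _ _ mu2 _ _ (fun z : R * R => `|W z.1 * (kD z.1 z.2 * (g z.2 - g z.1))|)).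
- move=> n; have [Fn _] := Pop_prod_L1 (mfun_kF n) (kF_le n) gi; exact: (L1_meas (L1_norm Fn)).
- exact: mfun_cst.
- apply: (aeS ae_offdiag) => z zn0.
  have [h0|h0] := boolP ((0 < z.1) && (0 < z.2)); last first.
    rewrite (_ : (fun n => _) = fun=> 0); first exact: cvg_cst.
    apply/funext => n; have : `|kF n z.1 z.2| <= 0.
      by apply: le_trans (kF_le n _ _) _; rewrite /kD kM_eq0// kL_eq0// subrr normr0.
    by rewrite normr_le0 => /eqP ->; rewrite mul0r mulr0 normr0.
  move: h0 => /andP[z1 z2]; apply/cvgrPdist_le => eps eps0.
  apply: filterS (far_eventually z1 z2 zn0) => n hf.
  by rewrite /kF /kDd hf subrr mul0r mulr0 normr0 subr0 normr0 ltW.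
- exact: L1_norm.
- move=> n; apply: aeW => z; rewrite normr_id !normrM; apply: ler_wpM2l => //.
  by apply: ler_wpM2r => //; exact: kF_le.
Qed.

Let del n := 86 * \int[mu]_x `|gn n x - g x| + zn n.

(** The regular part needs no cancellation: mollification is controlled by the L1 bound of the
    operator, truncation by dominated convergence off the diagonal. *)
Lemma lim_Pd n : NB mu (fun x => W x * (Pop (kDd (Dn R n)) (gn n) x - P x)) (del n).
Proof.
have d1 := L1B (lim_gn_L1 n) gi.
have N1 := NB_W_Pop (mfun_kDd (Dn R n)) (@kDd_le (Dn R n)) d1.
have [Fn _] := Pop_prod_L1 (mfun_kF n) (kF_le n) gi.
have N2 : NB mu (fun x => \int[mu]_y (W x * (kF n x y * (g y - g x)))) (zn n) := NB_int1 (L1_NB Fn).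
apply: NB_ae (NBD N1 N2).
  by apply: mfunM => //; apply: mfunB => //; exact: (mfun_Pop (mfun_kDd (Dn R n)) (lim_gn_L1 n)).
have s1 := Pop_section (mfun_kDd (Dn R n)) (@kDd_le (Dn R n)) d1.
have s2 := Pop_section (mfun_kDd (Dn R n)) (@kDd_le (Dn R n)) gi.
have s3 := Pop_section (@mfun_kD R) (fun x y => lexx _) gi.
apply: (aeI s1 (aeI s2 s3 (fun x p q => conj p q))) => x a1 [a2 a3].
have E2 : Pop (kDd (Dn R n)) (gn n) x = Pop (kDd (Dn R n)) (fun y => gn n y - g y) x + Pop (kDd (Dn R n)) g x.
  by rewrite /Pop -(intRD a1 a2); apply: intR_ext => y; ring.
have E3 : \int[mu]_y (W x * (kF n x y * (g y - g x))) = W x * (Pop (kDd (Dn R n)) g x - P x).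
  by rewrite /Pop -(intRB a2 a3) -(intRZ _ (L1B a2 a3)); apply: intR_ext => y; rewrite /kF; ring.
by rewrite E3 E2; ring.
Qed.

Lemma lim_del : del n @[n --> \oo] --> 0.
Proof.
rewrite -[X in _ --> X]addr0; apply: cvgD lim_zn.
by rewrite -[X in _ --> X](mulr0 86); apply: cvgMr; exact: lim_gn_L1cvg.
Qed.

Section Form.
Variables (j : R -> R) (Jb c r s : R).
Hypothesis cj : continuous j.
Hypothesis jb : forall a, `|j a| <= Jb.
Hypothesis jm : forall a b, a <= b -> j a <= j b.
Hypothesis c0 : 0 <= c.
Hypothesis r0 : 0 < r.
Hypothesis rs : r <= s.
Hypothesis kc : forall x y, r < x < s -> r < y < s -> x != y -> c <= nw x * kM x y.

Let box (z : R * R) : bool := (r < z.1 < s) && (r < z.2 < s).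
Let mj : measfun j. Proof. exact: continuous_measurable_fun. Qed.
Let q (G : R -> R) (z : R * R) := (j (G z.1) - j (G z.2)) * (G z.1 - G z.2).
Let bn n (z : R * R) := if box z && far (Dn R n) z.1 z.2 then c else 0.
Let b (z : R * R) := if box z then c else 0.

Lemma form_mq G : measfun G -> measfun (q G).
Proof.
move=> mG.
have m1 : measfun (fun z : R * R => G z.1) by apply: (mfun_comp mG); mfun.
have m2 : measfun (fun z : R * R => G z.2) by apply: (mfun_comp mG); mfun.
apply: mfunM; last exact: mfunB.
by apply: mfunB; [exact: (mfun_comp mj m1)|exact: (mfun_comp mj m2)].
Qed.

Lemma form_mbn n : measfun (bn n).
Proof. apply: mfun_ite; [apply: mfun_and; [by rewrite /box; mfun|exact: mfun_far]|by mfun|by mfun]. Qed.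

Lemma form_mb : measfun b.
Proof. by rewrite /b /box; mfun. Qed.

Lemma form_L1b : L1 mu2 b.
Proof.
have [||hb _] := @L1_prod_of1 _ _ _ _ _ mu mu b (fun x => if r < x < s then `|c| * (s - r) else 0) form_mb; last exact: hb.
- apply: aeW => x; rewrite /b /box/=; case: (r < x < s) => /=; first exact: NB_itv.
  exact: NB_0.
- exact: (NB_L1 (NB_itv _ rs)).
Qed.

Lemma form_bound G z : (forall x, `|G x| <= C) -> `|q G z| <= 4 * (Jb * C).
Proof.
move=> GC; have J0 : 0 <= Jb := le_trans (normr_ge0 _) (jb 0).
rewrite normrM (_ : 4 * (Jb * C) = (Jb + Jb) * (C + C)); last by ring.
by apply: ler_pM => //; apply: le_trans (ler_normB _ _) _; apply: lerD.
Qed.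

Lemma form_cvg : \int[mu2]_z (bn n z * q (gn n) z) @[n --> \oo] -->
  \int[mu2]_z (b z * q g z).
Proof.
have a1 : {ae mu2, forall z : R * R, (0 < z.1 -> gn n z.1 @[n --> \oo] --> g z.1) /\
    (0 < z.2 -> gn n z.2 @[n --> \oo] --> g z.2)}.
  exact: (aeI (ae_prod1 mu lim_gn_cvg) (ae_prod2 mu lim_gn_cvg) (fun z p q => conj p q)).
apply: (@dct _ _ _ mu2 _ _ (fun z : R * R => 4 * (Jb * C) * b z)).
- by move=> n; apply: mfunM; [exact: form_mbn|exact: form_mq].
- by apply: mfunM; [exact: form_mb|exact: form_mq].
- apply: (aeI a1 ae_offdiag) => z [h1 h2] zne.
  have [bz|bz] := boolP (box z); last first.
    rewrite (_ : (fun n => _) = fun=> 0); first by rewrite /b (negbTE bz) mul0r; exact: cvg_cst.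
    by apply/funext => n; rewrite /bn (negbTE bz)/= mul0r.
  have [z1 z2] : 0 < z.1 /\ 0 < z.2.
    by move: bz => /andP[/andP[p1 _] /andP[p2 _]]; split; [exact: lt_trans p1|exact: lt_trans p2].
  have l1 := h1 z1; have l2 := h2 z2.
  have lq : q (gn n) z @[n --> \oo] --> q g z.
    apply: cvgM; last exact: cvgB.
    by apply: cvgB; [apply: continuous_cvg l1; exact: cj|apply: continuous_cvg l2; exact: cj].
  apply: cvgM lq; apply/cvgrPdist_le => eps eps0.
  apply: filterS (far_eventually z1 z2 zne) => n hf.
  by rewrite /bn /b bz hf subrr normr0 ltW.
- exact: (L1Z _ form_L1b).
- move=> n; apply: aeW => z; rewrite normrM mulrC; apply: ler_pM => //.
  + by apply: form_bound => x; exact: lim_gn_bd.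
  + rewrite /bn /b; case: (box z); rewrite ?normr0//=.
    by case: (far _ _ _); rewrite ?normr0// ger0_norm.
Qed.

(** Both pieces are truncated by the same symmetric condition, so their sum has the kernel [kMd],
    symmetric with respect to nw and bounded enough for Fubini. They are written apart because their
    limits are identified by different means. *)
Lemma form_n n : \int[mu]_x (j (gn n x) * (nw x * Ld (Dn R n) (gn n) x)) +
    \int[mu]_x (j (gn n x) * (nw x * Pop (kDd (Dn R n)) (gn n) x)) <=
  - (\int[mu2]_z (bn n z * q (gn n) z)) / 2.
Proof.
have d0 := Dn_gt0 R n; have d1 := Dn_lt1 R n.
have [A1 A1'] := schur_kMd d0 d1; have [A20 [A2 A2']] := schur_kLd d0 d1; have [A3 A3'] := schur_kDd (Dn R n).
have Gi := lim_gn_L1 n.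
have mkM : measfun2 R (kMd (Dn R n)).
  by apply: mfun_ite; [exact: mfun_far|exact: mfun_kM|mfun].
have mv : measfun (fun x => j (gn n x)) by exact: (mfun_comp mj (mgn n)).
have vb x : `|j (gn n x)| <= Jb by exact: jb.
have [p1 e1] := pair_PopE (@mfun_kLd R (Dn R n)) A2 A2' Gi mnw nwW mv vb.
have [p2 e2] := pair_PopE (mfun_kDd (Dn R n)) A3 A3' Gi mnw nwW mv vb.
have H1 := pair_H (@mfun_kLd R (Dn R n)) A2 A2' Gi mnw nwW mv vb.
have H2 := pair_H (mfun_kDd (Dn R n)) A3 A3' Gi mnw nwW mv vb.
have [p3 e3] := pair_PopE mkM A1 A1' Gi mnw nwW mv vb.
have KS x y : nw x * kMd (Dn R n) x y = nw y * kMd (Dn R n) y x.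
  by rewrite /kMd farC; case: (far _ y x); rewrite ?mulr0.
have bn0 z : 0 <= bn n z by rewrite /bn; case: ifP.
have bnle z : bn n z <= nw z.1 * kMd (Dn R n) z.1 z.2.
  rewrite /bn; case: (boolP (box z && far (Dn R n) z.1 z.2)) => [/andP[bz hf]|_]; last first.
    by apply: mulr_ge0; [have /andP[] := nwW z.1|rewrite /kMd; case: (far _ _ _) => //; exact: kM_ge0].
  have /andP[b1 b2] := bz; have /andP[rz _] := b1.
  by rewrite /kMd hf; apply: kc => //; exact: (far_neq d0 (lt_trans r0 rz) hf).
have [_ D] := dissipation mkM A1 A1' Gi mnw nwW mj jb jm KS (form_mbn n) bn0 bnle.
apply: le_trans D; rewrite e3 e1 e2 -(intRD H1 H2) le_eqVlt; apply/orP; left; apply/eqP.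
by apply: intR_ext => z; rewrite kMdE; ring.
Qed.

(** The inequality is exact for each n and passes to the limit. Restricting the dissipation to a
    box, with the constant c in place of the kernel, makes its integrand bounded, so that this side
    converges by dominated convergence. *)
Lemma energy : L1 mu (fun x => j (g x) * (nw x * k x)) /\
  \int[mu]_x (j (g x) * (nw x * k x)) <= - (\int[mu2]_z (b z * q g z)) / 2.
Proof.
have mv : measfun (fun x => j (g x)) by exact: (mfun_comp mj mg).
have mvn n : measfun (fun x => j (gn n x)) by exact: (mfun_comp mj (mgn n)).
have vc : {ae mu, forall x, 0 < x -> j (gn n x) @[n --> \oo] --> j (g x)}.
  by apply: (aeS lim_gn_cvg) => x hx x0; apply: continuous_cvg (hx x0); exact: cj.
have [i1 c1] := weighted_cvg mnw nwW mvn mv (fun n x => jb (gn n x)) (fun x => jb (g x)) vc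
  mh lim_Wh lim_Ld lim_tau (fun n => mfun_Ld (Dn R n) (lim_gn_L1 n)).
have [i2 c2] := weighted_cvg mnw nwW mvn mv (fun n x => jb (gn n x)) (fun x => jb (g x)) vc
  mP lim_WP lim_Pd lim_del (fun n => mfun_Pop (mfun_kDd (Dn R n)) (lim_gn_L1 n)).
have E x : j (g x) * (nw x * k x) = j (g x) * (nw x * h x) + j (g x) * (nw x * P x).
  by rewrite /h; ring.
split; first by apply: L1_ext (L1D i1 i2) _ => x; exact: E.
have -> : \int[mu]_x (j (g x) * (nw x * k x)) =
    \int[mu]_x (j (g x) * (nw x * h x)) + \int[mu]_x (j (g x) * (nw x * P x)).
  by rewrite -(intRD i1 i2); apply: intR_ext => x; exact: E.
have l1 : \int[mu]_x (j (gn n x) * (nw x * Ld (Dn R n) (gn n) x)) +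
    \int[mu]_x (j (gn n x) * (nw x * Pop (kDd (Dn R n)) (gn n) x)) @[n --> \oo] -->
  \int[mu]_x (j (g x) * (nw x * h x)) + \int[mu]_x (j (g x) * (nw x * P x)).
  by apply: cvgD; [exact: c1|exact: c2].
have l2 : - (\int[mu2]_z (bn n z * q (gn n) z)) / 2 @[n --> \oo] -->
    - (\int[mu2]_z (b z * q g z)) / 2.
  by apply: cvgMl; apply: cvgN; exact: form_cvg.
by apply: (ler_cvg_to l1 l2); apply: nearW => n; exact: form_n.
Qed.

End Form.
End Limit.
End Energy.

(** * Relaxation to the mean value *)

Section Weight.
Variable R : realType.
Notation mu := (@lebesgue_measure R).
Implicit Types (r s t x y : R).

Lemma sinh_ge_sqr u : 0 <= u -> u ^+ 2 / 2 <= sinh (u : R).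
Proof.
move=> u0; have := @ndecr_of_is_derive R (fun x => sinh x - x ^+ 2 / 2) (fun x => cosh x - x).
move=> H; have {}H := H _ _ 0 u (lexx 0) u0.
rewrite -subr_ge0; have -> : 0 = sinh (0 : R) - 0 ^+ 2 / 2 by rewrite sinh0 expr0n/= mul0r subrr.
apply: H => [x|x x0].
- have h := @is_derive_sinh R x.
  have -> : cosh x - x = cosh x - (x *+ 2) / 2 by rewrite mulr2n; field.
  apply: is_deriveB; apply: is_derive_eq; rewrite /= ?scaler0 ?addr0 ?add0r.
  by rewrite !scaler1/= /GRing.scale/=; field.
- have h1 := sinh_ge x0; suff : sinh x <= cosh x by lra.
  by rewrite /sinh /cosh ler_pM2r ?invr_gt0// lerD2l; have := expR_gt0 (- x); lra.
Qed.

Definition w0 x : R := if 0 < x then (4 * sinh (x ^+ 2) ^+ 2)^-1 else 0.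
Definition w4 x : R := w0 x * x ^+ 4.
Definition w6 x : R := w0 x * x ^+ 6.

Lemma weightE (beta0 x : R) : 0 < beta0 -> 0 < x -> weight beta0 x = w0 x.
Proof.
move=> b0 x0; rewrite /weight /n0 /equilibrium /w0 x0.
have -> : beta0 * (Num.sqrt 2 * x / Num.sqrt beta0) ^+ 2 = x ^+ 2 + x ^+ 2.
  rewrite exprMn exprMn exprVn !sqr_sqrtr ?ler0n ?(ltW b0)//.
  by field; rewrite gt_eqF.
rewrite expRD /sinh expRN; set E := expR (x ^+ 2).
have E1 : 1 < E by rewrite /E expR_gt1 exprn_gt0.
have En : E != 0 by rewrite gt_eqF//; lra.
have EE : E * E - 1 != 0 by rewrite gt_eqF//; nra.
by field; rewrite EE En.
Qed.

Lemma mfun_sinh : measfun (@sinh R).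
Proof. by rewrite /sinh; mfun. Qed.

Lemma mfun_w0 : measfun w0.
Proof.
apply: mfun_ite; [by mfun| |by mfun]; apply: mfunV; apply: mfunM; first by mfun.
by apply: mfunX; apply: (mfun_comp mfun_sinh); mfun.
Qed.

Lemma mfun_w4 : measfun w4.
Proof. by apply: mfunM; [exact: mfun_w0|mfun]. Qed.

Lemma mfun_w6 : measfun w6.
Proof. by apply: mfunM; [exact: mfun_w0|mfun]. Qed.

Lemma w0_gt0 x : 0 < x -> 0 < w0 x.
Proof.
move=> x0; have s0 : 0 < sinh (x ^+ 2) by apply: sinh_gt0; rewrite exprn_gt0.
by rewrite /w0 x0 invr_gt0; apply: mulr_gt0 => //; exact: exprn_gt0.
Qed.

Lemma w0_ge0 x : 0 <= w0 x.
Proof. by have [x0|x0] := ltP 0 x; [exact/ltW/w0_gt0|rewrite /w0 ltNge x0]. Qed.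

Lemma w4_ge0 x : 0 <= w4 x.
Proof. by apply: mulr_ge0; [exact: w0_ge0|rewrite (exprM x 2 2); exact: sqr_ge0]. Qed.

Lemma w6_ge0 x : 0 <= w6 x.
Proof. by apply: mulr_ge0; [exact: w0_ge0|rewrite (exprM x 3 2); exact: sqr_ge0]. Qed.

Lemma w6_gt0 x : 0 < x -> 0 < w6 x.
Proof. by move=> x0; apply: mulr_gt0; [exact: w0_gt0|exact: exprn_gt0]. Qed.

Lemma w_eq0 x : x <= 0 -> w0 x = 0.
Proof. by move=> x0; rewrite /w0 ltNge x0. Qed.

Lemma w4_le x : w4 x <= 4^-1.
Proof.
have [x0|x0] := ltP 0 x; last by rewrite /w4 w_eq0// mul0r invr_ge0.
rewrite /w4 /w0 x0; have t0 : 0 < x ^+ 2 by rewrite exprn_gt0.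
have st := sinh_ge (ltW t0); have s0 := sinh_gt0 t0; move: (sinh _) st s0 => S st s0.
have p : 0 < 4 * S ^+ 2 by apply: mulr_gt0 => //; exact: exprn_gt0.
have -> : x ^+ 4 = x ^+ 2 * x ^+ 2 by ring.
by rewrite mulrC ler_pdivrMr//; nra.
Qed.

Lemma w4_le_hb x : w4 x <= hb x.
Proof.
have [x0|x0] := ltP 0 x; last by rewrite /w4 w_eq0// mul0r; exact: hb_ge0.
have := w4_le x; rewrite /hb x0/=; case: ltP => [_|x1] h; first by lra.
have t0 : 0 < x ^+ 2 by rewrite exprn_gt0.
rewrite /w4 /w0 x0; have st := sinh_ge_sqr (ltW t0); have s0 := sinh_gt0 t0.
have t1 : 1 <= x ^+ 2 by nra.
move: (sinh _) st s0 => S; have -> : x ^+ 4 = x ^+ 2 * x ^+ 2 by ring.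
move: (x ^+ 2) t0 t1 => t t0 t1 st s0.
have p : 0 < 4 * S ^+ 2 by apply: mulr_gt0 => //; exact: exprn_gt0.
rewrite mulrC ler_pdivrMr// mulrAC ler_pdivlMr//.
have : t ^+ 2 * t ^+ 2 <= 4 * S ^+ 2.
  have : (t ^+ 2 / 2) ^+ 2 <= S ^+ 2 by apply: lerXn2r st; rewrite nnegrE; [apply: divr_ge0 => //; exact: sqr_ge0|exact: ltW].
  by rewrite exprMn; lra.
have tt : t * t * t <= t ^+ 2 * t ^+ 2.
  have -> : t ^+ 2 * t ^+ 2 = (t * t * t) * t by ring.
  by rewrite ler_peMr//; apply: ltW; rewrite !mulr_gt0.
by move: (t * t * t) (t ^+ 2 * t ^+ 2) (S ^+ 2) tt p => A B D; lra.
Qed.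

(** This comparison carries all the estimates in L1(W dx) over to the invariant weight. With t = x^2
    it follows from sinh t >= t and sinh t >= t^2 / 2. *)
Lemma w6_W x : 0 <= w6 x <= 4 * W x.
Proof.
rewrite w6_ge0/=; have [x0|x0] := ltP 0 x; last by rewrite /w6 w_eq0// mul0r; apply: mulr_ge0 => //; exact: W_ge0.
have t0 : 0 < x ^+ 2 by rewrite exprn_gt0.
rewrite /w6 /w0 /W /etaW x0; have st := sinh_ge_sqr (ltW t0); have st' := sinh_ge (ltW t0); have s0 := sinh_gt0 t0.
move: (sinh _) st st' s0 => S; have -> : x ^+ 4 = x ^+ 2 * x ^+ 2 by ring.
have -> : x ^+ 6 = x ^+ 2 * x ^+ 2 * x ^+ 2 by ring.
move: (x ^+ 2) t0 => t t0 st st' s0.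
have p : 0 < 4 * S ^+ 2 by apply: mulr_gt0 => //; exact: exprn_gt0.
have d0 : 0 < 1 + t * t by nra.
rewrite mulrC ler_pdivrMr//.
have -> : 4 * (t / (1 + t * t)) * (4 * S ^+ 2) = 4 * t * (4 * S ^+ 2) / (1 + t * t) by field; rewrite gt_eqF.
rewrite ler_pdivlMr//.
have h1 : (t ^+ 2 / 2) ^+ 2 <= S ^+ 2 by apply: lerXn2r st; rewrite nnegrE; [apply: divr_ge0 => //; exact: sqr_ge0|exact: ltW].
have h2 : t ^+ 2 <= S ^+ 2 by apply: lerXn2r st'; rewrite nnegrE; exact: ltW.
have h3 : t * t * (1 + t * t) <= 4 * 4 * S ^+ 2.
  have -> : t * t * (1 + t * t) = t ^+ 2 + 4 * (t ^+ 2 / 2) ^+ 2 by field.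
  by move: (t ^+ 2) ((_ / 2) ^+ 2) (S ^+ 2) h1 h2 p => A B D; lra.
have := ler_wpM2l (ltW t0) h3.
by move: (S ^+ 2) => D; lra.
Qed.

Lemma w6_le4 x : w6 x <= 4.
Proof. by have /andP[_ h] := w6_W x; have := W_le1 x; lra. Qed.

Lemma w4_L1 : L1 mu w4.
Proof.
apply: (@L1_le _ _ _ mu _ (@hb R)); [exact: mfun_w4| |exact: (NB_L1 (@NB_hb R))].
by move=> x; rewrite ger0_norm ?w4_ge0// w4_le_hb.
Qed.

Lemma w6_L1 : L1 mu w6.
Proof.
apply: (@L1_le _ _ _ mu _ (fun x : R => 4 * W x)); [exact: mfun_w6| |exact: (L1Z 4 (NB_L1 (@NB_W R)))].
by move=> x; have /andP[h0 h1] := w6_W x; rewrite ger0_norm.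
Qed.

Lemma kM_lt_pos x y : 0 < x -> x < y -> w6 x * kM x y =
  x ^+ 3 * y ^+ 3 * cosh (y ^+ 2) /
  (2 * sinh (y ^+ 2) * (sinh (y ^+ 2 - x ^+ 2) * sinh (x ^+ 2 + y ^+ 2))).
Proof.
move=> x0 xy; have y0 := lt_trans x0 xy.
rewrite /kM x0 xy orbT /kerM /w6 /w0 x0.
have a0 : 0 < x ^+ 2 by rewrite exprn_gt0.
have ab : x ^+ 2 < y ^+ 2 by rewrite ltr_sqr ?nnegrE// ltW.
have b0 := lt_trans a0 ab.
have -> : `|x ^+ 2 - y ^+ 2| = y ^+ 2 - x ^+ 2 by rewrite distrC gtr0_norm// subr_gt0.
rewrite (sinhD_mul a0 ab).
have sa := sinh_gt0 a0; have sb := sinh_gt0 b0.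
have sd : 0 < sinh (y ^+ 2 - x ^+ 2) by apply: sinh_gt0; rewrite subr_gt0.
have ss : 0 < sinh (x ^+ 2 + y ^+ 2) by apply: sinh_gt0; exact: addr_gt0.
move: (sinh (x ^+ 2)) (sinh (y ^+ 2)) (sinh (y ^+ 2 - x ^+ 2)) (sinh (x ^+ 2 + y ^+ 2)) (cosh (y ^+ 2)) sa sb sd ss => A B D S Q sa sb sd ss.
by field; rewrite !gt_eqF.
Qed.

(** The last factor of [kerM] is the square root of w6 y / w6 x, so multiplication by w6 x turns it
    into the geometric mean of the two weights. *)
Lemma w6_kM_sym x y : w6 x * kM x y = w6 y * kM y x.
Proof.
have [xp|xn] := boolP ((0 < x) && (0 < y)); last first.
  by rewrite !kM_eq0 ?mulr0//; rewrite andbC.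
have /andP[x0 y0] := xp.
have key (a b : R) : 0 < a -> a < b -> w6 a * kM a b = w6 b * kM b a.
  move=> a0 ab; have b0 := lt_trans a0 ab.
  rewrite /kM a0 ab b0 orbT/= /kerM /w6 /w0 a0 b0 (addrC (b ^+ 2) (a ^+ 2)) (distrC (b ^+ 2)).
  have sa : 0 < sinh (a ^+ 2) by apply: sinh_gt0; rewrite exprn_gt0.
  have sb : 0 < sinh (b ^+ 2) by apply: sinh_gt0; rewrite exprn_gt0.
  move: (sinh (a ^+ 2)) (sinh (b ^+ 2)) ((sinh `|a ^+ 2 - b ^+ 2|)^-1 - (sinh (a ^+ 2 + b ^+ 2))^-1) sa sb => A B D sa sb.
  by field; rewrite !gt_eqF.
have [xy|yx|->//] := ltgtP x y; first exact: key.
by rewrite (key y x).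
Qed.

(** Lower bound of the symmetric kernel on the box (r, s)^2: in [kM_lt_pos] the numerator is at
    least r^6, as cosh >= 1, and each sinh in the denominator is at most sinh (2 s^2). *)
Definition cbox r s : R := r ^+ 6 / (2 * sinh (2 * s ^+ 2) ^+ 3).

Lemma cbox_gt0 r s : 0 < r -> 0 < s -> 0 < cbox r s.
Proof.
move=> r0 s0; have S0 : 0 < sinh (2 * s ^+ 2) by apply: sinh_gt0; apply: mulr_gt0 => //; exact: exprn_gt0.
by rewrite /cbox divr_gt0 ?exprn_gt0//; apply: mulr_gt0 => //; exact: exprn_gt0.
Qed.

Lemma cbox_le r s x y : 0 < r -> r < x < s -> r < y < s -> x != y ->
  cbox r s <= w6 x * kM x y.
Proof.
move=> r0 /andP[rx xs] /andP[ry ys].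
have key (a b : R) : r < a -> a < b -> b < s -> cbox r s <= w6 a * kM a b.
  move=> ra ab bs; have a0 := lt_trans r0 ra; have b0 := lt_trans a0 ab; have s0 := lt_trans b0 bs.
  rewrite kM_lt_pos// /cbox.
  have A0 : 0 < a ^+ 2 by rewrite exprn_gt0.
  have AB : a ^+ 2 < b ^+ 2 by rewrite ltr_sqr ?nnegrE// ltW.
  have BS : b ^+ 2 < s ^+ 2 by rewrite ltr_sqr ?nnegrE// ltW.
  have h1 : sinh (b ^+ 2) <= sinh (2 * s ^+ 2) by apply: sinh_mono; lra.
  have h2 : sinh (b ^+ 2 - a ^+ 2) <= sinh (2 * s ^+ 2) by apply: sinh_mono; lra.
  have h3 : sinh (a ^+ 2 + b ^+ 2) <= sinh (2 * s ^+ 2) by apply: sinh_mono; lra.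
  have p1 : 0 < sinh (b ^+ 2) by apply: sinh_gt0; lra.
  have p2 : 0 < sinh (b ^+ 2 - a ^+ 2) by apply: sinh_gt0; lra.
  have p3 : 0 < sinh (a ^+ 2 + b ^+ 2) by apply: sinh_gt0; lra.
  have C1 := cosh_ge1 (b ^+ 2).
  have S0 : 0 < sinh (2 * s ^+ 2) := lt_le_trans p1 h1.
  move: (sinh (b ^+ 2)) (sinh (b ^+ 2 - a ^+ 2)) (sinh (a ^+ 2 + b ^+ 2)) (sinh (2 * s ^+ 2)) (cosh (b ^+ 2)) h1 h2 h3 p1 p2 p3 C1 S0 =>
    B D E S Q h1 h2 h3 p1 p2 p3 C1 S0.
  have P1 : 0 < 2 * B * (D * E) by rewrite !mulr_gt0.
  have P2 : 0 < 2 * S ^+ 3 by apply: mulr_gt0 => //; exact: exprn_gt0.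
  have N1 : r ^+ 6 <= a ^+ 3 * b ^+ 3 * Q.
    have -> : r ^+ 6 = r ^+ 3 * r ^+ 3 * 1 by rewrite mulr1; ring.
    apply: ler_pM => //; first by rewrite mulr_ge0// exprn_ge0// ltW.
    by apply: ler_pM; rewrite ?exprn_ge0 ?(ltW r0)//; apply: lerXn2r; rewrite ?nnegrE ?ltW//; exact: lt_trans ra ab.
  have N2 : 2 * B * (D * E) <= 2 * S ^+ 3.
    rewrite -mulrA ler_pM2l//; have -> : S ^+ 3 = S * (S * S) by ring.
    apply: ler_pM; [exact: ltW|by apply: mulr_ge0; exact: ltW|exact: h1|].
    by apply: ler_pM => //; exact: ltW.
  apply: ler_pM => //; first by rewrite exprn_ge0// ltW.
    by rewrite invr_ge0 ltW.
  by rewrite lef_pV2 ?posrE.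
rewrite neq_lt => /orP[xy|yx]; first exact: key.
by rewrite w6_kM_sym; exact: key.
Qed.

End Weight.

Section Evolution.
Variable R : realType.
Notation mu := (@lebesgue_measure R).
Notation mu2 := (mu \x mu)%E.
Implicit Types (s r y m tau sigma : R).
Variables (Lam : R -> R -> R) (u0 : R -> R) (f : R -> R -> R).
Hypothesis HF : fundamental_solution Lam.
Hypothesis SS : strong_solution u0 f.
Hypothesis MS : mild_solution Lam u0 f.
Hypothesis u0i : mu.-integrable `]0, +oo[%classic (fun x => (u0 x)%:E).

Notation u := (uu u0).
Notation F := (FF f).
Notation k := (kk f).
Notation w6 := (@w6 R).

Let mF : measfun2 R F. Proof. exact: mfun_FF SS. Qed.
Let mk : measfun2 R k. Proof. exact: mfun_kk SS. Qed.

(** The sup bound of f depends on the compact time interval; countably many such intervals exhaust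
    the positive times. *)
Lemma ae_locally (P : R -> Prop) : (forall N : nat, {ae mu, forall s, N.+1%:R^-1 <= s <= N.+1%:R -> P s}) ->
  {ae mu, forall s, 0 < s -> P s}.
Proof.
move=> h; have := ae_foralln h; apply: filterS => s hs s0.
pose N := maxn (Num.bound s) (Num.bound s^-1).
have lt1 (y : R) (b : nat) : 0 < y -> y < b%:R -> (b <= N)%N -> y <= N.+1%:R.
  by move=> y0 yb bN; apply: ltW; apply: lt_le_trans yb _; rewrite ler_nat (leq_trans bN).
apply: (hs N); apply/andP; split.
- have i0 : 0 < s^-1 by rewrite invr_gt0.
  have := lt1 _ _ i0 (archi_boundP (ltW i0)) (leq_maxr _ _).
  by move=> h1; rewrite -[leRHS]invrK lef_pV2 ?posrE.
- exact: lt1 _ _ s0 (archi_boundP (ltW s0)) (leq_maxl _ _).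
Qed.

Lemma kk_L1_ae : {ae mu, forall s, 0 < s -> L1 mu (k s)}.
Proof.
have h N := fub_ae1 (kk_L1 SS N%:R).
have := ae_foralln h; apply: filterS => s hs s0; have := hs (Num.bound s).
by rewrite /= (archi_boundP (ltW s0)).
Qed.

Lemma FF_bound a b : 0 < a -> a < b -> exists2 C, 0 <= C &
  {ae mu, forall s, a <= s <= b -> {ae mu, forall x, `|F s x| <= C}}.
Proof.
move=> a0 ab; have [_ _ Li _ _] := SS; have [C hC] := Li a b a0 ab.
exists (Num.max C 0); first by rewrite le_max lexx orbT.
apply: (aeS (ae_sections hC)) => s hs sab; apply: (aeS hs) => x /= hx.
rewrite /FF; case: (boolP ((0 < s) && (0 < x))) => [/andP[_ x0]|_]; last by rewrite normr0 le_max lexx orbT.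
by rewrite le_max hx.
Qed.

(** The functions j and the boxes are quantified inside, so that one null set of times serves for
    all of them. *)
Definition energy_at s : Prop := forall (j : R -> R) (Jb r t : R), continuous j ->
  (forall a, `|j a| <= Jb) -> (forall a b, a <= b -> j a <= j b) -> 0 < r -> r <= t ->
  L1 mu (fun x => j (F s x) * (w6 x * k s x)) /\
  \int[mu]_x (j (F s x) * (w6 x * k s x)) <=
  - (\int[mu2]_z ((if (r < z.1 < t) && (r < z.2 < t) then cbox r t else 0) *
       ((j (F s z.1) - j (F s z.2)) * (F s z.1 - F s z.2)))) / 2.

Lemma energy_ae : {ae mu, forall s, 0 < s -> energy_at s}.
Proof.
apply: ae_locally => N.
have [C C0 hC] : exists2 C, 0 <= C &
    {ae mu, forall s, N.+1%:R^-1 <= s <= N.+1%:R -> {ae mu, forall x, `|F s x| <= C}}.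
  have [C C0 hC] := @FF_bound N.+1%:R^-1 (N.+1%:R + 1) (ltac:(by rewrite invr_gt0)) (ltac:(
    apply: (@le_lt_trans _ _ 1); [by rewrite invf_le1// ler1n|by rewrite ltrDr])).
  by exists C => //; apply: (aeS hC) => s hs /andP[h1 h2]; apply: hs; rewrite h1 (le_trans h2)// lerDl.
apply: (aeI (averaged_equation HF SS MS u0i) (aeI hC kk_L1_ae (fun s p q => conj p q))) => s ea [hb hk] sN.
have s0 : 0 < s by have /andP[h1 _] := sN; apply: lt_le_trans h1; rewrite invr_gt0.
move=> j Jb r t cj jb jm r0 rt; have t0 := lt_le_trans r0 rt.
have F0 x : x <= 0 -> F s x = 0 by move=> x0; rewrite FF_eq0// [0 < x]ltNge x0 andbF.
have k0 x : x <= 0 -> k s x = 0 by move=> x0; rewrite /kk [0 < x]ltNge x0 andbF.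
exact: (energy (FF_L1 SS s) (hk s0) F0 k0 C0 (hb sN) (ea s0) (@mfun_w6 R) (@w6_W R) (@w6_kM_sym R)
  cj jb jm (ltW (cbox_gt0 r0 t0)) r0 rt (fun x y => cbox_le r0)).
Qed.

(** Constants of either sign are monotone and dissipate nothing, hence the energy inequality holds
    in both directions. *)
Lemma energy_mean s : energy_at s -> \int[mu]_x (w6 x * k s x) = 0.
Proof.
move=> h; have key (c : R) : \int[mu]_x (c * (w6 x * k s x)) <= 0 /\ L1 mu (fun x => c * (w6 x * k s x)).
  have [hL hb] := h (fun=> c) `|c| 1 1 (fun x => cvg_cst c) (fun _ => lexx _) (fun _ _ _ => lexx _) ltr01 (lexx _).
  split => //; apply: le_trans hb _.
  rewrite intR_eq0 ?oppr0 ?mul0r// => z.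
  by rewrite subrr mul0r mulr0.
have [h1 hL] := key 1; have [h2 _] := key (-1).
have hL' : L1 mu (fun x => w6 x * k s x) by apply: L1_ext hL _ => x; rewrite mul1r.
rewrite (intRZ _ hL') mul1r in h1; rewrite (intRZ _ hL') mulN1r oppr_le0 in h2.
by apply/eqP; rewrite eq_le h1 h2.
Qed.

Section BoundedWeight.
Variables (v : R -> R) (Cv : R).
Hypothesis mv : measfun v.
Hypothesis vb : forall x, `|v x| <= Cv.
Let kv r := \int[mu]_x (k r x * v x).
Let Cv0 : 0 <= Cv. Proof. exact: le_trans (normr_ge0 _) (vb 0). Qed.

Lemma bv_L1 (g : R -> R) : L1 mu g -> L1 mu (fun x => g x * v x).
Proof.
move=> gi; apply: (@L1_ext _ _ _ mu _ (fun x : R => v x * g x)); last by move=> x; rewrite mulrC.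
exact: (@L1M _ _ _ mu Cv v g mv vb gi).
Qed.

Lemma bv_prod T : L1 mu2 (fun z : R * R => v z.2 * (if z.1 < T then k z.1 z.2 else 0)).
Proof.
apply: (@L1M _ _ _ mu2 Cv (fun z : R * R => v z.2)).
- by apply: (mfun_comp mv); mfun.
- by move=> z; exact: vb.
- exact: kk_L1 SS T.
Qed.

Lemma bv_kv T : L1 mu (fun r => if r < T then kv r else 0).
Proof.
apply: L1_ext (fub_L11 (bv_prod T)) _ => r /=; case: (boolP (r < T)) => _.
  by apply: intR_ext => x; rewrite mulrC.
by rewrite intR_eq0// => x; rewrite mulr0.
Qed.

Lemma bv_kvi a b : L1 mu (fun r => if a < r < b then kv r else 0).
Proof.
apply: (@L1_ext _ _ _ mu _ (fun r : R => (if a < r < b then 1 else 0) * (if r < b then kv r else 0))).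
  by apply: (L1M _ (C := 1) _ (bv_kv b)); [mfun|move=> r; case: ifP; rewrite ?normr1 ?normr0].
by move=> r; case: (boolP (a < r < b)) => [/andP[_ ->]|_]; rewrite ?mul1r ?mul0r.
Qed.

Lemma bv_increment t0 t1 : 0 < t0 -> t0 <= t1 ->
  Ic kv t0 t1 = \int[mu]_x ((F t1 x - F t0 x) * v x).
Proof.
move=> t00 t01; pose G (z : R * R) := (if t0 < z.1 < t1 then 1 else 0) * (v z.2 * (if z.1 < t1 then k z.1 z.2 else 0)).
have Gi : L1 mu2 G.
  apply: (@L1M _ _ _ mu2 1 (fun z : R * R => if t0 < z.1 < t1 then 1 else 0)).
  - by mfun.
  - by move=> z; case: ifP; rewrite ?normr1 ?normr0.
  - exact: bv_prod.
have -> : Ic kv t0 t1 = \int[mu]_r \int[mu]_x G (r, x).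
  apply: intR_ext => r; rewrite /G/=; case: (boolP (t0 < r < t1)) => [/andP[_ ->]|_].
    by apply: intR_ext => m; rewrite mul1r mulrC.
  by rewrite intR_eq0// => m; rewrite mul0r.
rewrite (fub_swap Gi); apply: intR_ae.
- exact: (L1_meas (fub_L12 Gi)).
- exact: (L1_meas (bv_L1 (L1B (FF_L1 SS t1) (FF_L1 SS t0)))).
apply: (aeI (increment SS u0i t00 t01) (fub_ae2 (kk_L1 SS t1))) => x E ki; rewrite /= in ki.
have kL : L1 mu (fun r => if t0 < r < t1 then k r x else 0).
  apply: (@L1_ext _ _ _ mu _ (fun r : R => (if t0 < r < t1 then 1 else 0) * (if r < t1 then k r x else 0))).
    by apply: (L1M _ (C := 1) _ ki); [mfun|move=> r; case: ifP; rewrite ?normr1 ?normr0].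
  by move=> r; case: (boolP (t0 < r < t1)) => [/andP[_ ->]|_]; rewrite ?mul1r ?mul0r.
rewrite E addrAC subrr add0r mulrC /Ic -(intRZ _ kL); apply: intR_ext => r; rewrite /G/=.
by case: (boolP (t0 < r < t1)) => [/andP[_ ->]|_]; rewrite ?mul1r ?mul0r ?mulr0.
Qed.

Lemma bv_init eps : 0 < eps -> \forall t \near 0^'+, `|\int[mu]_x ((F t x - u x) * v x)| <= Cv * eps.
Proof.
move=> eps0; apply: filterS (FF_init SS u0i eps0) => t ht.
have dL := L1B (FF_L1 SS t) (uu_L1 u0i).
apply: le_trans (intR_norm (bv_L1 dL)) _.
apply: (@le_trans _ _ (Cv * \int[mu]_x `|F t x - u x|)); last exact: ler_wpM2l.
rewrite -(intRZ _ (L1_norm dL)); apply: (intR_le (L1_norm (bv_L1 dL)) (L1Z Cv (L1_norm dL))) => x.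
by rewrite normrM mulrC; apply: ler_wpM2r.
Qed.

Lemma bv_from0 tau : 0 < tau -> Ic kv 0 tau = \int[mu]_x ((F tau x - u x) * v x).
Proof.
move=> tau0; apply/eqP; rewrite -subr_eq0 -normr_le0; apply/ler_addgt0Pl => eps eps0; rewrite addr0.
have e1 : 0 < eps / 2 by rewrite divr_gt0.
have e2 : 0 < eps / 2 / (Cv + 1) by rewrite divr_gt0//; move: Cv0; lra.
have [d d0 hd] := Ic_small (bv_kvi 0 tau) e1.
near (0 : R)^'+ => t.
have t0 : 0 < t by near: t; exact: nbhs_right_gt.
have td : t < d by near: t; exact: nbhs_right_lt.
have tt : t <= tau by apply: ltW; near: t; exact: nbhs_right_lt.
have h1 : `|Ic kv 0 t| <= eps / 2.
  apply: le_trans (Ic_norm (bv_kvi 0 t)) _; apply: ltW.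
  by apply: (hd 0 t (lexx 0) (ltW t0) tt); rewrite subr0.
have h2 : `|\int[mu]_x ((F t x - u x) * v x)| <= Cv * (eps / 2 / (Cv + 1)) by near: t; exact: bv_init.
have h3 : Cv * (eps / 2 / (Cv + 1)) <= eps / 2.
  by rewrite mulrCA ler_piMr ?(ltW e1)// ler_pdivrMr; move: Cv0; lra.
rewrite (Ic_split (ltW t0) tt (bv_kvi 0 tau)) (bv_increment t0 tt).
have l1 := bv_L1 (L1B (FF_L1 SS tau) (uu_L1 u0i)).
have l2 := bv_L1 (L1B (FF_L1 SS tau) (FF_L1 SS t)).
have -> : \int[mu]_x ((F tau x - u x) * v x) =
    \int[mu]_x ((F tau x - F t x) * v x) + \int[mu]_x ((F t x - u x) * v x).
  rewrite -(intRD l2 (bv_L1 (L1B (FF_L1 SS t) (uu_L1 u0i)))); apply: intR_ext => x; ring.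
move: (Ic kv 0 t) (\int[mu]_x ((F t x - u x) * v x)) (\int[mu]_x ((F tau x - F t x) * v x)) h1 h2 => A B D h1 h2.
rewrite (_ : A + D - (D + B) = A - B); last by ring.
apply: le_trans (ler_normB _ _) _; lra.
Unshelve. all: by end_near. Qed.

End BoundedWeight.

Lemma w6_bd x : `|w6 x| <= 4.
Proof. by rewrite ger0_norm ?w6_ge0// w6_le4. Qed.

Lemma conservation tau : 0 < tau -> \int[mu]_x (F tau x * w6 x) = \int[mu]_x (u x * w6 x).
Proof.
move=> tau0; have E := bv_from0 (@mfun_w6 R) w6_bd tau0.
have h1 := bv_L1 (@mfun_w6 R) w6_bd (FF_L1 SS tau).
have h2 := bv_L1 (@mfun_w6 R) w6_bd (uu_L1 u0i).
apply/eqP; rewrite -subr_eq0 -(intRB h1 h2).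
have -> : \int[mu]_x (F tau x * w6 x - u x * w6 x) = \int[mu]_x ((F tau x - u x) * w6 x).
  by apply: intR_ext => x; rewrite mulrBl.
rewrite -E; apply/eqP; rewrite -[RHS](@intR0 _ _ R mu); apply: intR_ae.
- exact: (L1_meas (bv_kvi (@mfun_w6 R) w6_bd 0 tau)).
- exact: mfun_cst.
apply: (aeS energy_ae) => s hs; case: (boolP (0 < s < tau)) => // /andP[s0 _].
rewrite -[RHS](energy_mean (hs s0)); apply: intR_ext => x; exact: mulrC.
Qed.

End Evolution.

(** * Convex functionals along the solution *)

Section Clip.
Variable R : realType.
Implicit Types (a b C : R).

(** [energy_at] asks for a bounded j. Clipping at a bound of f makes j bounded without changing it
    on the range of f. *)
Definition clip C a : R := Num.max (- C) (Num.min C a).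

Lemma clip_bd C a : 0 <= C -> `|clip C a| <= C.
Proof.
move=> C0; rewrite /clip ler_norml; apply/andP; split; first by rewrite le_max lexx.
by rewrite ge_max ge_min lexx andbT; lra.
Qed.

Lemma clip_id C a : `|a| <= C -> clip C a = a.
Proof. by rewrite ler_norml /clip => /andP[h1 h2]; rewrite min_r// max_r. Qed.

Lemma min_mono C a b : a <= b -> Num.min C a <= Num.min C b.
Proof. by move=> ab; rewrite le_min !ge_min lexx/= ab orbT. Qed.

Lemma max_mono C a b : a <= b -> Num.max C a <= Num.max C b.
Proof. by move=> ab; rewrite ge_max !le_max lexx/= ab orbT. Qed.

Lemma clip_mono C a b : a <= b -> clip C a <= clip C b.
Proof. by move=> ab; exact/max_mono/min_mono. Qed.

Lemma dist_bounds a b : a - b <= `|a - b| /\ b - a <= `|a - b|.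
Proof. by split; [exact: ler_norm|rewrite distrC; exact: ler_norm]. Qed.

Lemma max_lip C a b : `|Num.max C a - Num.max C b| <= `|a - b|.
Proof.
have [n1 n2] := dist_bounds a b; rewrite ler_norml; move: `|a - b| n1 n2 => n n1 n2.
by case: (leP C a) => h1; case: (leP C b) => h2; apply/andP; split; lra.
Qed.

Lemma min_lip C a b : `|Num.min C a - Num.min C b| <= `|a - b|.
Proof.
have [n1 n2] := dist_bounds a b; rewrite ler_norml; move: `|a - b| n1 n2 => n n1 n2.
by case: (leP C a) => h1; case: (leP C b) => h2; apply/andP; split; lra.
Qed.

Lemma clip_lip C a b : `|clip C a - clip C b| <= `|a - b|.
Proof. by apply: le_trans (max_lip _ _ _) _; exact: min_lip. Qed.

Lemma pos_sqr_sub a b : Num.max 0 a ^+ 2 + 2 * Num.max 0 a * (b - a) <= Num.max 0 b ^+ 2.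
Proof.
case: (leP 0 a) => h1; case: (leP 0 b) => h2.
- by rewrite -subr_ge0 (_ : _ - _ = (b - a) ^+ 2) ?sqr_ge0//; ring.
- have h : a * b <= 0 by nra.
  by have := sqr_ge0 a; rewrite expr0n/=; move: h; rewrite expr2; lra.
- by rewrite mulr0 mul0r addr0 expr0n/=; exact: sqr_ge0.
- by rewrite mulr0 mul0r addr0.
Qed.

Lemma lipschitz_continuous (h : R -> R) (L : R) : (forall a b, `|h a - h b| <= L * `|a - b|) ->
  continuous h.
Proof.
move=> hL x; apply/cvgrPdist_le => eps eps0.
have L0 : 0 <= L by have := hL 1 0; rewrite subr0 normr1 mulr1; exact: le_trans.
have d0 : 0 < eps / (L + 1) by rewrite divr_gt0//; lra.
near=> y; apply: le_trans (hL x y) _.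
have xy : `|x - y| <= eps / (L + 1) by near: y; exact: cvgr_dist_le.
apply: (@le_trans _ _ (L * (eps / (L + 1)))); first exact: ler_wpM2l.
by rewrite mulrCA ler_piMr ?(ltW eps0)// ler_pdivrMr; lra.
Unshelve. all: by end_near. Qed.

End Clip.

Section TimeDissipation.
Variable R : realType.
Notation mu := (@lebesgue_measure R).
Implicit Types (s r y m tau sigma : R).
Variables (Lam : R -> R -> R) (u0 : R -> R) (f : R -> R -> R).
Hypothesis HF : fundamental_solution Lam.
Hypothesis SS : strong_solution u0 f.
Hypothesis MS : mild_solution Lam u0 f.
Hypothesis u0i : mu.-integrable `]0, +oo[%classic (fun x => (u0 x)%:E).

Notation F := (FF f).
Notation k := (kk f).
Notation w6 := (@w6 R).

Let mF : measfun2 R F. Proof. exact: mfun_FF SS. Qed.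
Let mk : measfun2 R k. Proof. exact: mfun_kk SS. Qed.
Let mFs s : measfun (F s). Proof. exact: mfun_FFs SS s. Qed.

Section Convex.
Variables (t0 t1 C Lj : R) (J j : R -> R).
Hypothesis t00 : 0 < t0.
Hypothesis t01 : t0 <= t1.
Hypothesis C0 : 0 <= C.
Hypothesis hC : {ae mu, forall s, t0 < s < t1 -> {ae mu, forall x, `|F s x| <= C}}.
Hypothesis Jsub : forall x y, J x + j x * (y - x) <= J y.
Hypothesis jlip : forall x y, `|j x - j y| <= Lj * `|x - y|.
Hypothesis jm : forall a b, a <= b -> j a <= j b.
Hypothesis J0 : forall a, 0 <= J a.
Hypothesis mJ : measfun J.
Hypothesis J1 : L1 mu (fun x => w6 x * J (F t0 x)).

Definition jclip a : R := j (clip C a).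
Let jc := jclip.
Let E r := \int[mu]_x (jc (F r x) * (w6 x * k r x)).

Lemma jclip_cont : continuous jc.
Proof.
apply: (@lipschitz_continuous R _ Lj) => a b; apply: le_trans (jlip _ _) _.
have L0 : 0 <= Lj by have := jlip 1 0; rewrite subr0 normr1 mulr1; exact: le_trans.
by apply: ler_wpM2l => //; exact: clip_lip.
Qed.

Lemma jclip_bd : exists Jb, forall a, `|jc a| <= Jb.
Proof.
have L0 : 0 <= Lj by have := jlip 1 0; rewrite subr0 normr1 mulr1; exact: le_trans.
exists (`|j 0| + Lj * C) => a; rewrite -[jc a](subrK (j 0)) addrC.
apply: le_trans (ler_normD _ _) _; rewrite lerD2l; apply: le_trans (jlip _ _) _.
by rewrite subr0; apply: ler_wpM2l => //; exact: clip_bd.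
Qed.

Lemma jclip_mono a b : a <= b -> jc a <= jc b.
Proof. by move=> ab; apply/jm/clip_mono. Qed.

Let Phi (z : R * R) := (if t0 < z.1 < t1 then 1 else 0) *
  (jc (F z.1 z.2) * w6 z.2) * (if z.1 < t1 then k z.1 z.2 else 0).

Lemma cv_Phi : L1 (mu \x mu)%E Phi.
Proof.
have [Jb hJ] := jclip_bd; have mj := continuous_measurable_fun jclip_cont.
apply: (@L1M _ _ _ (mu \x mu)%E (Jb * 4) (fun z : R * R => (if t0 < z.1 < t1 then 1 else 0) *
  (jc (F z.1 z.2) * w6 z.2))).
- apply: mfunM; first by mfun.
  by apply: mfunM; [exact: (mfun_comp mj mF)|apply: (mfun_comp (@mfun_w6 R)); mfun].
- move=> z; rewrite normrM -[leRHS]mul1r; apply: ler_pM => //; first by case: ifP; rewrite ?normr1 ?normr0.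
  by rewrite normrM; apply: ler_pM => //; exact: w6_bd.
- exact: kk_L1 SS t1.
Qed.

Lemma cv_PhiE r : \int[mu]_x Phi (r, x) = if t0 < r < t1 then E r else 0.
Proof.
rewrite /Phi/=; case: (boolP (t0 < r < t1)) => [/andP[_ ->]|_].
  by apply: intR_ext => x; rewrite mul1r mulrA.
by rewrite intR_eq0// => x; rewrite !mul0r.
Qed.

Let a x r := F t0 x + Ic (fun q => k q x) t0 r.

(** [increment] concerns almost every x at each fixed time. After exchanging the quantifiers, the
    path of F at almost every x agrees for almost every r with the absolutely continuous function a
    x, to which the chain rule applies. *)
Lemma cv_ae : {ae mu, forall x, {ae mu, forall r, t0 < r < t1 -> F r x = a x r /\ `|F r x| <= C}}.
Proof.
(* Both properties are coded in the vanishing of one measurable function, as [ae_swap] demands. *)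
pose G (z : R * R) := if t0 < z.1 < t1 then `|F z.1 z.2 - a z.2 z.1| + Num.max (`|F z.1 z.2| - C) 0 else 0.
have mG : measfun G.
  apply: mfun_ite; [by mfun| |by mfun]; apply: mfunD; last by mfun.
  apply: mfun_norm; apply: mfunB => //; apply: mfunD.
    by apply: (mfun_comp (mFs t0)); mfun.
  apply: (@mfun_intR1 _ _ _ _ _ mu (fun w : (R * R) * R => if t0 < w.2 < w.1.1 then k w.2 w.1.2 else 0)).
  by apply: mfun_ite; [mfun|apply: (mfun_curry mk); mfun|mfun].
have h : {ae mu, forall r, {ae mu, forall x, G (r, x) = 0}}.
  apply: (aeS hC) => r hr; case: (boolP (t0 < r < t1)) => rt; last first.
    by apply: aeW => x; rewrite /G/= (negbTE rt).
  have /andP[r0 _] := rt.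
  apply: (aeI (hr rt) (increment SS u0i t00 (ltW r0))) => x hx e.
  by rewrite /G/= rt e subrr normr0 add0r; rewrite -e max_r// subr_le0.
apply: (aeS (@ae_swap _ _ _ _ _ mu mu _ mG h)) => x hx; apply: (aeS hx) => r.
rewrite /G/= => hz rt; move: hz; rewrite rt => /eqP.
rewrite paddr_eq0 ?normr_ge0 ?le_max ?lexx ?orbT// normr_eq0 subr_eq0 => /andP[/eqP e /eqP m].
by split => //; rewrite -subr_le0 -m le_max lexx.
Qed.

Lemma cv_pointwise : {ae mu, forall x,
  w6 x * J (F t1 x) <= w6 x * J (F t0 x) + \int[mu]_r Phi (r, x)}.
Proof.
apply: (aeI cv_ae (aeI (fub_ae2 (kk_L1 SS t1)) (aeI (fub_ae2 cv_Phi) (increment SS u0i t00 t01)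
  (fun x p q => conj p q)) (fun x p q => conj p q))) => x hx [hk [hP hi]]; rewrite /= in hk hP.
have bi : L1 mu (fun r => if t0 < r < t1 then k r x else 0).
  apply: (@L1_ext _ _ _ mu _ (fun r : R => (if t0 < r < t1 then 1 else 0) * (if r < t1 then k r x else 0))).
    by apply: (L1M _ (C := 1) _ hk); [mfun|move=> r; case: ifP; rewrite ?normr1 ?normr0].
  by move=> r; case: (boolP (t0 < r < t1)) => [/andP[_ ->]|_]; rewrite ?mul1r ?mul0r.
have aE t : t0 <= t <= t1 -> a x t = a x t0 + Ic (fun q => k q x) t0 t.
  by move=> _; rewrite /a Ic_empty addr0.
have [hL hc] := chain_convex t01 Jsub jlip bi aE.
have at1 : a x t1 = F t1 x by rewrite hi.
have at0 : a x t0 = F t0 x by rewrite /a Ic_empty addr0.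
have <- : w6 x * \int[mu]_r (if t0 < r < t1 then j (a x r) * k r x else 0) = \int[mu]_r Phi (r, x).
  rewrite -(intRZ _ hL); apply: intR_ae.
  - exact: (L1_meas (L1Z (w6 x) hL)).
  - exact: (L1_meas hP).
  apply: (aeS hx) => r hr; rewrite /Phi/=; case: (boolP (t0 < r < t1)) => rt; last by rewrite !mul0r mulr0.
  have [e b] := hr rt; have /andP[_ ->] := rt.
  by rewrite mul1r /jc /jclip (clip_id b) e; ring.
rewrite -mulrDr; apply: ler_wpM2l; first exact: w6_ge0.
by rewrite -at1 -at0.
Qed.

(** Integrability at the later time is part of the conclusion: the pointwise chain rule bounds this
    nonnegative function by an integrable one. *)
Lemma dissipation_in_time : [/\ L1 mu (fun x => w6 x * J (F t1 x)),
  L1 mu (fun r => if t0 < r < t1 then E r else 0) &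
  \int[mu]_x (w6 x * J (F t1 x)) <= \int[mu]_x (w6 x * J (F t0 x)) + Ic E t0 t1].
Proof.
have h2 := fub_L12 cv_Phi; have S := L1D J1 h2.
have L : L1 mu (fun x => w6 x * J (F t1 x)).
  apply: (L1_le_ae _ _ S).
  - by apply: mfunM; [exact: mfun_w6|exact: (mfun_comp mJ (mFs t1))].
  - apply: (aeS cv_pointwise) => x h; rewrite ger0_norm//.
    by apply: mulr_ge0; [exact: w6_ge0|exact: J0].
split => //.
- by apply: L1_ext (fub_L11 cv_Phi) _ => r; rewrite -cv_PhiE.
- apply: le_trans (intR_le_ae L S cv_pointwise) _; rewrite (intRD J1 h2) lerD2l.
  rewrite -(fub_swap cv_Phi) le_eqVlt; apply/orP; left; apply/eqP.
  by apply: intR_ext => r; rewrite -cv_PhiE.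
Qed.

Lemma dissipation_rate r s : 0 < r -> r <= s -> {ae mu, forall q, t0 < q < t1 ->
  E q <= - (\int[(mu \x mu)%E]_z ((if (r < z.1 < s) && (r < z.2 < s) then cbox r s else 0) *
       ((jc (F q z.1) - jc (F q z.2)) * (F q z.1 - F q z.2)))) / 2}.
Proof.
move=> r0 rs; have [Jb hJ] := jclip_bd.
apply: (aeS (energy_ae HF SS MS u0i)) => q hq /andP[q0 _].
by have [_ h] := hq (lt_trans t00 q0) jc Jb r s jclip_cont hJ jclip_mono r0 rs.
Qed.

Lemma jclip_form_ge0 q z : 0 <= (jc (F q z.1) - jc (F q z.2)) * (F q z.1 - F q z.2).
Proof.
have [h|h] := leP (F q z.1) (F q z.2).
  by rewrite -mulrNN; apply: mulr_ge0; rewrite oppr_ge0 subr_le0//; exact: jclip_mono.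
by apply: mulr_ge0; rewrite subr_ge0; [exact/jclip_mono/ltW|exact: ltW].
Qed.

Lemma dissipation_sign : Ic E t0 t1 <= 0.
Proof.
have [_ h _] := dissipation_in_time; rewrite -(@intR0 _ _ R mu).
apply: (intR_le_ae h (L1_0 mu)).
apply: (aeS (dissipation_rate ltr01 (lexx 1))) => q hq; case: (boolP (t0 < q < t1)) => // qt.
apply: le_trans (hq qt) _; rewrite mulNr oppr_le0; apply: divr_ge0 => //; apply: intR_ge0 => z.
apply: mulr_ge0; last exact: jclip_form_ge0.
by case: ifP => // _; apply/ltW/cbox_gt0.
Qed.

Lemma comparison : {ae mu, forall x, J (F t0 x) = 0} -> {ae mu, forall x, 0 < x -> J (F t1 x) = 0}.
Proof.
move=> h0; have [L _ hI] := dissipation_in_time.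
have I0 : \int[mu]_x (w6 x * J (F t0 x)) = 0.
  rewrite -[RHS](@intR0 _ _ R mu); apply: intR_ae; [exact: (L1_meas J1)|exact: mfun_cst|].
  by apply: (aeS h0) => x ->; rewrite mulr0.
have N : NB mu (fun x => w6 x * J (F t1 x)) 0.
  apply/NBP; split => //.
  have -> : \int[mu]_x `|w6 x * J (F t1 x)| = \int[mu]_x (w6 x * J (F t1 x)).
    by apply: intR_ext => x; rewrite ger0_norm//; apply: mulr_ge0; [exact: w6_ge0|exact: J0].
  by apply: le_trans hI _; rewrite I0 add0r; exact: dissipation_sign.
apply: (aeS (NB0_ae N)) => x /eqP h x0; move: h; rewrite mulf_eq0 gt_eqF/=; first by move/eqP.
exact: w6_gt0.
Qed.

End Convex.

(** The local sup bound C of the solution serves only for clipping. The squares of the positive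
    parts of a - B and - B - a vanish exactly on [-B, B] together, and [comparison] propagates their
    vanishing. *)
Lemma sup_bound t0 t1 B : 0 < t0 -> t0 <= t1 -> 0 <= B -> {ae mu, forall x, `|F t0 x| <= B} ->
  {ae mu, forall x, `|F t1 x| <= B}.
Proof.
move=> t00 t01 B0 hB.
have [C C0 hC'] := @FF_bound R u0 f SS t0 (t1 + 1) t00 (ltac:(by rewrite ltr_pwDr)).
have hC : {ae mu, forall s, t0 < s < t1 -> {ae mu, forall x, `|F s x| <= C}}.
  by apply: (aeS hC') => s h /andP[/ltW a /ltW b]; apply: h; rewrite a (le_trans b)// lerDl.
have gen (J j : R -> R) : (forall x y, J x + j x * (y - x) <= J y) ->
    (forall x y, `|j x - j y| <= 2 * `|x - y|) -> (forall a b, a <= b -> j a <= j b) ->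
    (forall a, 0 <= J a) -> measfun J -> (forall a, `|a| <= B -> J a = 0) ->
    {ae mu, forall x, 0 < x -> J (F t1 x) = 0}.
  move=> Jsub jlip jm J0 mJ JB.
  have h0 : {ae mu, forall x, J (F t0 x) = 0} by apply: (aeS hB) => x; exact: JB.
  apply: (comparison t00 t01 C0 hC Jsub jlip jm J0 mJ) => //.
  apply: L1_ae (L1_0 mu); first by apply: mfunM; [exact: mfun_w6|exact: (mfun_comp mJ (mFs t0))].
  by apply: (aeS h0) => x ->; rewrite mulr0.
have up : {ae mu, forall x, 0 < x -> Num.max 0 (F t1 x - B) ^+ 2 = 0}.
  apply: (gen (fun a => Num.max 0 (a - B) ^+ 2) (fun a => 2 * Num.max 0 (a - B))).
  - by move=> x y; have := pos_sqr_sub (x - B) (y - B); rewrite (_ : y - B - (x - B) = y - x)//; ring.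
  - move=> x y; rewrite -mulrBr normrM (ger0_norm (ler0n R 2)) ler_pM2l//.
    by apply: le_trans (max_lip _ _ _) _; rewrite (_ : x - B - (y - B) = x - y)//; ring.
  - by move=> a b ab; rewrite ler_pM2l//; apply: max_mono; lra.
  - by move=> a; exact: sqr_ge0.
  - by mfun.
  - by move=> a; rewrite ler_norml => /andP[_ h]; rewrite max_l ?expr0n//; lra.
have dn : {ae mu, forall x, 0 < x -> Num.max 0 (- B - F t1 x) ^+ 2 = 0}.
  apply: (gen (fun a => Num.max 0 (- B - a) ^+ 2) (fun a => - (2 * Num.max 0 (- B - a)))).
  - move=> x y; have := pos_sqr_sub (- B - x) (- B - y); rewrite (_ : - B - y - (- B - x) = x - y); last ring.
    by move: (Num.max 0 (- B - x)) (Num.max 0 (- B - y)) => p q; rewrite mulNr -mulrN opprB.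
  - move=> x y; rewrite -opprD normrN -mulrBr normrM (ger0_norm (ler0n R 2)) ler_pM2l//.
    by apply: le_trans (max_lip _ _ _) _; rewrite distrC (_ : - B - y - (- B - x) = x - y)//; ring.
  - by move=> a b ab; rewrite lerN2 ler_pM2l//; apply: max_mono; lra.
  - by move=> a; exact: sqr_ge0.
  - by mfun.
  - by move=> a; rewrite ler_norml => /andP[h _]; rewrite max_l ?expr0n//; lra.
apply: (aeI up dn) => x h1 h2; have [x0|x0] := ltP 0 (x : R); last first.
  by rewrite FF_eq0 ?normr0// [0 < x]ltNge x0 andbF.
have := h1 x0; have := h2 x0; move=> /eqP; rewrite sqrf_eq0 => /eqP e2 /eqP; rewrite sqrf_eq0 => /eqP e1.
have l1 : F t1 x - B <= 0 by rewrite -e1 le_max lexx orbT.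
have l2 : - B - F t1 x <= 0 by rewrite -e2 le_max lexx orbT.
by rewrite ler_norml; apply/andP; split; lra.
Qed.

End TimeDissipation.

(** * Decay of the variance *)

Section Decay.
Variable R : realType.
Notation mu := (@lebesgue_measure R).
Notation mu2 := (mu \x mu)%E.
Implicit Types (s t y m tau sigma : R).

Notation w6 := (@w6 R).
Let m0 : R := \int[mu]_x w6 x.

Lemma exists_of_ae (P : R -> Prop) a b : a < b -> {ae mu, forall x, P x} ->
  exists2 x, a < x < b & P x.
Proof.
move=> ab hP; apply: contrapT => hn.
have h : {ae mu, forall x, (if a < x < b then 1 else 0 : R) = 0}.
  apply: (aeS hP) => x Px; case: (boolP (a < x < b)) => // xab.
  by exfalso; apply: hn; exists x.
have := int_cst_itv 1 (ltW ab); rewrite mul1r.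
have -> : \int[mu]_m (if a < m < b then 1 else 0) = 0.
  by rewrite -[RHS](@intR0 _ _ R mu); apply: intR_ae => //; mfun.
lra.
Qed.

Lemma m0_gt0 : 0 < m0.
Proof.
rewrite lt_neqAle; apply/andP; split; last by apply: intR_ge0; exact: w6_ge0.
apply/eqP => e; have N : NB mu w6 0.
  apply/NBP; split; first exact: w6_L1.
  rewrite e le_eqVlt; apply/orP; left; apply/eqP.
  by apply: intR_ext => x; rewrite ger0_norm// w6_ge0.
have [x /andP[x0 _] h] := exists_of_ae (@ltr01 R) (NB0_ae N).
by have := w6_gt0 x0; rewrite h ltxx.
Qed.

Lemma exists_box eps : 0 < eps -> exists r s : R, [/\ 0 < r, r <= s &
  \int[mu]_x (if r < x < s then 0 else w6 x) <= eps].
Proof.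
move=> e0; pose h n x : R := if n.+1%:R^-1 < x < n.+1%:R then 0 else w6 x.
have lim : \int[mu]_x h n x @[n --> \oo] --> \int[mu]_x (0 : R).
  apply: (@dct _ _ _ mu _ _ w6).
  - by move=> n; apply: mfun_ite; [mfun|mfun|exact: mfun_w6].
  - exact: mfun_cst.
  - apply: aeW => x; have [x0|x0] := ltP 0 (x : R); last first.
      rewrite (_ : (fun n => _) = fun=> 0); first exact: cvg_cst.
      by apply/funext => n; rewrite /h /w6 w_eq0// mul0r; case: ifP.
    apply/cvgrPdist_le => ep ep0; exists (maxn (Num.bound x) (Num.bound x^-1)) => // n /= hn.
    have hx : x < n.+1%:R.
      by apply: lt_le_trans (archi_boundP (ltW x0)) _; rewrite ler_nat (leq_trans (leq_maxl _ _) (leq_trans hn _)).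
    have i0 : 0 < x^-1 by rewrite invr_gt0.
    have hi : n.+1%:R^-1 < x.
      rewrite -[ltRHS]invrK ltf_pV2 ?posrE//.
      by apply: lt_le_trans (archi_boundP (ltW i0)) _; rewrite ler_nat (leq_trans (leq_maxr _ _) (leq_trans hn _)).
    by rewrite /h hi hx subrr normr0 ltW.
  - exact: w6_L1.
  - by move=> n; apply: aeW => x; rewrite /h; case: ifP => _; rewrite ?normr0 ?ger0_norm ?w6_ge0.
rewrite intR0 in lim; move/cvgrPdist_le : lim => /(_ _ e0) [N _ /(_ N (leqnn N))].
rewrite sub0r normrN => hN; exists N.+1%:R^-1, N.+1%:R; split; first by rewrite invr_gt0.
  by apply: (@le_trans _ _ 1); [rewrite invf_le1 ?ltr0n// ler1n|rewrite ler1n].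
exact: le_trans (ler_norm _) hN.
Qed.

Section Poincare.
Variables (G : R -> R) (B c r s : R).
Hypothesis mG : measfun G.
Hypothesis B0 : 0 <= B.
Hypothesis GB : {ae mu, forall x, `|G x| <= B}.
Hypothesis Gc : \int[mu]_x (w6 x * (G x - c)) = 0.
Let V := \int[mu]_x (w6 x * (G x - c) ^+ 2).
Let box (z : R * R) : bool := (r < z.1 < s) && (r < z.2 < s).
Let out x := if r < x < s then 0 else w6 x.

Lemma bdd_w6_L1 (q : R -> R) (C : R) : measfun q -> {ae mu, forall x, `|q x| <= C} ->
  L1 mu (fun x => w6 x * q x).
Proof.
move=> mq qC; apply: (@L1_le_ae _ _ _ mu _ (fun x : R => C * w6 x)).
- by apply: mfunM => //; exact: mfun_w6.
- apply: (aeS qC) => x h; rewrite normrM (ger0_norm (w6_ge0 x)) mulrC.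
  by apply: ler_wpM2r => //; exact: w6_ge0.
- exact: (L1Z C (@w6_L1 R)).
Qed.

Lemma pc_a : L1 mu (fun x => w6 x * (G x - c)).
Proof.
apply: (@bdd_w6_L1 _ (B + `|c|)); first by mfun.
by apply: (aeS GB) => x h; apply: le_trans (ler_normB _ _) _; rewrite lerD2r.
Qed.

Lemma pc_V : L1 mu (fun x => w6 x * (G x - c) ^+ 2).
Proof.
apply: (@bdd_w6_L1 _ ((B + `|c|) ^+ 2)); first by mfun.
apply: (aeS GB) => x h; rewrite normrX; apply: lerXn2r; rewrite ?nnegrE ?normr_ge0 ?addr_ge0//.
by apply: le_trans (ler_normB _ _) _; rewrite lerD2r.
Qed.

Let ww (z : R * R) := w6 z.1 * w6 z.2.

Lemma pc_prod (p : R -> R) C : measfun p -> 0 <= C -> (forall x, 0 <= p x <= C) ->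
  L1 mu2 (fun z : R * R => p z.1 * ww z) /\
  L1 mu2 (fun z : R * R => p z.2 * ww z) /\
  \int[mu2]_z (p z.1 * ww z) = m0 * \int[mu]_x (p x * w6 x) /\
  \int[mu2]_z (p z.2 * ww z) = m0 * \int[mu]_x (p x * w6 x).
Proof.
move=> mp C0 pC.
have pb x : `|p x| <= C by have /andP[a b] := pC x; rewrite ger0_norm.
have pw : L1 mu (fun x => p x * w6 x) by exact: (@L1M _ _ _ mu C p w6 mp pb (@w6_L1 R)).
have m1 : measfun (fun z : R * R => w6 z.1) by apply: (mfun_comp (@mfun_w6 R)); mfun.
have m2 : measfun (fun z : R * R => w6 z.2) by apply: (mfun_comp (@mfun_w6 R)); mfun.
have m3 : measfun (fun z : R * R => p z.1) by apply: (mfun_comp mp); mfun.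
have H : L1 mu2 (fun z : R * R => p z.1 * ww z).
  have mm : measfun (fun z : R * R => p z.1 * ww z) by apply: mfunM => //; exact: mfunM.
  have [||h _] := @L1_prod_of1 _ _ _ _ _ mu mu _ (fun x => m0 * (p x * w6 x)) mm; last exact: h.
  - apply: aeW => x /=; have /andP[p0 _] := pC x.
    apply: (NB_ext (NBZ (p x * w6 x) (L1_NB (@w6_L1 R)))); first by move=> y; rewrite /ww/= mulrA.
    rewrite ger0_norm; last by apply: mulr_ge0 => //; exact: w6_ge0.
    rewrite mulrC; apply: ler_wpM2r; first by apply: mulr_ge0 => //; exact: w6_ge0.
    by rewrite le_eqVlt; apply/orP; left; apply/eqP; apply: intR_ext => y; rewrite ger0_norm// w6_ge0.
  - exact: (L1Z m0 pw).
have E1 : \int[mu2]_z (p z.1 * ww z) = m0 * \int[mu]_x (p x * w6 x).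
  rewrite -(fub_eq1 H) -(intRZ _ pw); apply: intR_ext => x.
  by rewrite /ww/= mulrC -(intRZ _ (@w6_L1 R)); apply: intR_ext => y; rewrite mulrA.
have H' : L1 mu2 (fun z : R * R => p z.2 * ww z).
  by apply: L1_ext (L1_prod_swap H) _ => z; rewrite /ww/= (mulrC (w6 z.2)).
split => //; split => //; split => //.
rewrite -(fub_eq2 H') -(intRZ _ pw); apply: intR_ext => y.
rewrite /ww/= mulrC -(intRZ _ (@w6_L1 R)); apply: intR_ext => x; ring.
Qed.

Let H (z : R * R) := ww z * (G z.1 - G z.2) ^+ 2.

Lemma pc_H : L1 mu2 H.
Proof.
have [h _] := @pc_prod (fun=> 1) 1 (mfun_cst _) ler01 (fun=> ltac:(by rewrite ler01 lexx)).
have m1 : measfun (fun z : R * R => G z.1) by apply: (mfun_comp mG); mfun.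
have m2 : measfun (fun z : R * R => G z.2) by apply: (mfun_comp mG); mfun.
apply: (@L1_le_ae _ _ _ mu2 _ (fun z : R * R => (B + B) ^+ 2 * (1 * ww z))); last exact: L1Z.
- apply: mfunM; last by apply: mfunX; exact: mfunB.
  by apply: mfunM; apply: (mfun_comp (@mfun_w6 R)); mfun.
- apply: (aeI (ae_prod1 mu GB) (ae_prod2 mu GB)) => z h1 h2.
  have w0 : 0 <= ww z by apply: mulr_ge0; exact: w6_ge0.
  rewrite mul1r normrM (ger0_norm w0) mulrC; apply: ler_wpM2r => //; rewrite normrX.
  apply: lerXn2r; rewrite ?nnegrE ?normr_ge0 ?addr_ge0//.
  by apply: le_trans (ler_normB _ _) _; exact: lerD.
Qed.

Lemma pc_H_int : \int[mu2]_z H z = 2 * m0 * V.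
Proof.
rewrite -(fub_eq1 pc_H).
have w6i := @w6_L1 R.
have E x : \int[mu]_y H (x, y) = m0 * (w6 x * (G x - c) ^+ 2) + V * w6 x.
  transitivity (\int[mu]_y ((w6 x * (G x - c) ^+ 2) * w6 y +
    (w6 x * (w6 y * (G y - c) ^+ 2) - 2 * w6 x * (G x - c) * (w6 y * (G y - c))))).
    by apply: intR_ext => y; rewrite /H /ww/=; ring.
  have l1 := L1Z (w6 x * (G x - c) ^+ 2) w6i; have l2 := L1Z (w6 x) pc_V.
  have l3 := L1Z (2 * w6 x * (G x - c)) pc_a.
  rewrite (intRD l1 (L1B l2 l3)) (intRB l2 l3) (intRZ _ w6i) (intRZ _ pc_V) (intRZ _ pc_a) Gc mulr0 subr0.
  by rewrite -/m0 -/V; ring.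
transitivity (\int[mu]_x (m0 * (w6 x * (G x - c) ^+ 2) + V * w6 x)).
  by apply: intR_ext => x; exact: E.
rewrite (intRD (L1Z m0 pc_V) (L1Z V w6i)) (intRZ _ pc_V) (intRZ _ w6i).
by rewrite -/m0 -/V; ring.
Qed.

(** A Poincare inequality with a defect, obtained without a spectral gap. Twice m0 times the
    variance is the double integral of w6 w6 (G x - G y)^2. On the box w6 w6 <= 16; off the box the
    square is at most 4 B^2, and two strips contribute. *)
Lemma poincare : L1 mu2 (fun z => (if box z then 1 else 0) * (G z.1 - G z.2) ^+ 2) ->
  2 * m0 * V <= 16 * \int[mu2]_z ((if box z then 1 else 0) * (G z.1 - G z.2) ^+ 2) +
    8 * B ^+ 2 * m0 * \int[mu]_x out x.
Proof.
move=> Lb; pose p x : R := if r < x < s then 0 else 1.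
have mp : measfun p by rewrite /p; mfun.
have p01 x : 0 <= p x <= 1 by rewrite /p; case: ifP; rewrite ?lexx ?ler01.
have [h1 [h2 [e1 e2]]] := pc_prod mp ler01 p01.
have Eo : \int[mu]_x (p x * w6 x) = \int[mu]_x out x.
  by apply: intR_ext => x; rewrite /p /out; case: ifP; rewrite ?mul0r ?mul1r.
rewrite -pc_H_int -Eo.
have -> : 8 * B ^+ 2 * m0 * \int[mu]_x (p x * w6 x) =
    4 * B ^+ 2 * (\int[mu2]_z (p z.1 * ww z) + \int[mu2]_z (p z.2 * ww z)).
  by rewrite e1 e2; ring.
rewrite -(intRD h1 h2) -(intRZ _ (L1D h1 h2)) -(intRZ _ Lb) -(intRD (L1Z 16 Lb) (L1Z _ (L1D h1 h2))).
apply: (intR_le_ae pc_H (L1D (L1Z 16 Lb) (L1Z _ (L1D h1 h2)))).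
apply: (aeI (ae_prod1 mu GB) (ae_prod2 mu GB)) => z g1 g2.
have w0 : 0 <= ww z by apply: mulr_ge0; exact: w6_ge0.
have w16 : ww z <= 16.
  have -> : (16 : R) = 4 * 4 by ring.
  by apply: ler_pM; rewrite ?w6_ge0 ?w6_le4.
have q0 : 0 <= (G z.1 - G z.2) ^+ 2 := sqr_ge0 _.
have q4 : (G z.1 - G z.2) ^+ 2 <= 4 * B ^+ 2.
  have -> : 4 * B ^+ 2 = (B + B) ^+ 2 by ring.
  apply: le_trans (ler_norm _) _; rewrite normrX; apply: lerXn2r; rewrite ?nnegrE ?normr_ge0 ?addr_ge0//.
  by apply: le_trans (ler_normB _ _) _; exact: lerD.
rewrite /H; have /andP[p10 _] := p01 z.1; have /andP[p20 _] := p01 z.2.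
have [bz|bz] := boolP (box z).
  rewrite mul1r; apply: le_trans (ler_wpM2r q0 w16) _; rewrite lerDl.
  by apply: mulr_ge0; [apply: mulr_ge0 => //; exact: sqr_ge0|apply: addr_ge0; exact: mulr_ge0].
rewrite mul0r mulr0 add0r mulrC; apply: ler_pM => //.
have pp : 1 <= p z.1 + p z.2.
  by move: bz p10 p20; rewrite negb_and /p => /orP[/negbTE ->|/negbTE ->]; case: ifP => _; lra.
by rewrite -mulrDl ler_peMl.
Qed.

End Poincare.

End Decay.

Section Relaxation.
Variable R : realType.
Notation mu := (@lebesgue_measure R).
Notation mu2 := (mu \x mu)%E.
Implicit Types (s t y m tau sigma : R).
Variables (Lam : R -> R -> R) (u0 : R -> R) (f : R -> R -> R).
Hypothesis HF : fundamental_solution Lam.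
Hypothesis SS : strong_solution u0 f.
Hypothesis MS : mild_solution Lam u0 f.
Hypothesis u0i : mu.-integrable `]0, +oo[%classic (fun x => (u0 x)%:E).

Notation u := (uu u0).
Notation F := (FF f).
Notation k := (kk f).
Notation w6 := (@w6 R).
Notation w4 := (@w4 R).
Let m0 : R := \int[mu]_x w6 x.
Let m00 : 0 < m0. Proof. exact: m0_gt0. Qed.
Definition mean : R := (\int[mu]_x (u x * w6 x)) / m0.
Let c : R := mean.

Let mFs s : measfun (F s). Proof. exact: mfun_FFs SS s. Qed.

(** Boundedness is given only locally in positive time. One time in (1, 2) at which f is bounded is
    selected, and the comparison principle carries its bound to all later times. *)
Lemma eventually_bounded : exists tau1 B : R, [/\ 0 < tau1, 0 <= B &
  forall t, tau1 <= t -> {ae mu, forall x, `|F t x| <= B}].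
Proof.
have l12 : (1 : R) < 2 by rewrite ltr1n.
have [B B0 hB] := @FF_bound R u0 f SS 1 2 ltr01 l12.
have [t1 /andP[h1 h2] hb] := exists_of_ae l12 hB.
have t10 : 0 < t1 := lt_trans ltr01 h1.
have hb' := hb (ltac:(by rewrite (ltW h1) (ltW h2))).
exists t1, B; split => // t tt.
exact: (sup_bound HF SS MS u0i t10 tt B0 hb').
Qed.

Section Bounded.
Variables (tau1 B : R).
Hypothesis tau10 : 0 < tau1.
Hypothesis B0 : 0 <= B.
Hypothesis FB : forall t, tau1 <= t -> {ae mu, forall x, `|F t x| <= B}.

Definition variance t : R := \int[mu]_x (w6 x * (F t x - c) ^+ 2).
Let V := variance.
Let J (a : R) : R := (a - c) ^+ 2.
Let j (a : R) : R := 2 * (a - c).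

Lemma rx_mean t : tau1 <= t -> \int[mu]_x (w6 x * (F t x - c)) = 0.
Proof.
move=> tt; have t0 := lt_le_trans tau10 tt.
have h := bv_L1 (@mfun_w6 R) (@w6_bd R) (FF_L1 SS t).
transitivity (\int[mu]_x (F t x * w6 x - c * w6 x)); first by apply: intR_ext => x; ring.
rewrite (intRB h (L1Z c (@w6_L1 R))) (intRZ _ (@w6_L1 R)) (conservation HF SS MS u0i t0).
by rewrite -/m0 /c /mean mulfVK ?subrr// gt_eqF.
Qed.

Lemma rx_V_L1 t : tau1 <= t -> L1 mu (fun x => w6 x * J (F t x)).
Proof. by move=> tt; exact: (@pc_V R (F t) B c (mFs t) B0 (FB tt)). Qed.

Lemma rx_V_ge0 t : 0 <= V t.
Proof. by apply: intR_ge0 => x; apply: mulr_ge0; [exact: w6_ge0|exact: sqr_ge0]. Qed.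

Let E r := \int[mu]_x (jclip B j (F r x) * (w6 x * k r x)).

Lemma rx_jlip x y : `|j x - j y| <= 2 * `|x - y|.
Proof. by rewrite /j -mulrBr normrM (ger0_norm (ler0n R 2)) (_ : x - c - (y - c) = x - y)//; ring. Qed.

Lemma rx_jm a b : a <= b -> j a <= j b.
Proof. by move=> ab; rewrite /j ler_pM2l//; lra. Qed.

Lemma rx_FB t0 t1 : tau1 <= t0 -> {ae mu, forall s, t0 < s < t1 -> {ae mu, forall x, `|F s x| <= B}}.
Proof. by move=> tt; apply: aeW => s /andP[h _]; apply: FB; exact: le_trans tt (ltW h). Qed.

Lemma rx_step t0 t1 : tau1 <= t0 -> t0 <= t1 ->
  L1 mu (fun r => if t0 < r < t1 then E r else 0) /\ V t1 <= V t0 + Ic E t0 t1.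
Proof.
move=> tt t01; have t00 := lt_le_trans tau10 tt.
have Jsub x y : J x + j x * (y - x) <= J y.
  by rewrite /J /j -subr_ge0 (_ : _ - _ = (y - x) ^+ 2) ?sqr_ge0//; ring.
have mJ : measfun J by rewrite /J; mfun.
by have [_ h1 h2] := dissipation_in_time SS u0i t00 t01 B0 (rx_FB t1 tt) Jsub rx_jlip
  (fun a => sqr_ge0 _) mJ (rx_V_L1 tt).
Qed.

Section Box.
Variables (r s : R).
Hypothesis r0 : 0 < r.
Hypothesis rs : r <= s.
Let box (z : R * R) : bool := (r < z.1 < s) && (r < z.2 < s).

Lemma rx_box_L1 t : tau1 <= t ->
  L1 mu2 (fun z => (if box z then 1 else 0) * (F t z.1 - F t z.2) ^+ 2).
Proof.
move=> tt; have hB := FB tt.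
have m1 : measfun (fun z : R * R => F t z.1) by apply: (mfun_comp (mFs t)); mfun.
have m2 : measfun (fun z : R * R => F t z.2) by apply: (mfun_comp (mFs t)); mfun.
have mb : measfun (fun z : R * R => if box z then 1 else 0 : R) by rewrite /box; mfun.
have bL : L1 mu2 (fun z : R * R => if box z then 1 else 0 : R).
  have [||h _] := @L1_prod_of1 _ _ _ _ _ mu mu _ (fun x => if r < x < s then `|1| * (s - r) else 0) mb; last exact: h.
  - apply: aeW => x; rewrite /box/=; case: (r < x < s) => /=; first exact: NB_itv.
    exact: NB_0.
  - exact: (NB_L1 (NB_itv _ rs)).
apply: (@L1_le_ae _ _ _ mu2 _ (fun z : R * R => (B + B) ^+ 2 * (if box z then 1 else 0))); last exact: L1Z.
- by apply: mfunM => //; apply: mfunX; exact: mfunB.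
- apply: (aeI (ae_prod1 mu hB) (ae_prod2 mu hB)) => z g1 g2; rewrite normrM mulrC.
  apply: ler_pM => //; last by case: (box z); rewrite ?normr1 ?normr0.
  rewrite normrX; apply: lerXn2r; rewrite ?nnegrE ?normr_ge0 ?addr_ge0//.
  by apply: le_trans (ler_normB _ _) _; exact: lerD.
Qed.

Let D t := \int[mu2]_z ((if box z then 1 else 0) * (F t z.1 - F t z.2) ^+ 2).

Lemma rx_rate t0 t1 : tau1 <= t0 -> {ae mu, forall q, t0 < q < t1 -> E q <= - (cbox r s * D q)}.
Proof.
move=> tt; have t00 := lt_le_trans tau10 tt.
apply: (aeS (dissipation_rate HF SS MS u0i t1 t00 B0 rx_jlip rx_jm r0 rs)) => q hq qt.
have tq : tau1 <= q by have /andP[h _] := qt; exact: le_trans tt (ltW h).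
apply: le_trans (hq qt) _; have hB := FB tq; have hD := rx_box_L1 tq.
have s0 : 0 < s := lt_le_trans r0 rs.
(* On the range of F clipping is the identity and j a - j b = 2 (a - b), so the Dirichlet form is
   quadratic. *)
set X := (X in - X / 2); suff -> : X = 2 * (cbox r s * D q) by rewrite mulNr mulrC mulKf// pnatr_eq0.
rewrite /D -(intRZ _ hD) -(intRZ _ (L1Z _ hD)) {}/X.
have m1 : measfun (fun z : R * R => F q z.1) by apply: (mfun_comp (mFs q)); mfun.
have m2 : measfun (fun z : R * R => F q z.2) by apply: (mfun_comp (mFs q)); mfun.
have mj : measfun (jclip B j).
  by apply: continuous_measurable_fun; apply: jclip_cont; exact: rx_jlip.
apply: intR_ae.
- apply: mfunM; first by rewrite /box; mfun.
  by apply: mfunM; apply: mfunB => //; [exact: (mfun_comp mj m1)|exact: (mfun_comp mj m2)].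
- exact: (L1_meas (L1Z 2 (L1Z (cbox r s) hD))).
apply: (aeI (ae_prod1 mu hB) (ae_prod2 mu hB)) => z g1 g2.
rewrite /jclip (clip_id g1) (clip_id g2) /j /box; case: ifP => _; ring.
Qed.

End Box.

Lemma rx_mono t0 t1 : tau1 <= t0 -> t0 <= t1 -> V t1 <= V t0.
Proof.
move=> tt t01; have [hE h] := rx_step tt t01; apply: le_trans h _.
rewrite gerDl -(@intR0 _ _ R mu); apply: (intR_le_ae hE (L1_0 mu)).
apply: (aeS (rx_rate (@ltr01 R) (lexx 1) t1 tt)) => q hq; case: (boolP (t0 < q < t1)) => // qt.
apply: le_trans (hq qt) _; rewrite oppr_le0; apply: mulr_ge0; first exact/ltW/cbox_gt0.
by apply: intR_ge0 => z; apply: mulr_ge0; [case: ifP|exact: sqr_ge0].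
Qed.

(** The variance is nonincreasing. As long as it exceeds del, the Poincare inequality on a large
    enough box forces a dissipation rate of at least eta, which can last only for a bounded time. *)
Lemma variance_cvg : variance t @[t --> +oo] --> 0.
Proof.
apply/cvgrPdist_le => del del0.
(* With this mass left outside the box the defect is at most m0 * del, half of the lower bound 2 *
   m0 * del of the left side. *)
have d8 : 0 < del / (8 * (B ^+ 2 + 1)).
  by rewrite divr_gt0//; apply: mulr_gt0 => //; have := sqr_ge0 B; lra.
have [r [s [r0 rs hout]]] := exists_box d8.
have s0 := lt_le_trans r0 rs; have cb0 := cbox_gt0 r0 s0.
(* The remaining m0 * del is at most 16 times the form on the box. At this rate V would be negative
   at time T. *)
pose eta := cbox r s * (m0 * del) / 16.
have eta0 : 0 < eta by rewrite divr_gt0//; apply: mulr_gt0 => //; exact: mulr_gt0.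
pose T := tau1 + (V tau1 / eta + 1).
have V1 : 0 <= V tau1 / eta by rewrite divr_ge0// ?rx_V_ge0// ltW.
have tT : tau1 <= T by rewrite /T; lra.
have VT : V T <= del.
  rewrite leNgt; apply/negP => hV.
  have [hE hs] := rx_step (lexx tau1) tT.
  have hI : Ic E tau1 T <= - eta * (T - tau1).
    rewrite -(int_cst_itv (- eta) tT); apply: (intR_le_ae hE (NB_L1 (NB_itv (- eta) tT))).
    apply: (aeS (rx_rate r0 rs T (lexx tau1))) => q hq; case: (boolP (tau1 < q < T)) => // qt.
    have /andP[q1 q2] := qt; have tq := ltW q1.
    apply: le_trans (hq qt) _; rewrite lerN2.
    have Vq : del < V q := lt_le_trans hV (rx_mono tq (ltW q2)).
    pose Dq := \int[mu2]_z ((if (r < z.1 < s) && (r < z.2 < s) then 1 else 0) *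
      (F q z.1 - F q z.2) ^+ 2).
    pose Oq := \int[mu]_x (if r < x < s then 0 else w6 x).
    have hp : 2 * m0 * V q <= 16 * Dq + 8 * B ^+ 2 * m0 * Oq.
      exact: (poincare (mFs q) B0 (FB tq) (rx_mean tq) (rx_box_L1 rs tq)).
    rewrite -/Dq.
    have O1 : 8 * B ^+ 2 * m0 * Oq <= m0 * del.
      apply: (@le_trans _ _ (8 * B ^+ 2 * m0 * (del / (8 * (B ^+ 2 + 1))))).
        by apply: ler_wpM2l => //; apply: mulr_ge0; [apply: mulr_ge0 => //; exact: sqr_ge0|exact: ltW].
      have b1 : 0 < B ^+ 2 + 1 by have := sqr_ge0 B; lra.
      have -> : 8 * B ^+ 2 * m0 * (del / (8 * (B ^+ 2 + 1))) = m0 * del * (B ^+ 2 / (B ^+ 2 + 1)) by field; rewrite gt_eqF.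
      by rewrite ler_piMr ?mulr_ge0 ?ltW// ltr_pdivrMr//; lra.
    have V2 : 2 * m0 * del <= 2 * m0 * V q by apply: ler_wpM2l; [apply: mulr_ge0 => //; exact: ltW|exact: ltW].
    rewrite -mulrA in V2.
    have D1 : m0 * del <= 16 * Dq by move: (m0 * del) (8 * B ^+ 2 * m0 * Oq) (2 * m0 * V q) O1 V2 hp => a1 a2 a3; lra.
    rewrite /eta -mulrA; apply: ler_wpM2l; first exact: ltW.
    by rewrite ler_pdivrMr ?ltr0n// (mulrC Dq).
  have : V T <= V tau1 - eta * (V tau1 / eta + 1).
    by apply: le_trans hs _; rewrite lerD2l; apply: le_trans hI _; rewrite /T addrAC subrr add0r mulNr.
  rewrite mulrDr mulrCA divff ?gt_eqF// !mulr1 => h.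
  by have := rx_V_ge0 T; move: h eta0; lra.
near=> t; rewrite sub0r normrN ger0_norm ?rx_V_ge0//.
have Tt : T <= t by near: t; apply: nbhs_pinfty_ge; exact: num_real.
exact: le_trans (rx_mono tT Tt) VT.
Unshelve. all: by end_near. Qed.

Let m4 := \int[mu]_x w4 x.

Lemma w4_bd x : `|w4 x| <= 1.
Proof. by rewrite ger0_norm ?w4_ge0//; apply: le_trans (w4_le x) _; rewrite invf_le1// ler1n. Qed.

(** The weight w4 = w6 / x^2 is not dominated by w6 at the origin. On (0, eps) the bound of F
    suffices; beyond eps, w4 <= eps^-2 w6 and d <= eta + d^2 / eta brings in the variance. *)
Lemma rx_w4_le t eps eta : tau1 <= t -> 0 < eps -> 0 < eta ->
  `|\int[mu]_x (F t x * w4 x) - c * m4| <=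
  (B + `|c|) * eps + eps ^- 2 * (eta * m0 + V t / eta).
Proof.
move=> tt eps0 eta0; have hB := FB tt.
have h1 := bv_L1 (@mfun_w4 R) w4_bd (FF_L1 SS t).
have h2 := L1Z c (@w4_L1 R).
have hd := L1B h1 h2; have hV := rx_V_L1 tt.
have K0 : 0 <= B + `|c| by exact: addr_ge0.
have b1 := NB_itv (B + `|c|) (ltW eps0); rewrite subr0 (ger0_norm K0) in b1.
have i0 : 0 <= eps ^- 2 by rewrite invr_ge0 exprn_ge0// ltW.
have q1 := L1Z eta (@w6_L1 R); have q2 := L1Z eta^-1 hV.
have q3 := L1Z (eps ^- 2) (L1D q1 q2).
have -> : \int[mu]_x (F t x * w4 x) - c * m4 = \int[mu]_x (F t x * w4 x - c * w4 x).
  by rewrite (intRB h1 h2) (intRZ _ (@w4_L1 R)).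
apply: le_trans (intR_norm hd) _.
have -> : (B + `|c|) * eps + eps ^- 2 * (eta * m0 + V t / eta) =
   \int[mu]_x ((if 0 < x < eps then B + `|c| else 0) + eps ^- 2 * (eta * w6 x + eta^-1 * (w6 x * J (F t x)))).
  rewrite (intRD (NB_L1 b1) q3) (intRZ _ (L1D q1 q2)) (intRD q1 q2) (intRZ _ (@w6_L1 R)) (intRZ _ hV).
  by rewrite (int_cst_itv _ (ltW eps0)) subr0 (mulrC (V t)).
apply: (intR_le_ae (L1_norm hd) (L1D (NB_L1 b1) q3)).
apply: (aeS hB) => x hx; rewrite -mulrBl normrM (ger0_norm (w4_ge0 x)).
have a1 : `|F t x - c| <= B + `|c| by apply: le_trans (ler_normB _ _) _; rewrite lerD2r.
have z0 : 0 <= eta * w6 x + eta^-1 * (w6 x * J (F t x)).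
  apply: addr_ge0; apply: mulr_ge0; rewrite ?w6_ge0 ?(ltW eta0)// ?invr_ge0 ?(ltW eta0)//.
  by apply: mulr_ge0; [exact: w6_ge0|exact: sqr_ge0].
have [x0|x0] := ltP 0 (x : R); last first.
  rewrite /w4 w_eq0// mul0r mulr0; apply: addr_ge0; last exact: mulr_ge0.
  exact: lexx.
have [xe|xe] := ltP (x : R) eps.
  rewrite /= -[leLHS]addr0; apply: lerD; last exact: mulr_ge0.
  rewrite -[leRHS]mulr1; apply: ler_pM => //; first exact: w4_ge0.
  by have := w4_bd x; rewrite ger0_norm// w4_ge0.
rewrite /= add0r.
have w46 : w4 x <= eps ^- 2 * w6 x.
  have -> : w6 x = x ^+ 2 * w4 x by rewrite /w6 /w4; ring.
  rewrite mulrA ler_peMl ?w4_ge0// mulrC ler_pdivlMr ?exprn_gt0// mul1r.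
  by apply: lerXn2r => //; rewrite nnegrE ltW.
apply: le_trans (ler_wpM2l (normr_ge0 _) w46) _; rewrite mulrCA; apply: ler_wpM2l => //.
rewrite /J -(real_normK (num_real (F t x - c))).
have d0 : 0 <= `|F t x - c| := normr_ge0 _; move: `|_ - c| d0 => d d0.
have -> : eta * w6 x + eta^-1 * (w6 x * d ^+ 2) = (eta + d ^+ 2 / eta) * w6 x by field; rewrite gt_eqF.
apply: ler_wpM2r; first exact: w6_ge0.
have -> : eta + d ^+ 2 / eta = (eta ^+ 2 + d ^+ 2) / eta by field; rewrite gt_eqF.
rewrite ler_pdivlMr//; have := sqr_ge0 (eta - d); have := mulr_ge0 d0 (ltW eta0); nra.
Qed.

Lemma moment_cvg_aux : \int[mu]_x (F t x * w4 x) @[t --> +oo] --> c * m4.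
Proof.
apply/cvgrPdist_le => del del0.
have K0 : 0 < B + `|c| + 1 by rewrite ltr_wpDl// addr_ge0.
(* Three errors of at most del / 3: eps settles the region near 0, then eta the term eta * m0, then
   large t the variance. *)
pose eps := del / 3 / (B + `|c| + 1).
have eps0 : 0 < eps by rewrite !divr_gt0.
pose eta := eps ^+ 2 * (del / 3) / (m0 + 1).
have m1 : 0 < m0 + 1 by move: m00; lra.
have eta0 : 0 < eta by rewrite divr_gt0// mulr_gt0 ?exprn_gt0// divr_gt0.
have e20 : 0 < eps ^+ 2 by rewrite exprn_gt0.
have d3 : 0 < del / 3 by rewrite divr_gt0.
have nu0 : 0 < eps ^+ 2 * (del / 3) * eta by apply: mulr_gt0 eta0; exact: mulr_gt0.
have /cvgrPdist_le/(_ _ nu0) hV := variance_cvg.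
near=> t; have tt : tau1 <= t by near: t; apply: nbhs_pinfty_ge; exact: num_real.
have Vt : V t <= eps ^+ 2 * (del / 3) * eta.
  have : `|0 - variance t| <= eps ^+ 2 * (del / 3) * eta by near: t.
  by rewrite sub0r normrN ger0_norm ?rx_V_ge0.
rewrite distrC; apply: le_trans (rx_w4_le tt eps0 eta0) _.
have p1 : (B + `|c|) * eps <= del / 3.
  by rewrite /eps mulrCA ler_piMr ?(ltW d3)// ler_pdivrMr// mul1r lerDl.
have p2 : eps ^- 2 * (eta * m0) <= del / 3.
  have -> : eps ^- 2 * (eta * m0) = del / 3 * (m0 / (m0 + 1)) by rewrite /eta; field; rewrite !gt_eqF.
  by rewrite ler_piMr ?(ltW d3)// ler_pdivrMr// mul1r lerDl.
have p3 : eps ^- 2 * (V t / eta) <= del / 3.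
  have -> : eps ^- 2 * (V t / eta) = V t / (eps ^+ 2 * eta) by field; rewrite !gt_eqF.
  by rewrite (ler_pdivrMr _ _ (mulr_gt0 e20 eta0)); apply: le_trans Vt _; rewrite le_eqVlt; apply/orP; left; apply/eqP; ring.
rewrite mulrDr; have -> : del = del / 3 + (del / 3 + del / 3) by field.
by apply: lerD => //; exact: lerD.
Unshelve. all: by end_near. Qed.

End Bounded.

Lemma moment_cvg : \int[mu]_x (F t x * w4 x) @[t --> +oo] --> mean * \int[mu]_x w4 x.
Proof.
have [tau1 [B [h1 h2 h3]]] := eventually_bounded; exact: (moment_cvg_aux h1 h2 h3).
Qed.

End Relaxation.

(** * The condensate density *)

Section Condensate.
Variable R : realType.
Notation mu := (@lebesgue_measure R).
Implicit Types (s t y m tau sigma : R).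
Variables (Lam : R -> R -> R) (beta0 : R) (u0 : R -> R) (f : R -> R -> R).
Hypothesis b0 : 0 < beta0.
Hypothesis HF : fundamental_solution Lam.
Hypothesis SS : strong_solution u0 f.
Hypothesis MS : mild_solution Lam u0 f.
Hypothesis u0i : mu.-integrable `]0, +oo[%classic (fun x => (u0 x)%:E).

Notation u := (uu u0).
Notation F := (FF f).
Notation k := (kk f).
Notation w6 := (@w6 R).
Notation w4 := (@w4 R).

Lemma Rpos_weight (g : R -> R) n : \int[mu]_(x in `]0, +oo[%classic) (g x * weight beta0 x * x ^+ n) =
  \int[mu]_x ((if 0 < x then g x else 0) * (w0 x * x ^+ n)).
Proof.
rewrite (intR_Rpos (fun x => g x * weight beta0 x * x ^+ n)); apply: intR_ext => x.
by case: (boolP (0 < x)) => x0; rewrite ?mul0r// weightE// mulrA.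
Qed.

Let kv r := \int[mu]_x (k r x * w4 x).
Let M tau := Ic kv 0 tau.

Lemma calME tau : calM beta0 f tau = M tau.
Proof.
rewrite /calM intR_itv; apply: intR_ext => s; case: (boolP (0 < s < tau)) => // /andP[s0 _].
by rewrite Rpos_weight; apply: intR_ext => x; rewrite /kk s0.
Qed.

Let kvi := bv_kvi SS (@mfun_w4 R) (@w4_bd R).

(** M vanishes at negative arguments, so that it is continuous on the whole line and no one-sided
    limits are needed. *)
Lemma M_max tau : M tau = M (Num.max 0 tau).
Proof.
case: (leP 0 tau) => // t0; rewrite /M Ic_empty /Ic intR_eq0// => r.
case: (boolP (0 < r < tau)) => // /andP[a c].
by have := lt_trans a (lt_trans c t0); rewrite ltxx.
Qed.

Lemma M_cont : continuous M.
Proof.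
move=> tau; apply/cvgrPdist_le => eps eps0.
pose S : R := Num.max 0 tau + 1.
have [d d0 hd] := Ic_small (kvi 0 S) eps0.
have key p q : 0 <= p -> p <= q -> q <= S -> q - p < d -> `|M q - M p| <= eps.
  move=> p0 pq qS qp; rewrite /M (Ic_split p0 pq (kvi 0 q)) addrAC subrr add0r.
  by apply: le_trans (Ic_norm (kvi p q)) _; apply/ltW/hd.
have d1 : 0 < Num.min d 1 by rewrite lt_min d0 ltr01.
near=> y.
have : `|tau - y| < Num.min d 1 by near: y; exact: cvgr_dist_lt.
rewrite lt_min => /andP[yd y1].
rewrite (M_max tau) (M_max y); have := max_lip 0 tau y.
set p := Num.max 0 tau; set q := Num.max 0 y => pq.
have p0 : 0 <= p by rewrite /p le_max lexx.
have q0 : 0 <= q by rewrite /q le_max lexx.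
have pqd := le_lt_trans pq yd; have pq1 := le_lt_trans pq y1.
have [n1 n2] := dist_bounds p q.
have [h|h] := leP p q.
- by rewrite distrC; apply: key => //; [rewrite /S -/p|]; lra.
- by apply: key => //; [exact: ltW|rewrite /S -/p; lra|lra].
Unshelve. all: by end_near. Qed.

Lemma meanE : mean u0 = C_star beta0 u0.
Proof.
rewrite /mean /C_star; congr (_ / _).
  rewrite (_ : (fun x => weight beta0 x * u0 x * x ^+ 6) = (fun x => u0 x * weight beta0 x * x ^+ 6)).
    by rewrite Rpos_weight.
  by apply/funext => x; rewrite (mulrC (u0 x)).
rewrite (_ : (fun x => weight beta0 x * x ^+ 6) = (fun x => (fun=> 1) x * weight beta0 x * x ^+ 6)).
  rewrite (Rpos_weight (fun=> 1)); apply: intR_ext => x.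
  by case: (boolP (0 < x)) => x0; rewrite ?mul1r// mul0r /w6 w_eq0 ?mul0r// leNgt.
by apply/funext => x; rewrite mul1r.
Qed.

Lemma M_inftyE : M_infty beta0 u0 = mean u0 * \int[mu]_x w4 x - \int[mu]_x (u x * w4 x).
Proof.
rewrite /M_infty meanE; congr (_ * _ - _).
  rewrite (_ : (fun x => weight beta0 x * x ^+ 4) = (fun x => (fun=> 1) x * weight beta0 x * x ^+ 4)).
    rewrite (Rpos_weight (fun=> 1)); apply: intR_ext => x.
    by case: (boolP (0 < x)) => x0; rewrite ?mul1r// mul0r /w4 w_eq0 ?mul0r// leNgt.
  by apply/funext => x; rewrite mul1r.
rewrite (_ : (fun x => weight beta0 x * u0 x * x ^+ 4) = (fun x => u0 x * weight beta0 x * x ^+ 4)).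
  by rewrite Rpos_weight.
by apply/funext => x; rewrite (mulrC (u0 x)).
Qed.

Lemma M_cvg : M t @[t --> +oo] --> M_infty beta0 u0.
Proof.
rewrite M_inftyE.
have h : \int[mu]_x (F t x * w4 x) - \int[mu]_x (u x * w4 x) @[t --> +oo] -->
    mean u0 * \int[mu]_x w4 x - \int[mu]_x (u x * w4 x).
  by apply: cvgB; [exact: moment_cvg HF SS MS u0i|exact: cvg_cst].
apply: cvg_trans h; apply: near_eq_cvg; near=> t.
have t0 : 0 < t by near: t; apply: nbhs_pinfty_gt; exact: num_real.
rewrite /M /kv (bv_from0 SS u0i (@mfun_w4 R) (@w4_bd R) t0).
have h1 := bv_L1 (@mfun_w4 R) (@w4_bd R) (FF_L1 SS t).
have h2 := bv_L1 (@mfun_w4 R) (@w4_bd R) (uu_L1 u0i).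
by rewrite -(intRB h1 h2); apply: intR_ext => x; rewrite mulrBl.
Unshelve. all: by end_near. Qed.

(** Beyond some S convergence bounds M; before S the L1 norm of its density on (0, S) does. *)
Lemma M_bounded : exists K, forall tau, `|M tau| <= K.
Proof.
have /cvgrPdist_le/(_ _ ltr01) [S [_ hS]] := M_cvg.
pose A := Ic (fun r => `|kv r|) 0 S.
have A0 : 0 <= A by apply: intR_ge0 => r; case: ifP.
exists (A + (`|M_infty beta0 u0| + 1)) => tau.
have [h|h] := leP tau S; last first.
  have := hS _ h; move: (M_infty beta0 u0) (M tau) => Mi m h1.
  rewrite -[m](subrK Mi) addrC; apply: le_trans (ler_normD _ _) _; rewrite distrC.
  by apply: (@le_trans _ _ (0 + (`|Mi| + 1))); [rewrite add0r lerD2l|rewrite lerD2r].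
apply: (@le_trans _ _ A); last by rewrite lerDl addr_ge0.
apply: le_trans (Ic_norm (kvi 0 tau)) _.
have L S' : L1 mu (fun r => if 0 < r < S' then `|kv r| else 0).
  by apply: L1_ext (L1_norm (kvi 0 S')) _ => r; case: ifP => // _; rewrite normr0.
apply: (intR_le (L tau) (L S)) => r.
case: (boolP (0 < r < tau)) => [/andP[r0 rt]|_]; last by case: ifP.
by rewrite r0 (lt_le_trans rt h).
Qed.

Section TimeChange.
Variables (qc0 : R) (T : R -> R).
Hypothesis qc00 : 0 < qc0.
Hypothesis hT : time_change (q_c beta0 qc0 f) T.
Notation q := (q_c beta0 qc0 f).

Lemma q_cont : continuous q.
Proof.
have -> : q = fun tau => qc0 * expR (- M tau) by apply/funext => tau; rewrite /q_c calME.
move=> tau; have h : - M s @[s --> tau] --> - M tau by apply: cvgN; exact: M_cont.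
by apply: cvgMr; apply: continuous_cvg h; exact: continuous_expR.
Qed.

Lemma q_bounds : exists lo hi : R, [/\ 0 < lo, 0 < hi & forall tau, lo <= q tau <= hi].
Proof.
have [K hK] := M_bounded; exists (qc0 * expR (- K)), (qc0 * expR K); split.
- by apply: mulr_gt0 => //; exact: expR_gt0.
- by apply: mulr_gt0 => //; exact: expR_gt0.
- move=> tau; have := hK tau; rewrite ler_norml /q_c calME => /andP[h1 h2].
  by rewrite !ler_pM2l// !ler_expR lerN2 h2 lerNl h1.
Qed.

Let P s := Ic (fun r => (q r)^-1) 0 s.

Lemma time_P t : 0 <= t -> 0 <= T t /\ t = P (T t).
Proof.
have [T0 hs] := hT; rewrite le_eqVlt => /orP[/eqP <-|t0].
  by rewrite T0 lexx /P Ic_empty.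
have : [set T t] (T t) by [].
by rewrite -(hs t t0) /= intR_itv.
Qed.

Lemma P_incr lo hi s s' : 0 < lo -> 0 < hi -> (forall tau, lo <= q tau <= hi) -> 0 <= s -> s <= s' ->
  hi^-1 * (s' - s) <= P s' - P s <= lo^-1 * (s' - s).
Proof.
move=> lo0 hi0 hq s0 ss.
have mq : measfun (fun r => (q r)^-1).
  by apply: mfunV; exact: (continuous_measurable_fun q_cont).
have q0 r : 0 < q r by have /andP[h _] := hq r; exact: lt_le_trans lo0 h.
have b1 r : (q r)^-1 <= lo^-1 by rewrite lef_pV2 ?posrE//; have /andP[] := hq r.
have b2 r : hi^-1 <= (q r)^-1 by rewrite lef_pV2 ?posrE//; have /andP[] := hq r.
have qi a b : L1 mu (fun r => if a < r < b then (q r)^-1 else 0).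
  apply: (@L1_itv_bd R (fun r => (q r)^-1) lo^-1) => // r _.
  by rewrite ger0_norm ?b1// invr_ge0 ltW.
rewrite /P (Ic_split s0 ss (qi 0 s')) addrAC subrr add0r.
rewrite -(int_cst_itv hi^-1 ss) -(int_cst_itv lo^-1 ss).
apply/andP; split.
- by apply: (intR_le (NB_L1 (NB_itv hi^-1 ss)) (qi s s')) => r; case: ifP.
- by apply: (intR_le (qi s s') (NB_L1 (NB_itv lo^-1 ss))) => r; case: ifP.
Qed.

(** P inverts T on nonnegative times and grows at rate at least 1 / hi. The restriction to t >= 0 is
    essential, as T is unconstrained at negative times. *)
Lemma T_lip : exists L : R, forall t t', 0 <= t -> 0 <= t' -> `|T t - T t'| <= L * `|t - t'|.
Proof.
have [lo [hi [lo0 hi0 hq]]] := q_bounds; exists hi.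
have key t t' : 0 <= t -> 0 <= t' -> T t <= T t' -> T t' - T t <= hi * `|t - t'|.
  move=> t0 t0' h; have [p1 e1] := time_P t0; have [p2 e2] := time_P t0'.
  have /andP[h1 _] := P_incr lo0 hi0 hq p1 h; rewrite -e1 -e2 in h1.
  rewrite -ler_pdivrMl//; apply: le_trans h1 _; rewrite distrC; exact: ler_norm.
move=> t t' t0 t0'; have [h|h] := leP (T t) (T t').
- by rewrite distrC ger0_norm ?subr_ge0//; exact: key.
- by rewrite gtr0_norm ?subr_gt0// (distrC t); apply: key => //; exact: ltW.
Qed.

(** The lower bound of q_c gives t = P (T t) <= T t / lo. *)
Lemma T_pinfty : T t @[t --> +oo] --> +oo.
Proof.
have [lo [hi [lo0 hi0 hq]]] := q_bounds; apply/cvgryPge => A.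
near=> t; have t0 : 0 <= t by near: t; apply: nbhs_pinfty_ge; exact: num_real.
have tA : lo^-1 * A <= t by near: t; apply: nbhs_pinfty_ge; exact: num_real.
have [p e] := time_P t0; have /andP[_ h] := P_incr lo0 hi0 hq (lexx 0) p.
rewrite -e /P Ic_empty !subr0 in h.
by have := le_trans tA h; rewrite ler_pM2l// invr_gt0.
Unshelve. all: by end_near. Qed.

Variable pc : R -> R.
Hypothesis pcE : forall t, 0 <= t -> pc t = q (T t).

Lemma pc_within : {within `[0, +oo[%classic, continuous pc}.
Proof.
have [L hL] := T_lip; apply/subspace_continuousP => t; rewrite /= in_itv/= andbT => t0.
have hTc : T s @[s --> within `[0, +oo[%classic (nbhs t)] --> T t.
  apply/cvgrPdist_le => eps eps0.
  have L1p : 0 < `|L| + 1 by rewrite ltr_wpDl.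
  have d0 : 0 < eps / (`|L| + 1) by rewrite divr_gt0.
  rewrite near_withinE; near=> s; rewrite /= in_itv/= andbT => s0.
  have ts : `|t - s| <= eps / (`|L| + 1) by near: s; exact: cvgr_dist_le.
  apply: le_trans (hL t s t0 s0) _.
  apply: (@le_trans _ _ ((`|L| + 1) * `|t - s|)).
    by apply: ler_wpM2r => //; apply: le_trans (ler_norm L) _; rewrite lerDl.
  by rewrite -ler_pdivlMl// mulrC.
suff h' : pc s @[s --> within `[0, +oo[%classic (nbhs t)] --> pc t by exact: h'.
rewrite (pcE t0).
have h : q (T s) @[s --> within `[0, +oo[%classic (nbhs t)] --> q (T t).
  by apply: continuous_cvg hTc; exact: q_cont.
apply: cvg_trans h; apply: near_eq_cvg; rewrite near_withinE; near=> s.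
by rewrite /= in_itv/= andbT => s0; rewrite pcE.
Unshelve. all: by end_near. Qed.

Lemma pc_bounded : exists B : R, forall t, 0 <= t -> `|pc t| <= B.
Proof.
have [lo [hi [lo0 hi0 hq]]] := q_bounds; exists hi => t t0; rewrite pcE//.
have /andP[h1 h2] := hq (T t); rewrite ger0_norm//; exact: le_trans (ltW lo0) h1.
Qed.

Lemma pc_cvg : pc t @[t --> +oo] --> pc 0 * expR (- M_infty beta0 u0).
Proof.
have [T0 _] := hT.
have -> : pc 0 = qc0.
  by rewrite pcE// T0 /q_c calME /M Ic_empty oppr0 expR0 mulr1.
have hq : q s @[s --> +oo] --> qc0 * expR (- M_infty beta0 u0).
  have -> : q = fun tau => qc0 * expR (- M tau) by apply/funext => tau; rewrite /q_c calME.
  have h : - M s @[s --> +oo] --> - M_infty beta0 u0 by apply: cvgN; exact: M_cvg.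
  by apply: cvgMr; apply: continuous_cvg h; exact: continuous_expR.
have h := cvg_comp _ _ T_pinfty hq.
apply: cvg_trans h; apply: near_eq_cvg; near=> t.
have t0 : 0 <= t by near: t; apply: nbhs_pinfty_ge; exact: num_real.
by rewrite /= pcE.
Unshelve. all: by end_near. Qed.

End TimeChange.
End Condensate.

Theorem corollary4 (R : realType) (beta0 theta : R) (u0 : R -> R)
    (u : R -> R -> R) (pc : R -> R)
    (beta0_gt0 : 0 < beta0) (theta01 : 0 < theta < 1)
    (u0_L1 : (@lebesgue_measure R).-integrable `]0, +oo[%classic
               (fun x => (u0 x)%:E))
    (u0_bound : (ereal_sup [set (x `^ theta * `|u0 x|)%:E | x in (`]0%R, 1%R[%classic : set R)]
                 + ereal_sup [set `|u0 x|%:E | x in (`]1%R, +oo[%classic : set R)]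
                 < +oo)%E)
    (upc : solution_pair beta0 u0 u pc) :
  [/\ {within `[0, +oo[%classic, continuous pc},
      exists B : R, forall t : R, 0 <= t -> `|pc t| <= B &
      pc t @[t --> +oo] --> pc 0 * expR (- M_infty beta0 u0)].
Proof.
have [Lam [f [qc0 [T [HF [SS MS] q0 hT hE]]]]] := upc.
have pcE t (t0 : 0 <= t) : pc t = q_c beta0 qc0 f (T t) by have [] := hE t t0.
split.
- exact: (pc_within beta0_gt0 HF SS MS u0_L1 q0 hT pcE).
- exact: (pc_bounded beta0_gt0 HF SS MS u0_L1 q0 pcE).
- exact: (pc_cvg beta0_gt0 HF SS MS u0_L1 q0 hT pcE).
Qed.
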